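(* Let $P$ be a law in the model and suppose $q_P\in L^2(P)$ and $\zeta_1,\dots,\zeta_J\in L^2(P)$ satisfy $E_P[\zeta_j\mid X]=0$. Let $\mathcal H$, $\Gamma_{\mathrm{act}}$, $\lambda^*$ and $D^*=q_P+\lambda^{*\top}\zeta$ be as in the context. (i) (Projection) For $j_0(X)=\min\mathcal A^*(X)$, $\Pi_{\mathcal H}(q_P+\zeta_{j_0})=D^*$; likewise $\Pi_{\mathcal H}(q_P+\lambda^\top\zeta)=D^*$ for every measurable unit-sum weight vector $\lambda(X)$ supported on $\mathcal A^*(X)$ such that $q_P+\lambda^\top\zeta\in L^2(P)$. (ii) (Value) $\|D^*\|_{L^2(P)}^2=\mathrm{Var}_P\{m_P(X)\}+E_P[v_{\mathrm{br}}(\Gamma_{\mathrm{act}}(X))]$, where for positive semidefinite $M$, $v_{\mathrm{br}}(M)=(\mathbf 1^\top M^+\mathbf 1)^{-1}$ if $\mathbf 1\in\mathrm{range}(M)$ and $v_{\mathrm{br}}(M)=0$ otherwise ($M^+$ the Moore–Penrose inverse). (iii) (Classical interpretation) Suppose in addition that a linear space $\mathcal S\subseteq\mathcal H$ of bounded scores is given such that for every finite subset $s_1,\dots,s_\ell\in\mathcal S$ the law $dP_t=(1+\sum_lt_ls_l)\,dP$ belongs to the model for all sufficiently small $t\in\mathbb R^\ell$, and for each $j$, $b_j(P_t)=b_j(P)+\sum_lt_lE_P[\zeta_js_l\mid X]+o_{L^1(P_X)}(\|t\|)$. Let $\mathcal T=\overline{\mathcal S}^{L^2(P)}$. Then the canonical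 gradient of $\Psi$ at $P$ in these local experiments is $\Pi_{\mathcal T}D^*$. If $D^*\in\mathcal T$, it is $D^*$, and the convolution lower bound for the asymptotic variance of estimators regular in these experiments is $\|D^*\|_{L^2(P)}^2$.
   Context: Observation $O=(X,W)$. The model is a class of laws $R$ of $O$; to each law $R$ and $j\le J$ is associated a measurable real function (branch) $b_j(R)(x)$ of the covariate. $m_R(x)=\max_{j\le J}b_j(R)(x)$ and the target is $\Psi(R)=E_R\{m_R(X)\}$. At the fixed law $P$: $q_P(X)=m_P(X)-\Psi(P)$, $\mathcal A^*(x)=\arg\max_jb_j(P)(x)$, $L_0^2(P)=\{s\in L^2(P):E_Ps=0\}$, $\zeta=(\zeta_1,\dots,\zeta_J)^\top$ (conditional branch gradients), and $$\mathcal H=\{s\in L_0^2(P): E_P[(\zeta_i-\zeta_j)s\mid X]=0\ \text{on}\ \{i,j\in\mathcal A^*(X)\},\ i,j\le J\},$$ with $\Pi_{\mathcal H}$ the orthogonal projection in $L^2(P)$ (similarly $\Pi_{\mathcal T}$). $\Gamma(X)=E_P[\zeta\zeta^\top\mid X]$ and $\Gamma_{\mathrm{act}}(X)$ is its principal submatrix indexed by $\mathcal A^*(X)$. $\lambda^*(X)$ is a measurable vector, zero outside $\mathcal A^*(X)$, with coordinates summing to one, minimizing $\lambda^\top\Gamma_{\mathrm{act}}\lambda$ among unit-sum vectors on $\mathcal A^*(X)$; signed weights and singular $\Gamma_{\mathrm{act}}$ are allowed. The local experiments are the finite-dimensional submodels $t\mapsto P_t$ of (iii). The canonical gradient is the unique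 $D\in\mathcal T$ with $\frac{d}{dt}\Psi(P_{t})|_{t=0}=E_P[Ds]$ along $dP_t=(1+ts)dP$ for every $s\in\mathcal S$. An estimator sequence $T_n$ is regular if for every such submodel and every $h$, $\sqrt n\{T_n-\Psi(P_{h/\sqrt n})\}$ has, under i.i.d. sampling from $P_{h/\sqrt n}$, a limit law not depending on $h$; the convolution lower bound is the variance of the Gaussian convolution factor in the limit law of regular estimators. *)

(* Defs.v *)
From HB Require Import structures.
From mathcomp Require Import all_boot all_order all_algebra.
From mathcomp Require Import all_classical all_reals all_analysis.
From mathcomp Require Import giry.

Set Implicit Arguments.
Unset Strict Implicit.
Unset Printing Implicit Defensive.

Import Order.TTheory GRing.Theory Num.Theory.
Import numFieldNormedType.Exports.

Local Open Scope classical_set_scope.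
Local Open Scope ring_scope.

(* Elements of L^2(P) are represented by functions in [Lfun P 2%:E]; equalities
   in L^2(P) become P-almost sure equalities. An observation is a pair
   o = (x, w), so that the covariate is [fst]. *)

Definition L2norm {d} {T : measurableType d} {R : realType}
    (P : probability T R) (f : T -> R) : \bar R :=
  'N[P]_2%:E[EFin \o f]%E.

Definition L2_closure {d} {T : measurableType d} {R : realType}
    (P : probability T R) (S : set (T -> R)) : set (T -> R) :=
  [set f | f \in Lfun P 2%:E /\
    forall e : R, 0 < e ->
      exists s, S s /\ (L2norm P (fun o => f o - s o)%R < e%:E)%E].

(* [g] is (a representative of) the orthogonal projection of [f] on the linear
   subspace [K] of L^2(P) *)
Definition orthogonal_projection {d} {T : measurableType d} {R : realType}
    (P : probability T R) (K : set (T -> R)) (f g : T -> R) : Prop :=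
  [/\ f \in Lfun P 2%:E, g \in Lfun P 2%:E, K g &
    forall h, K h -> \int[P]_o ((f o - g o) * h o) = 0].

Definition is_condexp {dX dW} {TX : measurableType dX} {TW : measurableType dW}
    {R : realType} (P : probability (TX * TW)%type R)
    (f : TX * TW -> R) (g : TX -> R) : Prop :=
  [/\ measurable_fun [set: TX] g,
      P.-integrable [set: TX * TW] (fun o => (g o.1)%:E) &
      forall A : set TX, measurable A ->
        \int[P]_(o in fst @^-1` A) g o.1 = \int[P]_(o in fst @^-1` A) f o].

(* x |-> E_P[f | X = x], a fixed version; it is unique up to a P_X-null set and
   exists as soon as [f] is P-integrable (0 is a dummy value otherwise). *)
Definition condexp {dX dW} {TX : measurableType dX} {TW : measurableType dW}
    {R : realType} (P : probability (TX * TW)%type R) (f : TX * TW -> R)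
    : TX -> R :=
  xget (cst 0 : TX -> R) [set g | is_condexp P f g].

Definition max_branch {R : realType} {TX : Type} {J : nat}
    (b : 'I_J.+1 -> TX -> R) (x : TX) : R :=
  \big[Num.max/b ord0 x]_(j < J.+1) b j x.

Definition argmax_branch {R : realType} {TX : Type} {J : nat}
    (b : 'I_J.+1 -> TX -> R) (x : TX) : {set 'I_J.+1} :=
  [set j | b j x == max_branch b x]%SET.

(* argmax sets are nonempty, so that the default [ord0] is irrelevant *)
Definition min_argmax_branch {R : realType} {TX : Type} {J : nat}
    (b : 'I_J.+1 -> TX -> R) (x : TX) : 'I_J.+1 :=
  [arg min_(j < ord0 | j \in argmax_branch b x) (j : nat)]%N.

Section target.
Context {dX dW : measure_display} {TX : measurableType dX}
  {TW : measurableType dW} {R : realType} {J : nat}.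
Implicit Types (P Q : probability (TX * TW)%type R)
  (b : probability (TX * TW)%type R -> 'I_J.+1 -> TX -> R)
  (zeta : 'I_J.+1 -> TX * TW -> R) (lam : 'I_J.+1 -> TX -> R).

Definition Psi b Q : R := \int[Q]_o max_branch (b Q) o.1.

Definition qfun b P (x : TX) : R := max_branch (b P) x - Psi b P.

Definition tangent_H b P zeta : set (TX * TW -> R) :=
  [set s | [/\ s \in Lfun P 2%:E, \int[P]_o s o = 0 &
    forall i j, {ae P, forall o : TX * TW,
      i \in argmax_branch (b P) o.1 -> j \in argmax_branch (b P) o.1 ->
      condexp P (fun o' => (zeta i o' - zeta j o') * s o') o.1 = 0}]].

Definition Gamma P zeta (x : TX) : 'M[R]_J.+1 :=
  \matrix_(i, j) condexp P (fun o => zeta i o * zeta j o) x.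

Definition principal_submx (A : {set 'I_J.+1}) (M : 'M[R]_J.+1)
    : 'M[R]_#|A| :=
  \matrix_(i, j) M (enum_val i) (enum_val j).

Definition Gamma_act b P zeta (x : TX) : 'M[R]_#|argmax_branch (b P) x| :=
  principal_submx (argmax_branch (b P) x) (Gamma P zeta x).

Definition qform n (M : 'M[R]_n) (v : 'cV[R]_n) : R := (v^T *m M *m v) 0 0.

Definition unit_sum_weight b P lam : Prop :=
  (forall j, measurable_fun [set: TX] (lam j)) /\
  {ae P, forall o : TX * TW,
    (forall j, j \notin argmax_branch (b P) o.1 -> lam j o.1 = 0) /\
    \sum_j lam j o.1 = 1}.

Definition minimizing_weight b P zeta lam : Prop :=
  unit_sum_weight b P lam /\
  {ae P, forall o : TX * TW,
    forall v : 'cV[R]_#|argmax_branch (b P) o.1|, \sum_a v a 0 = 1 ->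
      qform (Gamma_act b P zeta o.1) (\col_a lam (enum_val a) o.1) <=
      qform (Gamma_act b P zeta o.1) v}.

Definition weighted_score b P zeta lam (o : TX * TW) : R :=
  qfun b P o.1 + \sum_j lam j o.1 * zeta j o.

End target.

Definition is_MPinverse {R : realType} n (M N : 'M[R]_n) : Prop :=
  [/\ M *m N *m M = M, N *m M *m N = N,
      (M *m N)^T = M *m N & (N *m M)^T = N *m M].

(* exists and is unique for every real square matrix *)
Definition MPinverse {R : realType} n (M : 'M[R]_n) : 'M[R]_n :=
  xget (0 : 'M[R]_n) [set N | is_MPinverse M N].

Definition v_br {R : realType} n (M : 'M[R]_n) : R :=
  if `[< exists v : 'cV[R]_n, M *m v = const_mx 1 >]
  then (qform (MPinverse M) (const_mx 1))^-1 else 0.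

(* the law with density [g] with respect to [P]; dummy value [P] if [g dP] is
   not a probability *)
Definition tilt {d} {T : measurableType d} {R : realType}
    (P : probability T R) (g : T -> R) : probability T R :=
  xget P [set Q : probability T R | forall A : set T, measurable A ->
    Q A = (\int[P]_(o in A) (g o)%:E)%E].

Definition local_law {d} {T : measurableType d} {R : realType}
    (P : probability T R) (k : nat) (s : 'I_k -> T -> R) (t : 'rV[R]_k)
    : probability T R :=
  tilt P (fun o => 1 + \sum_l t 0 l * s l o).

Section local_experiments.
Context {dX dW : measure_display} {TX : measurableType dX}
  {TW : measurableType dW} {R : realType} {J : nat}.
Local Notation O := (TX * TW)%type.
Implicit Types (P : probability O R) (S : set (O -> R))
  (b : probability O R -> 'I_J.+1 -> TX -> R)
  (zeta : 'I_J.+1 -> O -> R) (model : set (probability O R)).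

Definition score_space b P zeta S : Prop :=
  [/\ S `<=` tangent_H b P zeta,
      forall s, S s -> exists C : R, forall o, `|s o| <= C,
      S (cst 0) &
      forall (a : R) s1 s2, S s1 -> S s2 -> S (fun o => a * s1 o + s2 o)].

Definition smooth_along model b P zeta S : Prop :=
  forall (k : nat) (s : 'I_k -> O -> R), injective s -> (forall l, S (s l)) ->
    (\forall t \near (0 : 'rV[R]_k), model (local_law P s t)) /\
    (forall j (e : R), 0 < e -> \forall t \near (0 : 'rV[R]_k),
      (\int[P]_o `| b (local_law P s t) j o.1 - b P j o.1
          - \sum_l t 0 l * condexp P (fun o' => zeta j o' * s l o')%R o.1 |%:E
       <= (e * `|t|)%:E)%E).

Definition pathwise_gradient b P S (D : O -> R) : Prop :=
  forall s, S s ->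
    is_derive (0 : R) 1 (fun t : R => Psi b (tilt P (fun o => 1 + t * s o)))
      (\int[P]_o (D o * s o)).

Definition canonical_gradient b P S (D : O -> R) : Prop :=
  [/\ L2_closure P S D, pathwise_gradient b P S D &
      forall D', L2_closure P S D' -> pathwise_gradient b P S D' ->
        {ae P, forall o, D' o = D o}].

End local_experiments.

Lemma measurable_tcons {d} {T : measurableType d} n :
  measurable_fun [set: T * n.-tuple T]
    (fun z => [the n.+1.-tuple T of z.1 :: z.2]).
Proof. exact: measurable_cons. Qed.

Fixpoint iid_law {d} {T : measurableType d} {R : realType}
    (P : probability T R) (n : nat) : giry (n.-tuple T) R :=
  if n is n'.+1 then
    giry_map (@measurable_tcons d T n') (giry_prod (P : giry T R, iid_law P n'))
  else giry_ret [tuple].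

Section convolution.
Context {dX dW : measure_display} {TX : measurableType dX}
  {TW : measurableType dW} {R : realType} {J : nat}.
Local Notation O := (TX * TW)%type.
Local Notation Rm := (measurableTypeR R).
Implicit Types (P : probability O R) (S : set (O -> R))
  (b : probability O R -> 'I_J.+1 -> TX -> R) (L : probability Rm R).

(* sqrt n (T_n - Psi (P_{h/sqrt n})) converges in distribution to [L] under
   i.i.d. sampling from P_{h/sqrt n}, for every finite-dimensional submodel and
   every h; at h = 0 the law does not depend on the submodel, hence a single
   [L]. *)
Definition regular_with_limit b P S (Tn : forall n, n.-tuple O -> R) L : Prop :=
  (forall n, measurable_fun [set: n.-tuple O] (Tn n)) /\
  forall (k : nat) (s : 'I_k -> O -> R) (h : 'rV[R]_k),
    injective s -> (forall l, S (s l)) ->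
    let Pn n := local_law P s ((Num.sqrt n%:R)^-1 *: h) in
    forall f : R -> R, continuous f -> (exists C : R, forall x, `|f x| <= C) ->
      \int[iid_law (Pn n) n]_o f (Num.sqrt n%:R * (Tn n o - Psi b (Pn n)))
        @[n --> \oo] --> \int[L]_x f x.

Definition regular_limit b P S L : Prop :=
  exists Tn : forall n, n.-tuple O -> R, regular_with_limit b P S Tn L.

(* N(0, v); [normal_prob 0 0] is not the Dirac mass in the library *)
Definition centered_gaussian (v : R) : probability Rm R :=
  if v == 0 then (dirac (0 : Rm) : probability Rm R)
  else (normal_prob 0 (Num.sqrt v) : probability Rm R).

Definition has_gaussian_factor (v : R) L : Prop :=
  exists M : probability Rm R, forall A : set Rm, measurable A ->
    L A = pushforward (centered_gaussian v \x M)%E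
            (fun z : Rm * Rm => z.1 + z.2 : Rm) A.

(* [v] is the variance of the Gaussian convolution factor common to all limit
   laws of regular estimators; as N(0, v) has every N(0, v') with v' <= v as a
   factor, this is the largest such variance. *)
Definition convolution_bound b P S (v : R) : Prop :=
  [/\ 0 <= v,
      forall L, regular_limit b P S L -> has_gaussian_factor v L &
      forall v', 0 <= v' ->
        (forall L, regular_limit b P S L -> has_gaussian_factor v' L) ->
        v' <= v].

End convolution.

(* Main.v *)
(* Given X, two unit-sum weightings of the branch gradients differ by a
   combination of differences zeta_i - zeta_j of active branches, and such
   combinations are orthogonal to H. Stationarity of the minimizing weights
   makes Gamma lambda* constant on the active set: hence D* belongs to H, and the
   constant is v_br(Gamma_act).

   Along a bounded score the maximum of the branches is linearized up to an error
   supported where an inactive branch comes within O(t) of the maximum, a set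
   shrinking to nothing; the derivative of Psi is then E[D* s].

   Convolution theorem, without characteristic functions: let s be a score with
   E[D* s] = -1, and put the prior N(0, 1/eps) on h in P_{h/sqrt n}. By local
   asymptotic normality the posterior of h is Gaussian with variance
   1/(E s^2 + eps), so the common limit L of a regular sequence is approximated,
   on finitely many test functions, by laws N(0, 1/(E s^2 + eps)) * M. This
   variance tends to |D*|^2 as eps tends to 0 and s to a multiple of D*, and
   compactness produces an exact factor. The bound is sharp because the
   sample mean of D* is regular with limit N(0, |D*|^2), by Lindeberg's
   replacement argument. *)
Require Import Defs.
From HB Require Import structures.
From mathcomp Require Import all_boot all_order all_algebra.
From mathcomp Require Import all_classical all_reals all_analysis.
From mathcomp Require Import measurable_realfun giry.
From mathcomp Require Import ring lra.

Set Implicit Arguments.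
Unset Strict Implicit.
Unset Printing Implicit Defensive.

Import Order.TTheory GRing.Theory Num.Theory.
Import numFieldNormedType.Exports.

Local Open Scope classical_set_scope.
Local Open Scope ring_scope.

(** * Integrals and densities *)

(** The weights are only measurable: signed and possibly unbounded, so the products [lam j * zeta j]
    have no a priori integrability. Identities for D* are proved under a cutoff depending on X and
    passed to the limit; minimality, tested against the first active branch, is what bounds the
    second moment of the weighted gradients.

    Each approximation in the lower bound uses a single score, normalized by E[D* s] = -1 so that
    Psi(P_{h/sqrt n}) is Psi(P) - h/sqrt n up to o(1/sqrt n). With X = sqrt n (T_n - Psi(P)),
    regularity says that X + h has the limit L for every h, and mixing over h adds noise to X. The
    likelihood is not bounded uniformly in h, whence a truncation where the normalized score is
    large.

    On the line one family of test functions serves throughout, the spline ramps: smooth enough for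
    Lindeberg's argument, monotone and Lipschitz for the compactness argument, and rich enough to
    determine laws and weak convergence. *)

Section integral_basics.
Context {d} {T : measurableType d} {R : realType}.
Implicit Types (f g : T -> R).

Lemma integrable_measurable (mu : {measure set T -> \bar R}) f :
  mu.-integrable setT (EFin \o f) -> measurable_fun setT f.
Proof. by move=> /measurable_int/measurable_EFinP. Qed.

Lemma bounded_integrable (mu : {finite_measure set T -> \bar R}) f (C : R) :
  measurable_fun setT f -> (forall x, `|f x| <= C) ->
  mu.-integrable setT (EFin \o f).
Proof.
move=> mf fC; apply: measurable_bounded_integrable => //.
  by rewrite ltey_eq fin_num_measure.
exists C; split; first exact: num_real.
by move=> M CM x _; exact: (le_trans (fC x) (ltW CM)).
Qed.

Lemma le_integrableR (mu : {measure set T -> \bar R}) f g :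
  measurable_fun setT f -> (forall x, `|f x| <= g x) ->
  mu.-integrable setT (EFin \o g) -> mu.-integrable setT (EFin \o f).
Proof.
move=> mf fg ig; apply: le_integrable ig => //; first exact/measurable_EFinP.
by move=> x _ /=; rewrite lee_fin (le_trans (fg x))// ler_norm.
Qed.

Lemma integrable_ge0 (mu : {measure set T -> \bar R}) f :
  measurable_fun setT f -> (forall x, 0 <= f x) ->
  (\int[mu]_x (f x)%:E < +oo)%E -> mu.-integrable setT (EFin \o f).
Proof.
move=> mf f0 foo; apply/integrableP; split; first exact/measurable_EFinP.
by under eq_integral do rewrite /= ger0_norm//.
Qed.

Lemma funrposBnegE f x : f^\+%R x - f^\-%R x = f x.
Proof. by rewrite -[in RHS](funrposBneg f). Qed.

Lemma measurable_pred (p : T -> bool) : measurable_fun setT p ->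
  measurable [set x | p x].
Proof.
move=> mp; rewrite -[X in measurable X]setTI.
have := mp measurableT [set true] Logic.I.
by congr measurable; apply/seteqP; split => x [].
Qed.

Lemma measurable_gt0 f : measurable_fun setT f -> measurable [set x | 0 < f x].
Proof. by move=> mf; apply: measurable_pred; exact: measurable_fun_ltr. Qed.

Lemma EFin_Rintegral (mu : {measure set T -> \bar R}) f :
  mu.-integrable setT (EFin \o f) ->
  (\int[mu]_x f x)%:E = (\int[mu]_x (f x)%:E)%E.
Proof. by move=> If; rewrite /Rintegral fineK// integrable_fin_num. Qed.

Lemma Rintegral_cst1 (P : probability T R) (r : R) : \int[P]_x r = r.
Proof. by rewrite Rintegral_cst//= probability_setT mulr1. Qed.

Lemma ae_eq_Rintegral (mu : {measure set T -> \bar R}) f g :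
  measurable_fun setT f -> measurable_fun setT g ->
  {ae mu, forall x, f x = g x} -> \int[mu]_x f x = \int[mu]_x g x.
Proof.
move=> mf mg fg; rewrite /Rintegral; congr fine; apply: ae_eq_integral => //.
- exact/measurable_EFinP.
- exact/measurable_EFinP.
by apply: filterS fg => x + _ => ->.
Qed.

Lemma Rintegral_ae0 (mu : {measure set T -> \bar R}) f :
  mu.-integrable setT (EFin \o f) ->
  (forall x, 0 <= f x) -> \int[mu]_x f x = 0 -> {ae mu, forall x, f x = 0}.
Proof.
move=> If f0 f0'.
have : (\int[mu]_x `|(f x)%:E| = 0)%E.
  under eq_integral do rewrite /= ger0_norm//.
  by rewrite -EFin_Rintegral// f0'.
move/(ae_eq_integral_abs mu measurableT) => /(_ (measurable_int _ If)).
by apply: filterS => x /(_ Logic.I)[].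
Qed.

Lemma Rintegral_sum (mu : {measure set T -> \bar R}) (I : Type) (s : seq I)
    (F : I -> T -> R) :
  (forall i, mu.-integrable setT (EFin \o F i)) ->
  \int[mu]_x (\sum_(i <- s) F i x) = \sum_(i <- s) \int[mu]_x F i x.
Proof.
move=> IF; elim: s => [|i s IH].
  under eq_Rintegral do rewrite big_nil.
  by rewrite big_nil /Rintegral integral0.
rewrite big_cons -IH; under eq_Rintegral do rewrite big_cons.
apply: RintegralD => //.
have := @integrable_sum _ _ _ mu setT measurableT _ s xpredT _
  (fun i _ => IF i).
by apply: eq_integrable => // x _ /=; rewrite sumEFin.
Qed.

Lemma integrable_sumR (mu : {measure set T -> \bar R}) (I : Type) (s : seq I)
    (F : I -> T -> R) :
  (forall i, mu.-integrable setT (EFin \o F i)) ->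
  mu.-integrable setT (EFin \o (fun x => \sum_(i <- s) F i x)).
Proof.
move=> IF.
have := @integrable_sum _ _ _ mu setT measurableT _ s xpredT _
  (fun i _ => IF i).
by apply: eq_integrable => // x _ /=; rewrite sumEFin.
Qed.

Lemma integrableDR (mu : {measure set T -> \bar R}) f g :
  mu.-integrable setT (EFin \o f) -> mu.-integrable setT (EFin \o g) ->
  mu.-integrable setT (EFin \o (fun x => f x + g x)).
Proof. by move=> If Ig; have := integrableD measurableT If Ig. Qed.

Lemma integrableBR (mu : {measure set T -> \bar R}) f g :
  mu.-integrable setT (EFin \o f) -> mu.-integrable setT (EFin \o g) ->
  mu.-integrable setT (EFin \o (fun x => f x - g x)).
Proof. by move=> If Ig; have := integrableB measurableT If Ig. Qed.

Lemma integrableZR (mu : {measure set T -> \bar R}) (a : R) f :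
  mu.-integrable setT (EFin \o f) ->
  mu.-integrable setT (EFin \o (fun x => a * f x)).
Proof. by move=> If; have := integrableZl measurableT a If. Qed.

Lemma integrable_mulb (mu : {measure set T -> \bar R}) f g (C : R) :
  measurable_fun setT g -> (forall x, `|g x| <= C) ->
  mu.-integrable setT (EFin \o f) ->
  mu.-integrable setT (EFin \o (fun x => g x * f x)).
Proof.
move=> mg gC If; apply: (@le_integrableR _ _ (fun x => C * `|f x|)).
- by apply: measurable_funM => //; exact: integrable_measurable If.
- by move=> x; rewrite normrM ler_wpM2r.
- exact/integrableZR/integrable_norm.
Qed.

Lemma le_abs_Rintegral (mu : {measure set T -> \bar R}) f g :
  measurable_fun setT f -> (forall x, `|f x| <= g x) ->
  mu.-integrable setT (EFin \o g) -> `|\int[mu]_x f x| <= \int[mu]_x g x.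
Proof.
move=> mf fg Ig; have If := le_integrableR mf fg Ig.
apply: (le_trans (le_normr_Rintegral _ _)) => //.
by apply: le_Rintegral => //; exact: integrable_norm.
Qed.

Lemma dominated_Rcvg (mu : {measure set T -> \bar R}) (F : nat -> T -> R) f g :
  (forall n, measurable_fun setT (F n)) -> measurable_fun setT f ->
  mu.-integrable setT (EFin \o g) ->
  (forall n x, `|F n x| <= g x) ->
  {ae mu, forall x, F n x @[n --> \oo] --> f x} ->
  \int[mu]_x F n x @[n --> \oo] --> \int[mu]_x f x.
Proof.
move=> mF mf Ig Fg Ff.
have [|||||If _ H] := @dominated_convergence _ _ _ mu setT measurableT
    (fun n x => (F n x)%:E) (EFin \o f) (EFin \o g) => //.
- by move=> n; exact/measurable_EFinP.
- exact/measurable_EFinP.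
- by apply: filterS Ff => x Fx _; apply/fine_cvgP; split => //; exact: nearW.
- by apply: aeW => x n _ /=; rewrite lee_fin.
apply: fine_cvg; rewrite fineK//; exact: integrable_fin_num.
Qed.

Lemma ae_le_Rintegral (mu : {measure set T -> \bar R}) f g :
  mu.-integrable setT (EFin \o f) -> mu.-integrable setT (EFin \o g) ->
  {ae mu, forall x, f x <= g x} -> \int[mu]_x f x <= \int[mu]_x g x.
Proof.
move=> If Ig fg.
have -> : \int[mu]_x g x = \int[mu]_x (Num.max (f x) (g x)).
  apply: ae_eq_Rintegral; [exact: integrable_measurable Ig| |].
    by apply: measurable_maxr;
      [exact: integrable_measurable If|exact: integrable_measurable Ig].
  by apply: filterS fg => x; case: leP.
apply: le_Rintegral => //; last by move=> x _; rewrite le_max lexx.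
apply: (@le_integrableR _ _ (fun x => `|f x| + `|g x|)).
- by apply: measurable_maxr;
    [exact: integrable_measurable If|exact: integrable_measurable Ig].
- by move=> x; rewrite /Num.max; case: ifP => _; rewrite ?lerDr ?lerDl.
- exact: integrableDR (integrable_norm If) (integrable_norm Ig).
Qed.

Lemma ae_le_integrable (mu : {measure set T -> \bar R}) f g :
  measurable_fun setT f -> {ae mu, forall x, `|f x| <= g x} ->
  mu.-integrable setT (EFin \o g) -> mu.-integrable setT (EFin \o f).
Proof.
move=> mf fg Ig; have mg := integrable_measurable Ig.
apply/integrableP; split; first exact/measurable_EFinP.
have /integrableP[_ goo] := Ig; apply: le_lt_trans goo.
apply: ae_ge0_le_integral => //.
- by apply: measurableT_comp => //; exact/measurable_EFinP.
- by apply: measurableT_comp => //; exact/measurable_EFinP.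
by apply: filterS fg => x h _ /=; rewrite lee_fin (le_trans h)// ler_norm.
Qed.

End integral_basics.

Section density.
Context {d} {T : measurableType d} {R : realType}.
Variables (mu : {measure set T -> \bar R}) (g : T -> R).

Definition density_measure of measurable_fun setT g & (forall x, 0 <= g x) :=
  fun A => (\int[mu]_(x in A) (g x)%:E)%E.

Hypotheses (mg : measurable_fun setT g) (g0 : forall x, 0 <= g x).

Local Notation nu := (density_measure mg g0).

Let nu0 : nu set0 = 0%E. Proof. by rewrite /nu integral_set0. Qed.

Let nu_ge0 A : (0 <= nu A)%E.
Proof. by apply: integral_ge0 => x _; rewrite lee_fin. Qed.

Let nu_sigma_additive : semi_sigma_additive nu.
Proof.
apply: semi_sigma_additive_nng_induced; first exact/measurable_EFinP.
by move=> x; rewrite lee_fin.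
Qed.

HB.instance Definition _ := isMeasure.Build _ T R nu
  nu0 nu_ge0 nu_sigma_additive.

End density.

Section density_integral.
Context {d} {T : measurableType d} {R : realType}.
Implicit Types (mu nu : {measure set T -> \bar R}) (f g : T -> R).

Import HBNNSimple.

(** The hypothesis is the case of indicators; the fibres of a simple function and monotone
    convergence along [nnsfun_approx] give the rest. The measures are linked only by an equation on
    sets, so that tilted laws, normal laws and [density_measure] all qualify. *)
Lemma ge0_integral_density mu nu g (f : T -> \bar R) :
  (forall A, measurable A -> nu A = \int[mu]_(x in A) (g x)%:E)%E ->
  measurable_fun setT g -> (forall x, 0 <= g x) ->
  measurable_fun setT f -> (forall x, 0 <= f x)%E ->
  (\int[nu]_x f x = \int[mu]_x (f x * (g x)%:E))%E.
Proof.
move=> nuE mg g0 mf f0; pose h := nnsfun_approx measurableT mf.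
have mh n : measurable_fun setT (EFin \o h n) by exact/measurable_EFinP.
have mG : measurable_fun setT (EFin \o g) by exact/measurable_EFinP.
have nd x a b : (a <= b)%N -> ((h a x)%:E <= (h b x)%:E)%E.
  by move=> ab; rewrite lee_fin; exact/lefP/nd_nnsfun_approx.
have hE x : (h n x)%:E @[n --> \oo] --> f x.
  by apply: cvg_nnsfun_approx.
transitivity (limn (fun n => \int[nu]_x (h n x)%:E)%E).
  rewrite -monotone_convergence//; last by move=> x _ a b; exact: nd.
    by apply: eq_integral => x _; apply/esym/cvg_lim => //; exact: hE.
  by move=> n x _; rewrite lee_fin.
transitivity (limn (fun n => \int[mu]_x ((h n x)%:E * (g x)%:E))%E); last first.
  rewrite -monotone_convergence//.
  - apply: eq_integral => x _; apply/cvg_lim => //; exact: cvgeZr.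
  - by move=> n; apply: emeasurable_funM => //; exact: mh.
  - by move=> n x _; rewrite mule_ge0// lee_fin.
  - by move=> x _ a b ab; rewrite lee_wpmul2r ?lee_fin//; exact: (nd x a b ab).
congr (limn _); apply/funext => n.
have mI y : measurable_fun setT (fun x => (y * \1_(h n @^-1` [set y]) x)%:E).
  by apply/measurable_EFinP; exact: measurable_funM.
transitivity (\int[nu]_x (\sum_(y \in range (h n))
    (y * \1_(h n @^-1` [set y]) x)%:E))%E.
  by apply: eq_integral => t tE; rewrite /= fimfunE -fsumEFin.
rewrite ge0_integral_fsum//; last by move=> m y Ey; exact: nnfun_muleindic_ge0.
transitivity (\int[mu]_x (\sum_(y \in range (h n))
    (y * \1_(h n @^-1` [set y]) x)%:E * (g x)%:E))%E; last first.
  apply: eq_integral => t tE.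
  rewrite -ge0_mule_fsuml => [|y]; last exact: nnfun_muleindic_ge0.
  by rewrite fsumEFin// -(fimfunE _ t).
rewrite ge0_integral_fsum//; last 2 first.
  - by move=> y; apply: emeasurable_funM.
  - move=> m y Ey; apply: mule_ge0; last by rewrite lee_fin.
    exact: nnfun_muleindic_ge0.
apply: eq_fsbigr => r rhn.
rewrite integralZl_indic_nnsfun//.
under [RHS]eq_integral do rewrite EFinM -muleA.
rewrite ge0_integralZl//.
- congr (_ * _)%E; under [RHS]eq_integral do rewrite muleC.
  rewrite integral_indic// setIT nuE// integral_mkcond.
  by apply: eq_integral => x xE; rewrite epatch_indic.
- by apply: emeasurable_funM => //; exact/measurable_EFinP.
- by move=> t Et; rewrite mule_ge0 ?lee_fin.
- by move: rhn; rewrite inE => -[t _ <-]; rewrite lee_fin.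
Qed.

Lemma integrable_density mu nu g f :
  (forall A, measurable A -> nu A = \int[mu]_(x in A) (g x)%:E)%E ->
  measurable_fun setT g -> (forall x, 0 <= g x) -> measurable_fun setT f ->
  mu.-integrable setT (EFin \o (fun x => f x * g x)) ->
  nu.-integrable setT (EFin \o f).
Proof.
move=> nuE mg g0 mf /integrableP[_ foo]; apply/integrableP; split.
  exact/measurable_EFinP.
rewrite (ge0_integral_density nuE)//; last first.
  by apply: measurableT_comp => //; exact/measurable_EFinP.
rewrite (le_lt_trans _ foo)// le_eqVlt; apply/orP; left; apply/eqP.
by apply: eq_integral => x _ /=; rewrite -EFinM normrM (ger0_norm (g0 x)).
Qed.

Lemma Rintegral_density mu nu g f :
  (forall A, measurable A -> nu A = \int[mu]_(x in A) (g x)%:E)%E ->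
  measurable_fun setT g -> (forall x, 0 <= g x) -> measurable_fun setT f ->
  mu.-integrable setT (EFin \o (fun x => f x * g x)) ->
  \int[nu]_x f x = \int[mu]_x (f x * g x).
Proof.
move=> nuE mg g0 mf If; rewrite /Rintegral; congr fine.
rewrite integralE [RHS]integralE; congr (_ - _)%E.
- rewrite (ge0_integral_density nuE)//; last first.
    by apply: measurable_funepos; exact/measurable_EFinP.
  apply: eq_integral => x _.
  by rewrite !funeposE EFinM maxe_pMl// ?lee_fin// mul0e.
- rewrite (ge0_integral_density nuE)//; last first.
    by apply: measurable_funeneg; exact/measurable_EFinP.
  apply: eq_integral => x _.
  by rewrite !funenegE EFinM maxe_pMl// ?lee_fin// mul0e mulNe.
Qed.

End density_integral.

Section tilt_lemmas.
Context {d} {T : measurableType d} {R : realType} (P : probability T R).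
Implicit Types f g : T -> R.

Lemma density_probability g : measurable_fun setT g -> (forall x, 0 <= g x) ->
  (\int[P]_x (g x)%:E = 1)%E ->
  exists Q : probability T R, forall A, measurable A ->
    Q A = (\int[P]_(x in A) (g x)%:E)%E.
Proof.
move=> mg g0 g1.
have Q1 : density_measure P mg g0 [set: T] = 1%E by [].
pose isP := Measure_isProbability.Build _ _ _ (density_measure P mg g0) Q1.
pose Q : probability T R := HB.pack (density_measure P mg g0) isP.
by exists Q.
Qed.

(** [density_probability] supplies a witness for the choice made in [tilt], which excludes the dummy
    value [P]. *)
Lemma tiltE g : measurable_fun setT g -> (forall x, 0 <= g x) ->
  (\int[P]_x (g x)%:E = 1)%E ->
  forall A, measurable A -> tilt P g A = (\int[P]_(x in A) (g x)%:E)%E.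
Proof.
move=> mg g0 g1; rewrite /tilt; case: xgetP => [Q -> //|no].
by have [Q QE] := density_probability mg g0 g1; case: (no Q QE).
Qed.

End tilt_lemmas.

(** * Conditional expectations and square integrable functions *)

Section image.
Context {d d'} {T : measurableType d} {T' : measurableType d'} {R : realType}.
Implicit Types (mu : {measure set T -> \bar R}) (nu : {measure set T' -> \bar R}).

Lemma image_measure mu (f : T -> T') : measurable_fun setT f ->
  exists nu : {measure set T' -> \bar R}, forall A, nu A = mu (f @^-1` A).
Proof.
move=> mf; pose fm : {mfun T >-> T'} := mfun_Sub (mem_set mf).
by unshelve eexists; [refine (pushforward mu fm : measure _ _); exact: mf|].
Qed.

Lemma image_probability (P : probability T R) (f : T -> T') :
  measurable_fun setT f ->
  exists Q : probability T' R, forall A, Q A = P (f @^-1` A).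
Proof.
move=> mf; pose fm : {mfun T >-> T'} := mfun_Sub (mem_set mf).
by exists (distribution P fm).
Qed.

Lemma ge0_integral_image mu nu (f : T -> T') (g : T' -> \bar R) :
  (forall A, measurable A -> nu A = mu (f @^-1` A)) ->
  measurable_fun setT f -> measurable_fun setT g -> (forall x, 0 <= g x)%E ->
  (\int[nu]_x g x = \int[mu]_x g (f x))%E.
Proof.
move=> nuE mf mg g0; pose fm : {mfun T >-> T'} := mfun_Sub (mem_set mf).
have := @ge0_integral_pushforward _ _ _ _ R fm mf mu setT g measurableT mg
  (fun y _ => g0 y).
by rewrite preimage_setT => <-; apply: eq_measure_integral => A mA _; exact: nuE.
Qed.

Lemma Rintegral_image mu nu (f : T -> T') (g : T' -> R) :
  (forall A, measurable A -> nu A = mu (f @^-1` A)) ->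
  measurable_fun setT f -> measurable_fun setT g ->
  \int[nu]_x g x = \int[mu]_x g (f x).
Proof.
move=> nuE mf mg; rewrite /Rintegral; congr fine.
have mg' : measurable_fun setT (EFin \o g) by exact/measurable_EFinP.
rewrite integralE [RHS]integralE; congr (_ - _)%E.
- rewrite (ge0_integral_image nuE mf)//; last exact: measurable_funepos mg'.
  by apply: eq_integral => x _; rewrite !funeposE.
- rewrite (ge0_integral_image nuE mf)//; last exact: measurable_funeneg mg'.
  by apply: eq_integral => x _; rewrite !funenegE.
Qed.

End image.

Section finite_measure_of.
Context {d} {T : measurableType d} {R : realType}.
Variable m : {measure set T -> \bar R}.
Let m' : set T -> \bar R := m.
Hypothesis mfin : fin_num_fun m'.

Let m'0 : m' set0 = 0%E. Proof. exact: measure0. Qed.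
Let m'_ge0 A : (0 <= m' A)%E. Proof. exact: measure_ge0. Qed.
Let m'_sigma : semi_sigma_additive m'.
Proof. exact: measure_semi_sigma_additive. Qed.

#[local] HB.instance Definition _ :=
  isMeasure.Build _ T R m' m'0 m'_ge0 m'_sigma.
#[local] HB.instance Definition _ := Measure_isFinite.Build _ T R m' mfin.

(** The image of [f dP] under [fst] is at first finite only as a property of its values; the
    Radon-Nikodym theorem is applied to a finite measure as a structure. *)
Lemma finite_measure_of : exists nu : {finite_measure set T -> \bar R},
  forall A, nu A = m A.
Proof. by exists m'. Qed.

End finite_measure_of.

Section condexp.
Context {dX dW} {TX : measurableType dX} {TW : measurableType dW}
  {R : realType} (P : probability (TX * TW)%type R).
Local Notation O := (TX * TW)%type.
Implicit Types (f : O -> R) (g w : TX -> R).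

Let mfst : measurable_fun setT (fst : O -> TX).
Proof. exact: measurable_fst. Qed.

Lemma measurable_fst_comp g : measurable_fun setT g ->
  measurable_fun setT (fun o : O => g o.1).
Proof. by move=> mg; exact: measurableT_comp mg mfst. Qed.

Lemma measurable_preimage_fst (A : set TX) : measurable A ->
  measurable (fst @^-1` A : set O).
Proof. by move=> mA; rewrite -[X in measurable X]setTI; exact: mfst. Qed.

(** The version is a finite Radon-Nikodym derivative of the image of [f dP] under [fst] with respect
    to the law of X. *)
Let ge0_condexp_exists f : P.-integrable setT (EFin \o f) ->
  (forall o, 0 <= f o) -> exists g, is_condexp P f g.
Proof.
move=> If f0; have mf := integrable_measurable If.
have [m mE'] := image_measure (density_measure P mf f0) mfst.
have mE A : m A = (\int[P]_(o in fst @^-1` A) (f o)%:E)%E by exact: mE'.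
have mfin : fin_num_fun m.
  move=> A mA; rewrite mE; apply: integrable_fin_num => //.
    exact: measurable_preimage_fst.
  by apply: integrableS If => //; exact: measurable_preimage_fst.
have [nu nuE] := finite_measure_of mfin.
have [PX PXE] := image_probability P mfst.
have dom : nu `<< PX.
  apply/null_content_dominatesP => A mA PA0.
  rewrite nuE mE; apply: null_set_integral => //.
  - exact: measurable_preimage_fst.
  - apply: measurable_funS (measurable_int _ If) => //.
  - exact: etrans (esym (PXE _)) PA0.
have [h [h0 hfin Ih hE]] := radon_nikodym_sigma_finite dom.
pose g x := fine (h x).
have gE x : (g x)%:E = h x by rewrite fineK.
have mg : measurable_fun setT g.
  apply/measurable_EFinP; have -> : EFin \o g = h by apply/funext => x; exact: gE.
  exact: measurable_int Ih.
have PXE' A : measurable A -> PX A = P (fst @^-1` A) by move=> _; exact: PXE.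
exists g; split => //.
- apply: integrable_ge0; first exact: measurable_fst_comp.
    by move=> o; exact: fine_ge0.
  have := integrable_lty measurableT Ih.
  rewrite (ge0_integral_image PXE' mfst)//; last exact: measurable_int Ih.
  have -> // : (\int[P]_o (g o.1)%:E = \int[P]_o h o.1)%E.
  by apply: eq_integral => o _; exact: gE.
- move=> A mA; rewrite /Rintegral -mE; congr fine.
  rewrite -nuE hE// [RHS]integral_mkcond.
  rewrite (ge0_integral_image PXE' mfst); last 2 first.
  - by apply/(measurable_restrictT _ _).1 => //; apply: measurable_funTS; exact: measurable_int Ih.
  - by move=> x; rewrite patchE; case: ifP.
  rewrite integral_mkcond; apply: eq_integral => o _.
  rewrite !patchE gE; have -> // : (o \in fst @^-1` A) = (o.1 \in A).
  by apply/idP/idP; rewrite !inE.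
Qed.

(** Positive and negative parts have versions, and their difference is a version for f; hence the
    dummy value in [condexp] is excluded. *)
Lemma condexpP f : P.-integrable setT (EFin \o f) -> is_condexp P f (condexp P f).
Proof.
move=> If; rewrite /condexp; case: xgetP => [g -> //|no].
have [g1 [mg1 Ig1 E1]] : exists g, is_condexp P (f^\+%R) g.
  apply: ge0_condexp_exists; first exact: integrable_funrpos.
  by move=> o; exact: funrpos_ge0.
have [g2 [mg2 Ig2 E2]] : exists g, is_condexp P (f^\-%R) g.
  apply: ge0_condexp_exists; first exact: integrable_funrneg.
  by move=> o; exact: funrneg_ge0.
case: (no (fun x => g1 x - g2 x)); split.
- exact: measurable_funB.
- exact: (integrableBR (f := fun o => g1 o.1) (g := fun o => g2 o.1)).
- move=> A mA; have mA' := measurable_preimage_fst mA.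
  rewrite RintegralB//; [|exact: integrableS Ig1|exact: integrableS Ig2].
  rewrite E1// E2// -RintegralB//; last 2 first.
    by apply: integrableS (integrable_funrpos _ If).
    by apply: integrableS (integrable_funrneg _ If).
  by apply: eq_Rintegral => o _; rewrite funrposBnegE.
Qed.

Lemma measurable_condexp f : P.-integrable setT (EFin \o f) ->
  measurable_fun setT (condexp P f).
Proof. by move=> /condexpP[]. Qed.

Lemma integrable_condexp f : P.-integrable setT (EFin \o f) ->
  P.-integrable setT (EFin \o (fun o => condexp P f o.1)).
Proof. by move=> /condexpP[]. Qed.

(** The hypothesis says that the measures with densities f^+ and f^- have the same image under
    [fst]; they therefore integrate every bounded nonnegative function of X alike. The sign of [w]
    is removed last, by splitting it into its two parts. *)
Lemma Rintegral_fst0 f w (C : R) : P.-integrable setT (EFin \o f) ->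
  (forall A : set TX, measurable A -> \int[P]_(o in fst @^-1` A) f o = 0) ->
  measurable_fun setT w -> (forall x, `|w x| <= C) ->
  \int[P]_o (w o.1 * f o) = 0.
Proof.
move=> If f0 mw wC.
have mf := integrable_measurable If.
have Ifp : P.-integrable setT (EFin \o f^\+%R) by exact: integrable_funrpos.
have Ifn : P.-integrable setT (EFin \o f^\-%R) by exact: integrable_funrneg.
have mfp := integrable_measurable Ifp; have mfn := integrable_measurable Ifn.
have fp0 o : 0 <= f^\+%R o by exact: funrpos_ge0.
have fn0 o : 0 <= f^\-%R o by exact: funrneg_ge0.
have [n1 n1E] := image_measure (density_measure P mfp fp0) mfst.
have [n2 n2E] := image_measure (density_measure P mfn fn0) mfst.
have n12 A : measurable A -> n1 A = n2 A.
  move=> mA; have mA' := measurable_preimage_fst mA.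
  have := f0 A mA.
  have -> : \int[P]_(o in fst @^-1` A) f o =
      \int[P]_(o in fst @^-1` A) f^\+%R o - \int[P]_(o in fst @^-1` A) f^\-%R o.
    rewrite -RintegralB//; [|exact: integrableS Ifp|exact: integrableS Ifn].
    by apply: eq_Rintegral => o _; rewrite funrposBnegE.
  move/eqP; rewrite subr_eq0 => /eqP E.
  have fin1 : (\int[P]_(o in fst @^-1` A) (f^\+%R o)%:E)%E \is a fin_num.
    by apply: integrable_fin_num => //; exact: integrableS Ifp.
  have fin2 : (\int[P]_(o in fst @^-1` A) (f^\-%R o)%:E)%E \is a fin_num.
    by apply: integrable_fin_num => //; exact: integrableS Ifn.
  have -> : n1 A = (\int[P]_(o in fst @^-1` A) (f^\+%R o)%:E)%E by exact: n1E.
  have -> : n2 A = (\int[P]_(o in fst @^-1` A) (f^\-%R o)%:E)%E by exact: n2E.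
  by rewrite -(fineK fin1) -(fineK fin2); congr _%:E.
have key (u : TX -> R) : measurable_fun setT u -> (forall x, 0 <= u x <= C) ->
    \int[P]_o (u o.1 * f o) = 0.
  move=> mu u0C.
  have u0 x : 0 <= u x by case/andP: (u0C x).
  have uC x : `|u x| <= C by rewrite ger0_norm//; case/andP: (u0C x).
  have muf := measurable_fst_comp mu.
  have E (h : O -> R) (mh : measurable_fun setT h) (h0 : forall o, 0 <= h o)
      (n : {measure set TX -> \bar R}) :
      (forall A, n A = density_measure P mh h0 (fst @^-1` A)) ->
      (\int[n]_x (u x)%:E = \int[P]_o (u o.1 * h o)%:E)%E.
    move=> nE.
    rewrite (@ge0_integral_image _ _ _ _ _ (density_measure P mh h0) n fst)//; last exact/measurable_EFinP.
    rewrite (@ge0_integral_density _ _ _ P _ h)//.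
      exact/measurable_EFinP.
    by move=> o; rewrite lee_fin.
  have : \int[P]_o (u o.1 * f^\+%R o) = \int[P]_o (u o.1 * f^\-%R o).
    rewrite /Rintegral -(E _ mfp fp0 n1)// -(E _ mfn fn0 n2)//.
    by congr fine; apply: eq_measure_integral => A mA _; exact: n12.
  move=> E'.
  have -> : \int[P]_o (u o.1 * f o) =
      \int[P]_o (u o.1 * f^\+%R o - u o.1 * f^\-%R o).
    by apply: eq_Rintegral => o _; rewrite -mulrBr funrposBnegE.
  rewrite RintegralB//; first by rewrite E' subrr.
  - by apply: (integrable_mulb (g := fun o => u o.1)) Ifp => // o; exact: uC.
  - by apply: (integrable_mulb (g := fun o => u o.1)) Ifn => // o; exact: uC.
have -> : \int[P]_o (w o.1 * f o) =
    \int[P]_o (w^\+%R o.1 * f o - w^\-%R o.1 * f o).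
  by apply: eq_Rintegral => o _; rewrite -mulrBl funrposBnegE.
have mwp : measurable_fun setT w^\+%R by exact: measurable_funrpos.
have mwn : measurable_fun setT w^\-%R by exact: measurable_funrneg.
have wp x : 0 <= w^\+%R x <= C.
  rewrite funrpos_ge0/= /funrpos ge_max (le_trans (ler_norm _) (wC x))/=.
  exact: le_trans (normr_ge0 _) (wC x).
have wn x : 0 <= w^\-%R x <= C.
  rewrite funrneg_ge0/= /funrneg ge_max.
  rewrite (le_trans (ler_norm _))/= ?normrN//.
  exact: le_trans (normr_ge0 _) (wC x).
rewrite RintegralB//; first by rewrite !key// subrr.
- apply: (integrable_mulb (g := fun o => w^\+%R o.1) (C := C)) If => //.
    exact: measurable_fst_comp.
  by move=> o; case/andP: (wp o.1) => w0 ?; rewrite ger0_norm.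
- apply: (integrable_mulb (g := fun o => w^\-%R o.1) (C := C)) If => //.
    exact: measurable_fst_comp.
  by move=> o; case/andP: (wn o.1) => w0 ?; rewrite ger0_norm.
Qed.

Lemma Rintegral_condexp f w (C : R) : P.-integrable setT (EFin \o f) ->
  measurable_fun setT w -> (forall x, `|w x| <= C) ->
  \int[P]_o (w o.1 * condexp P f o.1) = \int[P]_o (w o.1 * f o).
Proof.
move=> If mw wC; have [mc Ic cE] := condexpP If.
apply/esym/eqP; rewrite -subr_eq0; apply/eqP.
have mw' := measurable_fst_comp mw.
rewrite -RintegralB//; last 2 first.
- by apply: (integrable_mulb (g := fun o => w o.1)) If => // o; exact: wC.
- by apply: (integrable_mulb (g := fun o => w o.1)
    (f := fun o => condexp P f o.1)) Ic => // o; exact: wC.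
under eq_Rintegral do rewrite -mulrBr.
apply: (@Rintegral_fst0 (fun o => f o - condexp P f o.1) w C) => //.
  exact: (integrableBR (g := fun o => condexp P f o.1)).
move=> A mA; have mA' := measurable_preimage_fst mA.
rewrite RintegralB//; [|exact: integrableS If|exact: integrableS Ic].
by rewrite cE// subrr.
Qed.

(** Tested on the two sets where [s * c] is positive, for [s] equal to 1 and to -1. *)
Lemma fst_ae0 (c : TX -> R) : measurable_fun setT c ->
  P.-integrable setT (EFin \o (fun o => c o.1)) ->
  (forall B, measurable B -> \int[P]_o (\1_B o.1 * c o.1) = 0) ->
  {ae P, forall o, c o.1 = 0}.
Proof.
move=> mc Ic c0.
have aux (s : R) : {ae P, forall o, ~ 0 < s * c o.1}.
  set B := [set x | 0 < s * c x].
  have mB : measurable B by apply: measurable_gt0; exact: measurable_funM.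
  have I1 : P.-integrable setT (EFin \o (fun o => \1_B o.1 * c o.1)).
    apply: (integrable_mulb (g := fun o => \1_B o.1) (f := fun o => c o.1) (C := 1)) => //.
      by apply: (measurable_fst_comp (g := \1_B)); exact: measurable_indic.
    by move=> o; rewrite indicE; case: (_ \in _); rewrite ?normr1 ?normr0.
  have : {ae P, forall o, s * (\1_B o.1 * c o.1) = 0}.
    apply: Rintegral_ae0.
    - exact: integrableZR.
    - move=> o; rewrite indicE; have [|_] := boolP (o.1 \in B).
        by rewrite inE => /ltW; rewrite mul1r.
      by rewrite mul0r mulr0.
    - by rewrite RintegralZl// c0// mulr0.
  apply: filterS => o + sc0.
  have oB : o.1 \in B by rewrite inE.
  by rewrite indicE oB mul1r => sc; move: sc0; rewrite sc ltxx.
apply: filterS2 (aux 1) (aux (-1)) => o.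
rewrite mul1r mulN1r oppr_gt0 => /negP + /negP.
by rewrite -!leNgt => ? ?; apply/eqP; rewrite eq_le; apply/andP.
Qed.

(** A local form of uniqueness: the constraints defining the tangent space bind only where two given
    branches are both active, and [A] will be that event. *)
Lemma condexp_ae0 f (A : set TX) : P.-integrable setT (EFin \o f) ->
  measurable A ->
  (forall B, measurable B -> B `<=` A -> \int[P]_o (\1_B o.1 * f o) = 0) ->
  {ae P, forall o, A o.1 -> condexp P f o.1 = 0}.
Proof.
move=> If mA f0; have [mc Ic _] := condexpP If.
have ind1 (B : set TX) x : `|\1_B x : R| <= 1.
  by rewrite indicE; case: (_ \in _); rewrite ?normr1 ?normr0.
have mAc : measurable_fun setT (fun x => \1_A x * condexp P f x).
  by apply: measurable_funM => //; exact: measurable_indic.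
have : {ae P, forall o, \1_A o.1 * condexp P f o.1 = 0}.
  apply: (fst_ae0 mAc).
    apply: (integrable_mulb (g := fun o => \1_A o.1)
      (f := fun o => condexp P f o.1) (C := 1)) => //.
    by apply: (measurable_fst_comp (g := \1_A)); exact: measurable_indic.
  move=> B mB; under eq_Rintegral do rewrite mulrA -[_ * \1_A _]/((\1_B \* \1_A) _) -indicI.
  rewrite (Rintegral_condexp If (w := \1_(B `&` A)) (C := 1))//.
    by apply: f0; [exact: measurableI|exact: subIsetr].
  exact/measurable_indic/measurableI.
apply: filterS => o + Ao; rewrite indicE mem_set// mul1r; exact.
Qed.

(** [condexp] is a version chosen separately for each integrand, so even linearity holds only almost
    surely. *)
Lemma condexpB f (g : O -> R) : P.-integrable setT (EFin \o f) ->
  P.-integrable setT (EFin \o g) ->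
  {ae P, forall o, condexp P (fun o => f o - g o) o.1 =
                   condexp P f o.1 - condexp P g o.1}.
Proof.
move=> If Ig; have Ifg := integrableBR If Ig.
have [mc Ic cE] := condexpP If; have [mc' Ic' cE'] := condexpP Ig.
have [mc2 Ic2 cE2] := condexpP Ifg.
have ind1 (B : set TX) x : `|\1_B x : R| <= 1.
  by rewrite indicE; case: (_ \in _); rewrite ?normr1 ?normr0.
pose h x := condexp P (fun o => f o - g o) x - (condexp P f x - condexp P g x).
have Id : P.-integrable setT (EFin \o (fun o => condexp P f o.1 - condexp P g o.1)).
  exact: (integrableBR (f := fun o => condexp P f o.1)).
have : {ae P, forall o, h o.1 = 0}.
  apply: fst_ae0.
  - by apply: measurable_funB => //; exact: measurable_funB.
  - exact: (integrableBR (f := fun o => condexp P (fun o => f o - g o) o.1)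
      (g := fun o => condexp P f o.1 - condexp P g o.1)).
  move=> B mB.
  have Ib (u : O -> R) : P.-integrable setT (EFin \o u) ->
      P.-integrable setT (EFin \o (fun o => \1_B o.1 * u o)).
    apply: (integrable_mulb (g := fun o => \1_B o.1) (C := 1)) => //.
    by apply: (measurable_fst_comp (g := \1_B)); exact: measurable_indic.
  have mB1 : measurable_fun setT (\1_B : TX -> R) by exact: measurable_indic.
  under eq_Rintegral do rewrite /h mulrBr mulrBr.
  rewrite RintegralB//.
  - rewrite (Rintegral_condexp Ifg mB1 (ind1 B)) RintegralB//.
    + rewrite (Rintegral_condexp If mB1 (ind1 B)) (Rintegral_condexp Ig mB1 (ind1 B)).
      under eq_Rintegral do rewrite mulrBr.
      by rewrite RintegralB ?subrr//; exact: Ib.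
    + exact: (Ib (fun o => condexp P f o.1)).
    + exact: (Ib (fun o => condexp P g o.1)).
  - exact: (Ib (fun o => condexp P (fun o => f o - g o) o.1)).
  - have := Ib _ Id.
    by apply: eq_integrable => // o _ /=; rewrite mulrBr.
by apply: filterS => o /eqP; rewrite subr_eq0 => /eqP.
Qed.

End condexp.

(** * Square integrable functions on a probability space *)

Section L2.
Context {d} {T : measurableType d} {R : realType} (P : probability T R).
Implicit Types f g : T -> R.
Local Notation L2 f := (f \in Lfun P 2%:E).

Lemma Lfun2_measurable f : L2 f -> measurable_fun setT f.
Proof. by move=> /sub_Lfun_mfun; rewrite inE. Qed.

Lemma Lfun2_sqr f : L2 f -> P.-integrable setT (EFin \o (fun x => f x ^+ 2)).
Proof. exact: Lfun2_integrable_sqr. Qed.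

Lemma Lfun2M f g : L2 f -> L2 g ->
  P.-integrable setT (EFin \o (fun x => f x * g x)).
Proof. by move=> Lf Lg; apply/Lfun1_integrable; exact: Lfun2_mul_Lfun1. Qed.

Lemma Lfun2_integrable f : L2 f -> P.-integrable setT (EFin \o f).
Proof.
move=> Lf; have := Lfun2M Lf (Lfun_cst P 1 2).
by apply: eq_integrable => // x _ /=; rewrite mulr1.
Qed.

Lemma Lfun2I f : measurable_fun setT f ->
  P.-integrable setT (EFin \o (fun x => f x ^+ 2)) -> L2 f.
Proof.
move=> mf If; rewrite inE; apply/andP; split; rewrite inE//=.
rewrite /finite_norm unlock poweR_lty//.
rewrite (le_lt_trans _ (integrable_lty measurableT If))// le_eqVlt.
apply/orP; left; apply/eqP; apply: eq_integral => x _ /=.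
by rewrite powR_mulrn// real_normK// num_real.
Qed.

Lemma L2normE f : L2 f -> L2norm P f = (Num.sqrt (\int[P]_x (f x ^+ 2)))%:E.
Proof.
move=> Lf; have Nfin : L2norm P f \is a fin_num.
  rewrite ge0_fin_numE ?Lnorm_ge0//.
  by have := sub_Lfun_finLfun Lf; rewrite inE.
have := @powR_Lnorm _ _ _ P (EFin \o f) 2 (negbT (eqr_nat R 2 0)).
rewrite -/(L2norm P f) -(fineK Nfin) poweR_EFin powR_mulrn; last first.
  by rewrite fine_ge0// Lnorm_ge0.
have -> : (\int[P]_x (`|(EFin \o f) x| `^ 2)%E = (\int[P]_x (f x ^+ 2))%:E)%E.
  rewrite EFin_Rintegral; last exact: Lfun2_sqr.
  apply: eq_integral => x _ /=.
  by rewrite powR_mulrn// real_normK// num_real.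
by case=> <-; rewrite sqrtr_sqr ger0_norm// fine_ge0// Lnorm_ge0.
Qed.

Lemma L2norm_sqr f : L2 f ->
  ((L2norm P f) ^+ 2 = (\int[P]_x (f x ^+ 2))%:E)%E.
Proof.
move=> Lf; rewrite L2normE// -EFin_expe sqr_sqrtr//.
by apply: Rintegral_ge0 => x _; exact: sqr_ge0.
Qed.

Lemma Lfun2D f g : L2 f -> L2 g -> L2 (fun x => f x + g x).
Proof.
move=> Lf Lg; have mf := Lfun2_measurable Lf; have mg := Lfun2_measurable Lg.
apply: Lfun2I; first exact: measurable_funD.
have := integrableDR (integrableDR (Lfun2_sqr Lf) (Lfun2_sqr Lg))
  (integrableDR (Lfun2M Lf Lg) (Lfun2M Lf Lg)).
by apply: eq_integrable => // x _ /=; congr EFin; ring.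
Qed.

Lemma Lfun2Z (a : R) f : L2 f -> L2 (fun x => a * f x).
Proof.
move=> Lf; apply: Lfun2I; first exact/measurable_funM/Lfun2_measurable.
have := integrableZR (a ^+ 2) (Lfun2_sqr Lf).
by apply: eq_integrable => // x _ /=; rewrite exprMn.
Qed.

Lemma Lfun2B f g : L2 f -> L2 g -> L2 (fun x => f x - g x).
Proof.
move=> Lf Lg; have := Lfun2D Lf (Lfun2Z (-1) Lg).
have -> // : (fun x => f x + -1 * g x) = (fun x => f x - g x).
by apply/funext => x; rewrite mulN1r.
Qed.

Lemma Lfun2_bounded f (C : R) : measurable_fun setT f ->
  (forall x, `|f x| <= C) -> L2 f.
Proof.
move=> mf fC; apply: Lfun2I => //; apply: (@bounded_integrable _ _ _ _ _ (C ^+ 2)).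
  exact: measurable_funX.
by move=> x; rewrite normrX lerXn2r// ?nnegrE// (le_trans _ (fC x)).
Qed.

Lemma Lfun2_mulb f g (C : R) : measurable_fun setT g ->
  (forall x, `|g x| <= C) -> L2 f -> L2 (fun x => g x * f x).
Proof.
move=> mg gC Lf; have mf := Lfun2_measurable Lf.
apply: Lfun2I; first exact: measurable_funM.
have := @integrable_mulb _ _ _ P (fun x => f x ^+ 2) (fun x => g x ^+ 2) (C ^+ 2).
have H1 : measurable_fun setT (fun x => g x ^+ 2) by exact: measurable_funX.
have H2 x : `|g x ^+ 2| <= C ^+ 2.
  by rewrite normrX lerXn2r// ?nnegrE// (le_trans _ (gC x)).
move=> /(_ H1 H2 (Lfun2_sqr Lf)).
by apply: eq_integrable => // x _ /=; rewrite exprMn.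
Qed.

Lemma Lfun2_sum (I : Type) (s : seq I) (F : I -> T -> R) :
  (forall i, L2 (F i)) -> L2 (fun x => \sum_(i <- s) F i x).
Proof.
move=> LF; elim: s => [|i s IH].
  under eq_fun do rewrite big_nil; exact: Lfun_cst.
under eq_fun do rewrite big_cons; exact: Lfun2D.
Qed.

(** The integral of (f + t g)^2 is nonnegative for every t. If c > 0 it is evaluated at its
    minimizer t = -b / c; if c = 0 and b is nonzero, the affine function of t that remains takes the
    value -1. *)
Lemma cauchy_schwarz f g : L2 f -> L2 g ->
  (\int[P]_x (f x * g x)) ^+ 2 <=
  \int[P]_x (f x ^+ 2) * \int[P]_x (g x ^+ 2).
Proof.
move=> Lf Lg; set a := \int[P]_x (f x ^+ 2); set c := \int[P]_x (g x ^+ 2).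
set b := \int[P]_x (f x * g x).
have quad t : 0 <= a + t * b + t * b + t ^+ 2 * c.
  have : 0 <= \int[P]_x ((f x + t * g x) ^+ 2).
    by apply: Rintegral_ge0 => x _; exact: sqr_ge0.
  have -> : \int[P]_x ((f x + t * g x) ^+ 2) = \int[P]_x (f x ^+ 2 +
      t * (f x * g x) + t * (f x * g x) + t ^+ 2 * g x ^+ 2).
    by apply: eq_Rintegral => x _; ring.
  have I1 := Lfun2_sqr Lf; have I2 := Lfun2_sqr Lg; have I3 := Lfun2M Lf Lg.
  have I3t := integrableZR t I3; have I2t := integrableZR (t ^+ 2) I2.
  have I4 := integrableDR I1 I3t; have I5 := integrableDR I4 I3t.
  by rewrite RintegralD// RintegralD// RintegralD// !RintegralZl.
have c0 : 0 <= c by apply: Rintegral_ge0 => x _; exact: sqr_ge0.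
have [c00|cn0] := eqVneq c 0; last first.
  have cp : 0 < c by rewrite lt_def cn0.
  have := quad (- b / c).
  have -> : a + - b / c * b + - b / c * b + (- b / c) ^+ 2 * c = a - b ^+ 2 / c.
    by field.
  by rewrite subr_ge0 ler_pdivrMr.
have [->|bn0] := eqVneq b 0; first by rewrite c00 expr0n/= mulr0.
have := quad (- (a + 1) / (2 * b)); rewrite c00 mulr0 addr0.
have -> : a + - (a + 1) / (2 * b) * b + - (a + 1) / (2 * b) * b = -1 by field.
by rewrite oppr_ge0 ler10.
Qed.

End L2.

(** * The efficient score *)

Section ae_nonmeasurable.
Context {d} {T : measurableType d} {R : realType} (mu : {measure set T -> \bar R}).
Import HBNNSimple.

(* No measurability: the lower integral of a nonnegative function is a
   supremum over simple functions, which can be cut off on the null set. *)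
Lemma ge0_le_integral_off (f g : T -> \bar R) (N : set T) :
  measurable N -> mu N = 0 -> (forall x, 0 <= f x)%E ->
  (forall x, 0 <= g x)%E -> (forall x, ~ N x -> (f x <= g x)%E) ->
  (\int[mu]_x f x <= \int[mu]_x g x)%E.
Proof.
move=> mN N0 f0 g0 fg; rewrite ge0_integralTE//; apply: ge_ereal_sup => _ [h hf <-].
have mNc : measurable (~` N) by exact: measurableC.
have mh : measurable_fun setT (EFin \o h) by exact/measurable_EFinP.
have h0 x : (0 <= (h x)%:E)%E by rewrite lee_fin.
have -> : sintegral mu h = sintegral mu (proj_nnsfun h mNc).
  rewrite -!integralT_nnsfun (ge0_negligible_integral mN)//.
  rewrite integral_mkcond setTD; apply: eq_integral => x _.
  by rewrite patchE /= mindicE; case: ifP => _ /=; rewrite ?mulr1 ?mulr0.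
rewrite (ge0_integralTE mu g0); apply: ereal_sup_ubound.
exists (proj_nnsfun h mNc) => // x /=; rewrite mindicE.
have [|_] := boolP (x \in ~` N); last by rewrite mulr0.
by rewrite inE mulr1 => Nx; rewrite (le_trans (hf x))// fg.
Qed.

(** Used for the integrand [v_br (Gamma_act ...)], whose measurability is never established: it is
    replaced by a measurable function that agrees with it almost everywhere. *)
Lemma ae_eq_integral_nonmeasurable (f g : T -> \bar R) :
  {ae mu, forall x, f x = g x} -> (\int[mu]_x f x = \int[mu]_x g x)%E.
Proof.
move=> [N [mN N0 fgN]].
have fg x : ~ N x -> f x = g x by move=> Nx; apply: contrapT => /fgN.
rewrite integralE [RHS]integralE; congr (_ - _)%E;
  by apply/eqP; rewrite eq_le; apply/andP; split;
  apply: (ge0_le_integral_off mN) => // x Nx; rewrite ?funeposE ?funenegE fg.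
Qed.

End ae_nonmeasurable.

(** * Quadratic minimization and the Moore-Penrose inverse *)

Section branch_values.
Context {R : realType}.

(** If v A A^T = 0 then v A A^T v^T, the sum of squares of the coordinates of v A, is zero, so v A =
    0 and v = 0. *)
Lemma gram_unitmx m n (A : 'M[R]_(m, n)) : row_free A -> A *m A^T \in unitmx.
Proof.
move=> fA; rewrite -row_free_unit -kermx_eq0; apply: contraT.
move=> /rowV0Pn[v /sub_kermxP vk vn0].
have : (v *m A) *m (v *m A)^T = 0 by rewrite trmx_mul mulmxA -(mulmxA v) vk mul0mx.
have E j : (v *m A)^T j 0 = (v *m A) 0 j by rewrite mxE.
move/matrixP => /(_ 0 0); rewrite !mxE; under eq_bigr do rewrite E -expr2.
move/eqP; rewrite psumr_eq0; last by move=> i _; exact: sqr_ge0.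
move=> /allP h; have vA : v *m A = 0.
  apply/rowP => i; rewrite [RHS]mxE; apply/eqP.
  by have := h i (mem_index_enum i); rewrite sqrf_eq0.
have /row_freeP[B AB] := fA.
by move: vn0; rewrite -(mulmx1 v) -AB mulmxA vA mul0mx eqxx.
Qed.

(** From a full-rank factorization M = C F the inverse is F^T (F F^T)^-1 (C^T C)^-1 C^T; both Gram
    matrices are invertible because F has full row rank and C full column rank. *)
Lemma real_MPinverse_exists n (M : 'M[R]_n) : exists N, is_MPinverse M N.
Proof.
have [r [C [F [<- uF uC]]]] : exists r (C : 'M[R]_(n, r)) (F : 'M[R]_(r, n)),
    [/\ C *m F = M, F *m F^T \in unitmx & C^T *m C \in unitmx].
  exists (\rank M), (col_base M), (row_base M); split; first exact: mulmx_base.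
    by apply: gram_unitmx; exact: row_base_free.
  have := @gram_unitmx _ _ (col_base M)^T; rewrite trmxK; apply.
  by rewrite /row_free mxrank_tr; exact: col_base_full.
pose X := invmx (F *m F^T); pose Y := invmx (C^T *m C).
have hX : F *m F^T *m X = 1%:M by exact: mulmxV.
have hX' : X *m (F *m F^T) = 1%:M by exact: mulVmx.
have hY : C^T *m C *m Y = 1%:M by exact: mulmxV.
have hY' : Y *m (C^T *m C) = 1%:M by exact: mulVmx.
have XT : X^T = X by rewrite trmx_inv trmx_mul trmxK.
have YT : Y^T = Y by rewrite trmx_inv trmx_mul trmxK.
pose N := F^T *m X *m Y *m C^T.
have MN : C *m F *m N = C *m Y *m C^T.
  have -> : C *m F *m N = C *m (F *m F^T *m X) *m Y *m C^T by rewrite /N !mulmxA.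
  by rewrite hX mulmx1.
have NM : N *m (C *m F) = F^T *m X *m F.
  have -> : N *m (C *m F) = F^T *m X *m (Y *m (C^T *m C)) *m F by rewrite /N !mulmxA.
  by rewrite hY' mulmx1.
exists N; split.
- have -> : C *m F *m N *m (C *m F) = C *m (Y *m (C^T *m C)) *m F.
    by rewrite MN !mulmxA.
  by rewrite hY' mulmx1.
- have -> : N *m (C *m F) *m N = F^T *m (X *m (F *m F^T)) *m X *m Y *m C^T.
    by rewrite NM /N !mulmxA.
  by rewrite hX' mulmx1.
- by rewrite MN !trmx_mul trmxK YT mulmxA.
- by rewrite NM !trmx_mul trmxK XT mulmxA.
Qed.

(** The first-order condition at a minimum. At t = -a / (|c| + 1) the quadratic term cannot
    compensate the linear one; the summand 1 keeps the denominator positive and larger than c. *)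
Lemma quadratic_ge0_eq0 (a c : R) : (forall t, 0 <= t * a + t ^+ 2 * c) -> a = 0.
Proof.
move=> h; apply/eqP; apply: contraT => a0.
have cp : 0 < `|c| + 1 by rewrite ltr_pwDr// normr_ge0.
have := h (- a / (`|c| + 1)); rewrite leNgt => /negP[].
have -> : - a / (`|c| + 1) * a + (- a / (`|c| + 1)) ^+ 2 * c =
    a ^+ 2 / (`|c| + 1) ^+ 2 * (c - (`|c| + 1)).
  by field; rewrite gt_eqF.
rewrite pmulr_rlt0; first by rewrite subr_lt0 (le_lt_trans (ler_norm c))// ltrDl.
by rewrite divr_gt0 ?exprn_even_gt0//= gt_eqF.
Qed.

(** Moving mass from j to i, in the direction e_i - e_j, preserves the unit sum. The derivative in
    that direction vanishes, so the coordinates of M l are all equal; their common value is l^T M l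
    because l sums to one. *)
Lemma minimizer_stationary n (M : 'M[R]_n) (l : 'cV_n) : M^T = M ->
  \sum_i l i 0 = 1 ->
  (forall v : 'cV_n, \sum_i v i 0 = 1 -> qform M l <= qform M v) ->
  M *m l = const_mx (qform M l).
Proof.
move=> MT l1 lmin.
have addE (A B : 'M[R]_1) : (A + B) 0 0 = A 0 0 + B 0 0 by rewrite mxE.
have oppE (A : 'M[R]_1) : (- A) 0 0 = - A 0 0 by rewrite mxE.
have scaE a (A : 'M[R]_1) : (a *: A) 0 0 = a * A 0 0 by rewrite mxE.
have trE (A : 'M[R]_1) : A^T 0 0 = A 0 0 by rewrite mxE.
pose B (u w : 'cV[R]_n) := (u^T *m M *m w) 0 0.
have BC u w : B u w = B w u by rewrite /B -trE !trmx_mul trmxK MT mulmxA.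
have eqij i j : (M *m l) i 0 = (M *m l) j 0.
  pose d : 'cV[R]_n := delta_mx i 0 - delta_mx j 0.
  have Bd : B d l = (M *m l) i 0 - (M *m l) j 0.
    rewrite /B /d linearB/= !trmx_delta -mulmxA mulmxBl addE oppE -!rowE.
    by rewrite !mxE.
  apply/eqP; rewrite -subr_eq0 -Bd; apply/eqP.
  have h t : 0 <= t * (B d l + B d l) + t ^+ 2 * B d d.
    have dl : \sum_k (l + t *: d) k 0 = 1.
      under eq_bigr do rewrite !mxE eqxx !andbT.
      rewrite big_split/= l1 -mulr_sumr sumrB.
      rewrite (bigD1 i)//= eqxx big1 ?addr0; last by move=> k /negPf ->.
      rewrite (bigD1 j)//= eqxx big1 ?addr0; last by move=> k /negPf ->.
      by rewrite subrr mulr0 addr0.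
    have := lmin _ dl.
    have -> : qform M (l + t *: d) = B l l + t * B d l + t * B l d + t ^+ 2 * B d d.
      have -> : qform M (l + t *: d) =
          ((l^T + t *: d^T) *m M *m (l + t *: d)) 0 0.
        by rewrite /qform; congr ((_ *m _ *m _) 0 0); apply/rowP => k; rewrite !mxE.
      rewrite !mulmxDl !mulmxDr -!scalemxAl -!scalemxAr.
      by rewrite !addE !scaE -/(B l l) -/(B d d) -/(B l d) -/(B d l); ring.
    rewrite (BC l d) -subr_ge0 => h; apply: le_trans h _.
    by rewrite le_eqVlt; apply/orP; left; apply/eqP; rewrite /qform -/(B l l); ring.
  by have /eqP := quadratic_ge0_eq0 h; rewrite -mulr2n mulrn_eq0/= => /eqP.
apply/colP => i; rewrite [RHS]mxE /qform -mulmxA [RHS]mxE.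
under [RHS]eq_bigr do rewrite mxE (eqij _ i).
by rewrite -mulr_suml l1 mul1r.
Qed.

(** Let c = l^T M l. If c is nonzero then 1 = M (l / c) lies in the range, and 1^T M^+ 1 = c^-2 l^T
    M M^+ M l = 1 / c. If c = 0 then M l = 0, and 1 = M v would give 1 = l^T 1 = (M l)^T v = 0, so 1
    is outside the range. *)
Lemma v_br_stationary n (M : 'M[R]_n) (l : 'cV_n) : M^T = M ->
  \sum_i l i 0 = 1 -> M *m l = const_mx (qform M l) -> v_br M = qform M l.
Proof.
move=> MT l1 Ml; set c := qform M l in Ml *.
have scaE a (A : 'M[R]_1) : (a *: A) 0 0 = a * A 0 0 by rewrite mxE.
rewrite /v_br; case: asboolP => [[v Mv]|nex]; last first.
  apply/esym/eqP; apply: contraT => c0; case: nex; exists (c^-1 *: l).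
  rewrite -scalemxAr Ml; apply/colP => i; rewrite !mxE mulVf//.
have c0 : c != 0.
  apply: contraT; rewrite negbK => /eqP c0.
  have : (l^T *m (M *m v)) 0 0 = 1.
    rewrite Mv mxE -[RHS]l1; apply: eq_bigr => i _; by rewrite !mxE mulr1.
  rewrite mulmxA -{1}MT -trmx_mul Ml c0.
  rewrite mxE big1 => [/esym/eqP|i _]; first by rewrite oner_eq0.
  by rewrite !mxE mul0r.
have [MNM _ _ _] : is_MPinverse M (MPinverse M).
  rewrite /MPinverse; case: xgetP => [N -> //|no].
  by have [N] := real_MPinverse_exists M => /no.
have -> : const_mx 1 = c^-1 *: (M *m l) :> 'cV[R]_n.
  by rewrite Ml; apply/colP => i; rewrite !mxE mulVf.
rewrite /qform [(_ *: _)^T]linearZ/= trmx_mul MT -!scalemxAl -!scalemxAr !scaE.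
have -> : l^T *m M *m MPinverse M *m (M *m l) = l^T *m (M *m MPinverse M *m M) *m l.
  by rewrite !mulmxA.
rewrite MNM -/(qform M l) -/c; field; exact: c0.
Qed.

End branch_values.

(** * Maximal branches and measurable selection *)

Section argmax.
Context {dX} {TX : measurableType dX} {R : realType} {J : nat}.
Variable b : 'I_J.+1 -> TX -> R.
Implicit Types (x : TX) (j : 'I_J.+1).
Local Notation m := (max_branch b).
Local Notation A := (argmax_branch b).
Local Notation j0 := (min_argmax_branch b).

Lemma le_max_branch j x : b j x <= m x.
Proof. by rewrite /max_branch; exact: le_bigmax. Qed.

Lemma max_branchP x : exists j, m x = b j x.
Proof.
rewrite /max_branch; apply: (big_ind (fun v => exists j, v = b j x)).
- by exists ord0.
- move=> _ _ [i ->] [j ->]; case: (leP (b i x) (b j x)) => _; [by exists j|by exists i].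
- by move=> j _; exists j.
Qed.

Lemma in_argmax j x : (j \in A x) = (b j x == m x).
Proof. by rewrite inE. Qed.

Lemma min_argmaxP x :
  j0 x \in A x /\ forall j, j \in A x -> (j0 x <= j)%N.
Proof.
rewrite /min_argmax_branch.
have [j mj] := max_branchP x; have Aj : j \in A x by rewrite in_argmax mj.
rewrite /arg_min /extremum; case: pickP => [i /andP[Ai /forallP h]|no].
  by split=> // k Ak; have := h k; rewrite Ak.
(* The default [ord0] in the definition need not be active. The same minimum with the active [j] as
   default shows that the search cannot fail. *)
have := @arg_minnP _ j (fun j => j \in A x) (fun j : 'I_J.+1 => j : nat) Aj.
case=> i Ai imin; have := no i; rewrite /= Ai/=.
move/negbT/forallPn => [k]; rewrite negb_imply => /andP[Ak].
by rewrite imin.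
Qed.

(** This form exhibits the event as a finite Boolean combination of events [i \in A x], from which
    its measurability follows. *)
Lemma min_argmax_eq j x :
  (j0 x == j) = (j \in A x) && [forall i : 'I_J.+1, (i < j)%N ==> (i \notin A x)].
Proof.
have [A0 le0] := min_argmaxP x; apply/eqP/andP => [<-|[Aj /forallP h]].
  split=> //; apply/forallP => i; apply/implyP => ij; apply/negP => /le0.
  by rewrite leqNgt ij.
apply/val_inj/eqP; rewrite eqn_leq le0//= leqNgt.
by apply/negP => lt0; have := h (j0 x); rewrite lt0 A0.
Qed.

Hypothesis mb : forall j, measurable_fun setT (b j).

Lemma measurable_max_branch : measurable_fun setT m.
Proof.
rewrite /max_branch; elim: (index_enum _) => [|i s IH].
  by under eq_fun do rewrite big_nil; exact: mb.
by under eq_fun do rewrite big_cons; exact: measurable_maxr.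
Qed.

Lemma measurable_in_argmax j : measurable_fun setT (fun x => j \in A x).
Proof.
under eq_fun do rewrite in_argmax.
by apply: measurable_fun_eqr => //; exact: measurable_max_branch.
Qed.

Lemma measurable_min_argmax j : measurable_fun setT (fun x => j0 x == j).
Proof.
under eq_fun do rewrite min_argmax_eq.
apply: measurable_and; first exact: measurable_in_argmax.
have -> : (fun x => [forall i : 'I_J.+1, (i < j)%N ==> (i \notin A x)]) =
    (fun x => \big[andb/true]_(i : 'I_J.+1) ((i < j)%N ==> (i \notin A x))).
  by apply/funext => x; rewrite big_andE; apply: eq_forallb => i.
elim: (index_enum _) => [|i s IH].
  by under eq_fun do rewrite big_nil; exact: measurable_cst.
under eq_fun do rewrite big_cons; apply: measurable_and => //.
by case: (i < j)%N => //=; apply: measurable_neg; exact: measurable_in_argmax.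
Qed.

End argmax.

Section principal.
Context {R : realType} {n : nat}.
Implicit Types (A : {set 'I_n.+1}) (G : 'M[R]_n.+1) (u : 'I_n.+1 -> R).

Lemma sum_enum_val A (F : 'I_n.+1 -> R) : (forall j, j \notin A -> F j = 0) ->
  \sum_(a < #|A|) F (enum_val a) = \sum_j F j.
Proof.
move=> FA; rewrite -(big_enum_val F).
rewrite big_mkcond/=; apply: eq_bigr => j _.
by case: ifPn => // /FA ->.
Qed.

Lemma mul_principal_submx A G u a : (forall j, j \notin A -> u j = 0) ->
  (principal_submx A G *m \col_a u (enum_val a)) a 0 =
  \sum_j G (enum_val a) j * u j.
Proof.
move=> uA; rewrite mxE; under eq_bigr do rewrite !mxE.
by apply: (@sum_enum_val A (fun j => G (enum_val a) j * u j)) => j /uA ->; rewrite mulr0.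
Qed.

Lemma qform_principal_submx A G u : (forall j, j \notin A -> u j = 0) ->
  qform (principal_submx A G) (\col_a u (enum_val a)) =
  \sum_(k : 'I_n.+1 * 'I_n.+1) u k.1 * u k.2 * G k.1 k.2.
Proof.
move=> uA; rewrite /qform -mulmxA mxE.
under eq_bigr do rewrite mul_principal_submx// !mxE mulr_sumr.
rewrite (@sum_enum_val A (fun i => \sum_j u i * (G i j * u j))); last first.
  by move=> i /uA ->; rewrite big1// => j _; rewrite mul0r.
rewrite pair_big/=; apply: eq_bigr => -[i j] _ /=; ring.
Qed.

Lemma principal_submx_sym A G : G^T = G -> (principal_submx A G)^T = principal_submx A G.
Proof.
by move=> GT; apply/matrixP => i j; rewrite !mxE -[in LHS]GT mxE.
Qed.

(** Stationarity gives the first two conclusions. The last one compares the minimizer with the unit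
    mass at [j0]; it bounds the minimal value by a diagonal entry of [Gamma], which is integrable,
    and so leads to square integrability of the weighted gradients. *)
Lemma minimizing_weight_facts A G u j0 : G^T = G ->
  (forall j, j \notin A -> u j = 0) -> \sum_j u j = 1 -> j0 \in A ->
  (forall v : 'cV[R]_#|A|, \sum_a v a 0 = 1 ->
    qform (principal_submx A G) (\col_a u (enum_val a)) <=
    qform (principal_submx A G) v) ->
  let g := \sum_(k : 'I_n.+1 * 'I_n.+1) u k.1 * u k.2 * G k.1 k.2 in
  [/\ v_br (principal_submx A G) = g,
      forall i, i \in A -> \sum_j G i j * u j = g & g <= G j0 j0].
Proof.
move=> GT uA u1 Aj0 umin g.
have MT := principal_submx_sym A GT.
set l := \col_a _ in umin; have l1 : \sum_a l a 0 = 1.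
  by under eq_bigr do rewrite mxE; rewrite (@sum_enum_val A u).
have qg : qform (principal_submx A G) l = g by exact: qform_principal_submx.
have st := minimizer_stationary MT l1 umin.
split.
- by rewrite (v_br_stationary MT l1 st).
- move=> i Ai; rewrite -qg.
  have := congr1 (fun M : 'cV_ _ => M (enum_rank_in Ai i) 0) st.
  by rewrite mul_principal_submx// mxE enum_rankK_in.
- pose e j : R := (j == j0)%:R.
  have eA j : j \notin A -> e j = 0.
    by rewrite /e; case: eqP => [->|//]; rewrite Aj0.
  rewrite -qg; apply: le_trans (umin (\col_a e (enum_val a)) _) _.
    under eq_bigr do rewrite mxE.
    rewrite (@sum_enum_val A e)// (bigD1 j0)//= /e eqxx big1 ?addr0//.
    by move=> j /negPf ->.
  rewrite qform_principal_submx// (bigD1 (j0, j0))//= /e eqxx !mul1r big1 ?addr0//.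
  move=> [i j]; rewrite xpair_eqE negb_and => /orP[]/negPf -> /=.
    by rewrite !mul0r.
  by rewrite mulr0 mul0r.
Qed.

End principal.

(** * Truncation of unbounded weights *)

Section truncation.
Context {dX dW} {TX : measurableType dX} {TW : measurableType dW}
  {R : realType} (P : probability (TX * TW)%type R).
Local Notation O := (TX * TW)%type.
Implicit Types (f : O -> R) (c w : TX -> R).

(* The weights are only measurable, so products of weights and branch gradients
   need not be integrable before multiplication by a cutoff. *)
Definition cutoff c (n : nat) x : R := (c x <= n%:R)%R%:R.

Lemma measurable_natb {d} {T : measurableType d} (p : T -> bool) :
  measurable_fun setT p -> measurable_fun setT (fun x => (p x)%:R : R).
Proof.
move=> mp; have -> : (fun x => (p x)%:R : R) = (fun x => if p x then 1 else 0).
  by apply/funext => x; case: (p x).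
exact: measurable_fun_ifT.
Qed.

Lemma measurable_cutoff c n : measurable_fun setT c -> measurable_fun setT (cutoff c n).
Proof.
move=> mc; apply: measurable_natb.
by apply: measurable_fun_ler => //; exact: measurable_cst.
Qed.

Lemma cutoff_ge0 c n x : 0 <= cutoff c n x. Proof. exact: ler0n. Qed.

Lemma cutoff_le1 c n x : cutoff c n x <= 1. Proof. by rewrite /cutoff; case: (leP (c x)) => _; rewrite ?ler01. Qed.

Lemma norm_cutoff c n x : `|cutoff c n x| <= 1.
Proof. by rewrite ger0_norm ?cutoff_ge0// cutoff_le1. Qed.

Lemma cutoff_bound c n x (y : R) : `|y| <= c x -> `|cutoff c n x * y| <= n%:R.
Proof.
move=> yc; rewrite /cutoff; case: (leP (c x)) => [h|_]; last by rewrite mul0r normr0.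
by rewrite mul1r (le_trans yc).
Qed.

(** Idempotence splits one cutoff into two, one for each of the weights in a quadratic term. *)
Lemma cutoffM c n x : cutoff c n x * cutoff c n x = cutoff c n x.
Proof. by rewrite /cutoff; case: (_ <= _); rewrite ?mulr1 ?mulr0. Qed.

Lemma cutoff_eq1 c x : \forall n \near \oo, cutoff c n x = 1.
Proof.
exists (Num.truncn `|c x|).+1 => // n /= cn; rewrite /cutoff (_ : _ <= _)//.
apply: (le_trans (ler_norm _)); apply/ltW/(lt_le_trans (truncnS_gt _)).
by rewrite ler_nat.
Qed.

Lemma cutoff_nd c x (n k : nat) : (n <= k)%N -> cutoff c n x <= cutoff c k x.
Proof.
rewrite /cutoff => nk; case: (leP (c x) n%:R) => [cn|_]; last exact: ler0n.
by rewrite (le_trans cn)// ler_nat.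
Qed.

Lemma cutoff_Rcvg c f : measurable_fun setT c -> P.-integrable setT (EFin \o f) ->
  \int[P]_o (cutoff c n o.1 * f o) @[n --> \oo] --> \int[P]_o f o.
Proof.
move=> mc If; have mf := integrable_measurable If.
apply: (dominated_Rcvg (g := fun o => `|f o|)) => //.
- move=> n; apply: measurable_funM => //; apply: (measurable_fst_comp (g := cutoff c n)).
  exact: measurable_cutoff.
- exact: integrable_norm.
- by move=> n o; rewrite normrM ler_piMl// norm_cutoff.
- apply: aeW => o; apply: cvg_near_cst.
  by apply: filterS (cutoff_eq1 c o.1) => n ->; rewrite mul1r.
Qed.

Lemma cutoff_Rintegral_eq c f f' : measurable_fun setT c ->
  P.-integrable setT (EFin \o f) -> P.-integrable setT (EFin \o f') ->
  (forall n, \int[P]_o (cutoff c n o.1 * f o) = \int[P]_o (cutoff c n o.1 * f' o)) ->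
  \int[P]_o f o = \int[P]_o f' o.
Proof.
move=> mc If If' E; have := cutoff_Rcvg mc If.
under eq_fun do rewrite E.
move=> h; exact: cvg_unique h (cutoff_Rcvg mc If').
Qed.

(** Monotone convergence in n; it is the uniformity of [M] in n that makes the limit finite. *)
Lemma cutoff_integrable c f (M : R) : measurable_fun setT c ->
  measurable_fun setT f -> (forall o, 0 <= f o) ->
  (forall n, P.-integrable setT (EFin \o (fun o => cutoff c n o.1 * f o))) ->
  (forall n, \int[P]_o (cutoff c n o.1 * f o) <= M) ->
  P.-integrable setT (EFin \o f).
Proof.
move=> mc mf f0 If fM; apply: integrable_ge0 => //.
apply: (@le_lt_trans _ _ M%:E); last by rewrite ltry.
have mt n : measurable_fun setT (fun o : O => (cutoff c n o.1 * f o)%:E).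
  exact: measurable_int (If n).
have := @cvg_monotone_convergence _ _ _ P setT measurableT
  (fun n o => (cutoff c n o.1 * f o)%:E) mt.
have h0 n o : setT o -> (0 <= (cutoff c n o.1 * f o)%:E)%E.
  by move=> _; rewrite lee_fin mulr_ge0// cutoff_ge0.
have hn o : setT o -> {homo (fun n => (cutoff c n o.1 * f o)%:E) :
    n m / (n <= m)%N >-> (n <= m)%E}.
  by move=> _ n m nm; rewrite lee_fin ler_wpM2r// cutoff_nd.
move=> /(_ h0 hn) h.
have E : (\int[P]_o (f o)%:E =
    \int[P]_o limn (fun n => (cutoff c n o.1 * f o)%:E))%E.
  apply: eq_integral => o _; apply/esym/cvg_lim => //.
  apply: cvg_near_cst.
  by apply: filterS (cutoff_eq1 c o.1) => n ->; rewrite mul1r.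
rewrite E; apply: (cvge_le _ h); apply: nearW => n.
by rewrite -EFin_Rintegral// lee_fin.
Qed.

Lemma integrable_weight w (C : R) f : measurable_fun setT w ->
  (forall x, `|w x| <= C) -> P.-integrable setT (EFin \o f) ->
  P.-integrable setT (EFin \o (fun o => w o.1 * f o)).
Proof.
move=> mw wC; apply: (integrable_mulb (g := fun o => w o.1) (C := C)) => //.
exact: measurable_fst_comp.
Qed.

Lemma Rintegral_condexp_sum (I : Type) (s : seq I) (w : I -> TX -> R) (C : R)
    (f : I -> O -> R) :
  (forall k, measurable_fun setT (w k)) -> (forall k x, `|w k x| <= C) ->
  (forall k, P.-integrable setT (EFin \o f k)) ->
  \int[P]_o (\sum_(k <- s) w k o.1 * f k o) =
  \int[P]_o (\sum_(k <- s) w k o.1 * condexp P (f k) o.1).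
Proof.
move=> mw wC If; rewrite !Rintegral_sum.
- by apply: eq_bigr => k _; rewrite (Rintegral_condexp (If k) (mw k) (wC k)).
- move=> k; apply: (integrable_weight (f := fun o => condexp P (f k) o.1) (mw k) (wC k)).
  exact: integrable_condexp.
- by move=> k; exact: integrable_weight (mw k) (wC k) (If k).
Qed.

End truncation.

(** * Unit-sum weights and the tangent space *)

Section weights.
Context {dX dW} {TX : measurableType dX} {TW : measurableType dW}
  {R : realType} {J : nat} (P : probability (TX * TW)%type R).
Local Notation O := (TX * TW)%type.
Variables (b : probability O R -> 'I_J.+1 -> TX -> R) (zeta : 'I_J.+1 -> O -> R).
Implicit Types (lam : 'I_J.+1 -> TX -> R) (h : O -> R).
Local Notation L2 f := (f \in Lfun P 2%:E).
Local Notation A := (argmax_branch (b P)).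
Local Notation q := (qfun b P).

Hypothesis mb : forall j, measurable_fun setT (b P j).
Hypothesis Lq : L2 (fun o : O => q o.1).
Hypothesis Lz : forall j, L2 (zeta j).
Hypothesis z0 : forall j, {ae P, forall o : O, condexp P (zeta j) o.1 = 0}.

Definition weighted_zeta lam o := \sum_j lam j o.1 * zeta j o.
Local Notation V := weighted_zeta.

Definition weight_size lam (x : TX) : R := \sum_j `|lam j x|.
Local Notation c := weight_size.

Let mz j : measurable_fun setT (zeta j). Proof. exact: Lfun2_measurable. Qed.

Lemma measurable_q : measurable_fun setT q.
Proof. by apply: measurable_funB => //; exact: measurable_max_branch. Qed.

Lemma measurable_weight_size lam : (forall j, measurable_fun setT (lam j)) ->
  measurable_fun setT (c lam).
Proof.
by move=> ml; apply: measurable_sum => j; exact: measurableT_comp.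
Qed.

Lemma le_weight_size lam j x : `|lam j x| <= c lam x.
Proof.
by rewrite /weight_size (bigD1 j)//= lerDl sumr_ge0.
Qed.

Lemma measurable_weighted_zeta lam : (forall j, measurable_fun setT (lam j)) ->
  measurable_fun setT (V lam).
Proof.
move=> ml; apply: measurable_sum => j; apply: measurable_funM => //.
exact: measurable_fst_comp.
Qed.

Lemma Rintegral_zeta0 (w : TX -> R) (C : R) j : measurable_fun setT w ->
  (forall x, `|w x| <= C) -> \int[P]_o (w o.1 * zeta j o) = 0.
Proof.
move=> mw wC; have Iz := Lfun2_integrable (Lz j).
rewrite -(Rintegral_condexp Iz mw wC).
transitivity (\int[P]_o (0 : R)); last exact: Rintegral_cst1.
apply: ae_eq_Rintegral => //.
- apply: measurable_funM; first exact: measurable_fst_comp.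
  exact: integrable_measurable (integrable_condexp Iz).
- by apply: filterS (z0 j) => o ->; rewrite mulr0.
Qed.

Lemma Rintegral_weighted_zeta0 lam (w : TX -> R) (C : R) n :
  (forall j, measurable_fun setT (lam j)) -> measurable_fun setT w ->
  (forall x, `|w x| <= C) ->
  \int[P]_o (w o.1 * (cutoff (c lam) n o.1 * V lam o)) = 0.
Proof.
move=> ml mw wC; have mc := measurable_weight_size ml.
pose u j x := w x * (cutoff (c lam) n x * lam j x).
have mu j : measurable_fun setT (u j).
  by apply: measurable_funM => //; apply: measurable_funM => //; exact: measurable_cutoff.
have uC j x : `|u j x| <= C * n%:R.
  rewrite normrM ler_pM//; apply: cutoff_bound; exact: le_weight_size.
rewrite (_ : \int[P]_o _ = \int[P]_o \sum_j (u j o.1 * zeta j o)); last first.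
  apply: eq_Rintegral => o _; rewrite /V mulrA mulr_sumr; apply: eq_bigr => j _.
  by rewrite /u; ring.
rewrite Rintegral_sum; first by rewrite big1// => j _; exact: Rintegral_zeta0 (mu j) (uC j).
move=> j; apply: integrable_weight (mu j) (uC j) _; exact: Lfun2_integrable.
Qed.

(** The constraints concern versions for differences; almost sure linearity separates the two terms,
    and the finitely many null sets are merged so that the quantifier over pairs comes inside. *)
Lemma tangent_H_condexp h : tangent_H b P zeta h ->
  {ae P, forall o : O, forall i j, i \in A o.1 -> j \in A o.1 ->
    condexp P (fun o' => zeta i o' * h o') o.1 =
    condexp P (fun o' => zeta j o' * h o') o.1}.
Proof.
move=> [Lh _ H0].
have E i j : {ae P, forall o : O, i \in A o.1 -> j \in A o.1 ->
    condexp P (fun o' => zeta i o' * h o') o.1 =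
    condexp P (fun o' => zeta j o' * h o') o.1}.
  apply: filterS2 (H0 i j) (condexpB (Lfun2M (Lz i) Lh) (Lfun2M (Lz j) Lh)).
  move=> o h1 h2 Ai Aj; apply/eqP; rewrite -subr_eq0 -h2; apply/eqP.
  rewrite -[RHS](h1 Ai Aj); congr condexp; apply/funext => o'; ring.
by apply: filter_forall => i; apply: filter_forall => j; exact: E.
Qed.

(** For h in the tangent space the conditional expectation of [zeta j * h] takes one and the same
    value for all active j, so that every unit-sum combination of these expectations equals that
    value. *)
Lemma Rintegral_weights_tangent lam lam' h :
  unit_sum_weight b P lam -> unit_sum_weight b P lam' ->
  tangent_H b P zeta h ->
  P.-integrable setT (EFin \o (fun o => V lam o * h o)) ->
  P.-integrable setT (EFin \o (fun o => V lam' o * h o)) ->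
  \int[P]_o (V lam o * h o) = \int[P]_o (V lam' o * h o).
Proof.
move=> [ml sl] [ml' sl'] Hh I1 I2; have [Lh _ _] := Hh.
have mc := measurable_weight_size ml; have mc' := measurable_weight_size ml'.
(* One truncation level for both families, since either of them may be unbounded. *)
pose cc x := c lam x + c lam' x.
have mcc : measurable_fun setT cc by exact: measurable_funD.
have c0 l x : 0 <= c l x by exact: sumr_ge0.
have ccl j x : `|lam j x| <= cc x by rewrite (le_trans (le_weight_size _ _ _))// lerDl.
have ccl' j x : `|lam' j x| <= cc x by rewrite (le_trans (le_weight_size _ _ _))// lerDr.
apply: (cutoff_Rintegral_eq mcc I1 I2) => n.
have key (l : 'I_J.+1 -> TX -> R) (ml0 : forall j, measurable_fun setT (l j))
    (lc : forall j x, `|l j x| <= cc x) :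
    \int[P]_o (cutoff cc n o.1 * (V l o * h o)) = \int[P]_o (\sum_j
      (cutoff cc n o.1 * l j o.1) * condexp P (fun o' => zeta j o' * h o') o.1).
  pose u j x := cutoff cc n x * l j x.
  have mu j : measurable_fun setT (u j).
    by apply: measurable_funM => //; exact: measurable_cutoff.
  have uC j x : `|u j x| <= n%:R by exact: cutoff_bound.
  rewrite -(@Rintegral_condexp_sum _ _ _ _ _ P _ _ u n%:R (fun j o => zeta j o * h o))//;
    last by move=> k; exact: Lfun2M.
  apply: eq_Rintegral => o _; rewrite /V mulr_suml mulr_sumr.
  by apply: eq_bigr => j _; rewrite /u; ring.
rewrite key// key//.
have mS (l : 'I_J.+1 -> TX -> R) (ml0 : forall j, measurable_fun setT (l j)) :
    measurable_fun setT (fun o : O => \sum_j (cutoff cc n o.1 * l j o.1) *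
      condexp P (fun o' => zeta j o' * h o') o.1).
  apply: measurable_sum => j; apply: measurable_funM.
    apply: (measurable_fst_comp (g := fun x => cutoff cc n x * l j x)).
    by apply: measurable_funM => //; exact: measurable_cutoff.
  exact: integrable_measurable (integrable_condexp (Lfun2M (Lz j) Lh)).
apply: ae_eq_Rintegral => //; [exact: mS|exact: mS|].
apply: filterS3 sl sl' (tangent_H_condexp Hh) => o [s0 s1] [s0' s1'] aE.
have [j0A _] := min_argmaxP (b P) o.1; set j0 := min_argmax_branch _ _ in j0A.
have red (l : 'I_J.+1 -> TX -> R) : (forall j, j \notin A o.1 -> l j o.1 = 0) ->
    \sum_j l j o.1 = 1 ->
    \sum_j (cutoff cc n o.1 * l j o.1) * condexp P (fun o' => zeta j o' * h o') o.1 =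
    cutoff cc n o.1 * condexp P (fun o' => zeta j0 o' * h o') o.1.
  move=> l0 l1; rewrite -[RHS]mul1r -l1 mulr_suml; apply: eq_bigr => j _.
  have [jA|jA] := boolP (j \in A o.1); first by rewrite (aE j j0)//; ring.
  by rewrite l0//; ring.
by rewrite red// red.
Qed.

(** The unit mass at the first active branch. It realizes q + zeta_{j_0} as a weighted score, and
    being bounded it provides a comparison that is square integrable from the outset. *)
Definition first_weight (j : 'I_J.+1) (x : TX) : R :=
  (min_argmax_branch (b P) x == j)%:R.

Lemma first_weight_unit_sum : unit_sum_weight b P first_weight.
Proof.
split=> [j|]; first by apply: measurable_natb; exact: measurable_min_argmax.
apply: aeW => o; have [j0A _] := min_argmaxP (b P) o.1; split.
  by move=> j; rewrite /first_weight; case: eqP => // <-; rewrite j0A.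
rewrite (bigD1 (min_argmax_branch (b P) o.1))//= /first_weight eqxx big1 ?addr0//.
by move=> j; rewrite eq_sym => /negPf ->.
Qed.

Lemma first_weightE o :
  V first_weight o = zeta (min_argmax_branch (b P) o.1) o.
Proof.
rewrite /V (bigD1 (min_argmax_branch (b P) o.1))//= /first_weight eqxx mul1r.
rewrite big1 ?addr0// => j; rewrite eq_sym => /negPf ->; by rewrite mul0r.
Qed.

Lemma Lfun2_first_weight : L2 (V first_weight).
Proof.
apply: Lfun2_sum => j; apply: (@Lfun2_mulb _ _ _ _ _ (fun o => first_weight j o.1) 1) => //.
  apply: (measurable_fst_comp (g := first_weight j)).
  by apply: measurable_natb; exact: measurable_min_argmax.
by move=> o; rewrite /first_weight; case: (_ == _); rewrite ?normr1 ?normr0.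
Qed.

End weights.

(** * The minimizing weights: integrability, membership in H, projection and value *)

Section minimizing_weights.
Context {dX dW} {TX : measurableType dX} {TW : measurableType dW}
  {R : realType} {J : nat} (P : probability (TX * TW)%type R).
Local Notation O := (TX * TW)%type.
Variables (b : probability O R -> 'I_J.+1 -> TX -> R) (zeta : 'I_J.+1 -> O -> R)
  (lam : 'I_J.+1 -> TX -> R).
Local Notation L2 f := (f \in Lfun P 2%:E).
Local Notation A := (argmax_branch (b P)).
Local Notation q := (qfun b P).
Local Notation V := (weighted_zeta zeta).
Local Notation c := (weight_size lam).
Local Notation D := (weighted_score b P zeta lam).
Local Notation G := (Gamma P zeta).

Hypothesis mb : forall j, measurable_fun setT (b P j).
Hypothesis Lq : L2 (fun o : O => q o.1).
Hypothesis Lz : forall j, L2 (zeta j).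
Hypothesis z0 : forall j, {ae P, forall o : O, condexp P (zeta j) o.1 = 0}.
Hypothesis minw : minimizing_weight b P zeta lam.

Let ml : forall j, measurable_fun setT (lam j). Proof. by case: minw => -[]. Qed.
Let mz j : measurable_fun setT (zeta j). Proof. exact: Lfun2_measurable. Qed.
Let mV : measurable_fun setT (V lam). Proof. exact: measurable_weighted_zeta. Qed.
Let mc : measurable_fun setT c. Proof. exact: measurable_weight_size. Qed.
Let mq : measurable_fun setT q. Proof. exact: measurable_q. Qed.

Let Izz i j : P.-integrable setT (EFin \o (fun o => zeta i o * zeta j o)).
Proof. exact: Lfun2M. Qed.

Let g x := \sum_(k : 'I_J.+1 * 'I_J.+1) lam k.1 x * lam k.2 x * G x k.1 k.2.

Let GE i j x : G x i j = condexp P (fun o => zeta i o * zeta j o) x.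
Proof. by rewrite mxE. Qed.

Let mG i j : measurable_fun setT (fun x => G x i j).
Proof. by under eq_fun do rewrite GE; exact: measurable_condexp. Qed.

Let GT x : (G x)^T = G x.
Proof.
apply/matrixP => i j; rewrite mxE !GE; congr condexp.
by apply/funext => o; rewrite mulrC.
Qed.

Let mg : measurable_fun setT g.
Proof.
apply: measurable_sum => k; apply: measurable_funM => //.
by apply: measurable_funM => //; exact: ml.
Qed.

Let gfacts : {ae P, forall o : O,
  [/\ v_br (Gamma_act b P zeta o.1) = g o.1,
      forall i, i \in A o.1 -> \sum_j G o.1 i j * lam j o.1 = g o.1 &
      g o.1 <= G o.1 (min_argmax_branch (b P) o.1) (min_argmax_branch (b P) o.1)]}.
Proof.
have [[_ sl] lmin] := minw.
apply: filterS2 sl lmin => o [s0 s1] omin.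
have [j0A _] := min_argmaxP (b P) o.1.
exact: (minimizing_weight_facts (GT o.1) s0 s1 j0A omin).
Qed.

Let tl n j x : `|cutoff c n x * lam j x| <= n%:R.
Proof. by apply: cutoff_bound; exact: le_weight_size. Qed.

Let u w n (k : 'I_J.+1 * 'I_J.+1) x : R :=
  w x * ((cutoff c n x * lam k.1 x) * (cutoff c n x * lam k.2 x)).

Let mu w n k : measurable_fun setT w -> measurable_fun setT (u w n k).
Proof.
move=> mw; apply: measurable_funM => //; apply: measurable_funM;
  by apply: measurable_funM => //; exact: measurable_cutoff.
Qed.

Let uC w C n k : (forall x, `|w x| <= C) -> forall x, `|u w n k x| <= C * (n%:R * n%:R).
Proof.
by move=> wC x; rewrite normrM ler_pM// normrM ler_pM.
Qed.

Let V2E (w : TX -> R) n (o : O) : w o.1 * (cutoff c n o.1 * V lam o ^+ 2) =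
  \sum_(k : 'I_J.+1 * 'I_J.+1) u w n k o.1 * (zeta k.1 o * zeta k.2 o).
Proof.
rewrite expr2 /weighted_zeta big_distrlr/= pair_big/= !mulr_sumr.
apply: eq_bigr => k _; rewrite /u -{1}cutoffM; ring.
Qed.

Let gE (w : TX -> R) n (o : O) : w o.1 * (cutoff c n o.1 * g o.1) =
  \sum_(k : 'I_J.+1 * 'I_J.+1) u w n k o.1 *
    condexp P (fun o => zeta k.1 o * zeta k.2 o) o.1.
Proof.
rewrite /g !mulr_sumr; apply: eq_bigr => k _; rewrite /u GE -{1}cutoffM; ring.
Qed.

(** Conditionally on X the second moment of the weighted gradients is the quadratic form [g]. A
    bounded factor [w] is kept because it will be both the constant 1 and the sign of [g]. *)
Let intV2 (w : TX -> R) (C : R) n : measurable_fun setT w -> (forall x, `|w x| <= C) ->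
  [/\ P.-integrable setT (EFin \o (fun o => w o.1 * (cutoff c n o.1 * V lam o ^+ 2))),
      P.-integrable setT (EFin \o (fun o => w o.1 * (cutoff c n o.1 * g o.1))) &
      \int[P]_o (w o.1 * (cutoff c n o.1 * V lam o ^+ 2)) =
      \int[P]_o (w o.1 * (cutoff c n o.1 * g o.1))].
Proof.
move=> mw wC.
have -> : (fun o => w o.1 * (cutoff c n o.1 * V lam o ^+ 2)) = (fun o =>
    \sum_(k : 'I_J.+1 * 'I_J.+1) u w n k o.1 * (zeta k.1 o * zeta k.2 o)).
  by apply/funext => o; exact: V2E.
have -> : (fun o : O => w o.1 * (cutoff c n o.1 * g o.1)) = (fun o =>
    \sum_(k : 'I_J.+1 * 'I_J.+1) u w n k o.1 *
    condexp P (fun o => zeta k.1 o * zeta k.2 o) o.1).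
  by apply/funext => o; exact: gE.
split.
- apply: integrable_sumR => k.
  exact: integrable_weight (mu n k mw) (uC n k wC) (Izz _ _).
- apply: integrable_sumR => k; apply: (integrable_weight
    (f := fun o => condexp P (fun o => zeta k.1 o * zeta k.2 o) o.1)
    (mu n k mw) (uC n k wC)).
  exact: integrable_condexp.
- apply: (Rintegral_condexp_sum _ (fun k => mu n k mw) (fun k => uC n k wC)) => k.
  exact: Izz.
Qed.

Let w1 : forall x : TX, `|(1 : R)| <= 1. Proof. by move=> x; rewrite normr1. Qed.

Let trV2_integrable n : P.-integrable setT (EFin \o (fun o => cutoff c n o.1 * V lam o ^+ 2)).
Proof.
have [I1 _ _] := intV2 n (measurable_cst (1 : R)) w1.
by apply: eq_integrable I1 => // o _ /=; rewrite mul1r.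
Qed.

Let trg_integrable n : P.-integrable setT (EFin \o (fun o : O => cutoff c n o.1 * g o.1)).
Proof.
have [_ I1 _] := intV2 n (measurable_cst (1 : R)) w1.
by apply: eq_integrable I1 => // o _ /=; rewrite mul1r.
Qed.

Let trV2E n : \int[P]_o (cutoff c n o.1 * V lam o ^+ 2) =
  \int[P]_o (cutoff c n o.1 * g o.1).
Proof.
have [_ _] := intV2 n (measurable_cst (1 : R)) w1.
by under eq_Rintegral do rewrite mul1r; under [RHS]eq_Rintegral do rewrite mul1r.
Qed.

(** Under the cutoff the second moment equals that of [g], which minimality bounds by the diagonal
    entry of [Gamma] at the first active branch; this entry integrates back to the square of one
    gradient, at most the sum of all squares. The bound does not depend on n, and the cutoff can be
    released. *)
Lemma Lfun2_weighted_zeta : L2 (V lam).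
Proof.
apply: Lfun2I => //.
apply: (@cutoff_integrable _ _ _ _ _ P c _ (\int[P]_o (\sum_j zeta j o ^+ 2))) => //.
- exact: measurable_funX.
- by move=> o; exact: sqr_ge0.
move=> n; rewrite trV2E.
pose v j x : R := cutoff c n x * first_weight P b j x.
have mv j : measurable_fun setT (v j).
  apply: measurable_funM; first exact: measurable_cutoff.
  by apply: measurable_natb; exact: measurable_min_argmax.
have v0 j x : 0 <= v j x by rewrite mulr_ge0 ?cutoff_ge0 ?ler0n.
have v1 j x : v j x <= 1.
  rewrite /v -[leRHS]mul1r ler_pM ?cutoff_ge0 ?cutoff_le1 ?ler0n//.
  by rewrite /first_weight; case: (_ == _).
have vC j x : `|v j x| <= 1 by rewrite ger0_norm.
have Iz2 : P.-integrable setT (EFin \o (fun o => \sum_j zeta j o ^+ 2)).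
  by apply: integrable_sumR => j; exact: Lfun2_sqr.
have Ivc : P.-integrable setT (EFin \o (fun o : O => \sum_j v j o.1 *
    condexp P (fun o => zeta j o * zeta j o) o.1)).
  apply: integrable_sumR => j; apply: (integrable_weight
    (f := fun o => condexp P (fun o => zeta j o * zeta j o) o.1) (mv j) (vC j)).
  exact: integrable_condexp.
have Ivz : P.-integrable setT (EFin \o (fun o : O => \sum_j v j o.1 *
    (zeta j o * zeta j o))).
  by apply: integrable_sumR => j; exact: integrable_weight (mv j) (vC j) (Izz _ _).
apply: (@le_trans _ _ (\int[P]_o (\sum_j v j o.1 *
    condexp P (fun o => zeta j o * zeta j o) o.1))).
  apply: ae_le_Rintegral => //.
  apply: filterS gfacts => o [_ _ gle]; set j0 := min_argmax_branch _ _ in gle.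
  rewrite (bigD1 j0)//= big1 ?addr0; last first.
    by move=> j; rewrite eq_sym /v /first_weight => /negPf ->; rewrite mulr0 mul0r.
  rewrite /v /first_weight eqxx mulr1 -GE.
  by rewrite ler_wpM2l ?cutoff_ge0.
rewrite -(Rintegral_condexp_sum _ mv vC)//.
apply: le_Rintegral => // o _; apply: ler_sum => j _.
by rewrite -expr2 ler_piMl ?sqr_ge0.
Qed.

Let IV2 : P.-integrable setT (EFin \o (fun o => V lam o ^+ 2)).
Proof. exact/Lfun2_sqr/Lfun2_weighted_zeta. Qed.

Let Ig : P.-integrable setT (EFin \o (fun o : O => g o.1)).
Proof.
have mgO := measurable_fst_comp (TW := TW) mg.
have Iabs : P.-integrable setT (EFin \o (fun o : O => `|g o.1|)).
  apply: (@cutoff_integrable _ _ _ _ _ P c _ (\int[P]_o (V lam o ^+ 2))) => //.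
  - exact: measurableT_comp.
  - move=> n; have := integrable_norm (trg_integrable n).
    apply: eq_integrable => // o _ /=.
    by rewrite normrM (ger0_norm (cutoff_ge0 _ _ _)).
  (* With the sign of [g] as weight, the absolute value becomes an integrand covered by [intV2]. *)
  move=> n; pose w x : R := if 0 <= g x then 1 else -1.
  have mw : measurable_fun setT w.
    by apply: measurable_fun_ifT => //; exact: measurable_fun_ler.
  have wC x : `|w x| <= 1 by rewrite /w; case: ifP; rewrite ?normrN normr1.
  have [I1 I2 E] := intV2 n mw wC.
  have -> : \int[P]_o (cutoff c n o.1 * `|g o.1|) =
      \int[P]_o (w o.1 * (cutoff c n o.1 * g o.1)).
    apply: eq_Rintegral => o _; rewrite /w; case: ifPn => g0.
      by rewrite mul1r ger0_norm.
    by rewrite ler0_norm ?mulN1r ?mulrN//; apply/ltW; rewrite ltNge.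
  rewrite -E; apply: le_Rintegral => // o _.
  rewrite mulrA ler_piMl ?sqr_ge0//.
  apply: (le_trans (ler_norm _)); rewrite normrM -[leRHS]mulr1.
  by rewrite ler_pM// norm_cutoff.
by apply: le_integrableR Iabs => // o; exact: lexx.
Qed.

Let intV2g : \int[P]_o (V lam o ^+ 2) = \int[P]_o g o.1.
Proof. by apply: (cutoff_Rintegral_eq mc IV2 Ig) => n; exact: trV2E. Qed.

Let LV := Lfun2_weighted_zeta.

Lemma Lfun2_weighted_score : L2 D.
Proof. exact: Lfun2D Lq LV. Qed.

Let Im : P.-integrable setT (EFin \o (fun o : O => max_branch (b P) o.1)).
Proof.
have := integrableDR (Lfun2_integrable Lq)
  (Lfun2_integrable (Lfun_cst P (Psi b P) 2)).
by apply: eq_integrable => // o _ /=; rewrite /qfun subrK.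
Qed.

Lemma Rintegral_q : \int[P]_o q o.1 = 0.
Proof.
rewrite /qfun RintegralB//; last exact: (Lfun2_integrable (Lfun_cst P _ 2)).
by rewrite Rintegral_cst1 subrr.
Qed.

Lemma Rintegral_weighted_zeta : \int[P]_o V lam o = 0.
Proof.
have IV := Lfun2_integrable LV.
have I0 : P.-integrable setT (EFin \o (fun=> 0 : R)).
  exact: (Lfun2_integrable (Lfun_cst P 0 2)).
rewrite (cutoff_Rintegral_eq mc IV I0) ?Rintegral_cst1// => n.
under [RHS]eq_Rintegral do rewrite mulr0.
rewrite Rintegral_cst1.
have := Rintegral_weighted_zeta0 Lz z0 n ml (measurable_cst (1 : R)) w1.
by under eq_Rintegral do rewrite mul1r.
Qed.

(** A truncation level that controls q as well as the weights, for products involving the whole of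
    D*. *)
Let cc x : R := `|q x| + c x.
Let mcc : measurable_fun setT cc.
Proof. by apply: measurable_funD => //; exact: measurableT_comp. Qed.
Let ccq x : `|q x| <= cc x. Proof. by rewrite lerDl; exact: sumr_ge0. Qed.
Let ccl j x : `|lam j x| <= cc x.
Proof. by rewrite (le_trans (le_weight_size _ _ _))// lerDr. Qed.

Lemma Rintegral_q_weighted_zeta : \int[P]_o (q o.1 * V lam o) = 0.
Proof.
have IV := Lfun2M Lq LV.
have I0 : P.-integrable setT (EFin \o (fun=> 0 : R)).
  exact: (Lfun2_integrable (Lfun_cst P 0 2)).
rewrite (cutoff_Rintegral_eq mcc IV I0) ?Rintegral_cst1// => n.
under [RHS]eq_Rintegral do rewrite mulr0.
rewrite Rintegral_cst1.
have mw : measurable_fun setT (fun x => cutoff cc n x * q x).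
  by apply: measurable_funM => //; exact: measurable_cutoff.
have wC x : `|cutoff cc n x * q x| <= n%:R by exact: cutoff_bound.
rewrite -[RHS](Rintegral_weighted_zeta0 Lz z0 n ml mw wC).
apply: eq_Rintegral => o _; rewrite mulrA [in RHS]mulrA.
rewrite /cutoff; case: (leP (cc o.1) n%:R) => [h|_]; last by rewrite !mul0r.
(* The two sides carry cutoffs at the levels [cc] and [c]; as [c] is at most [cc], the second equals
   1 wherever the first does. *)
have -> : c o.1 <= n%:R by rewrite (le_trans _ h)// lerDr.
have T : (true%:R : R) = 1 by [].
by rewrite T !mul1r mulr1.
Qed.

Let intzD (w : TX -> R) (C : R) i n : measurable_fun setT w -> (forall x, `|w x| <= C) ->
  \int[P]_o (w o.1 * (cutoff cc n o.1 * (zeta i o * D o))) =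
  \int[P]_o (w o.1 * (cutoff cc n o.1 * \sum_j G o.1 i j * lam j o.1)).
Proof.
move=> mw wC.
pose uq x := w x * (cutoff cc n x * q x).
have muq : measurable_fun setT uq.
  by apply: measurable_funM => //; apply: measurable_funM => //; exact: measurable_cutoff.
have uqC x : `|uq x| <= C * n%:R by rewrite normrM ler_pM// cutoff_bound.
pose ul j x := w x * (cutoff cc n x * lam j x).
have mul j : measurable_fun setT (ul j).
  by apply: measurable_funM => //; apply: measurable_funM => //; exact: measurable_cutoff.
have ulC j x : `|ul j x| <= C * n%:R by rewrite normrM ler_pM// cutoff_bound.
have -> : \int[P]_o (w o.1 * (cutoff cc n o.1 * (zeta i o * D o))) =
    \int[P]_o (uq o.1 * zeta i o + \sum_j ul j o.1 * (zeta i o * zeta j o)).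
  apply: eq_Rintegral => o _; rewrite /weighted_score (mulrDr (zeta i o)).
  rewrite (mulrDr (cutoff _ _ _)) (mulrDr (w _)); congr (_ + _); first by rewrite /uq; ring.
  by rewrite !mulr_sumr; apply: eq_bigr => j _; rewrite /ul; ring.
rewrite RintegralD//; last 2 first.
- exact: integrable_weight muq uqC (Lfun2_integrable (Lz i)).
- by apply: integrable_sumR => j; exact: integrable_weight (mul j) (ulC j) (Izz i j).
rewrite (Rintegral_zeta0 Lz z0 i muq uqC) add0r.
rewrite (Rintegral_condexp_sum _ mul ulC); last by move=> j; exact: Izz.
apply: eq_Rintegral => o _; rewrite !mulr_sumr; apply: eq_bigr => j _.
by rewrite /ul GE; ring.
Qed.

Lemma tangent_H_weighted_score : tangent_H b P zeta D.
Proof.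
have LD := Lfun2_weighted_score.
split => //.
  rewrite /weighted_score (RintegralD _ (Lfun2_integrable Lq) (Lfun2_integrable LV))//.
  by rewrite Rintegral_q Rintegral_weighted_zeta addr0.
move=> i j; pose E := [set x | (i \in A x) && (j \in A x)].
have mE : measurable E.
  apply: measurable_pred; apply: measurable_and; exact: measurable_in_argmax.
have Izij : P.-integrable setT (EFin \o (fun o => (zeta i o - zeta j o) * D o)).
  exact: Lfun2M (Lfun2B (Lz i) (Lz j)) LD.
have := condexp_ae0 Izij mE.
suff h B : measurable B -> B `<=` E ->
    \int[P]_o (\1_B o.1 * ((zeta i o - zeta j o) * D o)) = 0.
  by move=> /(_ h); apply: filterS => o H Ai Aj; apply: H; rewrite /E/= Ai Aj.
move=> mB BE.
have mB1 : measurable_fun setT (\1_B : TX -> R) by exact: measurable_indic.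
have B1 x : `|\1_B x : R| <= 1.
  by rewrite indicE; case: (_ \in _); rewrite ?normr1 ?normr0.
have Izi k : P.-integrable setT (EFin \o (fun o => zeta k o * D o)).
  exact: Lfun2M.
have IB k := integrable_weight mB1 B1 (Izi k).
have IBt k n : P.-integrable setT (EFin \o (fun o =>
    \1_B o.1 * (cutoff cc n o.1 * (zeta k o * D o)))).
  apply: (integrable_weight mB1 B1).
  exact: (integrable_weight (measurable_cutoff n mcc) (norm_cutoff cc n)).
under eq_Rintegral do rewrite mulrBl mulrBr.
rewrite RintegralB//; apply/eqP; rewrite subr_eq0; apply/eqP.
apply: (cutoff_Rintegral_eq mcc (IB i) (IB j)) => n.
under eq_Rintegral do rewrite mulrCA; under [RHS]eq_Rintegral do rewrite mulrCA.
rewrite (intzD i n mB1 B1) (intzD j n mB1 B1).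
have ms k : measurable_fun setT (fun o : O =>
    \1_B o.1 * (cutoff cc n o.1 * \sum_j0 G o.1 k j0 * lam j0 o.1) : R).
  apply: (measurable_fst_comp (g := fun x =>
    \1_B x * (cutoff cc n x * \sum_j0 G x k j0 * lam j0 x))).
  apply: measurable_funM => //; apply: measurable_funM; first exact: measurable_cutoff.
  by apply: measurable_sum => j0; exact: measurable_funM.
apply: ae_eq_Rintegral => //.
apply: filterS gfacts => o [_ gi _].
rewrite indicE; have [|_] := boolP (o.1 \in B); last by rewrite !mul0r.
by rewrite inE => /BE /= /andP[Ai Aj]; rewrite !gi.
Qed.

Lemma projection_weighted_score lam' :
  unit_sum_weight b P lam' -> L2 (weighted_score b P zeta lam') ->
  orthogonal_projection P (tangent_H b P zeta) (weighted_score b P zeta lam') D.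
Proof.
move=> ul' L'; split => //; [exact: Lfun2_weighted_score| |].
  exact: tangent_H_weighted_score.
move=> h Hh; have [Lh _ _] := Hh.
have LV' : L2 (V lam').
  have := Lfun2B L' Lq.
  have -> // : (fun o => weighted_score b P zeta lam' o - q o.1) = V lam'.
  by apply/funext => o; rewrite /weighted_score addrAC subrr add0r.
have I1 := Lfun2M LV' Lh; have I2 := Lfun2M LV Lh.
have -> : \int[P]_o ((weighted_score b P zeta lam' o - D o) * h o) =
    \int[P]_o (V lam' o * h o - V lam o * h o).
  by apply: eq_Rintegral => o _; rewrite /weighted_score /weighted_zeta; ring.
rewrite RintegralB//.
have [ul _] := minw.
by rewrite (Rintegral_weights_tangent Lz ul' ul Hh I1 I2) subrr.
Qed.

Lemma projection_first_score :
  orthogonal_projection P (tangent_H b P zeta)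
    (fun o => q o.1 + zeta (min_argmax_branch (b P) o.1) o) D.
Proof.
have -> : (fun o => q o.1 + zeta (min_argmax_branch (b P) o.1) o) =
    weighted_score b P zeta (first_weight P b).
  by apply/funext => o; rewrite -(first_weightE P b zeta).
apply: projection_weighted_score; first exact: first_weight_unit_sum.
by apply: Lfun2D Lq _; exact: Lfun2_first_weight.
Qed.

Lemma weighted_score_value :
  ((L2norm P D) ^+ 2 = 'V_P[fun o : O => max_branch (b P) o.1] +
      \int[P]_o (v_br (Gamma_act b P zeta o.1))%:E)%E.
Proof.
rewrite L2norm_sqr; last exact: Lfun2_weighted_score.
have -> : (\int[P]_o (v_br (Gamma_act b P zeta o.1))%:E = (\int[P]_o g o.1)%:E)%E.
  rewrite EFin_Rintegral//; apply: (@ae_eq_integral_nonmeasurable _ _ _ P).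
  by apply: filterS gfacts => o [-> _ _].
have -> : ('V_P[fun o : O => max_branch (b P) o.1] = (\int[P]_o (q o.1 ^+ 2))%:E)%E.
  rewrite EFin_Rintegral; last exact: Lfun2_sqr.
  rewrite /variance unlock unlock; apply: eq_integral => o _ /=.
  by rewrite expr2.
rewrite -EFinD -intV2g; congr EFin.
have Iq2 := Lfun2_sqr Lq; have IqV := Lfun2M Lq LV.
have -> : \int[P]_o (D o ^+ 2) = \int[P]_o (q o.1 ^+ 2 + V lam o ^+ 2 +
    2 * (q o.1 * V lam o)).
  by apply: eq_Rintegral => o _; rewrite /weighted_score -/(V lam o); ring.
rewrite RintegralD//; [|exact: integrableDR|exact: integrableZR].
rewrite RintegralD// RintegralZl//.
by rewrite Rintegral_q_weighted_zeta mulr0 addr0.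
Qed.

End minimizing_weights.

(** * Closed subspaces of square integrable functions *)

Section L2_complete.
Context {d} {T : measurableType d} {R : realType} (P : probability T R).
Local Notation L2 f := (f \in Lfun P 2%:E).

Let r8 n : R := 8^-1 ^+ n.

(** Riesz-Fischer for a geometric rate. The increments have L^1 norm at most 2^-n, hence are almost
    surely summable, and Fatou's lemma carries the L^2 distances to the limit. The factor 4 closes
    the induction behind [far]: from (a + b)^2 <= 2 a^2 + 2 b^2 one step gives (1 + 2) 8^-n <= 4 *
    8^-n. *)
Lemma L2_fast_cauchy (u : nat -> T -> R) : (forall n, L2 (u n)) ->
  (forall n, \int[P]_x ((u n.+1 x - u n x) ^+ 2) <= 8^-1 ^+ n) ->
  exists f, L2 f /\ forall n, \int[P]_x ((f x - u n x) ^+ 2) <= 4 * 8^-1 ^+ n.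
Proof.
move=> Lu uE.
have mu n : measurable_fun setT (u n) by exact: Lfun2_measurable.
have Ld n k : L2 (fun x => u n x - u k x) by exact: Lfun2B.
have Id n k := Lfun2_sqr (Ld n k).
have far k n : \int[P]_x ((u (n + k)%N x - u n x) ^+ 2) <= 4 * r8 n.
  elim: k n => [|k IH] n.
    rewrite addn0 (_ : \int[P]_x _ = 0) ?mulr_ge0 ?exprn_ge0 ?invr_ge0//.
    under eq_Rintegral do rewrite subrr expr0n/=.
    exact: Rintegral_cst1.
  have I2 := integrableDR (integrableZR 2 (Id (n + k.+1)%N n.+1))
    (integrableZR 2 (Id n.+1 n)).
  apply: (le_trans (le_Rintegral measurableT (Id _ _) I2 _)).
    move=> x _; rewrite -subr_ge0.
    have -> : 2 * (u (n + k.+1)%N x - u n.+1 x) ^+ 2 + 2 * (u n.+1 x - u n x) ^+ 2 -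
      (u (n + k.+1)%N x - u n x) ^+ 2 =
      (u (n + k.+1)%N x - u n.+1 x - (u n.+1 x - u n x)) ^+ 2 by ring.
    exact: sqr_ge0.
  rewrite RintegralD//; [|exact: integrableZR|exact: integrableZR].
  rewrite !RintegralZl//.
  have := IH n.+1; rewrite addSnnS /r8 exprS => h.
  have h2 := uE n; have r0 : 0 <= r8 n by rewrite exprn_ge0// invr_ge0.
  rewrite /r8 in r0 *; lra.
pose v x := telescope (u ^~ x).
pose F N x : R := series (fun k => `|v x k|) N.
have Iv k : P.-integrable setT (EFin \o (fun x => `|v x k|)).
  exact: (integrable_norm (Lfun2_integrable (Ld k.+1 k))).
have FE N : F N = fun x => \sum_(0 <= k < N) `|v x k| by [].
have IF N : P.-integrable setT (EFin \o F N).
  by rewrite FE; apply: integrable_sumR => k; exact: Iv.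
have intF N : \int[P]_x F N x <= 2 - 2 * 2^-1 ^+ N.
  elim: N => [|N IH].
    rewrite FE; under eq_Rintegral do rewrite big_geq//.
    by rewrite Rintegral_cst1 expr0 mulr1 subrr.
  rewrite FE; under eq_Rintegral do rewrite big_nat_recr//=.
  rewrite (RintegralD _ (IF N) (Iv N))//.
  suff : \int[P]_x `|v x N| <= 2^-1 ^+ N.
    by move: IH; rewrite exprS; set a := 2^-1 ^+ N; move: a => a; lra.
  (* The bound |a| <= t / 2 + a^2 / (2 t) avoids square roots; for t = 2^-N its last term also
     integrates to at most t / 2, because 8^-N <= t^2. *)
  set t : R := 2^-1 ^+ N; have t0 : 0 < t by rewrite exprn_gt0 ?invr_gt0.
  have I2 := integrableDR (Lfun2_integrable (Lfun_cst P (2^-1 * t) 2))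
    (integrableZR (2^-1 / t) (Id N.+1 N)).
  apply: (le_trans (le_Rintegral measurableT (Iv N) I2 _)).
    move=> x _; rewrite /v/telescope/= -[in leRHS]real_normK ?num_real//.
    set a := `| _ |; rewrite -subr_ge0.
    have -> : 2^-1 * t + 2^-1 / t * a ^+ 2 - a = 2^-1 / t * (t - a) ^+ 2.
      by field; rewrite gt_eqF.
    by rewrite mulr_ge0 ?sqr_ge0// divr_ge0 ?invr_ge0// ltW.
  rewrite RintegralD//; [|exact: (Lfun2_integrable (Lfun_cst P _ 2))|exact: integrableZR].
  rewrite Rintegral_cst1 RintegralZl//.
  have h2 := uE N.
  have t8 : 8^-1 ^+ N <= t ^+ 2.
    rewrite /t -exprM mulnC exprM lerXn2r ?nnegrE ?exprn_ge0 ?invr_ge0//.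
    by rewrite expr2; lra.
  have : 2^-1 / t * \int[P]_x ((u N.+1 x - u N x) ^+ 2) <= 2^-1 / t * t ^+ 2.
    by rewrite ler_wpM2l ?(le_trans h2)// divr_ge0 ?invr_ge0// ltW.
  have -> : 2^-1 / t * t ^+ 2 = 2^-1 * t by field; rewrite gt_eqF.
  lra.
have cvF : {ae P, forall x, cvgn (F ^~ x)}.
  pose U x := limn (fun N => (F N x)%:E).
  have mF N : measurable_fun setT (EFin \o F N) by exact: measurable_int (IF N).
  have F0 N x : setT x -> (0 <= (F N x)%:E)%E.
    by move=> _; rewrite lee_fin FE sumr_ge0.
  have ndF x : nondecreasing_seq (F ^~ x).
    by apply/nondecreasing_seqP => n; rewrite !FE big_nat_recr//= lerDl.
  have ndF' x : setT x -> {homo (fun N => (F N x)%:E) : n m / (n <= m)%N >-> (n <= m)%E}.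
    by move=> _ n m nm; rewrite lee_fin ndF.
  have h := @cvg_monotone_convergence _ _ _ P setT measurableT _ mF F0 ndF'.
  have cvU x : cvgn (fun N => (F N x)%:E).
    by apply: ereal_nondecreasing_is_cvgn => n m nm; rewrite lee_fin ndF.
  have U0 x : (0 <= U x)%E.
    by apply: lime_ge => //; apply: nearW => N; exact: F0.
  have mU : measurable_fun setT U.
    by apply: (emeasurable_fun_cvg (fun N => EFin \o F N)) => // x _; exact: cvU.
  have IU : P.-integrable setT U.
    apply/integrableP; split => //.
    under eq_integral do rewrite gee0_abs//.
    apply: (@le_lt_trans _ _ 2%:E); last by rewrite ltry.
    apply: (cvge_le _ h); apply: nearW => N.
    rewrite -EFin_Rintegral// lee_fin (le_trans (intF N))//.
    by rewrite lerBlDr lerDl mulr_ge0// exprn_ge0// invr_ge0.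
  have := integrable_ae measurableT IU; apply: filterS => x /(_ Logic.I) Ufin.
  apply: nondecreasing_is_cvgn => //; exists (fine (U x)) => _ [N _ <-].
  rewrite -lee_fin fineK//; apply: (lime_ge (cvU x)).
  by exists N => // M /= NM; rewrite lee_fin ndF.
have cvu : {ae P, forall x, cvgn (u ^~ x)}.
  apply: filterS cvF => x cF.
  have cs : cvgn (series (v x)) by exact: normed_cvg.
  have -> : u ^~ x = (fun n => u 0%N x + series (v x) n).
    by apply/funext => n; exact: (eq_sum_telescope (u ^~ x)).
  by apply: is_cvgD => //; exact: is_cvg_cst.
(* The upper limit is measurable and defined at every point, and it is the pointwise limit almost
   surely. *)
pose f x := fine (limn_esup (fun n => (u n x)%:E)).
have mf : measurable_fun setT f.
  apply: measurableT_comp; first exact: fine_measurable.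
  by apply: measurable_fun_limn_esup => n; exact/measurable_EFinP.
have uf : {ae P, forall x, u n x @[n --> \oo] --> f x}.
  apply: filterS cvu => x cu.
  have cu' : (u n x)%:E @[n --> \oo] --> (limn (u ^~ x))%:E.
    by apply/fine_cvgP; split => //; exact: nearW.
  by rewrite /f (cvg_limn_einf_sup cu').2/=; exact: cu.
have bound n : (\int[P]_x ((f x - u n x) ^+ 2)%:E <= (4 * r8 n)%:E)%E.
  pose w m x := ((u (n + m)%N x - u n x) ^+ 2)%:E.
  have mw m : measurable_fun setT (w m) by exact: measurable_int (Id _ _).
  have w0 m x : setT x -> (0 <= w m x)%E by move=> _; rewrite lee_fin sqr_ge0.
  have -> : (\int[P]_x ((f x - u n x) ^+ 2)%:E = \int[P]_x limn_einf (w ^~ x))%E.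
    apply: ae_eq_integral_nonmeasurable; apply: filterS uf => x ux.
    have : w m x @[m --> \oo] --> ((f x - u n x) ^+ 2)%:E.
      apply/fine_cvgP; split; first exact: nearW.
      rewrite (_ : fine \o w ^~ x = fun m =>
        (u (n + m)%N x - u n x) * (u (n + m)%N x - u n x)); last first.
        by apply/funext => m; rewrite /w/= expr2.
      rewrite expr2; suff h : u (n + m)%N x - u n x @[m --> \oo] --> f x - u n x.
        exact: cvgM.
      apply: cvgB; last exact: cvg_cst.
      under eq_fun do rewrite addnC.
      by have := ux; rewrite -(cvg_shiftn n).
    by move=> /cvg_limn_einf_sup[-> _].
  apply: (le_trans (fatou _ _ mw w0)) => //.
  rewrite limn_einf_lim; apply: lime_le; first exact: is_cvg_einfs.
  apply: nearW => k; rewrite /einfs.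
  apply: (@le_trans _ _ (\int[P]_x w k x)%E).
    by apply: ereal_inf_lbound; exists k => //=.
  by rewrite /w -EFin_Rintegral ?lee_fin.
have If n : P.-integrable setT (EFin \o (fun x => (f x - u n x) ^+ 2)).
  apply: integrable_ge0 => //.
  - by apply: measurable_funX; exact: measurable_funB.
  - by move=> x; exact: sqr_ge0.
  - by rewrite (le_lt_trans (bound n))// ltry.
exists f; split.
  have Lfu : L2 (fun x => f x - u 0%N x).
    by apply: Lfun2I => //; exact: measurable_funB.
  have := Lfun2D Lfu (Lu 0%N).
  have -> // : (fun x => f x - u 0%N x + u 0%N x) = f.
  by apply/funext => x; rewrite subrK.
by move=> n; rewrite -lee_fin EFin_Rintegral//; exact: bound.
Qed.

End L2_complete.

(** * Projection onto the closure of a linear space *)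

Section L2_projection.
Context {d} {T : measurableType d} {R : realType} (P : probability T R).
Local Notation L2 f := (f \in Lfun P 2%:E).
Variable S : set (T -> R).
Hypothesis SL2 : forall s, S s -> L2 s.
Hypothesis S0 : S (cst 0).
Hypothesis Slin : forall (a : R) s1 s2, S s1 -> S s2 -> S (fun o => a * s1 o + s2 o).

Lemma L2_closureP f : L2_closure P S f <->
  L2 f /\ forall e : R, 0 < e -> exists s, S s /\ \int[P]_o ((f o - s o) ^+ 2) < e.
Proof.
have E s e : L2 f -> S s -> 0 < e -> (L2norm P (fun o => f o - s o)%R < e%:E)%E =
    (\int[P]_o ((f o - s o) ^+ 2) < e ^+ 2).
  move=> Lf Ss e0; rewrite L2normE; last by apply: Lfun2B => //; exact: SL2.
  rewrite lte_fin -{1}(ger0_norm (ltW e0)) -sqrtr_sqr ltr_sqrt//.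
  by rewrite exprn_gt0.
split=> -[Lf h]; split=> // e e0.
  have [|s [Ss]] := h (Num.sqrt e); first by rewrite sqrtr_gt0.
  rewrite E ?sqrtr_gt0// sqr_sqrtr ?ltW// => ?; by exists s.
have [|s [Ss hs]] := h (e ^+ 2); first by rewrite exprn_gt0.
by exists s; rewrite E.
Qed.

Lemma sub_L2_closure s : S s -> L2_closure P S s.
Proof.
move=> Ss; apply/L2_closureP; split; first exact: SL2.
move=> e e0; exists s; split => //.
under eq_Rintegral do rewrite subrr expr0n/=.
by rewrite Rintegral_cst1.
Qed.

Lemma L2_closureB f g : L2_closure P S f -> L2_closure P S g ->
  L2_closure P S (fun o => f o - g o).
Proof.
move=> /L2_closureP[Lf hf] /L2_closureP[Lg hg]; apply/L2_closureP.
split; first exact: Lfun2B.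
move=> e e0; have e4 : 0 < e / 4 by rewrite divr_gt0.
have [s [Ss hs]] := hf _ e4; have [t [St ht]] := hg _ e4.
exists (fun o => -1 * t o + s o); split; first exact: Slin.
have I1 := Lfun2_sqr (Lfun2B Lf (SL2 Ss)); have I2 := Lfun2_sqr (Lfun2B Lg (SL2 St)).
have I3 := Lfun2_sqr (Lfun2B (Lfun2B Lf Lg) (SL2 (Slin (-1) St Ss))).
have I4 := integrableDR (integrableZR 2 I1) (integrableZR 2 I2).
apply: (le_lt_trans (le_Rintegral measurableT I3 I4 _)).
  move=> o _; rewrite -subr_ge0.
  have -> : 2 * (f o - s o) ^+ 2 + 2 * (g o - t o) ^+ 2 -
    (f o - g o - (-1 * t o + s o)) ^+ 2 = (f o - s o + (g o - t o)) ^+ 2 by ring.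
  exact: sqr_ge0.
rewrite RintegralD//; [|exact: integrableZR|exact: integrableZR].
by rewrite !RintegralZl//; lra.
Qed.

Lemma L2_closure_orthogonal f : L2 f -> (forall s, S s -> \int[P]_o (f o * s o) = 0) ->
  forall h, L2_closure P S h -> \int[P]_o (f o * h o) = 0.
Proof.
move=> Lf f0 h /L2_closureP[Lh hh]; apply/eqP; rewrite -sqrf_eq0; apply/eqP.
apply/le_anti; rewrite sqr_ge0 andbT; apply/ler_addgt0Pl => e e0; rewrite addr0.
set a := \int[P]_o (f o ^+ 2).
have a0 : 0 <= a by apply: Rintegral_ge0 => o _; exact: sqr_ge0.
have a1 : 0 < a + 1 by rewrite ltr_pwDr.
have [|s [Ss hs]] := hh (e / (a + 1)); first by rewrite divr_gt0.
have -> : \int[P]_o (f o * h o) = \int[P]_o (f o * (h o - s o)).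
  under [RHS]eq_Rintegral do rewrite mulrBr.
  rewrite RintegralB//; [|exact: Lfun2M|by apply: Lfun2M => //; exact: SL2].
  by rewrite (f0 s Ss) subr0.
apply: (le_trans (cauchy_schwarz Lf (Lfun2B Lh (SL2 Ss)))).
apply: (@le_trans _ _ ((a + 1) * (e / (a + 1)))).
  apply: ler_pM => //; [|by rewrite lerDl|exact: ltW].
  by apply: Rintegral_ge0 => o _; exact: sqr_ge0.
by rewrite mulrC divfK// gt_eqF.
Qed.

(** A minimizing sequence in S converges by the parallelogram law. Orthogonality is the first-order
    condition in the limit: perturbing each term along s yields an inequality 2 t b - t^2 |s|^2 <= 0
    valid for all t. *)
Lemma L2_projection_exists g : L2 g ->
  exists D, orthogonal_projection P (L2_closure P S) g D.
Proof.
move=> Lg; pose dist s := \int[P]_o ((g o - s o) ^+ 2).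
have dist0 s : 0 <= dist s by apply: Rintegral_ge0 => o _; exact: sqr_ge0.
pose E := [set dist s | s in S].
have hE : has_inf E.
  split; first by exists (dist (cst 0)), (cst 0).
  by exists 0 => _ [s _ <-].
have ge_inf s : S s -> inf E <= dist s.
  by move=> Ss; apply: ge_inf; [case: hE|exists s].
(* The midpoint of two consecutive terms is at squared distance at least [inf E], so the terms are
   at squared distance at most 2 eps_n + 2 eps_(n+1) <= 4 eps_n = 8^-n, the rate asked for by
   [L2_fast_cauchy]. *)
pose eps n : R := 4^-1 * 8^-1 ^+ n.
have eps0 n : 0 < eps n by rewrite mulr_gt0 ?exprn_gt0 ?invr_gt0.
have /choice[u uP] n : exists s, S s /\ dist s < inf E + eps n.
  by have [_ [s Ss <-] ?] := inf_adherent (eps0 n) hE; exists s.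
have Su n : S (u n) by case: (uP n).
have Lu n : L2 (u n) by exact: SL2.
have [|D [LD DE]] := @L2_fast_cauchy _ _ _ P u Lu.
  move=> n; pose w o := 2^-1 * u n o + (2^-1 * u n.+1 o + cst 0 o).
  have Sw : S w by apply: Slin => //; exact: Slin.
  have Ia := Lfun2_sqr (Lfun2B Lg (Lu n)); have Ib := Lfun2_sqr (Lfun2B Lg (Lu n.+1)).
  have Ic := Lfun2_sqr (Lfun2B Lg (SL2 Sw)).
  have -> : \int[P]_x ((u n.+1 x - u n x) ^+ 2) =
      2 * dist (u n) + 2 * dist (u n.+1) - 4 * dist w.
    rewrite /dist -!RintegralZl// -RintegralD//; try exact: integrableZR.
    rewrite -RintegralB//; [|by apply: integrableDR; exact: integrableZR|exact: integrableZR].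
    by apply: eq_Rintegral => o _; rewrite /w/=; field.
  have [_ h1] := uP n; have [_ h2] := uP n.+1; have h3 := ge_inf _ Sw.
  have h4 : eps n.+1 <= eps n.
    rewrite /eps exprS; have : 0 < (8^-1 : R) ^+ n by rewrite exprn_gt0 ?invr_gt0.
    by set a := 8^-1 ^+ n; move: a => a; lra.
  have h5 : 4 * eps n = 8^-1 ^+ n by rewrite /eps mulrA divff ?mul1r.
  by move: h1 h2 h3 h4 h5; lra.
have cE : L2_closure P S D.
  apply/L2_closureP; split=> // e e0.
  have : (4 * 8^-1 ^+ n) @[n --> \oo] --> (4 * 0 : R).
    by apply: cvgMr; apply: cvg_expr; rewrite ger0_norm ?invr_ge0// invf_lt1// ltr1n.
  rewrite mulr0 => /cvgr_lt/(_ e e0)[N _ /(_ N (leqnn N)) h].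
  by exists (u N); split => //; exact: le_lt_trans (DE N) h.
exists D; split => //; apply: L2_closure_orthogonal; first exact: Lfun2B.
move=> s Ss; have Ls := SL2 Ss.
pose sg := \int[P]_o (s o ^+ 2); pose bb n := \int[P]_o ((g o - u n o) * s o).
pose be := \int[P]_o ((g o - D o) * s o).
have hb n t : 2 * t * bb n - t ^+ 2 * sg <= eps n.
  have Sw : S (fun o => t * s o + u n o) by exact: Slin.
  have h3 := ge_inf _ Sw; have [_ h1] := uP n.
  have I1 := Lfun2_sqr (Lfun2B Lg (Lu n)); have I2 := Lfun2M (Lfun2B Lg (Lu n)) Ls.
  have I3 := Lfun2_sqr Ls.
  have E1 : dist (fun o => t * s o + u n o) = dist (u n) - 2 * t * bb n + t ^+ 2 * sg.
    rewrite /dist /bb /sg -!RintegralZl// -RintegralB//; last exact: integrableZR.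
    rewrite -RintegralD//; [|by apply: integrableBR => //; exact: integrableZR|exact: integrableZR].
    by apply: eq_Rintegral => o _; ring.
  by move: h3 h1; rewrite E1; lra.
have sg0 : 0 <= sg by apply: Rintegral_ge0 => o _; exact: sqr_ge0.
have eps_cvg : eps n @[n --> \oo] --> (0 : R).
  rewrite -[X in _ --> X](mulr0 (4^-1 : R)).
  by apply: cvgMr; apply: cvg_expr; rewrite ger0_norm ?invr_ge0// invf_lt1// ltr1n.
have bb_cvg : bb n @[n --> \oo] --> be.
  apply/cvgrPdist_le => e e0.
  have h : (e ^+ 2) > 0 by rewrite exprn_gt0.
  have : (16 * eps n * sg) @[n --> \oo] --> (16 * 0 * sg).
    by apply: cvgMl; exact: cvgMr.
  rewrite mulr0 mul0r => /cvgr_lt/(_ _ h); apply: filterS => n hn.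
  have -> : be - bb n = - \int[P]_o ((D o - u n o) * s o).
    rewrite /be /bb -RintegralB//; [|exact: Lfun2M (Lfun2B Lg LD) Ls|exact: Lfun2M (Lfun2B Lg (Lu n)) Ls].
    rewrite -mulN1r -RintegralZl//; last exact: Lfun2M (Lfun2B LD (Lu n)) Ls.
    by apply: eq_Rintegral => o _; ring.
  rewrite normrN -(@ler_pXn2r _ 2)// ?nnegrE ?(ltW e0)// real_normK ?num_real//.
  apply: (le_trans (cauchy_schwarz (Lfun2B LD (Lu n)) Ls)).
  apply: le_trans (ltW hn); apply: ler_wpM2r => //.
  apply: (le_trans (DE n)); rewrite /eps mulrA.
  by rewrite (_ : 16 * 4^-1 = 4 :> R)//; field.
have key t : 2 * t * be - t ^+ 2 * sg <= 0.
  have c1 : 2 * t * bb n - t ^+ 2 * sg @[n --> \oo] --> 2 * t * be - t ^+ 2 * sg.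
    by apply: cvgB; [exact: cvgMr|exact: cvg_cst].
  by apply: (ler_cvg_to c1 eps_cvg); apply: nearW => n; exact: hb.
have : - 2 * be = 0.
  by apply: (@quadratic_ge0_eq0 _ _ sg) => t; have := key t; lra.
by move/eqP; rewrite mulf_eq0 oppr_eq0 pnatr_eq0/= => /eqP.
Qed.

End L2_projection.

(** * The pathwise derivative *)

Section max_branch_perturbation.
Context {dX} {TX : measurableType dX} {R : realType} {J : nat}.
Implicit Types (f g : 'I_J.+1 -> TX -> R) (x : TX).

Lemma max_branch_lip f g x (c : R) : (forall j, `|f j x - g j x| <= c) ->
  `|max_branch f x - max_branch g x| <= c.
Proof.
move=> h; have [i fi] := max_branchP f x; have [j gj] := max_branchP g x.
have h1 := h i; have h2 := h j; have h3 := le_max_branch f j x; have h4 := le_max_branch g i x.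
by move: h1 h2; rewrite fi gj !ler_norml in h3 h4 * => /andP[? ?] /andP[? ?]; lra.
Qed.

(* Inactive branches can only matter where the gap to the maximum is at most
   of the order of the perturbation. *)
Definition near_tie f (a : 'I_J.+1 -> TX -> R) (t : R) x : bool :=
  [exists j : 'I_J.+1, (j \notin argmax_branch f x) &&
    (max_branch f x - f j x <= 2 * t * \sum_(k < J.+1) `|a k x|)].

(** Without a near tie no inactive branch can overtake, and the maximum moves with the common slope
    of the active ones. With a near tie both the increment of the maximum and its linear part are at
    most |t| times the sum of slopes, whence the factor 2. *)
Lemma max_branch_linearize f a x (t : R) j0 :
  j0 \in argmax_branch f x ->
  (forall i j, i \in argmax_branch f x -> j \in argmax_branch f x -> a i x = a j x) ->
  `|max_branch (fun j x => f j x + t * a j x) x - max_branch f x - t * a j0 x| <=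
  2 * `|t| * ((\sum_k `|a k x|) * (near_tie f a `|t| x)%:R).
Proof.
move=> Aj0 aE; set N := \sum_k _.
have aN j : `|a j x| <= N by rewrite /N (bigD1 j)//= lerDl sumr_ge0.
have taN j : `|t * a j x| <= `|t| * N by rewrite normrM ler_wpM2l.
have fj0 : f j0 x = max_branch f x by move: Aj0; rewrite inE => /eqP.
have [nt|nnt] := boolP (near_tie f a `|t| x).
  rewrite mulr1.
  have h : `|max_branch (fun j x => f j x + t * a j x) x - max_branch f x| <= `|t| * N.
    by apply: max_branch_lip => j; rewrite addrAC subrr add0r.
  by apply: (le_trans (ler_normB _ _)); have := taN j0; lra.
rewrite mulr0 mulr0 normr_le0 -addrA -opprD subr_eq0; apply/eqP.
apply/le_anti/andP; split; last first.
  by rewrite -fj0; exact: (le_max_branch (fun j x => f j x + t * a j x) j0).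
rewrite {1}/max_branch; apply/bigmax_leP.
have key j : f j x + t * a j x <= max_branch f x + t * a j0 x.
  have [Aj|nAj] := boolP (j \in argmax_branch f x).
    by rewrite (aE j j0)// lerD2r le_max_branch.
  move: nnt; rewrite negb_exists => /forallP/(_ j); rewrite nAj/= -ltNge => h.
  have := taN j; have := taN j0; rewrite !ler_norml => /andP[? ?] /andP[? ?].
  by move: h; rewrite -/N -mulrA; lra.
by split => // j _; exact: key.
Qed.

(** Lets a single scale 1/(n + 1) control all smaller perturbations at once. *)
Lemma near_tie_mono f a (s t : R) x : s <= t -> near_tie f a s x -> near_tie f a t x.
Proof.
move=> st /existsP[j /andP[nA h]]; apply/existsP; exists j; rewrite nA/=.
by rewrite (le_trans h)// ler_wpM2r ?sumr_ge0// ler_pM2l.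
Qed.

Lemma near_tie_cvg0 f a x : \forall n \near \oo, ~~ near_tie f a n.+1%:R^-1 x.
Proof.
have E j : \forall n \near \oo, ~~ ((j \notin argmax_branch f x) &&
    (max_branch f x - f j x <= 2 * n.+1%:R^-1 * \sum_k `|a k x|)).
  have [jA|nA] /= := boolP (j \in argmax_branch f x).
    by apply: nearW => n.
  have gap : 0 < max_branch f x - f j x.
    rewrite subr_gt0 lt_def; apply/andP; split; first by move: nA; rewrite inE eq_sym.
    exact: le_max_branch.
  have : (2 * n.+1%:R^-1 * \sum_k `|a k x|) @[n --> \oo] --> (2 * 0 * \sum_k `|a k x|).
    by apply: cvgMl; apply: cvgMr; exact: cvg_harmonic.
  rewrite mulr0 mul0r => /cvgr_lt/(_ _ gap); apply: filterS => n.
  by rewrite -ltNge.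
have [N _ h] := filter_forall _ E; exists N => // n /= Nn.
by rewrite negb_exists; apply/forallP => j; exact: (h n Nn j).
Qed.

End max_branch_perturbation.

(** * First-order expansion of the target along a score *)

Section pathwise_derivative.
Context {dX dW} {TX : measurableType dX} {TW : measurableType dW}
  {R : realType} {J : nat} (P : probability (TX * TW)%type R).
Local Notation O := (TX * TW)%type.
Variables (model : set (probability O R))
  (b : probability O R -> 'I_J.+1 -> TX -> R) (zeta : 'I_J.+1 -> O -> R)
  (lam : 'I_J.+1 -> TX -> R) (S : set (O -> R)).
Local Notation L2 f := (f \in Lfun P 2%:E).
Local Notation A := (argmax_branch (b P)).
Local Notation q := (qfun b P).
Local Notation D := (weighted_score b P zeta lam).

Hypothesis mbQ : forall Q, model Q -> forall j, measurable_fun setT (b Q j).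
Hypothesis modelP : model P.
Hypothesis Lq : L2 (fun o : O => q o.1).
Hypothesis Lz : forall j, L2 (zeta j).
Hypothesis z0 : forall j, {ae P, forall o : O, condexp P (zeta j) o.1 = 0}.
Hypothesis minw : minimizing_weight b P zeta lam.
Hypothesis scoreS : score_space b P zeta S.
Hypothesis smooth : smooth_along model b P zeta S.

Let mb : forall j, measurable_fun setT (b P j). Proof. exact: mbQ. Qed.

Lemma score_Lfun2 s : S s -> L2 s.
Proof. by case: scoreS => SH _ _ _ /SH[]. Qed.

Lemma score_mean0 s : S s -> \int[P]_o s o = 0.
Proof. by case: scoreS => SH _ _ _ /SH[]. Qed.

Definition linear_tilt (s : O -> R) (r : R) := tilt P (fun o => 1 + r * s o).

Lemma local_law1 s (t : 'rV[R]_1) :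
  local_law P (fun=> s) t = linear_tilt s (t 0 0).
Proof.
by rewrite /local_law/linear_tilt; congr tilt; apply/funext => o; rewrite big_ord1.
Qed.

Lemma near_const_mx1 (Q : 'rV[R]_1 -> Prop) :
  (\forall t \near (0 : 'rV[R]_1), Q t) -> \forall r \near (0 : R), Q (const_mx r).
Proof.
move=> /nbhs_ballP[e /= e0 h]; apply/nbhs_ballP; exists e => // r rr.
by apply: h; split=> // i j; rewrite !mxE.
Qed.

Lemma linear_tilt_smooth s : S s ->
  (\forall r \near (0 : R), model (linear_tilt s r)) /\
  (forall (e : R), 0 < e -> \forall r \near (0 : R), forall j,
     (\int[P]_o `| b (linear_tilt s r) j o.1 - b P j o.1 -
        r * condexp P (fun o' => zeta j o' * s o')%R o.1 |%:E <= (e * `|r|)%:E)%E).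
Proof.
move=> Ss; have inj : injective (fun _ : 'I_1 => s) by move=> i j _; rewrite !ord1.
have [H1 H2] := smooth inj (fun=> Ss); split.
  by apply: filterS (near_const_mx1 H1) => r; rewrite local_law1 mxE.
move=> e e0; suff key j : \forall r \near (0 : R),
    (\int[P]_o `| b (linear_tilt s r) j o.1 - b P j o.1 -
        r * condexp P (fun o' => zeta j o' * s o')%R o.1 |%:E <= (e * `|r|)%:E)%E.
  exact: filter_forall key.
(* Converts the norm on row vectors into |r|: the vector with entry r has norm at most c |r|. *)
pose c : R := `|const_mx 1 : 'rV[R]_1| + 1.
have c0 : 0 < c by rewrite ltr_pwDr.
have ec : 0 < e / c by rewrite divr_gt0.
apply: filterS (near_const_mx1 (H2 j _ ec)) => r; rewrite local_law1 mxE.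
under eq_integral do rewrite big_ord1 mxE.
move=> h; apply: (le_trans h); rewrite lee_fin.
have -> : (const_mx r : 'rV[R]_1) = r *: const_mx 1.
  by apply/matrixP => i k; rewrite !mxE mulr1.
rewrite normrZ; set k := `|const_mx 1 : 'rV[R]_1|.
have -> : e / c * (`|r| * k) = e * `|r| * (k / c) by field; rewrite gt_eqF.
rewrite ler_piMr ?mulr_ge0 ?(ltW e0)// ler_pdivrMr// mul1r.
by rewrite lerDl.
Qed.

Section bounded_score.
Variables (s : O -> R) (B : R).
Hypotheses (ms : measurable_fun setT s) (s0 : \int[P]_o s o = 0)
  (sB : forall o, `|s o| <= B).

Lemma linear_density_ge0 r : `|r| * B <= 1 -> forall o, 0 <= 1 + r * s o.
Proof.
move=> rB o; have : `|r * s o| <= 1.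
  by rewrite normrM (le_trans _ rB)// ler_wpM2l.
by rewrite ler_norml => /andP[+ _]; rewrite -subr_ge0 opprK addrC.
Qed.

Lemma measurable_linear_density r : measurable_fun setT (fun o => 1 + r * s o).
Proof. by apply: measurable_funD => //; exact: measurable_funM. Qed.

Lemma linear_tiltE r : `|r| * B <= 1 -> forall E, measurable E ->
  linear_tilt s r E = (\int[P]_(o in E) (1 + r * s o)%:E)%E.
Proof.
move=> rB; apply: tiltE; first exact: measurable_linear_density.
  exact: linear_density_ge0.
have Is : P.-integrable setT (EFin \o s) by exact: bounded_integrable sB.
have I1 := Lfun2_integrable (Lfun_cst P (1 : R) 2).
rewrite -EFin_Rintegral; last exact: integrableDR I1 (integrableZR r Is).
by rewrite (RintegralD _ I1 (integrableZR r Is))// Rintegral_cst1 RintegralZl// s0 mulr0 addr0.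
Qed.

End bounded_score.

(** D* is the projection onto H of q + zeta_{j_0}, so against a score in H it can be replaced by
    that function; the mean zero of s then removes the constant Psi. What remains is the derivative
    suggested by the product rule. *)
Lemma Rintegral_max_score s : S s ->
  \int[P]_o (D o * s o) = \int[P]_o (max_branch (b P) o.1 * s o) +
    \int[P]_o condexp P (fun o' => zeta (min_argmax_branch (b P) o.1) o' * s o') o.1.
Proof.
move=> Ss; have [SH Sbd _ _] := scoreS; have Hs := SH _ Ss; have [Ls ms0 _] := Hs.
have [LF LD _ /(_ _ Hs)] := projection_first_score mb Lq Lz z0 minw.
under eq_Rintegral do rewrite mulrBl.
have LV : L2 (weighted_zeta zeta (first_weight P b)) by exact: Lfun2_first_weight.
rewrite RintegralB//; [|exact: Lfun2M LF Ls|exact: Lfun2M LD Ls].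
move/eqP; rewrite subr_eq0 => /eqP <-.
under eq_Rintegral do rewrite -(first_weightE P b zeta) mulrDl.
rewrite RintegralD//; [|exact: Lfun2M Lq Ls|exact: Lfun2M LV Ls].
have Lc := Lfun_cst P (Psi b P) 2.
have Lm : L2 (fun o : O => max_branch (b P) o.1).
  have := Lfun2D Lq Lc; have -> // : (fun o : O => q o.1 + Psi b P) = (fun o => max_branch (b P) o.1).
  by apply/funext => o; rewrite /qfun subrK.
congr (_ + _).
  rewrite /qfun; under eq_Rintegral do rewrite mulrBl.
  rewrite RintegralB//; [|exact: Lfun2M Lm Ls|exact: Lfun2M Lc Ls].
  by rewrite RintegralZl ?ms0 ?mulr0 ?subr0//; exact: Lfun2_integrable.
have mw j : measurable_fun setT (first_weight P b j).
  by apply: measurable_natb; exact: measurable_min_argmax.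
have w1 j x : `|first_weight P b j x| <= 1.
  by rewrite /first_weight; case: (_ == _); rewrite ?normr1 ?normr0.
have -> : \int[P]_o (weighted_zeta zeta (first_weight P b) o * s o) =
    \int[P]_o (\sum_j first_weight P b j o.1 * (zeta j o * s o)).
  apply: eq_Rintegral => o _; rewrite /weighted_zeta mulr_suml.
  by apply: eq_bigr => j _; rewrite mulrA.
rewrite (Rintegral_condexp_sum _ mw w1); last by move=> j; exact: Lfun2M.
apply: eq_Rintegral => o _.
rewrite (bigD1 (min_argmax_branch (b P) o.1))//= /first_weight eqxx mul1r.
by rewrite big1 ?addr0// => j; rewrite eq_sym => /negPf ->; rewrite mul0r.
Qed.

(** With m_r the perturbed maximum and alpha the common slope of the active branches, the error is
    E[m_r - m - r alpha] + r E[s (m_r - m)]. The first term is bounded by the branch remainders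
    [rho] plus the slopes [N] integrated over near ties, a set shrinking to nothing; the second is
    of order r^2 up to a multiple of [rho]. *)
Lemma Psi_expansion s : S s -> forall e : R, 0 < e -> \forall r \near (0 : R),
  `|Psi b (linear_tilt s r) - Psi b P - r * \int[P]_o (D o * s o)| <= e * `|r|.
Proof.
move=> Ss e e0; have [SH Sbd _ _] := scoreS; have Hs := SH _ Ss.
have [Ls ms0 _] := Hs; have [B sB] := Sbd _ Ss.
have B0 : 0 <= B by rewrite (le_trans (normr_ge0 _) (sB point)).
have ms := Lfun2_measurable Ls.
pose a j := condexp P (fun o => zeta j o * s o).
have Izs j : P.-integrable setT (EFin \o (fun o => zeta j o * s o)) by exact: Lfun2M.
have ma j : measurable_fun setT (a j) by exact: measurable_condexp.
have Ia j : P.-integrable setT (EFin \o (fun o : O => a j o.1)) by exact: integrable_condexp.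
pose N x : R := \sum_j `|a j x|.
have mN : measurable_fun setT N by apply: measurable_sum => j; exact: measurableT_comp.
have N0 x : 0 <= N x by exact: sumr_ge0.
have IN : P.-integrable setT (EFin \o (fun o : O => N o.1)).
  by apply: integrable_sumR => j; exact: integrable_norm (Ia j).
pose nt t x : R := (near_tie (b P) a t x)%:R.
have mnt t : measurable_fun setT (nt t).
  apply: measurable_natb; rewrite /near_tie.
  have -> : (fun x => [exists j, (j \notin A x) &&
      (max_branch (b P) x - b P j x <= 2 * t * N x)]) =
    (fun x => \big[orb/false]_j ((j \notin A x) &&
      (max_branch (b P) x - b P j x <= 2 * t * N x))).
    by apply/funext => x; rewrite big_orE; apply: eq_existsb => j.
  elim: (index_enum _) => [|i l IH].
    by under eq_fun do rewrite big_nil; exact: measurable_cst.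
  under eq_fun do rewrite big_cons; apply: measurable_or => //.
  apply: measurable_and; first by apply: measurable_neg; exact: measurable_in_argmax.
  apply: measurable_fun_ler; last exact: measurable_funM.
  by apply: measurable_funB => //; exact: measurable_max_branch.
have nt01 t x : 0 <= nt t x <= 1 by rewrite ler0n /nt; case: near_tie => /=; rewrite ?ler01.
have IntN t : P.-integrable setT (EFin \o (fun o : O => N o.1 * nt t o.1)).
  apply: (le_integrableR (g := fun o => N o.1)) => //.
  - by apply: measurable_funM; apply: measurable_fst_comp.
  - move=> o; have /andP[h0 h1] := nt01 t o.1.
    by rewrite normrM (ger0_norm (N0 _)) (ger0_norm h0) ler_piMr.
pose G t := \int[P]_o (N o.1 * nt t o.1).
have G0 : G n.+1%:R^-1 @[n --> \oo] --> (0 : R).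
  rewrite -[X in _ --> X](Rintegral_cst1 P).
  apply: (dominated_Rcvg (g := fun o => N o.1)) => //.
  - by move=> n; exact: integrable_measurable (IntN _).
  - move=> n o; have /andP[h0 h1] := nt01 n.+1%:R^-1 o.1.
    by rewrite normrM (ger0_norm (N0 _)) (ger0_norm h0) ler_piMr.
  - apply: aeW => o; apply: cvg_near_cst.
    apply: filterS (near_tie_cvg0 (b P) a o.1) => n /negPf h.
    by rewrite /nt h mulr0.
(* The scale is fixed by the near-tie term; monotonicity of [G] then covers every |r| <= 1/(n0 +
   1). *)
have [n0 Gn0] : exists n, G n.+1%:R^-1 <= e / 16.
  have e16 : 0 < e / 16 by rewrite divr_gt0.
  have := G0 => /cvgr_le/(_ _ e16)[n _ h]; exists n; exact: (h n (leqnn n)).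
have Gmono t t' : t <= t' -> G t <= G t'.
  move=> tt'; apply: le_Rintegral => // o _; rewrite ler_wpM2l// /nt.
  have := @near_tie_mono _ _ _ _ (b P) a t t' o.1 tt'.
  by case: near_tie => [->//|_]; exact: ler0n.
have [H1 H2] := linear_tilt_smooth Ss.
(* Summed over the J + 1 branches, the remainders cost e |r| / 8. The whole budget is e/8 for [rho],
   e/8 for near ties, e/4 for the quadratic term and e/8 for [rho] multiplied by the score. *)
pose e1 := e / (8 * J.+1%:R).
have e10 : 0 < e1 by rewrite divr_gt0// mulr_gt0.
pose IN' := \int[P]_o N o.1.
have IN'0 : 0 <= IN' by apply: Rintegral_ge0 => o _.
have near_le (c : R) : 0 < c -> \forall r \near (0 : R), `|r| <= c.
  move=> c0; apply/nbhs_ballP; exists c => // r.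
  by rewrite /ball/= sub0r normrN => /ltW.
have c1 : 0 < B * IN' + 1 by rewrite ltr_pwDr// mulr_ge0.
have c2 : 0 < e / 4 / (B * IN' + 1) by rewrite !divr_gt0.
near=> r.
have rB : `|r| * B <= 1.
  have : `|r| <= (B + 1)^-1.
    by near: r; apply: near_le; rewrite invr_gt0 ltr_pwDr.
  move=> h; apply: (@le_trans _ _ ((B + 1)^-1 * B)); first exact: ler_wpM2r.
  by rewrite mulrC ler_pdivrMr ?ltr_pwDr// mul1r lerDl.
have rB2 : `|r| * (B * IN') <= e / 4.
  have : `|r| <= e / 4 / (B * IN' + 1).
    by near: r; exact: near_le.
  move=> h; apply: (@le_trans _ _ (e / 4 / (B * IN' + 1) * (B * IN'))).
    by rewrite ler_wpM2r// mulr_ge0.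
  have -> : e / 4 / (B * IN' + 1) * (B * IN') = e / 4 * (B * IN' / (B * IN' + 1)).
    by field; rewrite gt_eqF.
  by rewrite ger_pMr ?divr_gt0// ler_pdivrMr// mul1r lerDl.
have rn : `|r| <= n0.+1%:R^-1 by near: r; apply: near_le; rewrite invr_gt0.
have Mr : model (linear_tilt s r) by near: r.
have Br j : (\int[P]_o `| b (linear_tilt s r) j o.1 - b P j o.1 -
    r * a j o.1 |%:E <= (e1 * `|r|)%:E)%E.
  by move: j; near: r; exact: H2.
set Q := linear_tilt s r in Mr Br *.
have mbr j : measurable_fun setT (b Q j) by exact: mbQ.
pose rho (o : O) : R := \sum_j `|b Q j o.1 - b P j o.1 - r * a j o.1|.
have mterm j : measurable_fun setT (fun x => b Q j x - b P j x - r * a j x).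
  by apply: measurable_funB; [exact: measurable_funB|exact: measurable_funM].
have Iterm j : P.-integrable setT
    (EFin \o (fun o : O => `|b Q j o.1 - b P j o.1 - r * a j o.1|)).
  apply: integrable_ge0 => //; last by rewrite (le_lt_trans (Br j))// ltry.
  apply: measurableT_comp => //.
  exact: (measurable_fst_comp (g := fun x => b Q j x - b P j x - r * a j x)).
have Irho : P.-integrable setT (EFin \o rho) by exact: integrable_sumR.
have rho_le : \int[P]_o rho o <= e / 8 * `|r|.
  rewrite Rintegral_sum//; apply: (@le_trans _ _ (\sum_(j < J.+1) e1 * `|r|)).
    by apply: ler_sum => j _; rewrite -lee_fin EFin_Rintegral.
  rewrite sumr_const card_ord -mulr_natr /e1.
  have : J.+1%:R != 0 :> R by rewrite pnatr_eq0.
  set k : R := J.+1%:R; set y := `|r| => k0.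
  by rewrite le_eqVlt; apply/orP; left; apply/eqP; field.
pose m x := max_branch (b P) x; pose mr x := max_branch (b Q) x.
pose al x := a (min_argmax_branch (b P) x) x.
have mm : measurable_fun setT m by exact: measurable_max_branch.
have mmr : measurable_fun setT mr by exact: measurable_max_branch.
have Im : P.-integrable setT (EFin \o (fun o : O => m o.1)).
  have := integrableDR (Lfun2_integrable Lq) (Lfun2_integrable (Lfun_cst P (Psi b P) 2)).
  by apply: eq_integrable => // o _ /=; rewrite /qfun subrK.
have mrm o : `|mr o.1 - m o.1| <= `|r| * N o.1 + rho o.
  apply: max_branch_lip => j.
  have -> : b Q j o.1 - b P j o.1 = r * a j o.1 + (b Q j o.1 - b P j o.1 - r * a j o.1) by ring.
  apply: (le_trans (ler_normD _ _)); apply: lerD.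
    by rewrite normrM ler_wpM2l// /N (bigD1 j)//= lerDl sumr_ge0.
  by rewrite /rho (bigD1 j)//= lerDl sumr_ge0.
have Imrm : P.-integrable setT (EFin \o (fun o : O => mr o.1 - m o.1)).
  apply: (le_integrableR (g := fun o => `|r| * N o.1 + rho o)) => //.
  - by apply: measurable_funB; apply: measurable_fst_comp.
  - exact: integrableDR (integrableZR _ IN) Irho.
have Imr : P.-integrable setT (EFin \o (fun o : O => mr o.1)).
  have := integrableDR Imrm Im.
  by apply: eq_integrable => // o _ /=; rewrite subrK.
have Isg (g : O -> R) : P.-integrable setT (EFin \o g) ->
    P.-integrable setT (EFin \o (fun o => s o * g o)).
  exact: integrable_mulb ms sB.
have Ial : P.-integrable setT (EFin \o (fun o : O => al o.1)).
  have -> : al = fun x => \sum_j first_weight P b j x * a j x.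
    apply/funext => x; rewrite (bigD1 (min_argmax_branch (b P) x))//=.
    rewrite /first_weight eqxx mul1r big1 ?addr0// => j.
    by rewrite eq_sym => /negPf ->; rewrite mul0r.
  apply: integrable_sumR => j.
  apply: (integrable_weight (w := first_weight P b j) (f := fun o => a j o.1) (C := 1)) => //.
    by apply: measurable_natb; exact: measurable_min_argmax.
  by move=> x; rewrite /first_weight; case: (_ == _); rewrite ?normr1 ?normr0.
have PsiQ : Psi b Q = \int[P]_o (mr o.1 * (1 + r * s o)).
  apply: Rintegral_density.
  - exact: (linear_tiltE ms ms0 sB rB).
  - exact: measurable_linear_density.
  - exact: linear_density_ge0 rB.
  - exact: measurable_fst_comp.
  - have := integrableDR Imr (integrableZR r (Isg _ Imr)).
    apply: eq_integrable => // o _.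
    change ((mr o.1 + r * (s o * mr o.1))%:E = (mr o.1 * (1 + r * s o))%:E).
    by congr EFin; ring.
have -> : Psi b Q - Psi b P - r * \int[P]_o (D o * s o) =
    \int[P]_o ((mr o.1 - m o.1 - r * al o.1) + r * (s o * (mr o.1 - m o.1))).
  rewrite (Rintegral_max_score Ss) PsiQ.
  have Ism := Isg _ Im; have Ismr := Isg _ Imr; have Isd := Isg _ Imrm.
  have Iral := integrableZR r Ial.
  rewrite RintegralD//; [|exact: integrableBR|exact: integrableZR].
  rewrite RintegralB// RintegralB// !RintegralZl//.
  have -> : \int[P]_o (mr o.1 * (1 + r * s o)) =
      \int[P]_o (mr o.1 + r * (s o * mr o.1)) by apply: eq_Rintegral => o _; ring.
  rewrite RintegralD//; last exact: integrableZR.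
  rewrite RintegralZl//.
  under [X in _ = _ + r * X]eq_Rintegral do rewrite mulrBr.
  rewrite (RintegralB _ Ismr Ism)//.
  under [X in _ - r * (X + _) = _]eq_Rintegral do rewrite mulrC.
  rewrite /Psi -/(m) -/al; ring.
have Ibound : P.-integrable setT (EFin \o (fun o : O =>
    rho o + 2 * `|r| * (N o.1 * nt `|r| o.1) + `|r| * B * (`|r| * N o.1 + rho o))).
  apply: integrableDR.
    by apply: integrableDR => //; apply: integrableZR; exact: IntN.
  by apply: integrableZR; apply: integrableDR => //; exact: integrableZR.
have meas : measurable_fun setT (fun o => mr o.1 - m o.1 - r * al o.1 +
    r * (s o * (mr o.1 - m o.1))).
  have := integrable_measurable (integrableDR (integrableBR Imrm (integrableZR r Ial))
    (integrableZR r (Isg _ Imrm))).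
  by [].
have bound : {ae P, forall o, `|mr o.1 - m o.1 - r * al o.1 + r * (s o * (mr o.1 - m o.1))| <=
    rho o + 2 * `|r| * (N o.1 * nt `|r| o.1) + `|r| * B * (`|r| * N o.1 + rho o)}.
  apply: filterS (tangent_H_condexp Lz Hs) => o aE.
  have [j0A _] := min_argmaxP (b P) o.1.
  apply: (le_trans (ler_normD _ _)); apply: lerD; last first.
    rewrite 2!normrM -mulrA ler_wpM2l//; apply: ler_pM => //.
  have -> : mr o.1 - m o.1 - r * al o.1 =
    (mr o.1 - max_branch (fun j x => b P j x + r * a j x) o.1) +
    (max_branch (fun j x => b P j x + r * a j x) o.1 - m o.1 - r * al o.1) by ring.
  apply: (le_trans (ler_normD _ _)); apply: lerD; last first.
    exact: max_branch_linearize.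
  apply: max_branch_lip => j; rewrite opprD addrA.
  by rewrite /rho (bigD1 j)//= lerDl sumr_ge0.
have Imeas := ae_le_integrable meas bound Ibound.
apply: (le_trans (le_normr_Rintegral measurableT Imeas)).
apply: (le_trans (ae_le_Rintegral (integrable_norm Imeas) Ibound bound)).
rewrite RintegralD//; last 2 first.
- by apply: integrableDR => //; apply: integrableZR; exact: IntN.
- by apply: integrableZR; apply: integrableDR => //; exact: integrableZR.
rewrite RintegralD//; last by apply: integrableZR; exact: IntN.
rewrite !RintegralZl//; last by apply: integrableDR => //; exact: integrableZR.
rewrite RintegralD//; last exact: integrableZR.
rewrite RintegralZl// -/IN' -/(G `|r|).
have h1 : G `|r| <= e / 16 by exact: le_trans (Gmono _ _ rn) Gn0.
have r0 := normr_ge0 r.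
have rho0 : 0 <= \int[P]_o rho o.
  by apply: Rintegral_ge0 => o _; exact: sumr_ge0.
have h2 : 2 * `|r| * G `|r| <= 2 * `|r| * (e / 16) by rewrite ler_wpM2l// mulr_ge0.
have h3 : `|r| * B * (`|r| * IN') <= `|r| * (e / 4).
  have -> : `|r| * B * (`|r| * IN') = `|r| * (`|r| * (B * IN')) by ring.
  by rewrite ler_wpM2l.
have h4 : `|r| * B * \int[P]_o rho o <= \int[P]_o rho o by rewrite ler_piMl.
rewrite mulrDr.
have h5 : 0 <= e * `|r| by rewrite mulr_ge0// ltW.
move: h2 h3 h4 rho_le h5; set X := \int[P]_o rho o; set y := `|r|.
set u := 2 * y * G y; set v := y * B * (y * IN'); set w := y * B * X.
have -> : 2 * y * (e / 16) = e * y / 8 by field.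
have -> : y * (e / 4) = e * y / 4 by field.
have -> : e / 8 * y = e * y / 8 by field.
move: (e * y) => z a1 a2 a3 a4 a5; clear - h1 a1 a2 a3 a4 a5; lra.
Unshelve. all: by end_near. Qed.

(** The law chosen by [tilt] for the density 1 is tied to [P] only through its values on measurable
    sets, while [b] takes laws as arguments; the expansion read at r = 0 supplies the equality. *)
Lemma Psi_linear_tilt0 s : S s -> Psi b (linear_tilt s 0) = Psi b P.
Proof.
move=> Ss; have := Psi_expansion Ss ltr01 => /nbhs_singleton.
by rewrite mul0r subr0 normr0 mulr0 normr_le0 subr_eq0 => /eqP.
Qed.

Lemma pathwise_gradient_weighted_score : pathwise_gradient b P S D.
Proof.
move=> s Ss; set L := \int[P]_o _.
suff h : h^-1 *: ((fun t => Psi b (linear_tilt s t)) (h *: (1 : R) + 0) -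
    Psi b (linear_tilt s 0)) @[h --> (0 : R)^'] --> L.
  by apply: DeriveDef; [exact: cvgP h|exact: cvg_lim h].
apply/cvgrPdist_le => e e0.
have := Psi_expansion Ss e0 => H.
have H' : \forall r \near (0 : R)^', `|Psi b (linear_tilt s r) - Psi b P - r * L| <= e * `|r|.
  exact: cvg_within H.
have nz : \forall r \near (0 : R)^', r != 0 by exact: nbhs_dnbhs_neq.
apply: filterS2 H' nz => r Hr r0.
rewrite addr0 /= Psi_linear_tilt0// scaler1.
rewrite -normrN opprB.
have -> : r^-1 *: (Psi b (linear_tilt s r) - Psi b P) - L =
    r^-1 * (Psi b (linear_tilt s r) - Psi b P - r * L).
  by rewrite /GRing.scale/= [in RHS]mulrBr mulKf.
rewrite normrM normfV mulrC ler_pdivrMr ?normr_gt0//.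
Qed.

End pathwise_derivative.

(** * Gaussian averages *)

Section expR_taylor.
Context {R : realType}.
Implicit Types x : R.

(** In the exponential series the term of rank k + 3 is at most |x|^3 times the term of rank k at
    |x|, since (k + 3)! >= k!. *)
Lemma norm_expR_taylor2 x : `|expR x - 1 - x - x ^+ 2 / 2| <= `|x| ^+ 3 * expR `|x|.
Proof.
pose p n := series (exp_coeff x) n.+3 - 1 - x - x ^+ 2 / 2.
have cp : p n @[n --> \oo] --> expR x - 1 - x - x ^+ 2 / 2.
  apply: cvgB; last exact: cvg_cst.
  apply: cvgB; last exact: cvg_cst.
  apply: cvgB; last exact: cvg_cst.
  have c0 : series (exp_coeff x) n @[n --> \oo] --> expR x by exact: is_cvg_series_exp_coeff.
  have := c0; rewrite -(cvg_shiftn 3).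
  by under eq_fun do rewrite addn3.
have le_tail n : `|p n| <= `|x| ^+ 3 * series (exp_coeff `|x|) n.
  have -> : p n = \sum_(0 <= k < n) x ^+ (k + 3) / (k + 3)`!%:R.
    rewrite /p /series/= big_nat_recl//= big_nat_recl//= big_nat_recl//=.
    rewrite /exp_coeff/= !fact0 expr0 expr1 divr1 factS fact0 divr1.
    rewrite (_ : 2`! = 2%N)//.
    under eq_bigr do rewrite -addn3.
    by ring.
  apply: (le_trans (ler_norm_sum _ _ _)); rewrite /series/= mulr_sumr.
  apply: ler_sum => k _; rewrite /exp_coeff/= normrM normrX exprD normfV.
  rewrite mulrAC [leRHS]mulrA mulrC -mulrA ler_wpM2l ?exprn_ge0//.
  rewrite ler_wpM2l ?exprn_ge0//.
  rewrite ger0_norm ?ler0n// lef_pV2 ?posrE ?ltr0n ?fact_gt0//.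
  by rewrite ler_nat leq_fact ?leq_addr.
have le_exp n : series (exp_coeff `|x|) n <= expR `|x|.
  apply: (nondecreasing_cvgn_le _ (@is_cvg_series_exp_coeff R `|x|)).
  by apply/nondecreasing_seqP => k; rewrite /series/= big_nat_recr//= lerDl exp_coeff_ge0.
have le_p n : `|p n| <= `|x| ^+ 3 * expR `|x|.
  by apply: (le_trans (le_tail n)); rewrite ler_wpM2l// exprn_ge0.
by apply: ler_cvg_to (cvg_norm cp) (cvg_cst _) _; exact: nearW.
Qed.

End expR_taylor.

Section gaussian.
Context {R : realType}.
Local Notation Rm := (measurableTypeR R).
Implicit Types (v m : R) (f : R -> \bar R).
Local Notation leb := (@lebesgue_measure R).

(** Parametrized by the variance, so that the identities between products of Gaussian densities are
    rational in the parameters. *)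
Definition gauss_pdf m v (x : R) : R :=
  (Num.sqrt (v * pi *+ 2))^-1 * expR (- (x - m) ^+ 2 / (v *+ 2)).

Lemma normal_pdf_sqrt m v x : 0 < v -> normal_pdf m (Num.sqrt v) x = gauss_pdf m v x.
Proof.
move=> v0; rewrite normal_pdfE ?gt_eqF ?sqrtr_gt0//.
by rewrite /normal_peak /normal_fun sqr_sqrtr// ltW.
Qed.

Lemma gauss_pdf_ge0 m v x : 0 <= gauss_pdf m v x.
Proof. by rewrite mulr_ge0 ?expR_ge0// invr_ge0 sqrtr_ge0. Qed.

Lemma measurable_gauss_pdf m v : measurable_fun setT (gauss_pdf m v).
Proof.
apply: measurable_funM => //; apply: measurableT_comp => //.
apply: measurable_funM => //; apply: measurableT_comp => //.
by apply: measurable_funX; exact: measurable_funB.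
Qed.

Lemma integral_gauss_pdf m v : 0 < v -> (\int[leb]_x (gauss_pdf m v x)%:E = 1)%E.
Proof.
move=> v0; rewrite -(integral_normal_pdf m (Num.sqrt v)).
by apply: eq_integral => x _; rewrite normal_pdf_sqrt.
Qed.

Lemma ge0_integral_shift (a : R) f : measurable_fun setT f -> (forall x, 0 <= f x)%E ->
  (\int[leb]_x f ((x + a)%R) = \int[leb]_x f x)%E.
Proof.
move=> mf f0; have ms : measurable_fun setT ((fun x => x + a) : Rm -> Rm).
  exact: measurable_funD.
rewrite -(@ge0_integral_image _ _ Rm Rm R leb leb (fun x => x + a)) => // A mA.
have [nu nuE] := image_measure (leb : {measure set Rm -> \bar R}) ms.
rewrite -[RHS]nuE; apply: lebesgue_measure_unique mA => _ [[s t] _ <-].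
rewrite nuE.
have -> : (fun x => x + a) @^-1` [set` `]s, t]] = `]s - a, t - a]%classic.
  by apply/seteqP; split => x /=; rewrite !in_itv/= ltrBlDr lerBrDr.
rewrite /= !lebesgue_measure_itv/= !lte_fin ltrD2r.
by case: ifP => // _; congr EFin; ring.
Qed.

Lemma ge0_integral_gaussian v f : 0 < v -> measurable_fun setT f ->
  (forall x, 0 <= f x)%E ->
  (\int[centered_gaussian v]_x f x = \int[leb]_x (f x * (gauss_pdf 0 v x)%:E))%E.
Proof.
move=> v0 mf f0; rewrite /centered_gaussian gt_eqF//.
apply: (@ge0_integral_density _ Rm R leb (normal_prob 0 (Num.sqrt v))) => //.
- move=> A mA; rewrite /normal_prob; apply: eq_integral => x _.
  by rewrite normal_pdf_sqrt.
- exact: measurable_gauss_pdf.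
- by move=> x; exact: gauss_pdf_ge0.
Qed.

Lemma integral_gaussian0 f : measurable_fun setT f ->
  (\int[centered_gaussian 0]_x f x = f 0%R)%E.
Proof.
move=> mf; rewrite /centered_gaussian eqxx.
by rewrite integral_dirac// diracT mul1e.
Qed.

Local Opaque centered_gaussian lebesgue_measure.

Lemma gauss_pdf_shift m v x : gauss_pdf m v (x + m) = gauss_pdf 0 v x.
Proof. by rewrite /gauss_pdf addrK subr0. Qed.

Lemma ge0_integral_gauss_shift m v f : 0 < v -> measurable_fun setT f ->
  (forall x, 0 <= f x)%E ->
  (\int[leb]_x (f x * (gauss_pdf m v x)%:E) =
   \int[centered_gaussian v]_x f (x + m)%R)%E.
Proof.
move=> v0 mf f0.
have mfm : measurable_fun setT (fun x : R => f (x + m)).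
  by apply: measurableT_comp => //; exact: measurable_funD.
rewrite (ge0_integral_gaussian v0 mfm (fun x => f0 _)) -[LHS](@ge0_integral_shift m).
- by apply: eq_integral => x _; rewrite gauss_pdf_shift.
- apply: emeasurable_funM => //; apply/measurable_EFinP; exact: measurable_gauss_pdf.
- by move=> x; rewrite mule_ge0 ?f0// lee_fin gauss_pdf_ge0.
Qed.

(** Completing the square turns exp (h x) times the centred density into exp (h^2 v / 2) times the
    density of mean h v. *)
Lemma integral_gaussian_expR v (h : R) : 0 <= v ->
  (\int[centered_gaussian v]_x (expR (h * x))%:E = (expR (h ^+ 2 * v / 2))%:E)%E.
Proof.
rewrite le_eqVlt => /predU1P[<-|v0].
  rewrite integral_gaussian0; first by rewrite !mulr0 mul0r.
  by apply/measurable_EFinP; apply: measurableT_comp => //; exact: measurable_funM.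
have mE : measurable_fun setT (fun x : R => (expR (h * x))%:E).
  by apply/measurable_EFinP; apply: measurableT_comp => //; exact: measurable_funM.
have E0 (x : R) : (0 <= (expR (h * x))%:E)%E by rewrite lee_fin expR_ge0.
rewrite (ge0_integral_gaussian v0 mE E0).
rewrite -[RHS]mule1 -(integral_gauss_pdf (h * v) v0) -ge0_integralZl; last 4 first.
- exact: measurableT.
- by apply/measurable_EFinP; exact: measurable_gauss_pdf.
- by move=> x _; rewrite lee_fin gauss_pdf_ge0.
- exact: expR_ge0.
- apply: eq_integral => x _; rewrite -!EFinM; congr EFin.
  rewrite /gauss_pdf subr0 mulrCA [RHS]mulrCA -!expRD; congr (_ * expR _).
  by field; rewrite gt_eqF.
Qed.

Lemma gauss_pdf_prec m (k x : R) : 0 < k ->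
  gauss_pdf m k^-1 x = Num.sqrt (k / (pi *+ 2)) * expR (- (x - m) ^+ 2 * k / 2).
Proof.
move=> k0; have := pi_gt0 R; rewrite /gauss_pdf; move: pi => p p0.
have e1 : 0 <= k^-1 * p *+ 2 by rewrite mulrn_wge0// mulr_ge0 ?ltW ?invr_gt0.
rewrite -sqrtrV//; congr (Num.sqrt _ * expR _); field; rewrite ?gt_eqF//.
Qed.

(* Completing the square: under the prior N(0, 1/e), the "likelihood"
   exp (d h - h^2 s / 2) has posterior N(d / k, 1 / k), k = s + e. *)
Lemma gaussian_posterior (e s d x : R) f : 0 < e -> 0 <= s ->
  measurable_fun setT f -> (forall x, 0 <= f x)%E ->
  (\int[centered_gaussian e^-1]_h (f (x + h)%R * (expR (d * h - h ^+ 2 * s / 2))%:E) =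
   (Num.sqrt (e / (s + e)) * expR (d ^+ 2 / (2 * (s + e))))%:E *
   \int[centered_gaussian (s + e)^-1]_z f (x + d / (s + e) + z)%R)%E.
Proof.
move=> e0 s0 mf f0; set k := s + e; have k0 : 0 < k by rewrite ltr_wpDl.
have mfx y : measurable_fun setT (fun h : R => f (y + h)).
  by apply: measurableT_comp => //; exact: measurable_funD.
have mE : measurable_fun setT (fun h : R => (expR (d * h - h ^+ 2 * s / 2))%:E).
  apply/measurable_EFinP; apply: measurableT_comp => //.
  apply: measurable_funB; first exact: measurable_funM.
  by apply: measurable_funM => //; apply: measurable_funM => //; exact: measurable_funX.
have e'0 : 0 < e^-1 by rewrite invr_gt0.
rewrite [LHS](ge0_integral_gaussian e'0 (emeasurable_funM (mfx x) mE)); last first.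
  by move=> h; apply: mule_ge0; [exact: f0|rewrite lee_fin expR_ge0].
have -> : (\int[centered_gaussian k^-1]_z f (x + d / k + z)%R =
    \int[leb]_h (f (x + h)%R * (gauss_pdf (d / k) k^-1 h)%:E))%E.
  have k'0 : 0 < k^-1 by rewrite invr_gt0.
  rewrite [RHS](ge0_integral_gauss_shift _ k'0 (mfx x) (fun=> f0 _)).
  by apply: eq_integral => z _; congr f; ring.
have C0 : 0 <= Num.sqrt (e / k) * expR (d ^+ 2 / (2 * k)).
  by rewrite mulr_ge0 ?expR_ge0 ?sqrtr_ge0.
rewrite -ge0_integralZl.
- apply: eq_integral => h _; rewrite -muleA [RHS]muleCA; congr (_ * _)%E.
  rewrite -!EFinM; congr EFin.
  rewrite !gauss_pdf_prec// subr0.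
  rewrite mulrCA -expRD [RHS]mulrACA -expRD -sqrtrM; last by rewrite divr_ge0 ?ltW.
  congr (Num.sqrt _ * expR _); last by rewrite /k; field; rewrite gt_eqF.
  by move: (pi_gt0 R) => /lt0r_neq0; move: pi => p p0; field; rewrite p0 !gt_eqF.
- exact: measurableT.
- apply: emeasurable_funM; first exact: mfx.
  by apply/measurable_EFinP; exact: measurable_gauss_pdf.
- by move=> h _; rewrite mule_ge0 ?f0// lee_fin gauss_pdf_ge0.
- by rewrite lee_fin.
Qed.

(** Two forms of the joint density of x and u = x + y for independent x and y: on the right, the
    marginal density of u times the conditional density of x given u. *)
Lemma gauss_pdf_conv (a c x u : R) : 0 < a -> 0 < c ->
  gauss_pdf 0 a x * gauss_pdf 0 c (u - x) =
  gauss_pdf 0 (a + c) u * gauss_pdf (u * a / (a + c)) (a * c / (a + c)) x.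
Proof.
move=> a0 c0; have ac0 : 0 < a + c by rewrite addr_gt0.
rewrite /gauss_pdf !subr0 mulrACA [RHS]mulrACA -!expRD -!invfM; congr (_^-1 * expR _).
  rewrite -!sqrtrM; last 2 first.
  - by rewrite mulrn_wge0// mulr_ge0 ?pi_ge0// ltW.
  - by rewrite mulrn_wge0// mulr_ge0 ?pi_ge0// ltW.
  by congr Num.sqrt; field; rewrite gt_eqF.
by field; rewrite !gt_eqF.
Qed.

Lemma gaussian_semigroup (a c : R) f : 0 <= a -> 0 <= c ->
  measurable_fun setT f -> (forall x, 0 <= f x)%E ->
  (\int[centered_gaussian a]_x \int[centered_gaussian c]_y f (x + y)%R =
   \int[centered_gaussian (a + c)]_u f u)%E.
Proof.
move=> a0 c0 mf f0.
have mfx y : measurable_fun setT (fun h : R => f (y + h)).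
  by apply: measurableT_comp => //; exact: measurable_funD.
move: c0; rewrite le_eqVlt => /predU1P[<-|c0].
  rewrite addr0; apply: eq_integral => x _.
  by rewrite (integral_gaussian0 (mfx x)) addr0.
have mint : measurable_fun setT (fun x : R => \int[centered_gaussian c]_y f (x + y)%R)%E.
  have := @measurable_fun_fubini_tonelli_F _ _ Rm Rm R (centered_gaussian c)
    (fun z : Rm * Rm => f (z.1 + z.2)).
  apply => //; apply: measurableT_comp => //; exact: measurable_funD.
move: a0; rewrite le_eqVlt => /predU1P[<-|a0].
  rewrite [LHS](integral_gaussian0 mint) add0r.
  by apply: eq_integral => y _; rewrite add0r.
have ac0 : 0 < a + c by rewrite addr_gt0.
have mG m v : measurable_fun setT (fun x => (gauss_pdf m v x)%:E).
  by apply/measurable_EFinP; exact: measurable_gauss_pdf.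
have inner x : (\int[centered_gaussian c]_y f (x + y)%R =
    \int[leb]_u (f u * (gauss_pdf 0 c (u - x)%R)%:E))%E.
  rewrite -[RHS](@ge0_integral_shift x).
  - rewrite (ge0_integral_gaussian c0 (mfx x) (fun=> f0 _)); apply: eq_integral => u _.
    by rewrite addrK (addrC u).
  - apply: emeasurable_funM => //; apply/measurable_EFinP.
    by apply: (measurableT_comp (measurable_gauss_pdf 0 c)); exact: measurable_funB.
  - by move=> u; rewrite mule_ge0 ?f0// lee_fin gauss_pdf_ge0.
have int0 (x : R) : (0 <= \int[centered_gaussian c]_y f (x + y)%R)%E.
  by apply: integral_ge0 => y _; exact: f0.
rewrite [LHS](ge0_integral_gaussian a0 mint int0) [RHS](ge0_integral_gaussian ac0 mf f0).
pose F (z : Rm * Rm) := (f z.2 * (gauss_pdf 0 c (z.2 - z.1)%R)%:E * (gauss_pdf 0 a z.1)%:E)%E.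
have mF : measurable_fun setT F.
  apply: emeasurable_funM.
    apply: emeasurable_funM; first by apply: measurableT_comp => //.
    apply/measurable_EFinP; apply: (measurableT_comp (measurable_gauss_pdf 0 c)).
    exact: measurable_funB.
  apply/measurable_EFinP; exact: (measurableT_comp (measurable_gauss_pdf 0 a)).
have F0 z : (0 <= F z)%E.
  by rewrite !mule_ge0// lee_fin gauss_pdf_ge0.
transitivity (\int[leb]_x \int[leb]_u F (x, u))%E.
  apply: eq_integral => x _; rewrite inner muleC -ge0_integralZl.
  - by apply: eq_integral => u _; rewrite muleC.
  - exact: measurableT.
  - apply: emeasurable_funM => //; apply/measurable_EFinP.
    by apply: (measurableT_comp (measurable_gauss_pdf 0 c)); exact: measurable_funB.
  - by move=> u _; rewrite mule_ge0 ?f0// lee_fin gauss_pdf_ge0.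
  - by rewrite lee_fin gauss_pdf_ge0.
rewrite (@fubini_tonelli _ _ Rm Rm R leb leb F mF F0).
apply: eq_integral => u _.
under eq_integral do rewrite /F/= -muleA -EFinM mulrC gauss_pdf_conv// EFinM muleA.
rewrite ge0_integralZl.
- rewrite integral_gauss_pdf ?mule1//.
  by rewrite divr_gt0// mulr_gt0.
- exact: measurableT.
- by apply/measurable_EFinP; exact: measurable_gauss_pdf.
- by move=> x _; rewrite lee_fin gauss_pdf_ge0.
- by rewrite mule_ge0// lee_fin gauss_pdf_ge0.
Qed.

End gaussian.

Section parameter_integrals.
Context {d1 d2} {T1 : measurableType d1} {T2 : measurableType d2} {R : realType}.

(** Adding the bound C makes a bounded function nonnegative, so that statements for nonnegative
    extended integrals, Tonelli's theorem first, transfer to bounded real functions. *)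
Lemma Rintegral_addC {d} {T : measurableType d} (N : {finite_measure set T -> \bar R}) (f : T -> R) (C : R) :
  measurable_fun setT f -> (forall x, `|f x| <= C) ->
  (\int[N]_x (f x + C)%:E = (\int[N]_x f x + C * fine (N setT))%:E)%E.
Proof.
move=> mf fC; have If := bounded_integrable N mf fC.
have IC : N.-integrable setT (EFin \o cst C).
  by apply: (@bounded_integrable _ _ _ _ _ `|C|) => //; exact: measurable_cst.
rewrite -EFin_Rintegral; last exact: integrableDR IC.
by rewrite RintegralD// Rintegral_cst.
Qed.

Lemma addC_ge0 {T : Type} (f : T -> R) (C : R) x : (forall x, `|f x| <= C) -> 0 <= f x + C.
Proof. by move=> /(_ x); rewrite ler_norml => /andP[+ _]; rewrite -subr_ge0 opprK. Qed.

Lemma measurable_Rintegral_snd (N : {finite_measure set T2 -> \bar R})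
    (F : T1 * T2 -> R) (C : R) :
  measurable_fun setT F -> (forall z, `|F z| <= C) ->
  measurable_fun setT (fun x => \int[N]_y F (x, y)).
Proof.
move=> mF FC.
have mFx x : measurable_fun setT (fun y => F (x, y)).
  by apply: measurableT_comp mF _; exact: measurable_pair1.
have -> : (fun x => \int[N]_y F (x, y)) =
    fun x => fine (\int[N]_y (F (x, y) + C)%:E)%E - C * fine (N setT).
  apply/funext => x.
  rewrite (Rintegral_addC N (mFx x) (fun y => FC (x, y)))/=; ring.
apply: measurable_funB; last exact: measurable_cst.
apply: measurableT_comp; first exact: fine_measurable.
apply: (@measurable_fun_fubini_tonelli_F _ _ T1 T2 R N (fun z => (F z + C)%:E)).
- by apply/measurable_EFinP; apply: measurable_funD => //; exact: measurable_cst.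
- by move=> z; rewrite lee_fin; exact: addC_ge0 FC.
Qed.

End parameter_integrals.

Lemma normr_Rintegral_le {d} {T : measurableType d} {R : realType}
    (P : probability T R) (f : T -> R) (C : R) :
  measurable_fun setT f -> (forall x, `|f x| <= C) -> `|\int[P]_x f x| <= C.
Proof.
move=> mf fC; rewrite -[leRHS](Rintegral_cst1 P).
by apply: le_abs_Rintegral => //; exact: Lfun2_integrable (Lfun_cst P C 2).
Qed.

(** * Taylor classes of test functions *)

Section taylor_class.
Context {R : realType}.
Local Notation Rm := (measurableTypeR R).
Implicit Types (phi psi : R -> R) (C x y : R).

Definition average (N : probability Rm R) phi x : R := \int[N]_z phi (x + z).

Lemma measurable_shift phi x : measurable_fun setT phi ->
  measurable_fun setT (fun z : R => phi (x + z)).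
Proof. by move=> mp; apply: measurableT_comp mp _; exact: measurable_funD. Qed.

Lemma measurable_average N phi C : measurable_fun setT phi ->
  (forall x, `|phi x| <= C) -> measurable_fun setT (average N phi).
Proof.
move=> mp pC.
apply: (@measurable_Rintegral_snd _ _ Rm Rm R N (fun z => phi (z.1 + z.2)) C) => //.
by apply: measurableT_comp mp _; exact: measurable_funD.
Qed.

Lemma integrable_shift (N : probability Rm R) phi C x : measurable_fun setT phi ->
  (forall x, `|phi x| <= C) -> N.-integrable setT (EFin \o (fun z : R => phi (x + z))).
Proof.
move=> mp pC; apply: (@bounded_integrable _ _ _ _ _ C) => //.
exact: measurable_shift.
Qed.

(* C^2 functions with bounded derivatives of order 0, 1, 2 and Lipschitz second
   derivative, described by their Taylor remainders *)
Definition taylor2 C phi phi1 phi2 : Prop :=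
  [/\ measurable_fun setT phi, measurable_fun setT phi1, measurable_fun setT phi2,
      forall x, [/\ `|phi x| <= C, `|phi1 x| <= C & `|phi2 x| <= C] &
      forall x y, `|phi (x + y) - phi x - phi1 x * y - phi2 x * y ^+ 2 / 2| <=
        C * Num.min (y ^+ 2) (`|y| ^+ 3)].

(** The constant C is unchanged, so every iterated average stays in the same class; this is what
    lets the errors of Lindeberg's replacement add up linearly. *)
Lemma taylor2_average N C phi phi1 phi2 : taylor2 C phi phi1 phi2 ->
  taylor2 C (average N phi) (average N phi1) (average N phi2).
Proof.
move=> [m0 m1 m2 b T].
have b0 x : `|phi x| <= C by case: (b x).
have b1 x : `|phi1 x| <= C by case: (b x).
have b2 x : `|phi2 x| <= C by case: (b x).
split; [exact: measurable_average b0|exact: measurable_average b1|exact: measurable_average b2| |].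
  by move=> x; split; apply: normr_Rintegral_le => //; exact: measurable_shift.
move=> x y; rewrite /average.
have I0 u := integrable_shift N u m0 b0.
have I1 u := integrable_shift N u m1 b1.
have I2 u := integrable_shift N u m2 b2.
have -> : \int[N]_z phi (x + y + z) - \int[N]_z phi (x + z) -
    \int[N]_z phi1 (x + z) * y - \int[N]_z phi2 (x + z) * y ^+ 2 / 2 =
  \int[N]_z (phi (x + z + y) - phi (x + z) - y * phi1 (x + z) -
     (y ^+ 2 / 2) * phi2 (x + z)).
  have E : \int[N]_z phi (x + y + z) = \int[N]_z phi (x + z + y).
    by apply: eq_Rintegral => z _; rewrite addrAC.
  have I0' : N.-integrable setT (EFin \o (fun z : R => phi (x + z + y))).
    by apply: eq_integrable (I0 (x + y)) => // z _ /=; rewrite addrAC.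
  rewrite RintegralB//; last 2 first.
  - by apply: integrableBR (integrableZR y (I1 x)); exact: integrableBR.
  - exact: integrableZR.
  rewrite RintegralB//; [|exact: integrableBR|exact: integrableZR].
  rewrite RintegralB// !RintegralZl// E; ring.
apply: normr_Rintegral_le => [|z].
  have ms u := measurable_shift u.
  have m0' : measurable_fun setT (fun z : R => phi (x + z + y)).
    by under eq_fun do rewrite addrAC; exact: ms.
  apply: measurable_funB; last by apply: measurable_funM => //; exact: ms.
  apply: measurable_funB; last by apply: measurable_funM => //; exact: ms.
  by apply: measurable_funB => //; exact: ms.
by rewrite [y * _]mulrC [y ^+ 2 / 2 * _]mulrC mulrA.
Qed.

Lemma taylor2_translate C phi phi1 phi2 a : taylor2 C phi phi1 phi2 ->
  taylor2 C (fun x => phi (x + a)) (fun x => phi1 (x + a)) (fun x => phi2 (x + a)).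
Proof.
move=> [m0 m1 m2 b T]; split => //.
- by under eq_fun do rewrite addrC; exact: measurable_shift.
- by under eq_fun do rewrite addrC; exact: measurable_shift.
- by under eq_fun do rewrite addrC; exact: measurable_shift.
- by move=> x y; rewrite (addrAC x y); exact: T.
Qed.

(* Subdividing [0, y] into n pieces makes the quadratic error vanish. *)
Lemma first_order_increment phi phi1 C l u : 0 <= C ->
  (forall x y, `|phi (x + y) - phi x - phi1 x * y| <= C * y ^+ 2) ->
  (forall x, l <= phi1 x <= u) ->
  forall x y, 0 <= y -> l * y <= phi (x + y) - phi x <= u * y.
Proof.
move=> C0 T b x y y0.
have step n : l * y - C * y ^+ 2 / n.+1%:R <= phi (x + y) - phi x <=
    u * y + C * y ^+ 2 / n.+1%:R.
  pose h := y / n.+1%:R; have h0 : 0 <= h by rewrite divr_ge0.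
  have one z : l * h - C * h ^+ 2 <= phi (z + h) - phi z <= u * h + C * h ^+ 2.
    have := T z h; have /andP[b1 b2] := b z; rewrite ler_norml => /andP[t1 t2].
    have := ler_wpM2r h0 b1; have := ler_wpM2r h0 b2.
    by move=> ? ?; apply/andP; split; lra.
  have many k : k%:R * (l * h - C * h ^+ 2) <= phi (x + k%:R * h) - phi x <=
      k%:R * (u * h + C * h ^+ 2).
    elim: k => [|k IH]; first by rewrite !mul0r addr0 subrr lexx.
    have /andP[j1 j2] := one (x + k%:R * h); move/andP: IH => [i1 i2].
    rewrite -natr1 [(k%:R + 1) * h]mulrDl mul1r addrA.
    by rewrite !(mulrDl k%:R 1 (_ + _)) !mul1r; apply/andP; split; lra.
  have nh : n.+1%:R * h = y by rewrite /h mulrC divfK// pnatr_eq0.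
  have := many n.+1; rewrite nh.
  have E (a : R) : n.+1%:R * (a * h) = a * y by rewrite mulrCA nh.
  have E2 : n.+1%:R * (C * h ^+ 2) = C * y ^+ 2 / n.+1%:R.
    have : n.+1%:R != 0 :> R by rewrite pnatr_eq0.
    by rewrite /h; move: n.+1%:R => m m0; field.
  by rewrite !(mulrDr n.+1%:R) mulrN !E E2.
have cv : C * y ^+ 2 / n.+1%:R @[n --> \oo] --> (0 : R).
  by rewrite -(mulr0 (C * y ^+ 2)); apply: cvgMr; exact: cvg_harmonic.
apply/andP; split.
- have : l * y - C * y ^+ 2 / n.+1%:R @[n --> \oo] --> l * y - 0.
    by apply: cvgB cv; exact: cvg_cst.
  rewrite subr0 => h; apply: ler_cvg_to h (cvg_cst _) _.
  by apply: nearW => n; have /andP[] := step n.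
- have : u * y + C * y ^+ 2 / n.+1%:R @[n --> \oo] --> u * y + 0.
    by apply: cvgD cv; exact: cvg_cst.
  rewrite addr0 => h; apply: ler_cvg_to (cvg_cst _) h _.
  by apply: nearW => n; have /andP[] := step n.
Qed.

Lemma taylor2_first_order C phi phi1 phi2 : taylor2 C phi phi1 phi2 ->
  forall x y, `|phi (x + y) - phi x - phi1 x * y| <= 2 * C * y ^+ 2.
Proof.
move=> [_ _ _ b T] x y; have [_ _ b2] := b x.
have C0 : 0 <= C by exact: le_trans (normr_ge0 _) b2.
have h1 : `|phi2 x * y ^+ 2 / 2| <= C * y ^+ 2.
  have y2 : 0 <= y ^+ 2 by exact: sqr_ge0.
  have e2 : phi2 x * y ^+ 2 / 2 = phi2 x * (y ^+ 2 / 2) by rewrite mulrA.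
  have h : 0 <= y ^+ 2 / 2 by rewrite divr_ge0.
  rewrite e2 normrM (ger0_norm h); apply: ler_pM => //; lra.
have h2 := T x y.
have h3 : C * Num.min (y ^+ 2) (`|y| ^+ 3) <= C * y ^+ 2.
  by rewrite ler_wpM2l// ge_min lexx.
have := ler_normD (phi (x + y) - phi x - phi1 x * y - phi2 x * y ^+ 2 / 2)
  (phi2 x * y ^+ 2 / 2).
rewrite subrK; lra.
Qed.

End taylor_class.

(** * Moments of centred Gaussian laws *)

Section gaussian_moments.
Context {R : realType}.
Local Notation Rm := (measurableTypeR R).
Implicit Types (v h x y : R).

Lemma eq0_small (a K : R) : 0 <= K -> (forall h, 0 < h <= 1 -> `|a| <= K * h) -> a = 0.
Proof.
move=> K0 H; apply/eqP; rewrite -normr_le0 leNgt; apply/negP => a0.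
set c := `|a| in H a0; have cK : 0 < c + K by rewrite ltr_pwDl.
have h01 : 0 < c / (c + K) <= 1.
  by rewrite divr_gt0//= ler_pdivrMr// mul1r lerDl.
have := H _ h01; rewrite mulrA ler_pdivlMr//; nra.
Qed.

Lemma cube_le_expR x : `|x| ^+ 3 <= 6 * expR `|x|.
Proof.
have := expR_ge1Dxn 2 (normr_ge0 x); rewrite (_ : 3`!%:R = 6 :> R)//.
rewrite -(ler_pM2l (_ : 0 < (6 : R)))// mulrDr mulrCA divff// !mulr1.
by apply: le_trans; rewrite lerDr.
Qed.

Lemma expR_norm_le x : expR `|x| <= expR x + expR (- x).
Proof.
by case: (ger0P x) => _; [rewrite lerDl expR_ge0|rewrite lerDr expR_ge0].
Qed.

Lemma measurable_norm_cube : measurable_fun setT (fun z : R => `|z| ^+ 3).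
Proof. by apply: measurable_funX; exact: normr_measurable. Qed.

Section fixed_variance.
Variable v : R.
Hypothesis v0 : 0 <= v.
Let N : probability Rm R := centered_gaussian v.

Lemma measurable_expRM h : measurable_fun setT (fun z : R => expR (h * z)).
Proof. by apply: measurableT_comp => //; exact: measurable_funM. Qed.

Lemma integrable_expR_gaussian h : N.-integrable setT (EFin \o (fun z : R => expR (h * z))).
Proof.
apply: integrable_ge0; [exact: measurable_expRM|by move=> x; exact: expR_ge0|].
by rewrite (integral_gaussian_expR h v0) ltry.
Qed.

Lemma Rintegral_gaussian_expR h : \int[N]_z expR (h * z) = expR (h ^+ 2 * v / 2).
Proof. by rewrite /Rintegral (integral_gaussian_expR h v0). Qed.

Lemma integrable_expR_norm h : N.-integrable setT (EFin \o (fun z : R => expR (`|h| * `|z|))).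
Proof.
apply: (le_integrableR (g := fun z : Rm => expR (h * (z : R)) + expR (- h * (z : R)))).
- apply: measurableT_comp => //; apply: measurable_funM; first exact: measurable_cst.
  exact: normr_measurable.
- move=> z; rewrite ger0_norm ?expR_ge0// -normrM.
  by have := expR_norm_le (h * z); rewrite mulNr.
- by apply: integrableDR; exact: integrable_expR_gaussian.
Qed.

Lemma integrable_gaussian_cube : N.-integrable setT (EFin \o (fun z : R => `|z| ^+ 3)).
Proof.
apply: (le_integrableR (g := fun z : Rm => 6 * expR (`|1| * `|z : R|))).
- exact: measurable_norm_cube.
- by move=> z; rewrite normr1 mul1r ger0_norm ?exprn_ge0//; exact: cube_le_expR.
- by apply: integrableZR; exact: integrable_expR_norm.
Qed.

Lemma gaussian_Lfun2 : (fun z : R => z) \in Lfun N 2%:E.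
Proof.
apply: Lfun2I; first exact: measurable_id.
apply: (le_integrableR (g := fun z : Rm => 1 + `|z : R| ^+ 3)).
- exact: measurable_funX.
- move=> z; rewrite normrX; have := normr_ge0 z; set y := `|z|; move: y => y y0.
  have [y1|y1] := leP y 1.
    have h1 : y ^+ 2 <= 1 by rewrite expr_le1.
    by have h2 : 0 <= y ^+ 3 by [rewrite exprn_ge0]; lra.
  have : y ^+ 2 * 1 <= y ^+ 2 * y by rewrite ler_wpM2l ?sqr_ge0// ltW.
  by rewrite mulr1 -exprSr; lra.
- apply: integrableDR integrable_gaussian_cube.
  exact: Lfun2_integrable (Lfun_cst N (1 : R) 2).
Qed.

(** Both moments are read off the moment generating function, by comparing its expansion through the
    integrand with the expansion of exp (h^2 v / 2), each with an error of order |h|^3. *)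
Lemma gaussian_moments : \int[N]_z z = 0 /\ \int[N]_z z ^+ 2 = v.
Proof.
have I1 := Lfun2_integrable gaussian_Lfun2; have I2 := Lfun2_sqr gaussian_Lfun2.
have I0 := Lfun2_integrable (Lfun_cst N (1 : R) 2).
set m1 := \int[N]_z z; set m2 := \int[N]_z z ^+ 2.
(* For |h| <= 1 the Taylor remainder of exp (h z) is at most |h|^3 |z|^3 exp |z|, and |z|^3 <= 6 exp
   |z|. *)
pose G (z : R) : R := 6 * expR (`|2| * `|z|).
have IG : N.-integrable setT (EFin \o G) by apply: integrableZR; exact: integrable_expR_norm.
set K1 := \int[N]_z G z.
have K10 : 0 <= K1 by apply: Rintegral_ge0 => z _; rewrite mulr_ge0 ?expR_ge0.
have T h : `|h| <= 1 -> `|expR (h ^+ 2 * v / 2) - 1 - h * m1 - h ^+ 2 / 2 * m2| <= `|h| ^+ 3 * K1.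
  move=> h1; have Ie := integrable_expR_gaussian h.
  have -> : expR (h ^+ 2 * v / 2) - 1 - h * m1 - h ^+ 2 / 2 * m2 =
      \int[N]_z (expR (h * z) - 1 - h * z - h ^+ 2 / 2 * z ^+ 2).
    have J1 := integrableBR Ie I0; have J2 := integrableZR h I1.
    have J3 := integrableZR (h ^+ 2 / 2) I2.
    rewrite (RintegralB _ (integrableBR J1 J2) J3)//.
    rewrite (RintegralB _ J1 J2)// (RintegralB _ Ie I0)//.
    by rewrite !RintegralZl// Rintegral_gaussian_expR Rintegral_cst1.
  rewrite -RintegralZl//; apply: le_abs_Rintegral; last exact: integrableZR.
    apply: measurable_funB; last by apply: measurable_funM => //; exact: measurable_funX.
    apply: measurable_funB; last exact: measurable_funM.
    by apply: measurable_funB => //; exact: measurable_expRM.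
  move=> z; have := norm_expR_taylor2 (h * z).
  rewrite [(h * z) ^+ 2]exprMn [h ^+ 2 * _ / 2]mulrAC => t; apply: (le_trans t).
  rewrite normrM exprMn -mulrA ler_wpM2l ?exprn_ge0//.
  have e1 : expR (`|h| * `|z|) <= expR `|z| by rewrite ler_expR ler_piMl.
  have -> : G z = 6 * expR `|z| * expR `|z|.
    rewrite /G -mulrA -expRD; congr (_ * expR _).
    by rewrite ger0_norm//; ring.
  by apply: ler_pM => //; rewrite ?exprn_ge0 ?expR_ge0//; exact: cube_le_expR.
pose w := v / 2; have w0 : 0 <= w by rewrite divr_ge0.
pose K2 := w ^+ 2 + w ^+ 3 * expR w.
have K20 : 0 <= K2 by rewrite addr_ge0 ?mulr_ge0 ?exprn_ge0 ?expR_ge0.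
have E h : `|h| <= 1 -> `|expR (h ^+ 2 * v / 2) - 1 - h ^+ 2 * w| <= `|h| ^+ 3 * K2.
  move=> h1; rewrite -mulrA -/w; set u := h ^+ 2 * w.
  have h2 : 0 <= h ^+ 2 <= 1 by rewrite sqr_ge0 -real_normK ?num_real// expr_le1.
  have /andP[h20 h21] := h2.
  have u0 : 0 <= u by rewrite mulr_ge0.
  have uw : u <= w by rewrite ler_piMl.
  have := norm_expR_taylor2 u; rewrite (ger0_norm u0) => t.
  have t2 : `|expR u - 1 - u| <= u ^+ 2 / 2 + u ^+ 3 * expR u.
    have := ler_normD (expR u - 1 - u - u ^+ 2 / 2) (u ^+ 2 / 2); rewrite subrK.
    have u20 : 0 <= u ^+ 2 / 2 by rewrite divr_ge0 ?sqr_ge0.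
    by rewrite (ger0_norm u20); lra.
  apply: (le_trans t2); have a0 := normr_ge0 h.
  have a2 : h ^+ 2 = `|h| ^+ 2 by rewrite real_normK ?num_real.
  rewrite mulrDr; apply: lerD.
    apply: (@le_trans _ _ (u ^+ 2)); first by have := sqr_ge0 u; lra.
    rewrite /u exprMn ler_wpM2r ?sqr_ge0// a2 -exprM.
    by apply: ler_wiXn2l.
  have -> : u ^+ 3 * expR u = (h ^+ 2) ^+ 3 * (w ^+ 3 * expR u) by rewrite /u exprMn mulrA.
  apply: ler_pM.
  - exact: exprn_ge0.
  - by rewrite mulr_ge0 ?exprn_ge0 ?expR_ge0.
  - by rewrite a2 -exprM; apply: ler_wiXn2l.
  - by apply: ler_wpM2l; rewrite ?exprn_ge0// ler_expR.
have D h : `|h| <= 1 -> `|h * m1 + h ^+ 2 * (m2 / 2 - w)| <= `|h| ^+ 3 * (K1 + K2).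
  move=> h1; have := T h h1; have := E h h1; rewrite !ler_norml ![_ * (K1 + K2)]mulrDr.
  have -> : h ^+ 2 / 2 * m2 = h ^+ 2 * (m2 / 2) by field.
  by rewrite mulrBr => /andP[? ?] /andP[? ?]; apply/andP; split; lra.
have K0 : 0 <= K1 + K2 by rewrite addr_ge0.
(* Using the bound at h and at -h separates the odd coefficient, the mean, from the even one, the
   second moment. *)
have key h : 0 < h <= 1 -> `|m1| <= (K1 + K2) * h /\ `|m2 / 2 - w| <= (K1 + K2) * h.
  move=> /andP[h0 h1]; have hn : `|h| = h by rewrite gtr0_norm.
  have h1' : `|h| <= 1 by rewrite hn.
  have h2' : `|- h| <= 1 by rewrite normrN hn.
  have h2 : 0 < h ^+ 2 by rewrite exprn_gt0.
  have := D h h1'; have := D (- h) h2'; rewrite normrN hn sqrrN.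
  set d := m2 / 2 - w; set K := K1 + K2 in K0 *.
  rewrite !ler_norml => /andP[p1 p2] /andP[p3 p4].
  have e3 : h ^+ 3 * K = h * (h * (h * K)) by ring.
  have e2 : h ^+ 2 * d = h * (h * d) by ring.
  have q : h * (h * K) <= K * h.
    by rewrite (mulrC K) -[leRHS]mul1r; apply: ler_wpM2r => //; rewrite mulr_ge0// ltW.
  have b1 : h * m1 <= h * (h * (h * K)) by lra.
  have b2 : h * - (h * (h * K)) <= h * m1 by rewrite mulrN; lra.
  have b3 : h * (h * d) <= h * (h * (h * K)) by lra.
  have b4 : h * (h * - (h * K)) <= h * (h * d) by rewrite !mulrN; lra.
  move: b1 b2 b3 b4; rewrite !(ler_pM2l h0) => b1 b2 b3 b4.
  by clear - q b1 b2 b3 b4; split; apply/andP; split; lra.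
split; first by apply: (eq0_small K0) => h /key[].
have : m2 / 2 - w = 0 by apply: (eq0_small K0) => h /key[].
by rewrite /w; lra.
Qed.

(** At the scale t = sqrt v one has |z|^3 <= 6 t^3 (exp (z / t) + exp (- z / t)), and both
    exponentials have integral exp (1 / 2). The order v^(3/2) makes n such terms negligible for
    variance v / n. *)
Lemma gaussian_cube_le : \int[N]_z `|z| ^+ 3 <= 12 * expR 1 * (v * Num.sqrt v).
Proof.
have [v00|v_gt0] : v = 0 \/ 0 < v.
  by move: v0; rewrite le_eqVlt => /predU1P[<-|]; [left|right].
  rewrite v00 mul0r mulr0 /Rintegral /N v00 integral_gaussian0 ?normr0 ?expr0n//=.
  by apply/measurable_EFinP; exact: measurable_norm_cube.
set t := Num.sqrt v; have t0 : 0 < t by rewrite sqrtr_gt0.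
have tv : t ^+ 2 = v by rewrite sqr_sqrtr.
pose G (z : R) : R := 6 * t ^+ 3 * (expR (t^-1 * z) + expR (- t^-1 * z)).
have I1 := integrable_expR_gaussian t^-1; have I2 := integrable_expR_gaussian (- t^-1).
have IG : N.-integrable setT (EFin \o G) by apply: integrableZR; exact: integrableDR.
have -> : 12 * expR 1 * (v * t) = 6 * t ^+ 3 * (expR 1 + expR 1).
  by rewrite -tv; ring.
apply: (@le_trans _ _ (\int[N]_z G z)).
  apply: le_Rintegral => //; first exact: integrable_gaussian_cube.
  move=> z _; rewrite /G; have := cube_le_expR (t^-1 * z).
  have := expR_norm_le (t^-1 * z); rewrite -mulNr => a1 a2.
  have a3 : `|t^-1 * z| ^+ 3 <= 6 * (expR (t^-1 * z) + expR (- t^-1 * z)) by lra.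
  have -> : `|z| ^+ 3 = t ^+ 3 * `|t^-1 * z| ^+ 3.
    by rewrite normrM gtr0_norm ?invr_gt0// -exprMn mulrA divff ?mul1r// gt_eqF.
  have t3 : 0 <= t ^+ 3 by rewrite exprn_ge0// ltW.
  by apply: (le_trans (ler_wpM2l t3 a3)); rewrite mulrA (mulrC (t ^+ 3)).
rewrite RintegralZl//; last exact: integrableDR.
rewrite RintegralD// !Rintegral_gaussian_expR sqrrN exprVn tv mulVf ?gt_eqF//.
have e1 : expR (1 / 2) <= expR 1 :> R by rewrite ler_expR; lra.
by rewrite ler_wpM2l ?lerD// mulr_ge0// exprn_ge0// ltW.
Qed.

(** The mean of |z| is at most sqrt v, by Cauchy-Schwarz against the constant 1. *)
Lemma average_gaussian_lipschitz (phi : R -> R) (C K : R) x :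
  measurable_fun setT phi -> (forall x, `|phi x| <= C) -> 0 <= K ->
  (forall x y, `|phi x - phi y| <= K * `|x - y|) ->
  `|average N phi x - phi x| <= K * Num.sqrt v.
Proof.
move=> mp pC K0 lip.
have [m1 m2] := gaussian_moments.
have I1 := Lfun2_integrable gaussian_Lfun2.
have La : (fun z : R => `|z|) \in Lfun N 2%:E.
  apply: Lfun2I; first exact: measurableT_comp.
  apply: eq_integrable (Lfun2_sqr gaussian_Lfun2) => // z _ /=.
  by rewrite real_normK ?num_real.
have abs1 : \int[N]_z `|z| <= Num.sqrt v.
  have a0 : 0 <= \int[N]_z `|z| by exact: Rintegral_ge0.
  have := cauchy_schwarz La (Lfun_cst N (1 : R) 2).
  under eq_Rintegral do rewrite mulr1.
  have -> : \int[N]_x (cst (1 : R) x) ^+ 2 = 1.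
    by under eq_Rintegral do rewrite /cst expr1n; exact: Rintegral_cst1.
  rewrite mulr1.
  under [X in _ <= X]eq_Rintegral do rewrite real_normK ?num_real//.
  by rewrite m2 => h; rewrite -(ger0_norm a0) -sqrtr_sqr ler_sqrt.
rewrite /average -[X in _ - X](Rintegral_cst1 N) -RintegralB//; last 2 first.
- exact: integrable_shift pC.
- exact: Lfun2_integrable (Lfun_cst N (phi x) 2).
apply: (@le_trans _ _ (\int[N]_z (K * `|z|))).
  apply: le_abs_Rintegral; last by apply: integrableZR; exact: Lfun2_integrable.
    by apply: measurable_funB => //; exact: measurable_shift.
  by move=> z; apply: (le_trans (lip _ _)); rewrite addrC addKr.
rewrite RintegralZl//; last exact: Lfun2_integrable.
exact: ler_wpM2l.
Qed.

End fixed_variance.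

Lemma average_gaussian0 (phi : R -> R) x : measurable_fun setT phi ->
  average (centered_gaussian 0) phi x = phi x.
Proof.
move=> mp; rewrite /average /Rintegral integral_gaussian0 ?addr0//.
by apply/measurable_EFinP; exact: measurable_shift.
Qed.

Lemma average_gaussian_semigroup (a c : R) (phi : R -> R) (C x : R) :
  0 <= a -> 0 <= c -> measurable_fun setT phi -> (forall x, `|phi x| <= C) ->
  average (centered_gaussian a) (average (centered_gaussian c) phi) x =
  average (centered_gaussian (a + c)) phi x.
Proof.
move=> a0 c0 mp pC.
have mf : measurable_fun setT (fun u : R => (phi (x + u) + C)%:E).
  apply/measurable_EFinP; apply: measurable_funD; last exact: measurable_cst.
  exact: measurable_shift.
have f0 (u : R) : (0 <= (phi (x + u) + C)%:E)%E by rewrite lee_fin; exact: addC_ge0.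
have add (N : probability Rm R) (psi : R -> R) : measurable_fun setT psi ->
    (forall x, `|psi x| <= C) -> (\int[N]_y (psi y + C)%:E = (\int[N]_y psi y + C)%:E)%E.
  move=> m b; rewrite (Rintegral_addC N m b).
  by rewrite [fine _](congr1 fine (probability_setT N)) mulr1.
have ER := add (centered_gaussian (a + c)) (fun u => phi (x + u))
  (measurable_shift x mp) (fun u => pC _).
have mavg := measurable_average (centered_gaussian c) mp pC.
have avgC u : `|average (centered_gaussian c) phi u| <= C.
  by apply: normr_Rintegral_le => //; exact: measurable_shift.
have EL := add (centered_gaussian a) (fun z => average (centered_gaussian c) phi (x + z))
  (measurable_shift x mavg) (fun u => avgC _).
have E (z : R) : (\int[centered_gaussian c]_y (phi (x + (z + y)) + C)%:E)%E =
    (average (centered_gaussian c) phi (x + z) + C)%:E.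
  rewrite /average -(add (centered_gaussian c) (fun y => phi (x + z + y))).
  - by apply: eq_integral => y _; rewrite addrA.
  - exact: measurable_shift.
  - by move=> y.
have E1 : (\int[centered_gaussian a]_z \int[centered_gaussian c]_y (phi (x + (z + y)) + C)%:E)%E =
    (\int[centered_gaussian a]_z (average (centered_gaussian c) phi (x + z) + C)%:E)%E.
  by apply: eq_integral => z _; exact: E.
have inj (u w : R) : (u + C)%:E = (w + C)%:E -> u = w by case=> /addIr.
have := etrans (esym EL) (etrans (esym E1) (etrans (gaussian_semigroup a0 c0 mf f0) ER)).
exact: inj.
Qed.

End gaussian_moments.

(** * Smooth transition functions *)

Section ramps.
Context {R : realType}.
Implicit Types (x y t a d : R).

Let p x : R := Num.max x 0 ^+ 3.
Let p1 x : R := 3 * Num.max x 0 ^+ 2.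
Let p2 x : R := 6 * Num.max x 0.

Let pos_cube_taylor x y :
  `|p (x + y) - p x - p1 x * y - p2 x * y ^+ 2 / 2| <= `|y| ^+ 3.
Proof.
rewrite /p /p1 /p2; have [x0|x0] := leP x 0; have [xy0|xy0] := leP (x + y) 0.
- by rewrite !expr0n/= !mulr0 !mul0r !subr0 normr0 exprn_ge0.
- have y0 : 0 < y by lra.
  rewrite !expr0n/= !mulr0 !mul0r !subr0 normrX !gtr0_norm//.
  by apply: lerXn2r; rewrite ?nnegrE; lra.
- have y0 : y < 0 by lra.
  have -> : 0 ^+ 3 - x ^+ 3 - 3 * x ^+ 2 * y - 6 * x * y ^+ 2 / 2 =
    (- y) ^+ 3 * -1 + (- (x + y)) ^+ 3 * 1 + y ^+ 3 * 0 :> R.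
    by field.
  rewrite mulr0 addr0 mulr1 mulrN1 (ltr0_norm y0) ler_norml.
  have h0 : 0 <= (- (x + y)) ^+ 3 by rewrite exprn_ge0//; lra.
  have h1 : (- (x + y)) ^+ 3 <= (- y) ^+ 3 by apply: lerXn2r; rewrite ?nnegrE; lra.
  by apply/andP; split; lra.
- have -> : (x + y) ^+ 3 - x ^+ 3 - 3 * x ^+ 2 * y - 6 * x * y ^+ 2 / 2 = y ^+ 3 by field.
  by rewrite normrX.
Qed.

(* distribution function of the sum of three independent uniform variables on
   [0, 1]: a C^2 transition from 0 to 1 with Lipschitz second derivative *)
Definition spline t : R := (p t - 3 * p (t - 1) + 3 * p (t - 2) - p (t - 3)) / 6.
Let spline1 t : R := (p1 t - 3 * p1 (t - 1) + 3 * p1 (t - 2) - p1 (t - 3)) / 6.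
Let spline2 t : R := (p2 t - 3 * p2 (t - 1) + 3 * p2 (t - 2) - p2 (t - 3)) / 6.

Let spline_cases (Q : R -> R -> R -> R -> Prop) t :
  (t <= 0 -> Q 0 0 0 0) -> (0 <= t <= 1 -> Q t 0 0 0) ->
  (1 <= t <= 2 -> Q t (t - 1) 0 0) -> (2 <= t <= 3 -> Q t (t - 1) (t - 2) 0) ->
  (3 <= t -> Q t (t - 1) (t - 2) (t - 3)) ->
  Q (Num.max t 0) (Num.max (t - 1) 0) (Num.max (t - 2) 0) (Num.max (t - 3) 0).
Proof.
move=> q0 q1 q2 q3 q4.
have [t0|t0] := leP t 0.
  by rewrite !max_r; [exact: q0| | |]; lra.
have [t1|t1] := leP t 1.
  rewrite (max_r (_ : t - 1 <= 0)) ?(max_r (_ : t - 2 <= 0)) ?(max_r (_ : t - 3 <= 0)); [|lra..].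
  by apply: q1; apply/andP; split; lra.
have [t2|t2] := leP t 2.
  rewrite (max_l (_ : 0 <= t - 1)) ?(max_r (_ : t - 2 <= 0)) ?(max_r (_ : t - 3 <= 0)); [|lra..].
  by apply: q2; apply/andP; split; lra.
have [t3|t3] := leP t 3.
  rewrite (max_l (_ : 0 <= t - 1)) ?(max_l (_ : 0 <= t - 2)) ?(max_r (_ : t - 3 <= 0)); [|lra..].
  by apply: q3; apply/andP; split; lra.
rewrite (max_l (_ : 0 <= t - 1)) ?(max_l (_ : 0 <= t - 2)) ?(max_l (_ : 0 <= t - 3)); [|lra..].
by apply: q4; lra.
Qed.

Lemma spline0 t : t <= 0 -> spline t = 0.
Proof. by move=> t0; rewrite /spline /p !max_r; [rewrite expr0n/=; field| | | |]; lra. Qed.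

Lemma spline3 t : 3 <= t -> spline t = 1.
Proof. by move=> t0; rewrite /spline /p !max_l; [field| | | |]; lra. Qed.

Lemma spline01 t : 0 <= spline t <= 1.
Proof.
rewrite /spline /p.
apply: (spline_cases (Q := fun a b c d =>
  0 <= (a ^+ 3 - 3 * b ^+ 3 + 3 * c ^+ 3 - d ^+ 3) / 6 <= 1)).
- by rewrite expr0n/=; lra.
- move=> /andP[t0 t1]; rewrite expr0n/=.
  have h0 : 0 <= t ^+ 3 by rewrite exprn_ge0.
  have h1 : t ^+ 3 <= 1 by rewrite exprn_ile1.
  by apply/andP; split; lra.
- move=> /andP[t0 t1]; rewrite expr0n/=.
  have [s sE] : exists s, t = s + 1 by exists (t - 1); ring.
  rewrite {}sE in t0 t1 *; rewrite addrK.
  have s0 : 0 <= s by lra. have s1 : s <= 1 by lra.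
  have h0 : 0 <= s ^+ 2 by exact: sqr_ge0.
  have h1 : s ^+ 2 <= 1 by rewrite expr_le1.
  have h3 : 0 <= s ^+ 3 by rewrite exprn_ge0.
  have h4 : s ^+ 3 <= s ^+ 2 by rewrite exprS ler_piMl.
  have -> : ((s + 1) ^+ 3 - 3 * s ^+ 3 + 3 * 0 - 0) / 6 =
    (1 + 3 * s + 3 * s ^+ 2 - 2 * s ^+ 3) / 6 by field.
  have h5 : s ^+ 2 * 3 - 2 * s ^+ 3 <= 1.
    have -> : s ^+ 2 * 3 - 2 * s ^+ 3 = 1 - (1 - s) ^+ 2 * (1 + 2 * s) by ring.
    have : 0 <= (1 - s) ^+ 2 * (1 + 2 * s) by rewrite mulr_ge0 ?sqr_ge0//; lra.
    by lra.
  by apply/andP; split; lra.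
- move=> /andP[t0 t1]; rewrite expr0n/=.
  have -> : (t ^+ 3 - 3 * (t - 1) ^+ 3 + 3 * (t - 2) ^+ 3 - 0) / 6 = 1 - (3 - t) ^+ 3 / 6 by field.
  have h0 : 0 <= (3 - t) ^+ 3 by rewrite exprn_ge0//; lra.
  have h1 : (3 - t) ^+ 3 <= 1 by rewrite exprn_ile1//; lra.
  by apply/andP; split; lra.
- move=> t0.
  have -> : (t ^+ 3 - 3 * (t - 1) ^+ 3 + 3 * (t - 2) ^+ 3 - (t - 3) ^+ 3) / 6 = 1 by field.
  by rewrite ler01 lexx.
Qed.

Let spline1_01 t : 0 <= spline1 t <= 1.
Proof.
rewrite /spline1 /p1.
apply: (spline_cases (Q := fun a b c d =>
  0 <= (3 * a ^+ 2 - 3 * (3 * b ^+ 2) + 3 * (3 * c ^+ 2) - 3 * d ^+ 2) / 6 <= 1)).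
- by rewrite expr0n/=; lra.
- by move=> /andP[t0 t1]; rewrite expr0n/=; apply/andP; split; nra.
- by move=> /andP[t0 t1]; rewrite expr0n/=; apply/andP; split; nra.
- by move=> /andP[t0 t1]; rewrite expr0n/=; apply/andP; split; nra.
- by move=> t0; apply/andP; split; nra.
Qed.

Let spline2_le1 t : `|spline2 t| <= 1.
Proof.
rewrite ler_norml /spline2 /p2.
apply: (spline_cases (Q := fun a b c d =>
  -1 <= (6 * a - 3 * (6 * b) + 3 * (6 * c) - 6 * d) / 6 <= 1)).
- by lra.
- by move=> /andP[t0 t1]; apply/andP; split; lra.
- by move=> /andP[t0 t1]; apply/andP; split; lra.
- by move=> /andP[t0 t1]; apply/andP; split; lra.
- by move=> t0; apply/andP; split; lra.
Qed.

(** The cubic bound combines those of the four truncated cubes, with factor (1 + 3 + 3 + 1) / 6 =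
    4/3. For |y| > 1 boundedness of the spline and of its two derivatives gives 5/2 times y^2. The
    constant 3 covers both regimes. *)
Let spline_taylor x y :
  `|spline (x + y) - spline x - spline1 x * y - spline2 x * y ^+ 2 / 2| <=
  3 * Num.min (y ^+ 2) (`|y| ^+ 3).
Proof.
have y2 : y ^+ 2 = `|y| ^+ 2 by rewrite real_normK ?num_real.
set r := _ - _ - _ - _.
have cube : `|r| <= 4 / 3 * `|y| ^+ 3.
  have := pos_cube_taylor x y; have := pos_cube_taylor (x - 1) y.
  have := pos_cube_taylor (x - 2) y; have := pos_cube_taylor (x - 3) y.
  have E (a : R) : x - a + y = x + y - a by ring.
  rewrite !E; set r3 := p (x + y - 3) - _ - _ - _.
  set r2 := p (x + y - 2) - _ - _ - _; set r1 := p (x + y - 1) - _ - _ - _.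
  set r0 := p (x + y) - _ - _ - _.
  have -> : r = (r0 - 3 * r1 + 3 * r2 - r3) / 6.
    by rewrite /r /r0 /r1 /r2 /r3 /spline /spline1 /spline2; field.
  rewrite !ler_norml => /andP[? ?] /andP[? ?] /andP[? ?] /andP[? ?].
  by apply/andP; split; lra.
have a0 := normr_ge0 y.
have y30 : 0 <= `|y| ^+ 3 by rewrite exprn_ge0.
rewrite -ler_pdivrMl// le_min; apply/andP; split; rewrite ler_pdivrMl//; last by lra.
rewrite y2; have [y1|y1] := leP `|y| 1.
  have : `|y| ^+ 3 <= `|y| ^+ 2 by rewrite exprS ler_piMl// exprn_ge0.
  have := exprn_ge0 2 a0; lra.
have yy : `|y| <= `|y| ^+ 2 by rewrite expr2 ler_peMl// ltW.
have /andP[s0 s1] := spline01 (x + y); have /andP[s2 s3] := spline01 x.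
have b1 : `|spline1 x * y| <= `|y|.
  have /andP[h0 h1] := spline1_01 x.
  by rewrite normrM ger0_norm// ler_piMl.
have b2 : `|spline2 x * y ^+ 2 / 2| <= `|y| ^+ 2 / 2.
  rewrite y2 -mulrA normrM; set w := `|y| ^+ 2 / 2.
  have w0 : 0 <= w by rewrite divr_ge0 ?exprn_ge0.
  by rewrite (ger0_norm w0) ler_piMl// spline2_le1.
by move: b1 b2; rewrite /r !ler_norml => /andP[? ?] /andP[? ?]; apply/andP; split; lra.
Qed.

(** Equal to 0 up to a and to 1 from a + 3 d on, since the spline makes its transition over
    [0, 3]. *)
Definition ramp a d x : R := spline ((x - a) / d).

Let measurable_max0 : measurable_fun setT (fun x => Num.max x 0).
Proof. by apply: measurable_maxr => //; exact: measurable_cst. Qed.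

Let measurable_combination (g : R -> R) (a d k : R) : measurable_fun setT g ->
  measurable_fun setT (fun x => k * ((g ((x - a) / d) - 3 * g ((x - a) / d - 1) +
     3 * g ((x - a) / d - 2) - g ((x - a) / d - 3)) / 6)).
Proof.
move=> mg.
have mg' (u : R) : measurable_fun setT (fun x => g ((x - a) / d - u)).
  apply: measurableT_comp mg _; apply: measurable_funB; last exact: measurable_cst.
  apply: measurable_funM; last exact: measurable_cst.
  by apply: measurable_funB => //; exact: measurable_cst.
have mg0 : measurable_fun setT (fun x => g ((x - a) / d)).
  by have := mg' 0; under eq_fun do rewrite subr0.
apply: measurable_funM; first exact: measurable_cst.
apply: measurable_funM; last exact: measurable_cst.
apply: measurable_funB => //; apply: measurable_funD; last first.
  by apply: measurable_funM => //; exact: measurable_cst.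
by apply: measurable_funB => //; apply: measurable_funM => //; exact: measurable_cst.
Qed.

Lemma ramp01 a d x : 0 <= ramp a d x <= 1.
Proof. exact: spline01. Qed.

Lemma ramp_le1 a d x : `|ramp a d x| <= 1.
Proof. by have /andP[h0 h1] := ramp01 a d x; rewrite ger0_norm. Qed.

Lemma ramp0 a d x : 0 < d -> x <= a -> ramp a d x = 0.
Proof. by move=> d0 xa; apply: spline0; rewrite pmulr_lle0 ?invr_gt0// subr_le0. Qed.

Lemma ramp1 a d x : 0 < d -> a + 3 * d <= x -> ramp a d x = 1.
Proof. by move=> d0 xa; apply: spline3; rewrite ler_pdivlMr//; lra. Qed.

(** Rescaling by k = 1 / d multiplies successive derivatives by powers of k up to k^3; (1 + k)^3
    dominates all of them, and 1. *)
Lemma taylor2_ramp a d : 0 < d ->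
  exists f1 f2, (forall x, 0 <= f1 x <= d^-1) /\ taylor2 (3 * (1 + d^-1) ^+ 3) (ramp a d) f1 f2.
Proof.
move=> d0; pose k := d^-1; have k0 : 0 < k by rewrite invr_gt0.
rewrite -/k; exists (fun x => k * spline1 ((x - a) / d)), (fun x => k ^+ 2 * spline2 ((x - a) / d)).
have C1 : 1 <= (1 + k) ^+ 3 by rewrite exprn_ege1// lerDl ltW.
have C2 : k <= (1 + k) ^+ 3.
  by rewrite (@le_trans _ _ (1 + k))//; [rewrite lerDr|rewrite ler_eXnr// lerDl ltW].
have C3 : k ^+ 2 <= (1 + k) ^+ 3.
  apply: (@le_trans _ _ ((1 + k) ^+ 2)).
    by apply: lerXn2r; rewrite ?nnegrE ?addr_ge0 ?(ltW k0)// lerDr.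
  by apply: ler_weXn2l; rewrite // lerDl ltW.
have C4 : k ^+ 3 <= (1 + k) ^+ 3.
  by apply: lerXn2r; rewrite ?nnegrE ?addr_ge0 ?(ltW k0)// lerDr.
split.
  move=> x; have /andP[h0 h1] := spline1_01 ((x - a) / d).
  by rewrite mulr_ge0 ?(ltW k0)//= ler_piMr// ltW.
split.
- have := measurable_combination a d 1 (measurable_funX 3 measurable_max0).
  by under eq_fun do rewrite mul1r.
- apply: (measurable_combination (g := p1)).
  by apply: measurable_funM => //; exact: measurable_funX.
- by apply: (measurable_combination (g := p2)); exact: measurable_funM.
- move=> x; split.
  + by apply: (le_trans (ramp_le1 _ _ _)); lra.
  + have /andP[h0 h1] := spline1_01 ((x - a) / d).
    rewrite normrM (gtr0_norm k0) (ger0_norm h0).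
    apply: (@le_trans _ _ (k * 1)); first by rewrite ler_pM2l.
    lra.
  + have h := spline2_le1 ((x - a) / d); have k2 : 0 < k ^+ 2 by rewrite exprn_gt0.
    rewrite normrM (gtr0_norm k2); apply: (@le_trans _ _ (k ^+ 2 * 1)); first by rewrite ler_pM2l.
    lra.
- move=> x y; rewrite /ramp.
  have -> : (x + y - a) / d = (x - a) / d + y * k by rewrite -mulrDl; congr (_ / _); ring.
  have := spline_taylor ((x - a) / d) (y * k).
  rewrite exprMn normrM (gtr0_norm k0) exprMn.
  set s1 := spline1 _; set s2 := spline2 _.
  have -> : k * s1 * y = s1 * (y * k) by ring.
  have -> : k ^+ 2 * s2 * y ^+ 2 / 2 = s2 * (y ^+ 2 * k ^+ 2) / 2 by ring.
  move=> h; apply: (le_trans h); rewrite -[leRHS]mulrA ler_wpM2l//.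
  have q0 : 0 < (1 + k) ^+ 3 by lra.
  rewrite -ler_pdivrMl// le_min; apply/andP; split; rewrite ler_pdivrMl// ge_min; apply/orP.
    by left; rewrite mulrC ler_wpM2r// sqr_ge0.
  by right; rewrite mulrC ler_wpM2r// exprn_ge0.
Qed.

Lemma measurable_ramp a d : 0 < d -> measurable_fun setT (ramp a d).
Proof. by move=> /(taylor2_ramp a)[? [? [_ []]]]. Qed.

(** Monotonicity and the Lipschitz constant both come from the range [0, 1/d] of the first Taylor
    coefficient, through [first_order_increment]. *)
Let ramp_increment a d x y : 0 < d -> x <= y ->
  0 <= ramp a d y - ramp a d x <= d^-1 * (y - x).
Proof.
move=> d0 xy; have [f1 [f2 [f10 T]]] := taylor2_ramp a d0.
have [_ _ _ b _] := T.
have C0 : 0 <= 3 * (1 + d^-1) ^+ 3 by case: (b 0) => h _ _; exact: le_trans (normr_ge0 _) h.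
have yx : 0 <= y - x by rewrite subr_ge0.
have C20 : 0 <= 2 * (3 * (1 + d^-1) ^+ 3) by rewrite mulr_ge0.
have := first_order_increment C20 (taylor2_first_order T) f10 x yx.
by rewrite mul0r (addrC x) subrK.
Qed.

Lemma ramp_nondecreasing a d x y : 0 < d -> x <= y -> ramp a d x <= ramp a d y.
Proof. by move=> d0 /(ramp_increment a d0)/andP[]; rewrite subr_ge0. Qed.

Lemma ramp_lipschitz a d x y : 0 < d -> `|ramp a d x - ramp a d y| <= d^-1 * `|x - y|.
Proof.
move=> d0; wlog xy : x y / y <= x.
  by move=> H; have [/H//|/ltW/H] := leP y x; rewrite distrC (distrC x).
have /andP[h1 h2] := ramp_increment a d0 xy.
by rewrite !ger0_norm// subr_ge0.
Qed.

End ramps.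

(** * The central limit theorem *)

Section probability_of.
Context {d} {T : measurableType d} {R : realType}.
Variable m : {measure set T -> \bar R}.
Let m' : set T -> \bar R := m.
Hypothesis m1 : m' setT = 1%E.

Let m'0 : m' set0 = 0%E. Proof. exact: measure0. Qed.
Let m'_ge0 A : (0 <= m' A)%E. Proof. exact: measure_ge0. Qed.
Let m'_sigma : semi_sigma_additive m'.
Proof. exact: measure_semi_sigma_additive. Qed.

#[local] HB.instance Definition _ :=
  isMeasure.Build _ T R m' m'0 m'_ge0 m'_sigma.
#[local] HB.instance Definition _ := Measure_isProbability.Build _ T R m' m1.

(** [iid_law] is an element of [giry]; total mass one turns it into a [probability] with the same
    values, to which the lemmas on probabilities apply. *)
Lemma probability_of : exists nu : probability T R, forall A, nu A = m A.
Proof. by exists m'. Qed.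

End probability_of.

Section iid_integrals.
Context {d} {T : measurableType d} {R : realType} (Q : probability T R).
Implicit Types (phi : R -> R) (Y : T -> R) (C x : R).

Definition cons_tuple n (o : T) (t : n.-tuple T) : n.+1.-tuple T := [tuple of o :: t].

Lemma measurable_cons_tuple n :
  measurable_fun setT (fun z : T * n.-tuple T => cons_tuple z.1 z.2).
Proof. exact: measurable_tcons. Qed.

Lemma ge0_integral_iid n (F : n.+1.-tuple T -> \bar R) :
  measurable_fun setT F -> (forall t, 0 <= F t)%E ->
  (\int[iid_law Q n.+1]_t F t =
   \int[Q]_o \int[iid_law Q n]_t F (cons_tuple o t))%E.
Proof.
move=> mF F0.
have mFc : measurable_fun setT (fun z : T * n.-tuple T => F (cons_tuple z.1 z.2)).
  exact: measurableT_comp mF (@measurable_cons_tuple n).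
rewrite [LHS](giry_int_map (measurable_tcons (n := n)) _ mF F0).
exact: (giry_int_prod1 (Q : giry T R) (iid_law Q n) mFc (fun z => F0 _)).
Qed.

Lemma ge0_integral_iid0 (F : 0.-tuple T -> \bar R) : measurable_fun setT F ->
  (\int[iid_law Q 0]_t F t = F [tuple])%E.
Proof. by move=> mF; exact: (giry_int_ret [tuple] mF). Qed.

Lemma iid_law_setT n : iid_law Q n setT = 1%E.
Proof.
elim: n => [|n IH]; first by rewrite /= diracT.
have E := @ge0_integral_iid n (cst 1%E) (measurable_cst _) (fun=> lee01).
rewrite -[LHS]mul1e -(integral_cst _ measurableT) [LHS]E.
transitivity (\int[Q]_o (cst 1 o))%E; last first.
  by rewrite integral_cst// mul1e; exact: probability_setT.
apply: eq_integral => o _; rewrite (integral_cst _ measurableT) mul1e.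
exact: IH.
Qed.

Lemma Rintegral_iid n (F : n.+1.-tuple T -> R) (C : R) :
  measurable_fun setT F -> (forall t, `|F t| <= C) ->
  \int[iid_law Q n.+1]_t F t =
  \int[Q]_o \int[iid_law Q n]_t F (cons_tuple o t).
Proof.
move=> mF FC.
have mFc : measurable_fun setT (fun z : T * n.-tuple T => F (cons_tuple z.1 z.2)).
  exact: measurableT_comp mF (@measurable_cons_tuple n).
have mFo o : measurable_fun setT (fun t : n.-tuple T => F (cons_tuple o t)).
  exact: (measurableT_comp mFc (measurable_pair1 o)).
have mG := @measurable_Rintegral_snd _ _ _ _ R (iid_law Q n) _ C mFc (fun z => FC _).
have GC o : `|\int[iid_law Q n]_t F (cons_tuple o t)| <= C.
  have := le_abs_Rintegral (mu := iid_law Q n) (g := cst C) (mFo o) (fun t => FC _).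
  rewrite Rintegral_cst// [fine _](congr1 fine (iid_law_setT n)) mulr1; apply.
  apply: (@bounded_integrable _ _ _ _ _ `|C|) => //; exact: measurable_cst.
have mFE : measurable_fun setT (fun t => (F t + C)%:E).
  by apply/measurable_EFinP; apply: measurable_funD => //; exact: measurable_cst.
have FE0 t : (0 <= (F t + C)%:E)%E by rewrite lee_fin; exact: addC_ge0.
have add (d' : measure_display) (U : measurableType d') (N : {finite_measure set U -> \bar R}) (g : U -> R) :
    N setT = 1%E -> measurable_fun setT g -> (forall u, `|g u| <= C) ->
    (\int[N]_y (g y + C)%:E = (\int[N]_y g y + C)%:E)%E.
  by move=> N1 mg gC; rewrite (Rintegral_addC N mg gC) [fine _](congr1 fine N1) mulr1.
have E o : (\int[iid_law Q n]_t (F (cons_tuple o t) + C)%:E =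
    (\int[iid_law Q n]_t F (cons_tuple o t) + C)%:E)%E.
  exact: (add _ _ (iid_law Q n) _ (iid_law_setT n) (mFo o) (fun t => FC _)).
have E1 : (\int[Q]_o \int[iid_law Q n]_t (F (cons_tuple o t) + C)%:E =
    \int[Q]_o (\int[iid_law Q n]_t F (cons_tuple o t) + C)%:E)%E.
  by apply: eq_integral => o _; exact: E.
have EL := add _ _ (iid_law Q n.+1) _ (iid_law_setT n.+1) mF FC.
have ER := add _ _ Q _ (probability_setT Q) mG GC.
have inj (u w : R) : (u + C)%:E = (w + C)%:E -> u = w by case=> /addIr.
have := etrans (esym EL) (etrans (ge0_integral_iid mFE FE0) (etrans E1 ER)).
exact: inj.
Qed.

Lemma Rintegral_iid0 (F : 0.-tuple T -> R) : measurable_fun setT F ->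
  \int[iid_law Q 0]_t F t = F [tuple].
Proof. by move=> mF; rewrite /Rintegral ge0_integral_iid0//; exact/measurable_EFinP. Qed.

Definition sample_sum (Y : T -> R) n (t : n.-tuple T) : R := \sum_(i < n) Y (tnth t i).

Lemma sample_sum_cons Y n o (t : n.-tuple T) :
  sample_sum Y (cons_tuple o t) = Y o + sample_sum Y t.
Proof.
rewrite /sample_sum big_ord_recl tnth0; congr (_ + _).
by apply: eq_bigr => i _; rewrite tnthS.
Qed.

Lemma sample_sum0 Y (t : 0.-tuple T) : sample_sum Y t = 0.
Proof. by rewrite /sample_sum big_ord0. Qed.

Lemma measurable_sample_sum Y n : measurable_fun setT Y ->
  measurable_fun setT (@sample_sum Y n).
Proof.
move=> mY; apply: measurable_sum => i.
by apply: measurableT_comp mY _; exact: measurable_tnth.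
Qed.

Definition increment (Y : T -> R) (phi : R -> R) x : R := \int[Q]_o phi (x + Y o).

Lemma measurable_increment Y phi C : measurable_fun setT Y ->
  measurable_fun setT phi -> (forall x, `|phi x| <= C) ->
  measurable_fun setT (increment Y phi).
Proof.
move=> mY mp pC.
apply: (@measurable_Rintegral_snd _ _ (measurableTypeR R) T R Q
  (fun z => phi (z.1 + Y z.2)) C) => //.
apply: measurableT_comp mp _; apply: measurable_funD => //.
by apply: measurableT_comp mY _.
Qed.

Lemma increment_le Y phi C x : measurable_fun setT Y -> measurable_fun setT phi ->
  (forall x, `|phi x| <= C) -> `|increment Y phi x| <= C.
Proof.
move=> mY mp pC; apply: normr_Rintegral_le => //.
by apply: measurableT_comp mp _; exact: measurable_funD.
Qed.

Lemma iter_increment Y phi C n : measurable_fun setT Y -> measurable_fun setT phi ->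
  (forall x, `|phi x| <= C) ->
  measurable_fun setT (iter n (increment Y) phi) /\
  forall x, `|iter n (increment Y) phi x| <= C.
Proof.
move=> mY mp pC; elim: n => [//|n [IH1 IH2]]; split.
  by rewrite iterS; exact: measurable_increment IH2.
by move=> x; rewrite iterS; exact: increment_le.
Qed.

(** Independence in operator form: each observation applies the one-step operator [increment] once.
    Lindeberg's argument then compares powers of two operators. *)
Lemma Rintegral_sample_sum Y phi C n x : measurable_fun setT Y ->
  measurable_fun setT phi -> (forall x, `|phi x| <= C) ->
  \int[iid_law Q n]_t phi (x + sample_sum Y t) = iter n (increment Y) phi x.
Proof.
move=> mY mp pC.
have mF m y : measurable_fun setT (fun t : m.-tuple T => phi (y + sample_sum Y t)).
  apply: measurableT_comp mp _; apply: measurable_funD; first exact: measurable_cst.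
  exact: measurable_sample_sum.
elim: n x => [|n IH] x.
  by rewrite Rintegral_iid0// sample_sum0 addr0.
rewrite (Rintegral_iid (mF _ _) (fun t => pC _)) iterS /increment.
apply: eq_Rintegral => o _; rewrite -IH; apply: eq_Rintegral => t _.
by rewrite sample_sum_cons addrA.
Qed.

(** Integrable under a second moment alone, yet as small as a third moment where Y is small: its
    vanishing replaces Lindeberg's condition and matches the remainder in [taylor2]. *)
Definition small_moment (Y : T -> R) o : R := Num.min (Y o ^+ 2) (`|Y o| ^+ 3).

Lemma integrable_small_moment Y : Y \in Lfun Q 2%:E ->
  Q.-integrable setT (EFin \o small_moment Y).
Proof.
move=> LY; have mY := Lfun2_measurable LY.
apply: (le_integrableR (g := fun o => Y o ^+ 2)); last exact: Lfun2_sqr.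
  apply: measurable_minr; first exact: measurable_funX.
  by apply: measurable_funX; exact: measurableT_comp.
move=> o; rewrite ger0_norm ?ge_min ?lexx//.
by rewrite le_min sqr_ge0 exprn_ge0.
Qed.

Lemma increment_taylor C phi phi1 phi2 Y x : taylor2 C phi phi1 phi2 ->
  Y \in Lfun Q 2%:E ->
  `|increment Y phi x - phi x - phi1 x * \int[Q]_o Y o - phi2 x / 2 * \int[Q]_o Y o ^+ 2|
   <= C * \int[Q]_o small_moment Y o.
Proof.
move=> [m0 m1 m2 b Tp] LY; have mY := Lfun2_measurable LY.
have I1 := Lfun2_integrable LY; have I2 := Lfun2_sqr LY.
have Ic := Lfun2_integrable (Lfun_cst Q (phi x) 2).
have b0 z : `|phi z| <= C by case: (b z).
have mp : measurable_fun setT (fun o => phi (x + Y o)).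
  by apply: measurableT_comp m0 _; exact: measurable_funD.
have Ip := bounded_integrable Q mp (fun o => b0 _).
have -> : increment Y phi x - phi x - phi1 x * \int[Q]_o Y o -
    phi2 x / 2 * \int[Q]_o Y o ^+ 2 =
  \int[Q]_o (phi (x + Y o) - phi x - phi1 x * Y o - phi2 x / 2 * Y o ^+ 2).
  have J1 := integrableBR Ip Ic; have J2 := integrableZR (phi1 x) I1.
  have J3 := integrableZR (phi2 x / 2) I2.
  rewrite (RintegralB _ (integrableBR J1 J2) J3)// (RintegralB _ J1 J2)//.
  by rewrite (RintegralB _ Ip Ic)// !RintegralZl// Rintegral_cst1.
rewrite -RintegralZl//; last exact: integrable_small_moment.
apply: le_abs_Rintegral; last by apply: integrableZR; exact: integrable_small_moment.
  apply: measurable_funB; last by apply: measurable_funM => //; exact: measurable_funX.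
  apply: measurable_funB; last exact: measurable_funM.
  by apply: measurable_funB => //; exact: measurable_cst.
by move=> o; have := Tp x (Y o); rewrite [phi2 x * _ / 2]mulrAC.
Qed.

End iid_integrals.

(** * Lindeberg's replacement argument *)

Section lindeberg.
Context {R : realType}.
Local Notation Rm := (measurableTypeR R).
Implicit Types (phi : R -> R) (C a c v w x : R).

Lemma increment_diff {d d'} {T : measurableType d} {T' : measurableType d'}
    (Q : probability T R) (Q' : probability T' R) (Y : T -> R) (Y' : T' -> R)
    C phi phi1 phi2 x :
  taylor2 C phi phi1 phi2 -> Y \in Lfun Q 2%:E -> Y' \in Lfun Q' 2%:E ->
  `|increment Q Y phi x - increment Q' Y' phi x| <=
  C * (`|\int[Q]_o Y o - \int[Q']_o Y' o| + `|\int[Q]_o Y o ^+ 2 - \int[Q']_o Y' o ^+ 2| +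
       \int[Q]_o small_moment Y o + \int[Q']_o small_moment Y' o).
Proof.
move=> Tp LY LY'; have [_ _ _ b _] := Tp; have [b0 b1 b2] := b x.
have := increment_taylor x Tp LY; have := increment_taylor x Tp LY'.
set I := increment Q Y phi x; set I' := increment Q' Y' phi x.
set m := \int[Q]_o Y o; set m' := \int[Q']_o Y' o.
set q := \int[Q]_o Y o ^+ 2; set q' := \int[Q']_o Y' o ^+ 2.
set s := \int[Q]_o small_moment Y o; set s' := \int[Q']_o small_moment Y' o.
move=> h' h.
have C0 : 0 <= C by exact: le_trans (normr_ge0 _) b0.
have h1 : `|phi1 x * (m - m')| <= C * `|m - m'| by rewrite normrM ler_wpM2r.
have h2 : `|phi2 x / 2 * (q - q')| <= C * `|q - q'|.
  have p2 : `|phi2 x / 2| <= C.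
    have half : 0 <= 2^-1 :> R by rewrite invr_ge0.
    by rewrite normrM (ger0_norm half); have := normr_ge0 (phi2 x); lra.
  by rewrite normrM ler_wpM2r.
have -> : I - I' = (I - phi x - phi1 x * m - phi2 x / 2 * q) -
   (I' - phi x - phi1 x * m' - phi2 x / 2 * q') + phi1 x * (m - m') +
   phi2 x / 2 * (q - q') by ring.
apply: (le_trans (ler_normD _ _)).
have := ler_normD (I - phi x - phi1 x * m - phi2 x / 2 * q -
   (I' - phi x - phi1 x * m' - phi2 x / 2 * q')) (phi1 x * (m - m')).
have := ler_normB (I - phi x - phi1 x * m - phi2 x / 2 * q)
   (I' - phi x - phi1 x * m' - phi2 x / 2 * q').
rewrite !(mulrDr C); lra.
Qed.

Let gauss_increment a w phi : R -> R :=
  @increment _ Rm R (centered_gaussian w) (fun z : Rm => a + z) phi.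

Let gauss_incrementE a w phi x :
  gauss_increment a w phi x = average (centered_gaussian w) phi (x + a).
Proof. by rewrite /gauss_increment /increment; apply: eq_Rintegral => z _; rewrite addrA. Qed.

Let taylor2_gauss_increment a w C phi phi1 phi2 : taylor2 C phi phi1 phi2 ->
  taylor2 C (gauss_increment a w phi) (gauss_increment a w phi1) (gauss_increment a w phi2).
Proof.
move=> Tp; have := taylor2_translate a (taylor2_average (centered_gaussian w) Tp).
have E psi : (fun x => average (centered_gaussian w) psi (x + a)) = gauss_increment a w psi.
  by apply/funext => x; rewrite gauss_incrementE.
by rewrite !E.
Qed.

Let iter_gauss_increment a w C phi n x : 0 <= w -> measurable_fun setT phi ->
  (forall x, `|phi x| <= C) ->
  iter n (gauss_increment a w) phi x = average (centered_gaussian (n%:R * w)) phi (x + n%:R * a).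
Proof.
move=> w0 mp pC; elim: n x => [|n IH] x.
  by rewrite !mul0r addr0 average_gaussian0.
rewrite iterS gauss_incrementE.
have nw0 : 0 <= n%:R * w by rewrite mulr_ge0.
have -> : n.+1%:R * w = w + n%:R * w by rewrite -natr1; ring.
apply: (etrans _ (average_gaussian_semigroup _ w0 nw0 mp pC)).
apply: eq_Rintegral => z _; rewrite IH /average; apply: eq_Rintegral => y _.
by congr phi; rewrite -natr1; ring.
Qed.

Let iter_taylor2 a w C phi phi1 phi2 n : taylor2 C phi phi1 phi2 ->
  taylor2 C (iter n (gauss_increment a w) phi) (iter n (gauss_increment a w) phi1)
    (iter n (gauss_increment a w) phi2).
Proof. by move=> Tp; elim: n => //= n; exact: taylor2_gauss_increment. Qed.

(* Lindeberg's replacement: both operators are contractions, so the errors of n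
   single steps add up. *)
Lemma iter_increment_gaussian {d} {T : measurableType d} (Q : probability T R)
    (Y : T -> R) a w C phi phi1 phi2 (r : R) n x :
  0 <= w -> Y \in Lfun Q 2%:E -> taylor2 C phi phi1 phi2 ->
  (forall psi psi1 psi2 x, taylor2 C psi psi1 psi2 ->
     `|increment Q Y psi x - gauss_increment a w psi x| <= r) ->
  `|iter n (increment Q Y) phi x - average (centered_gaussian (n%:R * w)) phi (x + n%:R * a)|
   <= n%:R * r.
Proof.
move=> w0 LY Tp H; have [m0 _ _ b _] := Tp.
have b0 z : `|phi z| <= C by case: (b z).
have mY := Lfun2_measurable LY.
rewrite -(iter_gauss_increment a n x w0 m0 b0).
elim: n x => [|n IH] x; first by rewrite subrr normr0 mul0r.
rewrite !iterS.
set f := iter n (increment Q Y) phi; set g := iter n (gauss_increment a w) phi.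
have Tg := iter_taylor2 a w n Tp; rewrite -/g in Tg.
have [mf fC] := iter_increment Q n mY m0 b0; rewrite -/f in mf fC.
have [mg _ _ bg _] := Tg; have gC z : `|g z| <= C by case: (bg z).
have h1 : `|increment Q Y f x - increment Q Y g x| <= n%:R * r.
  have mfx : measurable_fun setT (fun o => f (x + Y o)).
    by apply: measurableT_comp mf _; exact: measurable_funD.
  have mgx : measurable_fun setT (fun o => g (x + Y o)).
    by apply: measurableT_comp mg _; exact: measurable_funD.
  rewrite /increment -RintegralB//; last 2 first.
  - by apply: (@bounded_integrable _ _ _ _ _ C).
  - by apply: (@bounded_integrable _ _ _ _ _ C).
  apply: normr_Rintegral_le; first exact: measurable_funB.
  by move=> o; exact: IH.
have h2 := H g _ _ x Tg.
have := ler_normD (increment Q Y f x - increment Q Y g x)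
  (increment Q Y g x - gauss_increment a w g x).
rewrite addrA subrK -natr1 mulrDl mul1r; lra.
Qed.

(** Square integrability is required only eventually, because the laws will be tilts that have their
    intended density only for large n. Drift and variance are those of the whole row, n times those
    of one term. *)
Definition triangular_limit {d} {T : measurableType d}
    (Q : nat -> probability T R) (Y : nat -> T -> R) c v : Prop :=
  [/\ \forall n \near \oo, Y n \in Lfun (Q n) 2%:E,
      n%:R * \int[Q n]_o Y n o @[n --> \oo] --> c,
      n%:R * \int[Q n]_o Y n o ^+ 2 @[n --> \oo] --> v &
      n%:R * \int[Q n]_o small_moment (Y n) o @[n --> \oo] --> (0 : R)].

(** The reference row: n terms of mean c / n and variance v / n, whose sum is exactly N(c, v). Its
    small moments are controlled by (p + q)^3 <= 4 p^3 + 4 q^3 and the cubic Gaussian bound. *)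
Lemma triangular_limit_gaussian c v : 0 <= v ->
  @triangular_limit _ Rm (fun n => centered_gaussian (v / n%:R))
    (fun n z => c / n%:R + z) c v.
Proof.
move=> v0.
have w0 n : 0 <= v / n%:R by rewrite divr_ge0.
have L n : (fun z : Rm => c / n%:R + (z : R)) \in Lfun (centered_gaussian (v / n%:R)) 2%:E.
  exact: (Lfun2D (Lfun_cst (centered_gaussian (v / n%:R)) (c / n%:R) 2) (gaussian_Lfun2 (w0 n))).
have Ic n (k : R) : (centered_gaussian (v / n%:R)).-integrable setT
    (EFin \o (fun _ : Rm => k)).
  exact: Lfun2_integrable (Lfun_cst (centered_gaussian (v / n%:R)) k 2).
have I1 n := Lfun2_integrable (gaussian_Lfun2 (w0 n)).
have I2 n := Lfun2_sqr (gaussian_Lfun2 (w0 n)).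
have h1 : (n%:R)^-1 @[n --> \oo] --> (0 : R).
  by rewrite -(cvg_shiftn 1); under eq_fun do rewrite addn1; exact: cvg_harmonic.
have nz : \forall n \near \oo, (n%:R : R) != 0.
  by near=> n; rewrite pnatr_eq0 -lt0n; near: n; exact: nbhs_infty_gt.
split.
- by apply: nearW => n; exact: L.
- apply: cvg_near_cst; apply: filterS nz => n n0.
  rewrite (RintegralD _ (Ic n (c / n%:R)) (I1 n))// Rintegral_cst1 (gaussian_moments (w0 n)).1.
  by rewrite addr0 mulrC divfK.
- have E : \forall n \near \oo, c ^+ 2 * n%:R^-1 + v =
      n%:R * \int[centered_gaussian (v / n%:R)]_z (c / n%:R + (z : R)) ^+ 2.
    apply: filterS nz => n n0.
    under [X in _ = _ * X]eq_Rintegral do rewrite sqrrD -mulrnAl.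
    have J := integrableZR (c / n%:R *+ 2) (I1 n).
    rewrite (RintegralD _ (integrableDR (Ic n _) J) (I2 n))// (RintegralD _ (Ic n _) J)//.
    rewrite Rintegral_cst1 RintegralZl//; last exact: I1.
    rewrite (gaussian_moments (w0 n)).1 (gaussian_moments (w0 n)).2.
    by field.
  apply: (cvg_trans (near_eq_cvg E)).
  have : c ^+ 2 * n%:R^-1 + v @[n --> \oo] --> c ^+ 2 * 0 + v.
    by apply: cvgD; [exact: cvgMr|exact: cvg_cst].
  by rewrite mulr0 add0r.
- pose K := 12 * expR 1 : R.
  pose B (n : nat) : R := 4 * (`|c| ^+ 3 * (n%:R^-1 * n%:R^-1) + K * v * Num.sqrt (v * n%:R^-1)).
  have B0 : B n @[n --> \oo] --> (0 : R).
    have -> : 0 = 4 * (`|c| ^+ 3 * (0 * 0) + K * v * Num.sqrt (v * 0)) :> R.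
      by rewrite !mulr0 sqrtr0; ring.
    apply: cvgMr; apply: cvgD; apply: cvgMr; first exact: cvgM.
    have h2 : v * n%:R^-1 @[n --> \oo] --> v * 0 by exact: cvgMr.
    exact: (cvg_comp _ _ h2 (@sqrt_continuous R (v * 0))).
  have sm0 n : 0 <= n%:R * \int[centered_gaussian (v / n%:R)]_z
      small_moment (fun z : Rm => c / n%:R + (z : R)) z.
    rewrite mulr_ge0//; apply: Rintegral_ge0 => z _.
    by rewrite le_min sqr_ge0 exprn_ge0.
  apply: (squeeze_cvgr (f := cst 0) (h := B)) => //; last exact: cvg_cst.
  apply: filterS nz => n n0; rewrite sm0/=.
  have n_gt0 : 0 < n%:R :> R by rewrite lt_def n0 ler0n.
  have I3 := integrable_gaussian_cube (w0 n).
  apply: (@le_trans _ _ (n%:R * \int[centered_gaussian (v / n%:R)]_z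
      (4 * `|c / n%:R| ^+ 3 + 4 * `|z : R| ^+ 3))).
    rewrite ler_wpM2l//; apply: le_Rintegral => //.
    - exact: integrable_small_moment.
    - by apply: integrableDR (integrableZR 4 I3); exact: Ic.
    - move=> z _; rewrite /small_moment ge_min; apply/orP; right.
      set u := c / n%:R; have := ler_normD u z.
      have := normr_ge0 u; have := normr_ge0 (z : R); move: `|u| `|z : R| => p q q0 p0 h.
      apply: (@le_trans _ _ ((p + q) ^+ 3)).
        by apply: lerXn2r => //; rewrite nnegrE addr_ge0.
      have : 0 <= (p + q) * (p - q) ^+ 2 by rewrite mulr_ge0 ?sqr_ge0 ?addr_ge0.
      nra.
  rewrite (RintegralD _ (Ic n _) (integrableZR 4 I3))// Rintegral_cst1 RintegralZl//.
  have := gaussian_cube_le (w0 n); rewrite -/K; set X := Rintegral _ _ _ => hX.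
  rewrite /B mulrDr [4 * (_ + _)]mulrDr; apply: lerD.
    rewrite normrM normfV (gtr0_norm n_gt0) le_eqVlt; apply/orP; left; apply/eqP.
    by field.
  have -> : 4 * (K * v * Num.sqrt (v * n%:R^-1)) =
      n%:R * (4 * (K * (v / n%:R * Num.sqrt (v / n%:R)))) by field.
  by rewrite ler_wpM2l// ler_wpM2l.
Unshelve. all: by end_near. Qed.

(** Two rows with the same limiting drift and variance differ by n [r n], which tends to 0. The
    bound is uniform in x; this is used later with a starting point that moves with n. *)
Theorem lindeberg {d} {T : measurableType d} (Q : nat -> probability T R)
    (Y : nat -> T -> R) c v C phi phi1 phi2 : 0 <= v ->
  triangular_limit Q Y c v -> taylor2 C phi phi1 phi2 ->
  forall e : R, 0 < e -> \forall n \near \oo, forall x,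
    `|\int[iid_law (Q n) n]_t phi (x + sample_sum (Y n) t) -
      average (centered_gaussian v) phi (x + c)| <= e.
Proof.
move=> v0 [LY l1 l2 l3] Tp e e0; have [_ g1 g2 g3] := triangular_limit_gaussian c v0.
have w0 n : 0 <= v / n%:R by rewrite divr_ge0.
pose G n := centered_gaussian (v / n%:R).
pose Z n := fun z : Rm => c / n%:R + (z : R).
have LZ n : Z n \in Lfun (G n) 2%:E.
  exact: (Lfun2D (Lfun_cst (G n) (c / n%:R) 2) (gaussian_Lfun2 (w0 n))).
pose r n : R := C * (`|\int[Q n]_o Y n o - \int[G n]_o Z n o| +
   `|\int[Q n]_o Y n o ^+ 2 - \int[G n]_o Z n o ^+ 2| +
    \int[Q n]_o small_moment (Y n) o + \int[G n]_o small_moment (Z n) o).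
have nr0 : n%:R * r n @[n --> \oo] --> (0 : R).
  have E : (fun n => n%:R * r n) = (fun n => C *
     (`|n%:R * (\int[Q n]_o Y n o) - n%:R * (\int[G n]_o Z n o)| +
      `|n%:R * (\int[Q n]_o Y n o ^+ 2) - n%:R * (\int[G n]_o Z n o ^+ 2)| +
      n%:R * (\int[Q n]_o small_moment (Y n) o) + n%:R * (\int[G n]_o small_moment (Z n) o))).
    apply/funext => n; rewrite /r -!mulrBr !(normrM n%:R) (ger0_norm (ler0n _ n)); ring.
  rewrite E; have -> : 0 = C * (`|c - c| + `|v - v| + 0 + 0) :> R.
    by rewrite !subrr normr0 !addr0 mulr0.
  apply: cvgMr; apply: cvgD => //; apply: cvgD => //; apply: cvgD.
    by apply: cvg_norm; exact: cvgB.
  by apply: cvg_norm; exact: cvgB.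
have nre : \forall n \near \oo, n%:R * r n <= e by exact: (cvgr_le _ nr0).
have [m0 _ _ b _] := Tp; have b0 z : `|phi z| <= C by case: (b z).
near=> n => x.
have n0 : (n%:R : R) != 0.
  by rewrite pnatr_eq0 -lt0n; near: n; exact: nbhs_infty_gt.
have LYn : Y n \in Lfun (Q n) 2%:E by near: n.
have mYn := Lfun2_measurable LYn.
rewrite (Rintegral_sample_sum _ _ _ mYn m0 b0).
have -> : v = n%:R * (v / n%:R) by rewrite mulrC divfK.
have -> : c = n%:R * (c / n%:R) by rewrite mulrC divfK.
apply: (@le_trans _ _ (n%:R * r n)); last by near: n.
apply: (iter_increment_gaussian _ _ (w0 n) LYn Tp) => psi psi1 psi2 y Tpsi.
exact: (increment_diff y Tpsi LYn (LZ n)).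
Unshelve. all: by end_near. Qed.

End lindeberg.

(** * Weak convergence and Gaussian factors *)

Section weak_convergence.
Context {R : realType}.
Local Notation Rm := (measurableTypeR R).
Implicit Types (f : R -> R) (a x y e : R).

Lemma uniform_continuity_segment f a c e : continuous f -> 0 < e ->
  \forall n \near \oo, forall x, a <= x <= c ->
    forall y, `|x - y| <= n.+1%:R^-1 -> `|f x - f y| <= e.
Proof.
move=> cf e0; have e2 : 0 < e / 2 by rewrite divr_gt0.
have /compact_near_coveringP cK := @segment_compact R a c.
pose Pr (n : nat) x := forall y, `|x - y| <= n.+1%:R^-1 -> `|f x - f y| <= e.
have := cK nat \oo Pr _ _.
move=> /(_ _)[|N _ H]; last first.
  by exists N => // n /= Nn x xac; apply: (H n Nn); rewrite in_itv.
move=> x _; have := cf x => /cvgrPdist_le/(_ _ e2)/nbhs_ballP[r /= r0 hr].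
have r2 : 0 < r / 2 by rewrite divr_gt0.
exists (ball x (r / 2), [set n | n.+1%:R^-1 < r / 2]) => /=.
  split; first exact: nbhsx_ballx.
  by have := @cvg_harmonic R => /cvgr_lt/(_ _ r2).
move=> [z n] /= [xz nr] y zy.
have h1 : `|f x - f z| <= e / 2.
  by apply: hr; rewrite /ball/=; apply: (lt_trans xz); lra.
have h2 : `|f x - f y| <= e / 2.
  apply: hr; rewrite /ball/=; move: xz; rewrite /ball/= => xz.
  apply: (le_lt_trans (ler_distD z x y)); rewrite [ltRHS]splitr.
  by apply: ltrD => //; exact: le_lt_trans zy nr.
by have := ler_distD (f x) (f z) (f y); rewrite (distrC (f z) (f x)); lra.
Qed.

(** The ramp at a + k del of width parameter del / 3 rises exactly over the k-th cell, so the sum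
    interpolates f at the grid points and is constant outside the grid. *)
Let stairs f a (del : R) := fix stairs m x : R := if m is k.+1 then
  stairs k x + (f (a + k.+1%:R * del) - f (a + k%:R * del)) * ramp (a + k%:R * del) (del / 3) x
  else f a.

Let stairs_left f a del m x : 0 < del -> x <= a -> stairs f a del m x = f a.
Proof.
move=> d0 xa; elim: m => //= m ->; rewrite ramp0 ?mulr0 ?addr0 ?divr_gt0//.
by apply: (le_trans xa); rewrite lerDl mulr_ge0// ltW.
Qed.

Let stairs_right f a del m x : 0 < del -> a + m%:R * del <= x ->
  stairs f a del m x = f (a + m%:R * del).
Proof.
move=> d0; elim: m => [|m IH] mx /=; first by rewrite mul0r addr0.
have mx' : a + m%:R * del <= x by move: mx; rewrite -natr1; lra.
rewrite IH// ramp1 ?divr_gt0//; first by rewrite mulr1 addrC subrK.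
by move: mx; rewrite -natr1; lra.
Qed.

Let stairs_approx f a del e m x : 0 < del ->
  (forall x, a <= x <= a + m%:R * del -> forall y, `|x - y| <= del -> `|f x - f y| <= e) ->
  a <= x <= a + m%:R * del -> `|f x - stairs f a del m x| <= e.
Proof.
move=> d0; elim: m => [|m IH] H /andP[ax xm] /=.
  have -> : x = a by apply/le_anti/andP; split => //; move: xm; rewrite mul0r addr0.
  have e0 : 0 <= e.
    have := H a _ a; rewrite !subrr normr0; apply; rewrite ?(ltW d0)//.
    by rewrite mul0r addr0 !lexx.
  by rewrite subrr normr0.
have E : m.+1%:R * del = m%:R * del + del by rewrite -natr1; ring.
have [xm'|mx] := leP x (a + m%:R * del).
  rewrite ramp0 ?divr_gt0// mulr0 addr0; apply: IH; last by rewrite ax.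
  by move=> z /andP[az zm]; apply: H; rewrite az E/=; lra.
rewrite stairs_right ?(ltW mx)//.
set u := a + m%:R * del in mx *; set w := a + m.+1%:R * del in xm *.
have uw : w = u + del by rewrite /w /u E; ring.
have xi : a <= x <= a + m.+1%:R * del by rewrite ax.
have h1 : `|f x - f u| <= e by apply: H => //; rewrite ger0_norm; lra.
have h2 : `|f x - f w| <= e by apply: H => //; rewrite ler0_norm; lra.
have /andP[r0 r1] := ramp01 u (del / 3) x; move: r0 r1; set r := ramp _ _ _ => r0 r1.
(* Inside a cell the staircase is a convex combination of the values of f at the two ends. *)
have -> : f x - (f u + (f w - f u) * r) = (1 - r) * (f x - f u) + r * (f x - f w) by ring.
have r1' : 0 <= 1 - r by rewrite subr_ge0.
have h3 : `|r * (f x - f w)| <= r * e by rewrite normrM (ger0_norm r0) ler_wpM2l.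
have h4 : `|(1 - r) * (f x - f u)| <= (1 - r) * e by rewrite normrM (ger0_norm r1') ler_wpM2l.
by apply: (le_trans (ler_normD _ _)); lra.
Qed.

Lemma integrable_ramp (N : probability Rm R) a d : 0 < d ->
  N.-integrable setT (EFin \o (ramp a d : Rm -> R)).
Proof.
move=> d0; apply: (@bounded_integrable _ Rm R N (ramp a d) 1).
  exact: measurable_ramp.
exact: ramp_le1.
Qed.

Let integrable_stairs (N : probability Rm R) f a del m : 0 < del ->
  N.-integrable setT (EFin \o (stairs f a del m : Rm -> R)).
Proof.
move=> d0; elim: m => [|m IH].
  exact: Lfun2_integrable (Lfun_cst N (f a) 2).
by apply: integrableDR IH _; apply: integrableZR; apply: integrable_ramp; rewrite divr_gt0.
Qed.

Lemma ramp_tails (mu : probability Rm R) (d : R) e : 0 < d -> 0 < e -> exists k : nat,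
  \int[mu]_x ramp k%:R d x <= e /\ \int[mu]_x (1 - ramp (- k%:R) d x) <= e.
Proof.
move=> d0 e0.
have I1 : mu.-integrable setT (EFin \o (fun _ : Rm => (1 : R))).
  exact: Lfun2_integrable (Lfun_cst mu (1 : R) 2).
have c1 : \int[mu]_x ramp k%:R d x @[k --> \oo] --> (0 : R).
  rewrite -[X in _ --> X](Rintegral_cst1 mu).
  apply: (dominated_Rcvg (g := fun _ : Rm => 1)) => //.
  - by move=> k; exact: measurable_ramp.
  - by move=> k x; exact: ramp_le1.
  - apply: aeW => x; apply: cvg_near_cst.
    have : \forall k \near \oo, (x : R) <= k%:R by exact: nbhs_infty_ger.
    by apply: filterS => k xk; rewrite ramp0.
have c2 : \int[mu]_x (1 - ramp (- k%:R) d x) @[k --> \oo] --> (0 : R).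
  rewrite -[X in _ --> X](Rintegral_cst1 mu).
  apply: (dominated_Rcvg (g := fun _ : Rm => 1)) => //.
  - by move=> k; apply: measurable_funB; [exact: measurable_cst|exact: measurable_ramp].
  - by move=> k x; have /andP[r0 r1] := ramp01 (- k%:R) d (x : R); rewrite ger0_norm; lra.
  - apply: aeW => x; apply: cvg_near_cst.
    have : \forall k \near \oo, 3 * d - (x : R) <= k%:R by exact: nbhs_infty_ger.
    by apply: filterS => k xk; rewrite ramp1 ?subrr//; lra.
have := cvgr_le _ c1 _ e0; have := cvgr_le _ c2 _ e0.
by move=> /(_ _) h2 /(_ _) h1; have [N _ H] := filterI h1 h2; exists N; have [] := H N (leqnn N).
Qed.

(** On a large window f is uniformly close to a finite combination of ramps; outside it the error is
    at most 2 C times two tail ramps. Convergence of those two ramps makes the tails of [nu n] small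
    as well, so tightness comes for free. *)
Lemma weak_cvg_of_ramps (nu : nat -> probability Rm R) (mu : probability Rm R) :
  (forall a d, 0 < d -> \int[nu n]_x ramp a d x @[n --> \oo] --> \int[mu]_x ramp a d x) ->
  forall f, continuous f -> (exists C : R, forall x, `|f x| <= C) ->
  \int[nu n]_x f x @[n --> \oo] --> \int[mu]_x f x.
Proof.
move=> H f cf [C fC].
have C0 : 0 <= C by exact: le_trans (normr_ge0 _) (fC 0).
apply/cvgrPdist_le => e e0.
(* Counts the errors: 1 + 4 C for [mu], whose tails are at most eta; 1 + 8 C for [nu n], whose tails
   are at most 2 eta; and 1 for the staircase. *)
pose eta := e / (12 * C + 3); have k0 : 0 < 12 * C + 3 by lra.
have eta0 : 0 < eta by rewrite divr_gt0.
have [k [t1 t2]] := ramp_tails mu ltr01 eta0.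
have [n0 Un0] : exists n : nat, forall x, - k%:R <= x <= k%:R + 3 ->
    forall y, `|x - y| <= n.+1%:R^-1 -> `|f x - f y| <= eta.
  have [N _ h] := uniform_continuity_segment (- k%:R) (k%:R + 3) cf eta0.
  by exists N; exact: (h N (leqnn N)).
(* The number of cells of width 1/(n0 + 1) needed to cover [-k, k + 3]. *)
pose m := (k.*2 + 3) * n0.+1; pose del : R := n0.+1%:R^-1.
have del0 : 0 < del by rewrite invr_gt0.
have E : - k%:R + m%:R * del = k%:R + 3.
  have nz : n0.+1%:R != 0 :> R by rewrite pnatr_eq0.
  rewrite /m /del natrM mulfK// natrD -addnn natrD; ring.
pose app := stairs f (- k%:R) del m.
have approx x : `|f x - app x| <= eta +
    2 * C * (1 - ramp (- k%:R) 1 x) + 2 * C * ramp k%:R 1 x.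
  have /andP[p0 p1] := ramp01 (- k%:R) 1 x; have /andP[q0 q1] := ramp01 k%:R 1 x.
  have far y : `|f x - f y| <= 2 * C.
    by have := ler_normB (f x) (f y); have := fC x; have := fC y; lra.
  have P0 : 0 <= 2 * C * (1 - ramp (- k%:R) 1 x) by rewrite mulr_ge0 ?mulr_ge0 ?subr_ge0.
  have Q0 : 0 <= 2 * C * ramp k%:R 1 x by rewrite mulr_ge0// mulr_ge0.
  have [xl|xl] := leP x (- k%:R).
    rewrite /app stairs_left// (ramp0 _ xl)// subr0 mulr1.
    by have := far (- k%:R); lra.
  have [xr|xr] := leP (k%:R + 3) x.
    rewrite /app stairs_right ?E// (@ramp1 _ k%:R)// ?mulr1//.
    by have := far (k%:R + 3); lra.
  have : `|f x - app x| <= eta.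
    by apply: stairs_approx => //; rewrite E; [exact: Un0|rewrite !ltW].
  by lra.
have capp : \int[nu n]_x app x @[n --> \oo] --> \int[mu]_x app x.
  rewrite /app; elim: m {E app approx} => [|j IH] /=.
    by rewrite Rintegral_cst1; under eq_fun do rewrite Rintegral_cst1; exact: cvg_cst.
  have d3 : 0 < del / 3 by rewrite divr_gt0.
  have EI (N : probability Rm R) : \int[N]_x (stairs f (- k%:R) del j x +
      (f (- k%:R + j.+1%:R * del) - f (- k%:R + j%:R * del)) *
        ramp (- k%:R + j%:R * del) (del / 3) x) =
      \int[N]_x stairs f (- k%:R) del j x +
      (f (- k%:R + j.+1%:R * del) - f (- k%:R + j%:R * del)) *
      \int[N]_x ramp (- k%:R + j%:R * del) (del / 3) x.
    have Ir := integrable_ramp N (- k%:R + j%:R * del) d3.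
    rewrite (RintegralD _ (integrable_stairs N f (- k%:R) j del0) (integrableZR _ Ir))//.
    by rewrite RintegralZl.
  rewrite EI; under eq_fun do rewrite EI.
  by apply: cvgD => //; apply: cvgMr; exact: H.
have mf : measurable_fun setT f by exact: continuous_measurable_fun.
have If (N : probability Rm R) : N.-integrable setT (EFin \o (f : Rm -> R)).
  exact: (@bounded_integrable _ Rm R N f C).
have Iapp (N : probability Rm R) := integrable_stairs N f (- k%:R) m del0.
have I1 (N : probability Rm R) (c : R) : N.-integrable setT (EFin \o (fun _ : Rm => c)).
  exact: Lfun2_integrable (Lfun_cst N c 2).
have dist (N : probability Rm R) : `|\int[N]_x f x - \int[N]_x app x| <=
    eta + 2 * C * (1 - \int[N]_x ramp (- k%:R) 1 x) + 2 * C * \int[N]_x ramp k%:R 1 x.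
  have Ir a := integrable_ramp N a ltr01.
  have IB : N.-integrable setT (EFin \o (fun x : Rm => 1 - ramp (- k%:R) 1 (x : R))).
    exact: integrableBR (I1 N 1) (Ir _).
  have J1 := integrableZR (2 * C) IB; have J2 := integrableZR (2 * C) (Ir k%:R).
  have J0 := integrableDR (I1 N eta) J1.
  rewrite -(RintegralB _ (If N) (Iapp N))//.
  apply: (@le_trans _ _ (\int[N]_x (eta + 2 * C * (1 - ramp (- k%:R) 1 (x : R)) +
       2 * C * ramp k%:R 1 (x : R)))).
    apply: le_abs_Rintegral; [|exact: approx|exact: integrableDR J0 J2].
    by apply: measurable_funB; apply: integrable_measurable; [exact: If|exact: Iapp].
  rewrite (RintegralD _ J0 J2)// (RintegralD _ (I1 N eta) J1)//.
  rewrite (RintegralZl _ measurableT IB) (RintegralZl _ measurableT (Ir _)) Rintegral_cst1.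
  by rewrite (RintegralB _ (I1 N 1) (Ir _))// Rintegral_cst1.
have t2' : 1 - \int[mu]_x ramp (- k%:R) 1 x <= eta.
  move: t2; rewrite (RintegralB _ (I1 mu 1) (integrable_ramp mu _ ltr01))//.
  by rewrite Rintegral_cst1.
have n1 : \forall n \near \oo, \int[nu n]_x ramp k%:R 1 x <= 2 * eta.
  by apply: cvgr_le; [exact: H|lra].
have n2 : \forall n \near \oo, 1 - 2 * eta <= \int[nu n]_x ramp (- k%:R) 1 x.
  by apply: cvgr_ge; [exact: H|lra].
have n3 : \forall n \near \oo, `|\int[mu]_x app x - \int[nu n]_x app x| <= eta.
  by move/cvgrPdist_le : capp; exact.
near=> n.
have b1 : \int[nu n]_x ramp k%:R 1 x <= 2 * eta by near: n.
have b2 : 1 - 2 * eta <= \int[nu n]_x ramp (- k%:R) 1 x by near: n.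
have b3 : `|\int[mu]_x app x - \int[nu n]_x app x| <= eta by near: n.
have := dist mu; have := dist (nu n).
have := ler_distD (\int[mu]_x app x) (\int[mu]_x f x) (\int[nu n]_x f x).
have := ler_distD (\int[nu n]_x app x) (\int[mu]_x app x) (\int[nu n]_x f x).
rewrite (distrC (\int[nu n]_x app x)).
have c1 : 2 * C * (1 - \int[nu n]_x ramp (- k%:R) 1 x) <= 2 * C * (2 * eta).
  by rewrite ler_wpM2l ?mulr_ge0//; lra.
have c2 : 2 * C * \int[nu n]_x ramp k%:R 1 x <= 2 * C * (2 * eta).
  by rewrite ler_wpM2l ?mulr_ge0.
have c3 : 2 * C * (1 - \int[mu]_x ramp (- k%:R) 1 x) <= 2 * C * eta.
  by rewrite ler_wpM2l ?mulr_ge0.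
have c4 : 2 * C * \int[mu]_x ramp k%:R 1 x <= 2 * C * eta.
  by rewrite ler_wpM2l ?mulr_ge0.
have c5 : e = eta * (12 * C + 3) by rewrite /eta divfK// gt_eqF.
move: b3 c1 c2 c3 c4; move: (Rintegral mu setT f) (Rintegral (nu n) setT f)
  (Rintegral mu setT app) (Rintegral (nu n) setT app).
move=> A1 A2 A3 A4 b3 c1 c2 c3 c4 d1 d2 d3 d4.
by clear - b3 c1 c2 c3 c4 c5 d1 d2 d3 d4; lra.
Unshelve. all: by end_near. Qed.

End weak_convergence.

Lemma ultra_limit {T : Type} {R : realType} (U : set_system T) (g : T -> R) (C : R) :
  UltraFilter U -> (forall t, `|g t| <= C) -> exists l : R, g t @[t --> U] --> l.
Proof.
move=> UU gC.
have [l [_ cl]] : `[- C, C]%classic `&` cluster (g @ U) !=set0.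
  apply: (@segment_compact R (- C) C (g @ U)).
  have UP : ProperFilter U by exact: ultra_proper.
  apply: (@filterE _ U) => t.
  by rewrite /= in_itv/= -ler_norml.
exists l; apply/cvgrPdist_lt => e e0.
have [//|nU] := in_ultra_setVsetC [set t | `|l - g t| < e] UU.
have [y [/= ly yl]] := cl _ _ (nU : (g @ U) [set y | ~ (`|l - y| < e)]) (nbhsx_ballx l e e0).
by [].
Qed.

(** * Laws on the line through their tails *)

Section real_line_probabilities.
Context {R : realType}.
Local Notation Rm := (measurableTypeR R).
Implicit Types (M : probability Rm R) (g : R -> R) (a c x y : R).

Definition tail M x : R := \int[M]_y (x < y :> R)%R%:R.

Lemma measurable_indicator_gt x : measurable_fun setT (fun y : R => (x < y)%R%:R : R).
Proof.
apply: measurable_natb; apply: measurable_fun_ltr; [exact: measurable_cst|exact: measurable_id].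
Qed.

Lemma natb_le1 (b : bool) : `|b%:R : R| <= 1.
Proof. by case: b; rewrite ?normr1 ?normr0. Qed.

Lemma integrable_natb M (b : R -> bool) : measurable_fun setT b ->
  M.-integrable setT (EFin \o (fun y : Rm => (b y)%:R : R)).
Proof.
move=> mb; apply: (@bounded_integrable _ Rm R M _ 1); first exact: measurable_natb.
by move=> y; exact: natb_le1.
Qed.

Lemma measurable_itv_gt x : measurable_fun setT (fun y : R => (x < y)%R).
Proof. by apply: measurable_fun_ltr; [exact: measurable_cst|exact: measurable_id]. Qed.

Lemma tailE M x : (tail M x)%:E = M `]x, +oo[%classic.
Proof.
rewrite /tail EFin_Rintegral; last exact: integrable_natb (measurable_itv_gt x).
rewrite -[in RHS](setIT `]x, +oo[%classic) -integral_indic//; apply: eq_integral => y _.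
by rewrite indicE mem_setE/= in_itv/= andbT.
Qed.

Lemma tail01 M x : 0 <= tail M x <= 1.
Proof. by rewrite -!lee_fin tailE measure_ge0 probability_le1. Qed.

Lemma probability_eq_tail (M N : probability Rm R) :
  (forall x, tail M x = tail N x) -> forall A, measurable A -> M A = N A.
Proof.
move=> MN.
have E x : M `]x, +oo[%classic = N `]x, +oo[%classic by rewrite -!tailE MN.
apply: (@measure_unique _ R Rm (@RGenOInfty.G R) (fun n => `](- n%:R : R), +oo[%classic)).
- exact: RGenOInfty.measurableE.
- move=> _ _ [x ->] [y ->]; exists (Num.max x y).
  by apply/seteqP; split => z /=; rewrite !in_itv/= !andbT gt_max => /andP.
- by move=> n; exists (- n%:R).
- apply/seteqP; split => // x _; have := nbhs_infty_gtr (- x : R) => -[n _ h].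
  by exists n => //=; rewrite in_itv/= andbT ltrNl; exact: (h n (leqnn n)).
- by move=> _ [x ->]; exact: E.
- by move=> n; apply: (le_lt_trans (probability_le1 _ _)) => //; exact: ltry.
Qed.

(** Ramps starting at a with width tending to 0 converge pointwise to the indicator of x > a, so
    their integrals determine the tails. *)
Lemma probability_eq_ramps (M N : probability Rm R) :
  (forall a d, 0 < d -> \int[M]_x ramp a d x = \int[N]_x ramp a d x) ->
  forall A, measurable A -> M A = N A.
Proof.
move=> MN; apply: probability_eq_tail => a.
have cv (K : probability Rm R) : \int[K]_x ramp a n.+1%:R^-1 x @[n --> \oo] --> tail K a.
  apply: (dominated_Rcvg (g := fun _ : Rm => 1)) => //.
  - by move=> n; apply: measurable_ramp; rewrite invr_gt0.
  - exact: measurable_indicator_gt.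
  - exact: Lfun2_integrable (Lfun_cst K (1 : R) 2).
  - by move=> n x; exact: ramp_le1.
  - apply: aeW => x; apply: cvg_near_cst.
    have [ax|xa] := ltP a (x : R); last first.
      by apply: nearW => n; rewrite ramp0// invr_gt0.
    have e0 : 0 < ((x : R) - a) / 3 by rewrite divr_gt0// subr_gt0.
    have := @cvg_harmonic R => /cvgr_lt/(_ _ e0); apply: filterS => n h.
    rewrite ramp1 ?invr_gt0//.
    have : n.+1%:R^-1 * 3 < (x : R) - a by rewrite -ltr_pdivlMr.
    by move/ltW; rewrite lerBrDl mulrC.
have := cv N; under eq_fun do rewrite -MN ?invr_gt0//.
by move=> cN; have := cvg_unique _ (cv M) cN; apply.
Qed.

(* u <= ceil (k u) / k <= u + 1 / k *)
Lemma layer_cake_sum (k : nat) (u : R) : 0 <= u <= 1 -> (0 < k)%N ->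
  k%:R * u <= \sum_(i < k) (i%:R / k%:R < u)%R%:R <= k%:R * u + 1.
Proof.
move=> /andP[u0 u1] k0; have kR : 0 < k%:R :> R by rewrite ltr0n.
have E (i : nat) : (i%:R / k%:R < u) = (i%:R < k%:R * u) by rewrite ltr_pdivrMr// mulrC.
under eq_bigr do rewrite E.
set w := k%:R * u; have w0 : 0 <= w by rewrite mulr_ge0// ltW.
have wk : w <= k%:R by rewrite ler_piMr// ltW.
have H (m : nat) : Num.min w m%:R <= \sum_(i < m) (i%:R < w)%R%:R <= Num.min (w + 1) m%:R.
  elim: m => [|m /andP[h1 h2]]; first by rewrite big_ord0 le_min ge_min lexx orbT/= addr_ge0// lexx.
  rewrite big_ord_recr/= -natr1; move: h1 h2; rewrite le_min ge_min.
  set s := \sum_(i < m) _ => h1 /andP[h2 h3].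
  have w1 : w <= w + 1 by rewrite lerDl.
  case: (ltP m%:R w) => mw /=.
    rewrite le_min ge_min; apply/andP; split.
      by case/orP: h1 => h; apply/orP; right; lra.
    by apply/andP; split; lra.
  rewrite addr0 le_min ge_min; apply/andP; split.
    by case/orP: h1 => h; apply/orP; left; lra.
  by apply/andP; split; lra.
have /andP[h1 h2] := H k; move: h1 h2; rewrite (min_idPl wk) => ->/=.
by rewrite le_min => /andP[].
Qed.

(** A superlevel set of a monotone continuous function is empty, everything, or an open right
    half-line starting at the supremum of its complement; the Lipschitz bound provides the
    openness. *)
Lemma sublevel_cases g (K c : R) : 0 <= K -> {homo g : x y / x <= y} ->
  (forall x y, `|g x - g y| <= K * `|x - y|) ->
  [\/ forall y, c < g y, forall y, g y <= c | exists x, forall y, (c < g y) = (x < y)].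
Proof.
move=> K0 gm gL.
have [|/existsNP[y1 /negP]] := pselect (forall y, c < g y); first by constructor 1.
rewrite -leNgt => g1.
have [|/existsNP[y2 /negP]] := pselect (forall y, g y <= c); first by constructor 2.
rewrite -ltNge => g2; constructor 3.
pose E := [set y | g y <= c].
have ub : ubound E y2.
  by move=> y Ey; rewrite leNgt; apply/negP => /ltW/gm; rewrite leNgt (le_lt_trans Ey g2).
have hE : has_sup E by split; [exists y1|exists y2].
exists (sup E) => y; apply/idP/idP.
  move=> cy; rewrite ltNge; apply/negP => yE.
  have e0 : 0 < (g y - c) / (K + 1) by rewrite divr_gt0 ?subr_gt0// ltr_wpDl.
  have [z Ez zE] := sup_adherent e0 hE.
  have [yz|zy] := leP y z.
    by have := gm _ _ yz; rewrite leNgt (le_lt_trans Ez cy).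
  have zy' : y - z <= (g y - c) / (K + 1) by lra.
  have := gL y z; rewrite (gtr0_norm (_ : 0 < y - z)) ?subr_gt0// => h.
  have h2 : K * (y - z) <= K * ((g y - c) / (K + 1)) by rewrite ler_wpM2l.
  have h3 : g y - g z <= K * (y - z) by exact: le_trans (ler_norm _) h.
  have h4 : K * ((g y - c) / (K + 1)) < g y - c.
    rewrite mulrA mulrAC -subr_gt0.
    have -> : g y - c - K / (K + 1) * (g y - c) = (g y - c) / (K + 1).
      by field; rewrite gt_eqF// ltr_wpDl.
    exact: e0.
  by move: Ez; rewrite /E/=; lra.
move=> Ey; rewrite ltNge; apply/negP => yc.
by have := ub_le_sup hE.2 (yc : E y); rewrite leNgt Ey.
Qed.

End real_line_probabilities.

Lemma ler_cvg_along {T : Type} {R : realFieldType} {F : set_system T}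
    {FF : ProperFilter F} (f g : T -> R) (l m : R) :
  f @ F --> l -> g @ F --> m -> (\forall t \near F, f t <= g t) -> l <= m.
Proof.
move=> fl gm fg; rewrite -subr_ge0; apply: (cvgr_to_ge (F := F) (cvgB gm fl)).
by apply: filterS fg => t; rewrite subr_ge0.
Qed.

(* An ultrafilter stands in for Prokhorov's theorem: the tails of any tight
   family converge along it, and the right-continuous modification of one minus
   their limit is a distribution function. *)
Section subsequential_limit.
Context {R : realType}.
Local Notation Rm := (measurableTypeR R).
Implicit Types (M : probability Rm R) (g : R -> R) (a c x y : R).

Variable U : set_system (probability Rm R).
Hypothesis UU : UltraFilter U.
Let UP : ProperFilter U. Proof. exact: ultra_proper. Qed.
#[local] Existing Instance UP.

Hypothesis tight_right : forall e : R, 0 < e -> exists x, \forall M \near U, tail M x <= e.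
Hypothesis tight_left : forall e : R, 0 < e -> exists x, \forall M \near U, 1 - e <= tail M x.

Let F x : R := lim (tail M x @[M --> U]).

Let cvgF x : tail M x @[M --> U] --> F x.
Proof.
have [l hl] : exists l : R, tail M x @[M --> U] --> l.
  apply: (@ultra_limit _ _ U (fun M => tail M x) 1) => // M.
  by have /andP[h0 h1] := tail01 M x; rewrite ger0_norm.
exact: (cvgP l hl).
Qed.
Arguments cvgF : clear implicits.

Let F01 x : 0 <= F x <= 1.
Proof.
apply/andP; split.
  by apply: ler_cvg_along (cvg_cst 0) (cvgF x) _; apply: nearW => M; case/andP: (tail01 M x).
by apply: ler_cvg_along (cvgF x) (cvg_cst (1 : R)) _; apply: nearW => M; case/andP: (tail01 M x).
Qed.

Let tail_nonincreasing M x y : x <= y -> tail M y <= tail M x.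
Proof.
move=> xy; apply: le_Rintegral => //.
- exact: integrable_natb (measurable_itv_gt y).
- exact: integrable_natb (measurable_itv_gt x).
- move=> z _; have [yz|_] := ltP y (z : R); last exact: ler0n.
  by rewrite (le_lt_trans xy yz).
Qed.

Let Fmono x y : x <= y -> F y <= F x.
Proof.
move=> xy; apply: ler_cvg_along (cvgF y) (cvgF x) _.
by apply: nearW => M; exact: tail_nonincreasing.
Qed.

Let G x : R := sup [set F y | y in [set y | x < y]].

Let hasG x : has_sup [set F y | y in [set y | x < y]].
Proof.
split; first by exists (F (x + 1)), (x + 1) => //=; rewrite ltrDl.
by exists 1 => _ [y _ <-]; case/andP: (F01 y).
Qed.

Let FG x y : x < y -> F y <= G x.
Proof. by move=> xy; apply: ub_le_sup; [exact: (hasG x).2|exists y]. Qed.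

Let GF x : G x <= F x.
Proof. by apply: ge_sup; [exact: (hasG x).1|move=> _ [y /= /ltW xy <-]; exact: Fmono]. Qed.

Let cdfG x : R := 1 - G x.

Let cdfG_nd : nondecreasing cdfG.
Proof.
move=> x y xy; rewrite /cdfG lerD2l lerN2; apply: ge_sup; first exact: (hasG y).1.
by move=> _ [z /= yz <-]; apply: FG; exact: le_lt_trans xy yz.
Qed.

Let cdfG_rc : right_continuous cdfG.
Proof.
move=> x; apply/cvgrPdist_le => e e0.
have [_ [y /= xy <-] h] := sup_adherent e0 (hasG x); rewrite -/(G x) in h.
near=> z; have xz : x < z by near: z; exact: nbhs_right_gt.
have zy : z < y by near: z; exact: nbhs_right_lt.
have h1 := FG zy; have h2 := cdfG_nd (ltW xz); move: h2; rewrite /cdfG => h2.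
by rewrite ler_norml; apply/andP; split; lra.
Unshelve. all: by end_near. Qed.

Let G01 x : 0 <= G x <= 1.
Proof.
have h1 := FG (ltr_pwDr ltr01 (lexx x)); have h2 := GF x.
by have /andP[h3 _] := F01 (x + 1); have /andP[_ h4] := F01 x; apply/andP; split; lra.
Qed.

Let cdfG_Ny : cdfG x @[x --> -oo] --> (0 : R).
Proof.
apply/cvgrPdist_le => e e0; have [x hx] := tight_left e0.
have Fx : 1 - e <= F x by exact: ler_cvg_along (cvg_cst _) (cvgF x) hx.
near=> y; have yx : y < x by near: y; apply: nbhs_ninfty_lt; rewrite num_real.
have h := FG yx; have /andP[_ h1] := G01 y.
by rewrite /cdfG ler_norml; apply/andP; split; lra.
Unshelve. all: by end_near. Qed.

Let cdfG_y : cdfG x @[x --> +oo] --> (1 : R).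
Proof.
apply/cvgrPdist_le => e e0; have [x hx] := tight_right e0.
have Fx : F x <= e by exact: ler_cvg_along (cvgF x) (cvg_cst _) hx.
near=> y; have yx : x < y by near: y; apply: nbhs_pinfty_gt; rewrite num_real.
have h := GF y; have h2 := Fmono (ltW yx); have /andP[h1 _] := G01 y.
by rewrite /cdfG ler_norml; apply/andP; split; lra.
Unshelve. all: by end_near. Qed.

#[local] HB.instance Definition _ := isCumulative.Build R _ R cdfG cdfG_nd cdfG_rc.
#[local] HB.instance Definition _ := isCumulativeBounded.Build R 0 1 cdfG cdfG_Ny cdfG_y.

Let exists_tail_limit : exists Mi : probability Rm R, forall x, tail Mi x = G x.
Proof.
exists (lebesgue_stieltjes_measure cdfG) => x.
apply: EFin_inj; rewrite tailE.
have := @cdf_lebesgue_stieltjes_id R cdfG x.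
rewrite /cdf /distribution /pushforward /= preimage_id => E.
rewrite -setCitvl probability_setC//= E.
by rewrite -EFinB /cdfG; congr EFin; ring.
Qed.

(** By the layer-cake formula the integral of g is, up to 1 / k, an average of k tails. At a jump
    the limit F of the tails may exceed the tail G of the limit law; but F (x + del) <= G x <= F x,
    and the Lipschitz constant absorbs the shift by del. *)
Theorem exists_ultra_limit : exists Mi : probability Rm R,
  forall (g : R -> R) (K : R), 0 <= K -> measurable_fun setT g -> {homo g : x y / x <= y} ->
    (forall x, 0 <= g x <= 1) -> (forall x y, `|g x - g y| <= K * `|x - y|) ->
    (fun M : probability Rm R => \int[M]_x g x) @ U --> \int[Mi]_x g x.
Proof.
have [Mi tailMi] := exists_tail_limit; exists Mi => g K K0 mg gm g01 gL.
have gC x : `|g x| <= 1 by have /andP[h0 h1] := g01 x; rewrite ger0_norm.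
have Ig M : M.-integrable setT (EFin \o (g : Rm -> R)).
  exact: (@bounded_integrable _ Rm R M g 1).
(* Translating g by [del] moves its superlevel half-line from x to x + del, where F is already below
   G x. *)
pose shift del y : R := g (y - del).
have mshift del : measurable_fun setT (shift del).
  by apply: measurableT_comp mg _; apply: measurable_funB => //; exact: measurable_cst.
have Ishift M del : M.-integrable setT (EFin \o (shift del : Rm -> R)).
  by apply: (@bounded_integrable _ Rm R M (shift del) 1); [exact: mshift|move=> x; exact: gC].
pose lvl M del c : R := \int[M]_y (c < shift del y)%R%:R.
have mlt del c : measurable_fun setT (fun y => c < shift del y).
  by apply: measurable_fun_ltr => //; exact: measurable_cst.
have sandwich M del (k : nat) : (0 < k)%N ->
    k%:R * \int[M]_y shift del y <= \sum_(i < k) lvl M del (i%:R / k%:R) <=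
    k%:R * \int[M]_y shift del y + 1.
  move=> k0.
  have I1 : M.-integrable setT (EFin \o (fun _ : Rm => (1 : R))).
    exact: Lfun2_integrable (Lfun_cst M (1 : R) 2).
  have IS : M.-integrable setT (EFin \o (fun y : Rm =>
      \sum_(i < k) (i%:R / k%:R < shift del y)%R%:R : R)).
    by apply: integrable_sumR => i; exact: integrable_natb (mlt del _).
  have Ik := integrableZR k%:R (Ishift M del).
  rewrite /lvl -(Rintegral_sum (mu := M) (index_enum _) (F := fun (i : 'I_k) (y : Rm) =>
    (i%:R / k%:R < shift del y)%R%:R)); last first.
    by move=> i; exact: integrable_natb (mlt del _).
  rewrite -(RintegralZl _ measurableT (Ishift M del)).
  apply/andP; split; first by apply: le_Rintegral => // y _; case/andP: (layer_cake_sum (g01 (y - del)) k0).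
  rewrite -[X in _ <= _ + X](Rintegral_cst1 M) -(RintegralD measurableT Ik I1).
  by apply: le_Rintegral => //; [exact: integrableDR Ik I1|move=> y _; case/andP: (layer_cake_sum (g01 (y - del)) k0)].
have shift0 : shift 0 = g by apply/funext => y; rewrite /shift subr0.
have lvl_lim del c : 0 <= del -> exists l : R, lvl M del c @[M --> U] --> l /\
    (del = 0 -> lvl Mi 0 c <= l) /\ (0 < del -> l <= lvl Mi 0 c).
  move=> del0; have [H|H|[x H]] := sublevel_cases c K0 gm gL.
  - have E M e : lvl M e c = 1.
      by rewrite /lvl -[RHS](Rintegral_cst1 M); apply: eq_Rintegral => y _; rewrite H.
    by exists 1; split; [under eq_fun do rewrite E; exact: cvg_cst|rewrite E lexx].
  - have E M e : lvl M e c = 0.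
      rewrite /lvl -[RHS](Rintegral_cst1 M); apply: eq_Rintegral => y _.
      by rewrite ltNge H.
    by exists 0; split; [under eq_fun do rewrite E; exact: cvg_cst|rewrite E lexx].
  - have E M e : lvl M e c = tail M (x + e).
      by rewrite /lvl /tail; apply: eq_Rintegral => y _; rewrite H ltrBrDr.
    exists (F (x + del)); split; first by under eq_fun do rewrite E; exact: cvgF.
    rewrite E addr0 tailMi; split=> [->|d0]; first by rewrite addr0.
    by apply: FG; rewrite ltrDl.
have [l hl] : exists l : R, (fun M : probability Rm R => \int[M]_x g x) @ U --> l.
  apply: (@ultra_limit _ _ U (fun M => \int[M]_x g x) 1) => // M.
  exact: (@normr_Rintegral_le _ Rm R M g 1).
suff -> : \int[Mi]_x g x = l by [].
have sum_lim del (k : nat) : 0 <= del -> exists s : R,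
    \sum_(i < k) lvl M del (i%:R / k%:R) @[M --> U] --> s /\
    (del = 0 -> \sum_(i < k) lvl Mi 0 (i%:R / k%:R) <= s) /\
    (0 < del -> s <= \sum_(i < k) lvl Mi 0 (i%:R / k%:R)).
  move=> d0; pose s (i : 'I_k) := projT1 (cid (lvl_lim del (i%:R / k%:R) d0)).
  have hs (i : 'I_k) := projT2 (cid (lvl_lim del (i%:R / k%:R) d0)).
  exists (\sum_(i < k) s i); split.
    elim: (index_enum _) => [|i r IH].
      by under eq_fun do rewrite big_nil; rewrite big_nil; exact: cvg_cst.
    under eq_fun do rewrite big_cons; rewrite big_cons.
    by apply: cvgD => //; exact: (hs i).1.
  by split=> h; apply: ler_sum => i _; [exact: (hs i).2.1|exact: (hs i).2.2].
have up (k : nat) : (0 < k)%N -> k%:R * \int[Mi]_x g x <= k%:R * l + 1.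
  move=> k0; have [s [h1 [h2 _]]] := sum_lim 0 k (lexx 0).
  have /andP[h3 _] := sandwich Mi 0 k k0; rewrite shift0 in h3.
  apply: (le_trans h3); apply: (le_trans (h2 erefl)).
  have h4 : (fun M : probability Rm R => k%:R * (\int[M]_x g x) + 1) @ U --> k%:R * l + 1.
    by apply: cvgD; [exact: cvgMr|exact: cvg_cst].
  apply: ler_cvg_along h1 h4 _; apply: nearW => M.
  by have /andP[_] := sandwich M 0 k k0; rewrite shift0.
have dn (k : nat) del : (0 < k)%N -> 0 < del -> k%:R * (l - K * del) <= k%:R * \int[Mi]_x g x + 1.
  move=> k0 d0; have [s [h1 [_ h2]]] := sum_lim del k (ltW d0).
  have /andP[_ h3] := sandwich Mi 0 k k0; rewrite shift0 in h3.
  apply: (le_trans _ h3); apply: (le_trans _ (h2 d0)).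
  have h4 : (fun M : probability Rm R => k%:R * (\int[M]_x g x - K * del)) @ U --> k%:R * (l - K * del).
    by apply: cvgMr; apply: cvgB => //; exact: cvg_cst.
  apply: ler_cvg_along h4 h1 _; apply: nearW => M.
  have /andP[h5 _] := sandwich M del k k0; apply: (le_trans _ h5).
  rewrite ler_wpM2l// lerBlDr.
  have Ic : M.-integrable setT (EFin \o (fun _ : Rm => K * del)).
    exact: Lfun2_integrable (Lfun_cst M (K * del) 2).
  rewrite -[X in _ <= _ + X](Rintegral_cst1 M) -(RintegralD measurableT (Ishift M del) Ic).
  apply: (le_Rintegral measurableT (Ig M) (integrableDR (Ishift M del) Ic)).
  move=> y _; have := gL y (y - del).
  have -> : (y : R) - (y - del) = del by ring.
  rewrite (gtr0_norm d0) -/(shift del y) => h; have := ler_norm (g y - shift del y).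
  by move: h; move: (shift del y) (g y) => p q; lra.
(* Removes the layer-cake error by letting the number of layers grow. *)
have div_le (u w : R) : (forall k : nat, (0 < k)%N -> k%:R * u <= k%:R * w + 1) -> u <= w.
  move=> H; rewrite leNgt; apply/negP => wu.
  have d0 : 0 < u - w by rewrite subr_gt0.
  have := @cvg_harmonic R => /cvgr_lt/(_ _ d0)[n _ /(_ n (leqnn n))] /=.
  rewrite /harmonic => h; have := H n.+1 (ltn0Sn n).
  have nR : 0 < n.+1%:R :> R by rewrite ltr0n.
  move: h; rewrite -(ltr_pM2l nR) divff ?gt_eqF// mulrBr; lra.
apply/le_anti/andP; split; first exact: div_le up.
have : forall del, 0 < del -> l - K * del <= \int[Mi]_x g x.
  by move=> del d0; apply: div_le => k k0; exact: dn.
move=> H; rewrite leNgt; apply/negP => lt; set I := \int[Mi]_x g x in H lt.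
have d0 : 0 < (l - I) / (2 * (K + 1)) by rewrite divr_gt0 ?subr_gt0// mulr_gt0// ltr_wpDl.
have := H _ d0.
have K1 : K + 1 != 0 by rewrite gt_eqF// ltr_wpDl.
have : K * ((l - I) / (2 * (K + 1))) <= (l - I) / 2.
  have -> : K * ((l - I) / (2 * (K + 1))) = (l - I) / 2 - (l - I) / (2 * (K + 1)) by field.
  lra.
lra.
Qed.

End subsequential_limit.

(** * Gaussian factors by compactness *)

Section gaussian_factor.
Context {R : realType}.
Local Notation Rm := (measurableTypeR R).
Implicit Types (L M : probability Rm R) (v a d x y e : R).

Lemma average_ramp N a d : 0 < d ->
  [/\ measurable_fun setT (average N (ramp a d)),
      {homo average N (ramp a d) : x y / x <= y},
      forall x, 0 <= average N (ramp a d) x <= 1 &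
      forall x y, `|average N (ramp a d) x - average N (ramp a d) y| <= d^-1 * `|x - y|].
Proof.
move=> d0; have mr : measurable_fun setT (ramp a d : R -> R) by exact: measurable_ramp.
have I x := integrable_shift N x mr (ramp_le1 a d).
split.
- exact: measurable_average (ramp_le1 a d).
- move=> x y xy; apply: (le_Rintegral measurableT (I x) (I y)) => z _.
  by apply: ramp_nondecreasing => //; rewrite lerD2r.
- move=> x; apply/andP; split.
    by apply: Rintegral_ge0 => z _; case/andP: (ramp01 a d (x + (z : R))).
  apply: (le_trans (ler_norm _)); apply: normr_Rintegral_le; first exact: measurable_shift.
  by move=> z; exact: ramp_le1.
- move=> x y; rewrite /average -(RintegralB measurableT (I x) (I y)).
  apply: normr_Rintegral_le.
    by apply: measurable_funB; exact: measurable_shift.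
  move=> z; apply: (le_trans (ramp_lipschitz a (x + (z : R)) (y + (z : R)) d0)).
  by rewrite opprD addrACA subrr addr0.
Qed.

Lemma image_sum_probability (N M : probability Rm R) : exists nu : probability Rm R,
  (forall A, measurable A ->
     nu A = pushforward (N \x M)%E (fun z : Rm * Rm => z.1 + z.2 : Rm) A) /\
  forall a d, 0 < d -> \int[nu]_x ramp a d x = \int[M]_x average N (ramp a d) x.
Proof.
have ms : measurable_fun setT (fun z : Rm * Rm => (z.1 : R) + (z.2 : R) : Rm).
  exact: measurable_funD.
have [nu nuE] := image_probability (N \x M : probability _ R)%E ms.
exists nu; split => // a d d0.
have mr : measurable_fun setT (ramp a d : Rm -> R) by exact: measurable_ramp.
have I : (N \x M)%E.-integrable setT (EFin \o (fun z : Rm * Rm => ramp a d ((z.1 : R) + (z.2 : R)))).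
  apply: (@bounded_integrable _ _ R (N \x M : probability _ R)%E _ 1).
    exact: measurableT_comp mr ms.
  by move=> z; exact: ramp_le1.
rewrite (Rintegral_image (fun A _ => nuE A) ms mr).
apply: EFin_inj; rewrite EFin_Rintegral//.
rewrite -(integral21_prod_meas1 I).
have [mg _ g01 _] := average_ramp N a d0.
rewrite EFin_Rintegral; last first.
  apply: (@bounded_integrable _ Rm R M _ 1); first exact: mg.
  by move=> x; have /andP[h0 h1] := g01 (x : R); rewrite ger0_norm.
apply: eq_integral => y _; rewrite /fubini_G/= /average EFin_Rintegral; last first.
  exact: (integrable_shift N y (measurable_ramp a d0) (ramp_le1 a d)).
by apply: eq_integral => x _; rewrite addrC.
Qed.

(** Approximate factors for finitely many ramps form a filter base; a finer ultrafilter has a limit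
    law as soon as the factors are tight, and tightness is inherited from L because convolution by a
    fixed Gaussian alters a wide ramp only slightly. *)
Theorem gaussian_factor_of_approximation v L : 0 <= v ->
  (forall (l : seq (R * R)) e, 0 < e -> exists M : probability Rm R,
     forall p, p \in l -> 0 < p.2 ->
       `|\int[M]_x average (centered_gaussian v) (ramp p.1 p.2) x -
         \int[L]_x ramp p.1 p.2 x| <= e) ->
  has_gaussian_factor v L.
Proof.
move=> v0 H; set N := centered_gaussian v in H *.
pose B (i : seq (R * R) * R) : set (probability Rm R) := [set M : probability Rm R | forall p, p \in i.1 -> 0 < p.2 ->
  `|\int[M]_x average N (ramp p.1 p.2) x - \int[L]_x ramp p.1 p.2 x| <= i.2].
pose D : set (seq (R * R) * R) := [set i | 0 < i.2].
have FF : ProperFilter (filter_from D B).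
  apply: filter_from_proper; last by move=> [l e] /= e0; have [M hM] := H l e e0; exists M.
  apply: filter_from_filter; first by exists ([::], 1); exact: (ltr01 : (0 : R) < 1).
  move=> [l e] [l' e'] /= e0 e'0; exists (l ++ l', Num.min e e') => /=.
    by rewrite /D/= lt_min e0.
  move=> M hM; split=> p pl p0; have := hM p; rewrite mem_cat pl ?orbT => /(_ isT p0).
    by rewrite le_min => /andP[].
  by rewrite le_min => /andP[].
have [U [UU FU]] := ultraFilterLemma FF.
have UP : ProperFilter U by exact: ultra_proper.
have near_ramp a d e : 0 < d -> 0 < e -> U [set M : probability Rm R |
    `|\int[M]_x average N (ramp a d) x - \int[L]_x ramp a d x| <= e].
  move=> d0 e0; apply: FU; exists ([:: (a, d)], e) => // M hM.
  by apply: (hM (a, d)) => //; rewrite mem_seq1.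
(* Wide enough that averaging over the Gaussian changes a ramp by at most 1/4. Where the ramp is 1
   twice the average is then at least 1, and where it is 0 twice the average minus 1 is at most 0;
   both tails of M are thus controlled by integrals of averaged ramps. *)
pose w := 4 * Num.sqrt v + 1.
have w0 : 0 < w by rewrite ltr_wpDl// mulr_ge0// sqrtr_ge0.
have close a x : `|average N (ramp a w) x - ramp a w x| <= 1 / 4.
  have h : 0 <= w^-1 by rewrite invr_ge0 ltW.
  have lip y z := ramp_lipschitz a y z w0.
  have b : w^-1 * Num.sqrt v <= 1 / 4 by rewrite mulrC ler_pdivrMr// /w; lra.
  exact: le_trans (average_gaussian_lipschitz v0 x (measurable_ramp a w0) (ramp_le1 a w) h lip) b.
have Iavg M a d : 0 < d -> M.-integrable setT (EFin \o (average N (ramp a d) : Rm -> R)).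
  move=> d0; have [mg _ g01 _] := average_ramp N a d0.
  apply: (@bounded_integrable _ Rm R M _ 1); first exact: mg.
  by move=> x; have /andP[h0 h1] := g01 (x : R); rewrite ger0_norm.
have I1 M (c : R) : M.-integrable setT (EFin \o (fun _ : Rm => c)).
  exact: Lfun2_integrable (Lfun_cst M c 2).
have right e : 0 < e -> exists x, \forall M \near U, tail M x <= e.
  move=> e0; have e4 : 0 < e / 4 by rewrite divr_gt0.
  have [k [hk _]] := ramp_tails L w0 e4; exists (k%:R + 3 * w).
  apply: filterS (near_ramp k%:R w _ w0 e4) => M /= hM.
  have [_ _ g01 _] := average_ramp N k%:R w0.
  have J := integrableZR 2 (Iavg M k%:R w w0).
  have : tail M (k%:R + 3 * w) <= \int[M]_x (2 * average N (ramp k%:R w) x).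
    apply: (le_Rintegral measurableT _ J); first exact: integrable_natb (measurable_itv_gt _).
    move=> y _; have /andP[g0 _] := g01 (y : R).
    have [yk|_] := ltP (k%:R + 3 * w) (y : R); last by rewrite mulr_ge0.
    have := close k%:R (y : R); rewrite (ramp1 w0 (ltW yk)) ler_norml => /andP[+ _].
    by rewrite [true%:R]mulr1n; move: (average N (ramp k%:R w) y) => q; lra.
  rewrite (RintegralZl _ measurableT (Iavg M k%:R w w0)).
  move: hM; rewrite ler_norml => /andP[_].
  by move: (tail M _) (Rintegral M setT _) (Rintegral L setT _) hk => p q r; lra.
have left e : 0 < e -> exists x, \forall M \near U, 1 - e <= tail M x.
  move=> e0; have e4 : 0 < e / 4 by rewrite divr_gt0.
  have [k [_ hk]] := ramp_tails L w0 e4; exists (- k%:R).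
  apply: filterS (near_ramp (- k%:R) w _ w0 e4) => M /= hM.
  have [_ _ g01 _] := average_ramp N (- k%:R) w0.
  have J := integrableZR 2 (Iavg M (- k%:R) w w0).
  have : \int[M]_x (2 * average N (ramp (- k%:R) w) x - 1) <= tail M (- k%:R).
    apply: (le_Rintegral measurableT (integrableBR J (I1 M 1))).
      exact: integrable_natb (measurable_itv_gt _).
    move=> y _; have /andP[_ g1] := g01 (y : R).
    have [_|yk] := ltP (- k%:R) (y : R); first by rewrite [true%:R]mulr1n; move: (average N (ramp (- k%:R) w) y) g1 => q; lra.
    have := close (- k%:R) (y : R); rewrite (ramp0 w0 yk) ler_norml => /andP[_].
    by rewrite [false%:R]mulr0n; move: (average N (ramp (- k%:R) w) y) => q; lra.
  rewrite (RintegralB measurableT J (I1 M 1)) Rintegral_cst1.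
  rewrite (RintegralZl _ measurableT (Iavg M _ w w0)).
  move: hk; rewrite (RintegralB measurableT (I1 L 1) (integrable_ramp L _ w0)) Rintegral_cst1.
  move: hM; rewrite ler_norml => /andP[+ _].
  by move: (tail M _) (Rintegral M setT _) (Rintegral L setT _) => p q r; lra.
have [Mi HMi] := exists_ultra_limit UU right left.
have [nu [nuE nuR]] := image_sum_probability N Mi.
exists Mi => A mA; rewrite -(nuE A mA).
apply: probability_eq_ramps mA => a d d0; rewrite (nuR a d d0).
have [mg gm g01 gL] := average_ramp N a d0.
have d'0 : 0 <= d^-1 by rewrite invr_ge0 ltW.
have c1 := HMi _ _ d'0 mg gm g01 gL.
have c2 : (fun M : probability Rm R => \int[M]_x average N (ramp a d) x) @ U --> \int[L]_x ramp a d x.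
  apply/cvgrPdist_le => e e0; apply: filterS (near_ramp a d e d0 e0) => M /=.
  by rewrite distrC.
by have := cvg_unique _ c2 c1; apply.
Qed.

End gaussian_factor.

(** * Local likelihoods *)

Lemma cvg_inv_sqrtn {R : realType} : (Num.sqrt n%:R)^-1 @[n --> \oo] --> (0 : R).
Proof.
have h1 : (n%:R)^-1 @[n --> \oo] --> (0 : R).
  by rewrite -(cvg_shiftn 1); under eq_fun do rewrite addn1; exact: cvg_harmonic.
have -> : (fun n => (Num.sqrt n%:R)^-1) = (fun n => Num.sqrt (n%:R^-1 : R)).
  by apply/funext => n; rewrite sqrtrV.
by rewrite -[X in _ --> X]sqrtr0; apply: (cvg_comp _ _ h1); exact: sqrt_continuous.
Qed.

Section powers.
Context {R : realType}.
Implicit Types (a u w B : R).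

Lemma norm_expB_le u w B n : `|u| <= B -> `|w| <= B -> 1 <= B ->
  `|u ^+ n - w ^+ n| <= n%:R * B ^+ n * `|u - w|.
Proof.
move=> uB wB B1; have B0 : 0 <= B by exact: le_trans ler01 B1.
elim: n => [|n IH]; first by rewrite !expr0 subrr normr0 !mul0r.
have -> : u ^+ n.+1 - w ^+ n.+1 = u * (u ^+ n - w ^+ n) + (u - w) * w ^+ n.
  by rewrite !exprS; ring.
have h1 : `|u * (u ^+ n - w ^+ n)| <= B * (n%:R * B ^+ n * `|u - w|).
  by rewrite normrM ler_pM.
have h2 : `|(u - w) * w ^+ n| <= B ^+ n.+1 * `|u - w|.
  rewrite normrM mulrC ler_wpM2r// normrX exprS.
  apply: (@le_trans _ _ (B ^+ n)); first by rewrite lerXn2r// nnegrE.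
  by rewrite ler_peMl// exprn_ge0.
apply: (le_trans (ler_normD _ _)); apply: (le_trans (lerD h1 h2)).
by rewrite exprS -natr1 le_eqVlt; apply/orP; left; apply/eqP; ring.
Qed.

(** Compares x_n^n with exp (a / n)^n = exp a. The difference is at most a bounded factor times n
    |x_n - exp (a / n)|, which tends to 0. *)
Lemma cvg_pow_expR (x : nat -> R) a :
  n%:R * (x n - 1) @[n --> \oo] --> a -> x n ^+ n @[n --> \oo] --> expR a.
Proof.
move=> xa; pose K : R := expR (`|a| + 1).
have h1 : (n%:R)^-1 @[n --> \oo] --> (0 : R).
  by rewrite -(cvg_shiftn 1); under eq_fun do rewrite addn1; exact: cvg_harmonic.
pose c : R := a ^+ 2 * (1 / 2 + `|a| * expR `|a|).
have bnd : K * (`|n%:R * (x n - 1) - a| + c * n%:R^-1) @[n --> \oo] --> (0 : R).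
  have -> : 0 = K * (`|a - a| + c * 0) :> R by rewrite subrr normr0 mulr0 addr0 mulr0.
  apply: cvgMr; apply: cvgD; last exact: cvgMr.
  by apply: cvg_norm; apply: cvgB => //; exact: cvg_cst.
apply/cvgrPdist_le => e e0.
have an : \forall n \near \oo, `|n%:R * (x n - 1)| <= `|a| + 1.
  by apply: cvgr_le; [exact: cvg_norm xa|rewrite ltrDl].
have bn : \forall n \near \oo, K * (`|n%:R * (x n - 1) - a| + c * n%:R^-1) <= e.
  exact: cvgr_le bnd _ e0.
near=> n.
have n0 : (0 < n)%N by near: n; exact: nbhs_infty_gt.
have nR : 0 < n%:R :> R by rewrite ltr0n.
have nz : n%:R != 0 :> R by rewrite gt_eqF.
have n1 : 1 <= n%:R :> R by rewrite ler1n.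
have dle : `|n%:R * (x n - 1)| <= `|a| + 1 by near: n.
have fin : K * (`|n%:R * (x n - 1) - a| + c * n%:R^-1) <= e by near: n.
set d := n%:R * (x n - 1) in dle fin.
have xE : x n = 1 + d / n%:R by rewrite /d mulrAC divff// mul1r addrC subrK.
(* A common bound for x_n and exp (a / n) whose n-th power is the constant [K], by the choice of |a|
   + 1 over n. *)
pose B := expR ((`|a| + 1) / n%:R); have B1 : 1 <= B.
  by rewrite -expR0 ler_expR divr_ge0// addr_ge0.
have BK : B ^+ n = K by rewrite -expRM_natl mulrC divfK.
have wn : expR (a / n%:R) ^+ n = expR a by rewrite -expRM_natl mulrC divfK.
have xB : `|x n| <= B.
  rewrite xE; apply: (le_trans (ler_normD _ _)); rewrite normr1.
  apply: (le_trans _ (expR_ge1Dx _)); rewrite lerD2l normrM normfV (gtr0_norm nR).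
  by rewrite ler_wpM2r// invr_ge0 ltW.
have wB : `|expR (a / n%:R)| <= B.
  rewrite ger0_norm ?expR_ge0// ler_expR ler_wpM2r ?invr_ge0 ?(ltW nR)//.
  by have := ler_norm a; lra.
rewrite -wn; apply: (le_trans (norm_expB_le n wB xB B1)).
apply: (le_trans _ fin).
rewrite BK mulrAC mulrC ler_wpM2l ?expR_ge0//.
have -> : expR (a / n%:R) - x n = (expR (a / n%:R) - 1 - a / n%:R) - (d - a) / n%:R.
  by rewrite xE; field.
have t := norm_expR_taylor2 (a / n%:R).
have an1 : `|a / n%:R| = `|a| / n%:R by rewrite normrM normfV (gtr0_norm nR).
have E1 : `|a / n%:R| ^+ 3 * expR `|a / n%:R| <= `|a| ^+ 3 * expR `|a| / n%:R ^+ 2.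
  have l1 : `|a| / n%:R <= `|a| by rewrite ler_pdivrMr// ler_peMr.
  rewrite an1 exprMn mulrAC ler_pM ?mulr_ge0 ?exprn_ge0 ?expR_ge0 ?invr_ge0//.
    by rewrite ler_wpM2l ?exprn_ge0// ler_expR.
  rewrite -exprVn; apply: ler_wiXn2l => //; rewrite ?invr_ge0 ?(ltW nR)//.
  by rewrite invf_le1.
have t2 : `|expR (a / n%:R) - 1 - a / n%:R| <= c / n%:R ^+ 2.
  have := ler_normD (expR (a / n%:R) - 1 - a / n%:R - (a / n%:R) ^+ 2 / 2) ((a / n%:R) ^+ 2 / 2).
  rewrite subrK.
  have q0 : 0 <= (a / n%:R) ^+ 2 / 2 by rewrite divr_ge0 ?sqr_ge0.
  rewrite (ger0_norm q0).
  have -> : c / n%:R ^+ 2 = (a / n%:R) ^+ 2 / 2 + `|a| ^+ 3 * expR `|a| / n%:R ^+ 2.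
    have -> : `|a| ^+ 3 = a ^+ 2 * `|a|.
      by rewrite exprSr real_normK ?num_real.
    by rewrite /c; field.
  lra.
apply: (le_trans (ler_wpM2l (ltW nR) (ler_normB _ _))).
rewrite mulrDr addrC; apply: lerD.
  by rewrite normrM normfV (gtr0_norm nR) mulrCA divff// mulr1.
apply: (le_trans (ler_wpM2l (ltW nR) t2)).
by rewrite le_eqVlt; apply/orP; left; apply/eqP; field.
Unshelve. all: by end_near. Qed.

End powers.

(** * Products over a sample *)

Section sample_products.
Context {d} {T : measurableType d} {R : realType} (Q : probability T R).
Implicit Types (g s : T -> R) (C h : R).

Definition sample_prod g n (t : n.-tuple T) : R := \prod_(i < n) g (tnth t i).

Lemma sample_prod_cons g n o (t : n.-tuple T) :
  sample_prod g (cons_tuple o t) = g o * sample_prod g t.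
Proof.
rewrite /sample_prod big_ord_recl tnth0; congr (_ * _).
by apply: eq_bigr => i _; rewrite tnthS.
Qed.

Lemma sample_prod0 g (t : 0.-tuple T) : sample_prod g t = 1.
Proof. by rewrite /sample_prod big_ord0. Qed.

Lemma measurable_sample_prod g n : measurable_fun setT g ->
  measurable_fun setT (@sample_prod g n).
Proof.
move=> mg; apply: measurable_prod => i _.
by apply: measurableT_comp mg _; exact: measurable_tnth.
Qed.

Lemma sample_prod_le g C n (t : n.-tuple T) : (forall o, `|g o| <= C) ->
  `|sample_prod g t| <= C ^+ n.
Proof.
move=> gC; rewrite /sample_prod normr_prod.
apply: (@le_trans _ _ (\prod_(i < n) C)); last by rewrite prodr_const card_ord.
by apply: ler_prod => i _; rewrite normr_ge0 gC.
Qed.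

Lemma sample_prodM g g' n (t : n.-tuple T) :
  sample_prod (fun o => g o * g' o) t = sample_prod g t * sample_prod g' t.
Proof. by rewrite /sample_prod big_split. Qed.

Lemma expR_sample_sum s h n (t : n.-tuple T) :
  expR (h * sample_sum s t) = sample_prod (fun o => expR (h * s o)) t.
Proof. by rewrite /sample_sum mulr_sumr expR_sum. Qed.

Lemma Rintegral_sample_prod g C n : measurable_fun setT g -> (forall o, `|g o| <= C) ->
  \int[iid_law Q n]_t sample_prod g t = (\int[Q]_o g o) ^+ n.
Proof.
move=> mg gC; have Ig := bounded_integrable Q mg gC.
elim: n => [|n IH].
  by rewrite Rintegral_iid0 ?sample_prod0//; exact: measurable_sample_prod.
rewrite (Rintegral_iid _ (@measurable_sample_prod g n.+1 mg) (fun t => sample_prod_le t gC)).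
rewrite exprSr -(RintegralZl _ measurableT Ig); apply: eq_Rintegral => o _.
under eq_Rintegral do rewrite sample_prod_cons.
rewrite RintegralZl//; first by rewrite IH mulrC.
apply: (@bounded_integrable _ _ _ _ _ (C ^+ n)).
  exact: measurable_sample_prod.
by move=> t; exact: sample_prod_le.
Qed.

Lemma Rintegral_iid_density (Q' : probability T R) g C n (F : n.-tuple T -> R) K :
  (forall A, measurable A -> Q' A = \int[Q]_(o in A) (g o)%:E)%E ->
  measurable_fun setT g -> (forall o, 0 <= g o) -> (forall o, `|g o| <= C) ->
  measurable_fun setT F -> (forall t, `|F t| <= K) ->
  \int[iid_law Q' n]_t F t = \int[iid_law Q n]_t (F t * sample_prod g t).
Proof.
move=> Q'E mg g0 gC; elim: n F => [|n IH] F mF FK.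
  rewrite Rintegral_iid0// Rintegral_iid0 ?sample_prod0 ?mulr1//.
  by apply: measurable_funM => //; exact: measurable_sample_prod.
have K0 : 0 <= K by have [t _] : exists t : n.+1.-tuple T, True by [exists (nseq_tuple _ point)]; exact: le_trans (FK t).
have FP m (F' : m.-tuple T -> R) t : (forall t, `|F' t| <= K) ->
    `|F' t * sample_prod g t| <= K * C ^+ m.
  by move=> F'K; rewrite normrM ler_pM//; exact: sample_prod_le.
have mFP : measurable_fun setT (fun t : n.+1.-tuple T => F t * sample_prod g t).
  by apply: measurable_funM => //; exact: measurable_sample_prod.
rewrite (Rintegral_iid _ mF FK) (Rintegral_iid _ mFP (fun t => FP _ F t FK)).
have mFc : measurable_fun setT (fun z : T * n.-tuple T => F (cons_tuple z.1 z.2)).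
  exact: measurableT_comp mF (@measurable_cons_tuple _ _ n).
have mFo o : measurable_fun setT (fun t : n.-tuple T => F (cons_tuple o t)).
  exact: (measurableT_comp mFc (measurable_pair1 o)).
have mPc : measurable_fun setT (fun z : T * n.-tuple T =>
    F (cons_tuple z.1 z.2) * sample_prod g z.2).
  by apply: measurable_funM => //; apply: measurableT_comp; [exact: measurable_sample_prod|].
have mG := @measurable_Rintegral_snd _ _ _ _ R (iid_law Q n) _ _ mPc
  (fun z => FP n (fun t => F (cons_tuple z.1 t)) z.2 (fun t => FK _)).
have GK o : `|\int[iid_law Q n]_t (F (cons_tuple o t) * sample_prod g t)| <= K * C ^+ n.
  have [nu nuE] := probability_of (m := iid_law Q n) (iid_law_setT Q n).
  have -> : \int[iid_law Q n]_t (F (cons_tuple o t) * sample_prod g t) =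
      \int[nu]_t (F (cons_tuple o t) * sample_prod g t).
    by rewrite /Rintegral; congr fine; apply: eq_measure_integral => A _ _; exact/esym/nuE.
  apply: normr_Rintegral_le; last by move=> t; exact: (FP n (fun t => F (cons_tuple o t))).
  by apply: measurable_funM => //; exact: measurable_sample_prod.
transitivity (\int[Q']_o \int[iid_law Q n]_t (F (cons_tuple o t) * sample_prod g t)).
  by apply: eq_Rintegral => o _; exact: (IH _ (mFo o)).
rewrite (Rintegral_density Q'E mg g0 mG); last first.
  apply: (@bounded_integrable _ _ _ _ _ (K * C ^+ n * C)); first exact: measurable_funM.
  move=> o; rewrite normrM.
  exact: (ler_pM (normr_ge0 _) (normr_ge0 _) (GK o) (gC o)).
apply: eq_Rintegral => o _; rewrite mulrC -RintegralZl//.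
  by apply: eq_Rintegral => t _; rewrite sample_prod_cons mulrCA.
apply: (@bounded_integrable _ _ _ _ _ (K * C ^+ n)).
  by apply: (measurable_funM (mFo o)); exact: measurable_sample_prod.
by move=> t; exact: (FP n (fun t => F (cons_tuple o t))).
Qed.

Section local_likelihood.
Variables (s : T -> R) (B : R).
Hypotheses (ms : measurable_fun setT s) (sB : forall o, `|s o| <= B)
  (s0 : \int[Q]_o s o = 0).
Let sigma2 := \int[Q]_o s o ^+ 2.

Let B0 : 0 <= B. Proof. exact: le_trans (normr_ge0 _) (sB point). Qed.

(** By independence the integral is the n-th power of 1 + g2 h^2 sigma2 / n + O(n^(-3/2)): the
    linear term vanishes as s has mean zero. One statement covers the likelihood ratio, its square,
    exponentials of the score and their products. *)
Lemma local_product_moment (G : R -> R) (g1 g2 K : R) :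
  measurable_fun setT G ->
  (forall y, `|y| <= 1 -> `|G y - 1 - g1 * y - g2 * y ^+ 2| <= K * `|y| ^+ 3) ->
  forall h, \int[iid_law Q n]_t sample_prod (fun o => G (h / Num.sqrt n%:R * s o)) t
    @[n --> \oo] --> expR (g2 * h ^+ 2 * sigma2).
Proof.
move=> mG GT h.
have small : \forall n \near \oo, `|h / Num.sqrt n%:R| * B <= 1.
  have : `|h / Num.sqrt n%:R| * B @[n --> \oo] --> `|h * 0| * B.
    by apply: cvgMl; apply: cvg_norm; apply: cvgMr; exact: cvg_inv_sqrtn.
  by rewrite mulr0 normr0 mul0r => /cvgr_le/(_ _ ltr01).
have mGs (c : R) : measurable_fun setT (fun o => G (c * s o)).
  by apply: measurableT_comp mG _; exact: measurable_funM.
have K0 : 0 <= K.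
  by have := GT 1; rewrite normr1 => /(_ (lexx 1)) /(le_trans (normr_ge0 _)); rewrite expr1n mulr1.
have I1 := bounded_integrable Q ms sB.
have L2s : s \in Lfun Q 2%:E by exact: Lfun2_bounded sB.
have I2 := Lfun2_sqr L2s; have I0 := Lfun2_integrable (Lfun_cst Q (1 : R) 2).
pose GC : R := 1 + `|g1| + `|g2| + K.
have Gb y : `|y| <= 1 -> `|G y| <= GC.
  move=> y1; have := GT y y1; have y0 := normr_ge0 y.
  have a1 : `|g1 * y| <= `|g1| by rewrite normrM ler_piMr.
  have a2 : `|g2 * y ^+ 2| <= `|g2| by rewrite normrM normrX ler_piMr// expr_le1.
  have a3 : K * `|y| ^+ 3 <= K by rewrite ler_piMr// exprn_ile1.
  move: a1 a2; rewrite !ler_norml /GC => /andP[? ?] /andP[? ?] /andP[? ?].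
  by apply/andP; split; lra.
have key : \forall n \near \oo,
    `|\int[Q]_o G (h / Num.sqrt n%:R * s o) - 1 - g2 * (h / Num.sqrt n%:R) ^+ 2 * sigma2| <=
    K * (`|h / Num.sqrt n%:R| ^+ 3 * B ^+ 3).
  apply: filterS small => n; set c := h / Num.sqrt n%:R => cB.
  have cs o : `|c * s o| <= 1 by rewrite normrM (le_trans _ cB)// ler_wpM2l.
  have IG : Q.-integrable setT (EFin \o (fun o => G (c * s o))).
    by apply: (bounded_integrable Q (mGs c)) => o; exact: Gb.
  have J1 := integrableZR (g1 * c) I1; have J2 := integrableZR (g2 * c ^+ 2) I2.
  have -> : \int[Q]_o G (c * s o) - 1 - g2 * c ^+ 2 * sigma2 =
     \int[Q]_o (G (c * s o) - 1 - g1 * c * s o - g2 * c ^+ 2 * s o ^+ 2).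
    rewrite (RintegralB measurableT (integrableBR (integrableBR IG I0) J1) J2).
    rewrite (RintegralB measurableT (integrableBR IG I0) J1) (RintegralB measurableT IG I0).
    rewrite (RintegralZl _ measurableT I1) (RintegralZl _ measurableT I2).
    by rewrite s0 mulr0 subr0 Rintegral_cst1.
  apply: normr_Rintegral_le => [|o].
    apply: measurable_funB; last by apply: measurable_funM => //; exact: measurable_funX.
    by apply: measurable_funB; [apply: measurable_funB|exact: measurable_funM].
  have := GT _ (cs o); rewrite exprMn [g1 * (_ * _)]mulrA [g2 * (_ * _)]mulrA => /le_trans; apply.
  rewrite normrM exprMn; apply: ler_wpM2l => //; apply: ler_wpM2l; first exact: exprn_ge0.
  by apply: lerXn2r => //; rewrite nnegrE.
have bd : \forall n \near \oo, forall o, `|G (h / Num.sqrt n%:R * s o)| <= GC.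
  apply: filterS small => n cB o; apply: Gb.
  by rewrite normrM (le_trans _ cB)// ler_wpM2l.
have E : \forall n \near \oo, (\int[Q]_o G (h / Num.sqrt n%:R * s o)) ^+ n =
    \int[iid_law Q n]_t sample_prod (fun o => G (h / Num.sqrt n%:R * s o)) t.
  by apply: filterS bd => n b; rewrite (Rintegral_sample_prod _ (mGs _) b).
apply: (cvg_trans (near_eq_cvg E)); apply: cvg_pow_expR.
have nz : \forall n \near \oo, (0 < n)%N by exact: nbhs_infty_gt.
apply/cvgrPdist_le => e e0.
have c0 : K * (`|h| ^+ 3 * B ^+ 3) * (Num.sqrt n%:R)^-1 @[n --> \oo] --> (0 : R).
  by rewrite -(mulr0 (K * (`|h| ^+ 3 * B ^+ 3))); apply: cvgMr; exact: cvg_inv_sqrtn.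
have c1 : \forall n \near \oo, K * (`|h| ^+ 3 * B ^+ 3) * (Num.sqrt n%:R)^-1 <= e.
  exact: cvgr_le c0 _ e0.
near=> n.
have n0 : (0 < n)%N by near: n.
have nR : 0 < n%:R :> R by rewrite ltr0n.
have r0 : 0 < Num.sqrt n%:R :> R by rewrite sqrtr_gt0.
have rn : n%:R = Num.sqrt n%:R ^+ 2 :> R by rewrite sqr_sqrtr// ltW.
have kn : `|\int[Q]_o G (h / Num.sqrt n%:R * s o) - 1 - g2 * (h / Num.sqrt n%:R) ^+ 2 * sigma2| <=
    K * (`|h / Num.sqrt n%:R| ^+ 3 * B ^+ 3) by near: n.
apply: (@le_trans _ _ (K * (`|h| ^+ 3 * B ^+ 3) * (Num.sqrt n%:R)^-1)); last by near: n.
move: kn; rewrite normrM normfV (gtr0_norm r0).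
set I := \int[Q]_o _; set r := Num.sqrt n%:R in r0 rn * => kn.
have rz : r != 0 by rewrite gt_eqF.
have -> : g2 * h ^+ 2 * sigma2 - n%:R * (I - 1) =
    - (n%:R * (I - 1 - g2 * (h / r) ^+ 2 * sigma2)) by rewrite rn; field.
rewrite normrN normrM (gtr0_norm nR).
apply: (le_trans (ler_wpM2l (ltW nR) kn)).
by rewrite rn le_eqVlt; apply/orP; left; apply/eqP; field.
Unshelve. all: by end_near. Qed.

End local_likelihood.

End sample_products.

(** * The convolution theorem *)

Lemma Rintegral_exchange {d1 d2} {T1 : measurableType d1} {T2 : measurableType d2}
    {R : realType} (M : probability T1 R) (N : probability T2 R) (F : T1 * T2 -> R) (C : R) :
  measurable_fun setT F -> (forall z, `|F z| <= C) ->
  \int[M]_x \int[N]_y F (x, y) = \int[N]_y \int[M]_x F (x, y).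
Proof.
move=> mF FC.
have I : (M \x N)%E.-integrable setT (EFin \o F).
  exact: (@bounded_integrable _ _ R (M \x N : probability _ R)%E F C).
have E1 := @integral12_prod_meas1 _ _ T1 T2 R M N _ I.
have E2 := @integral21_prod_meas1 _ _ T1 T2 R M N _ I.
have mF1 x : measurable_fun setT (fun y => F (x, y)) by exact: (measurableT_comp mF (measurable_pair1 x)).
have mF2 y : measurable_fun setT (fun x => F (x, y)) by exact: (measurableT_comp mF (measurable_pair2 y)).
rewrite /Rintegral; congr fine.
transitivity (\int[(M \x N)%E]_z (F z)%:E)%E.
  rewrite -E1; apply: eq_integral => x _; rewrite /fubini_F/= -EFin_Rintegral//.
  exact: (bounded_integrable N (mF1 x) (fun y => FC _)).
rewrite -E2; apply: eq_integral => y _; rewrite /fubini_G/= -EFin_Rintegral//.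
exact: (bounded_integrable M (mF2 y) (fun x => FC _)).
Qed.

Lemma eq_measure_Rintegral {d} {T : measurableType d} {R : realType}
    (m1 m2 : {measure set T -> \bar R}) (f : T -> R) :
  (forall A, measurable A -> m1 A = m2 A) -> \int[m1]_x f x = \int[m2]_x f x.
Proof.
by move=> E; rewrite /Rintegral; congr fine; apply: eq_measure_integral => A mA _; exact: E.
Qed.

(** * Averaging over a Gaussian prior *)

Section gaussian_mixture.
Context {d} {T : measurableType d} {R : realType}.
Local Notation Rm := (measurableTypeR R).
Variables (P : forall n, probability (n.-tuple T) R) (X D : forall n, n.-tuple T -> R)
  (L : probability Rm R) (s2 : R).
Hypotheses (mX : forall n, measurable_fun setT (@X n))
  (mD : forall n, measurable_fun setT (@D n)) (s2_gt0 : 0 < s2).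
Implicit Types (f : R -> R) (h A e : R).

Let lik h n (t : n.-tuple T) : R := expR (h * D t - h ^+ 2 * s2 / 2).

Hypothesis integrable_expD : forall h n,
  (P n).-integrable setT (EFin \o (fun t => expR (h * D t))).
Hypothesis cvg_expD : forall h,
  \int[P n]_t expR (h * D t) @[n --> \oo] --> expR (h ^+ 2 * s2 / 2).

Definition lipschitz01 f : Prop := [/\ measurable_fun setT f, forall x, 0 <= f x <= 1 &
  exists2 K, 0 <= K & forall x y, `|f x - f y| <= K * `|x - y|].

Hypothesis cvg_tilted : forall f h, lipschitz01 f ->
  \int[P n]_t (f (X t + h) * lik h t) @[n --> \oo] --> \int[L]_x f x.

Variable eps : R.
Hypothesis eps0 : 0 < eps.
Let kap := s2 + eps.
Let kap0 : 0 < kap. Proof. exact: addr_gt0. Qed.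
Let N : probability Rm R := centered_gaussian eps^-1.
Let G : probability Rm R := centered_gaussian kap^-1.
Let ieps0 : 0 <= eps^-1. Proof. by rewrite invr_ge0 ltW. Qed.

(* On [|D| <= A] the likelihood is bounded uniformly in h, so that limits can be
   integrated over the prior. *)
Let inside A n (t : n.-tuple T) : R := (`|D t| <= A)%R%:R.

Let inside01 A n (t : n.-tuple T) : 0 <= inside A t <= 1.
Proof. by rewrite /inside; case: (`|D t| <= A); rewrite ?lexx ?ler01. Qed.

Let measurable_inside A n : measurable_fun setT (@inside A n).
Proof.
apply: measurable_natb; apply: measurable_fun_ler; last exact: measurable_cst.
exact: (measurableT_comp (@normr_measurable R setT) (@mD n)).
Qed.

Let measurable_lik h n : measurable_fun setT (@lik h n).
Proof.
apply: measurableT_comp => //; apply: measurable_funB; last exact: measurable_cst.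
exact: (measurable_funM (measurable_cst h) (@mD n)).
Qed.

Let likE h n (t : n.-tuple T) : lik h t = expR (- (h ^+ 2 * s2 / 2)) * expR (h * D t).
Proof. by rewrite /lik addrC expRD. Qed.

Let integrable_lik h n : (P n).-integrable setT (EFin \o (@lik h n)).
Proof.
have := integrableZR (expR (- (h ^+ 2 * s2 / 2))) (integrable_expD h n).
by apply: eq_integrable => // t _ /=; rewrite likE.
Qed.

(** The supremum over h of exp (h D - h^2 s2 / 2) is exp (D^2 / (2 s2)), reached at h = D / s2. *)
Let bnd A : R := expR (A ^+ 2 / (2 * s2)).

Let lik_inside_le A h n (t : n.-tuple T) : 0 <= lik h t * inside A t <= bnd A.
Proof.
rewrite mulr_ge0 ?expR_ge0 ?(andP (inside01 A t)).1//=.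
have [DA|DA] := leP `|D t| A; last first.
  by rewrite /inside (leNgt `|D t| A) DA [false%:R]mulr0n mulr0 expR_ge0.
rewrite /inside DA mulr1.
rewrite ler_expR.
have D2 : D t ^+ 2 <= A ^+ 2.
  by rewrite -(real_normK (num_real (D t))) lerXn2r// nnegrE (le_trans (normr_ge0 _) DA).
have s2z : s2 != 0 by rewrite gt_eqF.
apply: (@le_trans _ _ (D t ^+ 2 / (2 * s2))); last first.
  by rewrite ler_wpM2r// invr_ge0 mulr_ge0// ltW.
rewrite -subr_ge0.
have -> : D t ^+ 2 / (2 * s2) - (h * D t - h ^+ 2 * s2 / 2) = (s2 * h - D t) ^+ 2 / (2 * s2) by field.
by rewrite divr_ge0 ?sqr_ge0// mulr_ge0// ltW.
Qed.

Let phi f A n h : R := \int[P n]_t (f (X t + h) * (lik h t * inside A t)).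

Let measurable_joint f n : measurable_fun setT f ->
  measurable_fun setT (fun z : Rm * n.-tuple T => f (X z.2 + z.1)).
Proof.
move=> mf; apply: (measurableT_comp mf); apply: measurable_funD => //.
exact: (measurableT_comp (@mX n) measurable_snd).
Qed.

Let measurable_phi_joint f A n : measurable_fun setT f ->
  measurable_fun setT (fun z : Rm * n.-tuple T => f (X z.2 + z.1) * (lik z.1 z.2 * inside A z.2)).
Proof.
move=> mf; apply: measurable_funM; first exact: measurable_joint.
apply: measurable_funM; last exact: (measurableT_comp (@measurable_inside A n) measurable_snd).
apply: measurableT_comp => //; apply: measurable_funB.
  by apply: measurable_funM => //; exact: (measurableT_comp (@mD n) measurable_snd).
apply: measurable_funM; last exact: measurable_cst.
by apply: measurable_funM; [exact: measurable_funX|exact: measurable_cst].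
Qed.

Let phi_joint_le f A n (z : Rm * n.-tuple T) : (forall x, 0 <= f x <= 1) ->
  `|f (X z.2 + z.1) * (lik z.1 z.2 * inside A z.2)| <= bnd A.
Proof.
move=> f01; have /andP[f0 f1] := f01 (X z.2 + z.1).
have /andP[l0 l1] := lik_inside_le A z.1 z.2.
rewrite ger0_norm; last exact: mulr_ge0.
by apply: (le_trans _ l1); rewrite ler_piMl.
Qed.

Let measurable_phi f A n : lipschitz01 f -> measurable_fun setT (phi f A n : Rm -> R).
Proof.
move=> [mf f01 _].
exact: (@measurable_Rintegral_snd _ _ Rm _ R (P n) _ (bnd A) (@measurable_phi_joint f A n mf) (fun z => @phi_joint_le f A n z f01)).
Qed.

Let phi_le f A n h : lipschitz01 f -> `|phi f A n h| <= bnd A.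
Proof.
move=> [mf f01 _]; apply: normr_Rintegral_le.
  apply: measurable_funM; last exact: (measurable_funM (@measurable_lik h n) (@measurable_inside A n)).
  by apply: (measurableT_comp mf); exact: (measurable_funD (@mX n) (measurable_cst h)).
by move=> t; exact: (@phi_joint_le f A n (h, t) f01).
Qed.

(** The limiting mass removed by the truncation: the indicator of |D| > A is at most exp (- A) (exp
    D + exp (- D)), and multiplying by the likelihood shifts the exponential moments to h + 1 and h
    - 1. *)
Let loss A h : R := expR (- A) * (expR ((h + 1 / 2) * s2) + expR ((1 / 2 - h) * s2)).

Let measurable_loss A : measurable_fun setT (loss A : Rm -> R).
Proof.
apply: measurable_funM; first exact: measurable_cst.
by apply: measurable_funD; apply: measurableT_comp => //; apply: measurable_funM => //;
  [apply: measurable_funD|apply: measurable_funB].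
Qed.

Let loss_ge0 A h : 0 <= loss A h.
Proof. by rewrite mulr_ge0 ?addr_ge0 ?expR_ge0. Qed.

Let phi_near f A h e : lipschitz01 f -> 0 < e ->
  \forall n \near \oo, `|phi f A n h - \int[L]_x f x| <= loss A h + e.
Proof.
move=> fL e0; have [mf f01 _] := fL.
pose q n : R := expR (- A) * (expR (- (h ^+ 2 * s2 / 2)) *
  (\int[P n]_t expR ((h + 1) * D t) + \int[P n]_t expR ((h - 1) * D t))).
have cq : q n @[n --> \oo] --> loss A h.
  have -> : loss A h = expR (- A) * (expR (- (h ^+ 2 * s2 / 2)) *
      (expR ((h + 1) ^+ 2 * s2 / 2) + expR ((h - 1) ^+ 2 * s2 / 2))).
    have e1 : (h + 1 / 2) * s2 = - (h ^+ 2 * s2 / 2) + (h + 1) ^+ 2 * s2 / 2 by field.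
    have e3 : (1 / 2 - h) * s2 = - (h ^+ 2 * s2 / 2) + (h - 1) ^+ 2 * s2 / 2 by field.
    by rewrite /loss e1 e3 !expRD -mulrDr.
  by apply: cvgMr; apply: cvgMr; apply: cvgD; exact: cvg_expD.
have e2 : 0 < e / 2 by rewrite divr_gt0.
have lt2 : loss A h < loss A h + e / 2 by rewrite ltrDl.
have c1 : \forall n \near \oo, q n <= loss A h + e / 2 by exact: cvgr_le cq _ lt2.
have c2 : \forall n \near \oo, `|\int[L]_x f x - \int[P n]_t (f (X t + h) * lik h t)| <= e / 2.
  by have /cvgrPdist_le := cvg_tilted h fL; exact.
apply: filterS2 c1 c2 => n qn.
have mfX : measurable_fun setT (fun t : n.-tuple T => f (X t + h)).
  by apply: (measurableT_comp mf); exact: (measurable_funD (@mX n) (measurable_cst h)).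
have fX01 (t : n.-tuple T) : `|f (X t + h)| <= 1.
  by have /andP[f0 f1] := f01 (X t + h); rewrite ger0_norm.
have J1 := integrable_mulb mfX fX01 (integrable_lik h n).
have mLI : measurable_fun setT (fun t : n.-tuple T => lik h t * inside A t).
  exact: (measurable_funM (@measurable_lik h n) (@measurable_inside A n)).
have ILI : (P n).-integrable setT (EFin \o (fun t => lik h t * inside A t)).
  apply: (bounded_integrable (P n) mLI (C := bnd A)) => t.
  by have /andP[l0 l1] := lik_inside_le A h t; rewrite ger0_norm.
have J2 := integrable_mulb mfX fX01 ILI.
have Jp := integrable_expD (h + 1) n; have Jm := integrable_expD (h - 1) n.
have qE : q n = \int[P n]_t (expR (- A) * (expR (- (h ^+ 2 * s2 / 2)) *
   (expR ((h + 1) * D t) + expR ((h - 1) * D t)))).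
  rewrite (RintegralZl _ measurableT (integrableZR _ (integrableDR Jp Jm))).
  by rewrite (RintegralZl _ measurableT (integrableDR Jp Jm)) (RintegralD measurableT Jp Jm).
have : `|\int[P n]_t (f (X t + h) * lik h t) - phi f A n h| <= q n.
  rewrite /phi -(RintegralB measurableT J1 J2) qE.
  apply: le_abs_Rintegral.
  - by apply: measurable_funB; apply: (measurable_funM mfX) => //; exact: measurable_lik.
  - move=> t; rewrite -mulrBr.
    have E1 : expR (- (h ^+ 2 * s2 / 2)) * (expR ((h + 1) * D t) + expR ((h - 1) * D t)) =
        lik h t * (expR (D t) + expR (- D t)).
      rewrite likE; have -> : (h + 1) * D t = h * D t + D t by ring.
      have -> : (h - 1) * D t = h * D t + - D t by ring.
      by rewrite !expRD; ring.
    rewrite E1; have l0 : 0 <= lik h t by exact: expR_ge0.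
    have in1 : 1 - inside A t <= expR (- A) * (expR (D t) + expR (- D t)).
      rewrite /inside; have [DA|DA] := leP `|D t| A.
        by rewrite [true%:R]mulr1n subrr mulr_ge0 ?addr_ge0 ?expR_ge0.
      rewrite [false%:R]mulr0n subr0.
      apply: (le_trans _ (ler_wpM2l (expR_ge0 _) (expR_norm_le (D t)))).
      by rewrite -expRD -expR0 ler_expR addrC subr_ge0 ltW.
    have /andP[i0 i1] := inside01 A t.
    have -> : lik h t - lik h t * inside A t = lik h t * (1 - inside A t) by ring.
    have li0 : 0 <= lik h t * (1 - inside A t) by rewrite mulr_ge0// subr_ge0.
    rewrite normrM (ger0_norm li0); apply: (le_trans (ler_wpM2r li0 (fX01 t))).
    by rewrite mul1r mulrCA ler_wpM2l.
  - by apply: integrableZR; apply: integrableZR; exact: integrableDR.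
move=> h3 h2.
have := ler_distD (\int[P n]_t (f (X t + h) * lik h t)) (phi f A n h) (\int[L]_x f x).
rewrite (distrC _ (\int[L]_x f x)) (distrC (phi f A n h) (\int[P n]_t _)).
move: qn h2 h3; move: (Rintegral L _ _) (Rintegral (P n) _ _) (phi f A n h) (q n) (loss A h).
by move=> a1 a2 a3 a4 a5 b1 b2 b3; rewrite (distrC a2 a1) => b4; lra.
Qed.

(** The integrals over the prior and over the sample are exchanged, and the inner one is evaluated
    by [gaussian_posterior]. *)
Let expected_phi f A n : lipschitz01 f ->
  \int[N]_h phi f A n h =
  \int[P n]_t (inside A t * (Num.sqrt (eps / kap) * expR (D t ^+ 2 / (2 * kap)) *
     average G f (X t + D t / kap))).
Proof.
move=> [mf f01 _].
have fC x : `|f x| <= 1 by have /andP[f0 f1] := f01 x; rewrite ger0_norm.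
rewrite /phi (@Rintegral_exchange _ _ Rm _ R N (P n) _ (bnd A)
  (@measurable_phi_joint f A n mf) (fun z => @phi_joint_le f A n z f01)).
apply: eq_Rintegral => t _ /=.
have mfx x : measurable_fun setT (fun h : R => f (x + h)) by exact: measurable_shift.
have mE : measurable_fun setT (fun h : R => expR (h * D t - h ^+ 2 * s2 / 2)).
  apply: measurableT_comp => //; apply: measurable_funB; first exact: measurable_funM.
  by apply: measurable_funM => //; apply: measurable_funM => //; exact: measurable_funX.
have Ipost : N.-integrable setT (EFin \o (fun h : Rm => f (X t + (h : R)) * lik (h : R) t)).
  apply: (@bounded_integrable _ Rm R N _ (bnd `|D t|)).
    by apply: measurable_funM; [exact: mfx|exact: mE].
  move=> h; have := @phi_joint_le f `|D t| n (h, t) f01.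
  by rewrite /= /inside lexx [true%:R]mulr1n mulr1.
have -> : \int[N]_h (f (X t + (h : R)) * (lik (h : R) t * inside A t)) =
    inside A t * \int[N]_h (f (X t + (h : R)) * lik (h : R) t).
  rewrite -(RintegralZl _ measurableT Ipost); apply: eq_Rintegral => h _; ring.
congr (_ * _); apply: EFin_inj; rewrite EFin_Rintegral// EFinM /average.
rewrite EFin_Rintegral; last exact: (integrable_shift G _ mf fC).
have := @gaussian_posterior R eps s2 (D t) (X t) (EFin \o f) eps0 (ltW s2_gt0).
rewrite -/kap => post; rewrite -post; last 2 first.
- exact/measurable_EFinP.
- by move=> x; rewrite lee_fin; case/andP: (f01 x).
by apply: eq_integral => h _; rewrite /lik -EFinM (mulrC h (D t)).
Qed.

Let loss_cst : R := \int[N]_h (expR ((h + 1 / 2) * s2) + expR ((1 / 2 - h) * s2)).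

Let integrable_loss A : N.-integrable setT (EFin \o (loss A : Rm -> R)) /\
  \int[N]_h loss A h = expR (- A) * loss_cst.
Proof.
have I1 := integrable_expR_gaussian ieps0 s2; have I2 := integrable_expR_gaussian ieps0 (- s2).
have I : N.-integrable setT (EFin \o (fun h : Rm =>
    expR (((h : R) + 1 / 2) * s2) + expR ((1 / 2 - (h : R)) * s2))).
  have := integrableDR (integrableZR (expR (s2 / 2)) I1) (integrableZR (expR (s2 / 2)) I2).
  apply: eq_integrable => // h _ /=; rewrite -!expRD.
  by congr (expR _ + expR _)%:E; ring.
by split; [exact: integrableZR|rewrite /loss (RintegralZl _ measurableT I)].
Qed.

(** The order of limits matters: A is fixed first, so that the averaged loss, at most a constant
    over A + 1, is small; for this A the integrands are bounded uniformly in n and h, and dominated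
    convergence applies as n grows. *)
Let expected_phi_cvg f e : lipschitz01 f -> 0 < e -> \forall A \near \oo,
  \forall n \near \oo, `|\int[N]_h phi f A%:R n h - \int[L]_x f x| <= e.
Proof.
move=> fL e0; have e2 : 0 < e / 2 by rewrite divr_gt0.
have lc0 : 0 <= loss_cst by apply: Rintegral_ge0 => h _; rewrite addr_ge0 ?expR_ge0.
have c0 : loss_cst * A.+1%:R^-1 @[A --> \oo] --> (0 : R).
  by rewrite -(mulr0 loss_cst); apply: cvgMr; exact: cvg_harmonic.
have cA : \forall A \near \oo, loss_cst * A.+1%:R^-1 <= e / 2 by exact: cvgr_le c0 _ e2.
apply: filterS cA => A hA.
have [Iloss lossE] := integrable_loss A%:R.
have loss_le : \int[N]_h loss A%:R h <= e / 2.
  rewrite lossE; apply: (le_trans _ hA); rewrite mulrC ler_wpM2l// expRN.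
  rewrite lef_pV2 ?posrE ?ltr0n ?expR_gt0//.
  by rewrite -natr1 addrC expR_ge1Dx.
set l := \int[L]_x f x.
have l1 : `|l| <= 1.
  case: fL => mf f01 _; apply: normr_Rintegral_le => // x.
  by have /andP[f0 f1] := f01 (x : R); rewrite ger0_norm.
pose u n h : R := `|phi f A%:R n h - l|.
have mu n : measurable_fun setT (u n : Rm -> R).
  apply: (measurableT_comp (@normr_measurable R setT)).
  by apply: measurable_funB; [exact: measurable_phi|exact: measurable_cst].
have u_le n h : `|u n h| <= bnd A%:R + 1.
  rewrite normr_id; apply: (le_trans (ler_normB _ _)); apply: lerD => //.
  exact: phi_le.
have Iu n : N.-integrable setT (EFin \o (u n : Rm -> R)).
  exact: (@bounded_integrable _ Rm R N (u n) (bnd A%:R + 1)).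
(* The pointwise limit is known only up to the loss, which is not uniform in h; the excess over the
   loss does tend to 0 and is bounded. *)
pose psi n h : R := Num.max (u n h - loss A%:R h) 0.
have mpsi n : measurable_fun setT (psi n : Rm -> R).
  apply: measurable_maxr; last exact: measurable_cst.
  by apply: measurable_funB => //; exact: measurable_loss.
have psi_le n h : `|psi n h| <= bnd A%:R + 1.
  have p0 : 0 <= psi n h by rewrite /psi le_max lexx orbT.
  rewrite ger0_norm// /psi ge_max; apply/andP; split.
    have := u_le n h; rewrite normr_id => hu; have := loss_ge0 A%:R h.
    by move: hu; rewrite /u; lra.
  exact: le_trans (normr_ge0 _) (u_le n h).
have Ipsi n : N.-integrable setT (EFin \o (psi n : Rm -> R)).
  exact: (@bounded_integrable _ Rm R N (psi n) (bnd A%:R + 1)).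
have cpsi : \int[N]_h psi n h @[n --> \oo] --> (0 : R).
  rewrite -[X in _ --> X](Rintegral_cst1 N).
  apply: (dominated_Rcvg (g := fun _ : Rm => bnd A%:R + 1)) => //.
  - exact: Lfun2_integrable (Lfun_cst N (bnd A%:R + 1) 2).
  - apply: aeW => h; apply/cvgrPdist_le => a a0.
    apply: filterS (phi_near A%:R h fL a0) => n hn.
    have p0 : 0 <= psi n h by rewrite /psi le_max lexx orbT.
    rewrite sub0r normrN ger0_norm// /psi ge_max (ltW a0) andbT.
    by rewrite lerBlDr addrC.
have cpsi2 : \forall n \near \oo, \int[N]_h psi n h <= e / 2 by exact: cvgr_le cpsi _ e2.
apply: filterS cpsi2 => n hn.
have Iphi : N.-integrable setT (EFin \o (phi f A%:R n : Rm -> R)).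
  apply: (@bounded_integrable _ Rm R N _ (bnd A%:R)); first exact: measurable_phi.
  by move=> h; exact: phi_le.
rewrite -(Rintegral_cst1 N l) -(RintegralB measurableT Iphi); last first.
  exact: Lfun2_integrable (Lfun_cst N l 2).
have J := integrableDR (Ipsi n) Iloss.
apply: (@le_trans _ _ (\int[N]_h (psi n h + loss A%:R h))).
  apply: le_abs_Rintegral => //.
    by apply: measurable_funB; [exact: measurable_phi|exact: measurable_cst].
  move=> h; rewrite -lerBlDr /psi -/(u n h) le_max lexx; exact: isT.
rewrite (RintegralD measurableT (Ipsi n) Iloss).
by move: hn loss_le; move: (Rintegral N _ _) (Rintegral N _ _) => p q; lra.
Qed.

(* Given the sample, h has posterior N(D / kap, 1 / kap); hence averaging over
   the prior turns X + h into X + D / kap plus an independent N(0, 1 / kap). *)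
Theorem mixture_approximation (l : seq (R * R)) e : 0 < e ->
  exists M : probability Rm R, forall p, p \in l -> 0 < p.2 ->
    `|\int[M]_x average G (ramp p.1 p.2) x - \int[L]_x ramp p.1 p.2 x| <= e.
Proof.
move=> e0; pose eta := Num.min (e / 4) (1 / 2).
have eta0 : 0 < eta by rewrite lt_min !divr_gt0.
have ramp_l a w : 0 < w -> lipschitz01 (ramp a w).
  move=> w0; split; [exact: measurable_ramp|by move=> x; exact: ramp01|].
  by exists w^-1; [rewrite invr_ge0 ltW|move=> x y; exact: ramp_lipschitz].
have one_l : lipschitz01 (cst 1).
  split; [exact: measurable_cst|by move=> x; rewrite ler01 lexx|].
  by exists 0 => // x y; rewrite subrr normr0 mul0r.
have H : \forall A \near \oo, \forall n \near \oo, forall p, p \in l -> 0 < p.2 ->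
    `|\int[N]_h phi (ramp p.1 p.2) A%:R n h - \int[L]_x ramp p.1 p.2 x| <= eta.
  elim: l => [|p l IH]; first by apply: nearW => A; apply: nearW.
  have [p0|p0] := ltP 0 p.2; last first.
    apply: filterS IH => A; apply: filterS => n IH q.
    by rewrite inE => /predU1P[->|]; [rewrite ltNge p0|exact: IH].
  apply: filterS2 IH (expected_phi_cvg (ramp_l p.1 _ p0) eta0) => A.
  apply: filterS2 => n IH hp q; rewrite inE => /predU1P[->//|]; exact: IH.
have [A _ /(_ A (leqnn A))[hA1 hA2]] := filterI (expected_phi_cvg one_l eta0) H.
have [n _ /(_ n (leqnn n))[h1 h2]] := filterI hA1 hA2.
(* The truncated likelihood of the sample after integrating out h. Normalized, it becomes the
   density under which X + D / kap has the sought law M. *)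
pose wt (t : n.-tuple T) : R := inside A%:R t * (Num.sqrt (eps / kap) * expR (D t ^+ 2 / (2 * kap))).
pose Wb : R := Num.sqrt (eps / kap) * expR (A%:R ^+ 2 / (2 * kap)).
have wt0 t : 0 <= wt t.
  by have /andP[i0 _] := inside01 A%:R t; rewrite !mulr_ge0 ?sqrtr_ge0 ?expR_ge0.
have wtb t : wt t <= Wb.
  rewrite /wt /inside; have [DA|_] := leP `|D t| A%:R.
    rewrite [true%:R]mulr1n mul1r ler_wpM2l ?sqrtr_ge0// ler_expR ler_wpM2r//.
      by rewrite invr_ge0 mulr_ge0// ltW.
    by rewrite -(real_normK (num_real (D t))) lerXn2r// nnegrE.
  by rewrite [false%:R]mulr0n mul0r mulr_ge0 ?sqrtr_ge0 ?expR_ge0.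
have mwt : measurable_fun setT wt.
  apply: (measurable_funM (@measurable_inside A%:R n)).
  apply: measurable_funM; first exact: measurable_cst.
  apply: measurableT_comp => //; apply: measurable_funM; last exact: measurable_cst.
  exact: (measurable_funX 2 (@mD n)).
have Iwt : (P n).-integrable setT (EFin \o wt).
  by apply: (bounded_integrable (P n) mwt (C := Wb)) => t; rewrite ger0_norm.
set Z := \int[P n]_t wt t.
(* The constant 1 used as a test function shows that the truncated mixture has total mass close to
   1. *)
have Z1 : `|Z - 1| <= eta.
  move: h1; rewrite (expected_phi _ _ one_l) (Rintegral_cst1 L).
  suff -> : \int[P n]_t (inside A%:R t * (Num.sqrt (eps / kap) * expR (D t ^+ 2 / (2 * kap)) *
      average G (cst 1) (X t + D t / kap))) = Z by [].
  by apply: eq_Rintegral => t _; rewrite /average (Rintegral_cst1 G) mulr1.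
have e2 : eta <= 1 / 2 by rewrite ge_min lexx orbT.
have e4 : eta <= e / 4 by rewrite ge_min lexx.
have Zhalf : 1 / 2 <= Z by move: Z1; rewrite ler_norml => /andP[+ _]; lra.
have Z0 : 0 < Z by apply: (lt_le_trans _ Zhalf); rewrite divr_gt0.
pose g t := Z^-1 * wt t.
have mg : measurable_fun setT g by exact: (measurable_funM (measurable_cst Z^-1) mwt).
have g0 t : 0 <= g t by rewrite mulr_ge0// invr_ge0 ltW.
have g1 : (\int[P n]_t (g t)%:E = 1)%E.
  rewrite -EFin_Rintegral; last exact: integrableZR.
  by rewrite (RintegralZl _ measurableT Iwt) mulVf// gt_eqF.
have [Q QE] := density_probability mg g0 g1.
have mY : measurable_fun setT (fun t : n.-tuple T => X t + D t / kap : Rm).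
  exact: (measurable_funD (@mX n) (measurable_funM (@mD n) (measurable_cst kap^-1))).
have [M ME] := image_probability Q mY.
exists M => p pl p0; have [mf f01 _] := ramp_l p.1 p.2 p0.
set f := ramp p.1 p.2 in mf f01 *.
have fC x : `|f x| <= 1 by have /andP[f0 f1] := f01 x; rewrite ger0_norm.
have mavg : measurable_fun setT (average G f : Rm -> R) by exact: measurable_average fC.
have avgC x : `|average G f x| <= 1.
  by apply: normr_Rintegral_le => //; exact: measurable_shift.
have mavgY : measurable_fun setT (fun t : n.-tuple T => average G f (X t + D t / kap)).
  exact: (measurableT_comp mavg mY).
have Iphi : (P n).-integrable setT (EFin \o (fun t => average G f (X t + D t / kap) * wt t)).
  exact: integrable_mulb mavgY (fun t => avgC _) Iwt.
have -> : \int[M]_x average G f x = Z^-1 * \int[N]_h phi f A%:R n h.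
  rewrite (Rintegral_image (fun B _ => ME B) mY mavg).
  rewrite (Rintegral_density QE mg g0 mavgY); last first.
    by have := integrableZR Z^-1 Iphi; apply: eq_integrable => // t _ /=; rewrite mulrCA.
  rewrite (expected_phi _ _ (ramp_l p.1 p.2 p0)) -/f.
  have -> : \int[P n]_t (inside A%:R t * (Num.sqrt (eps / kap) * expR (D t ^+ 2 / (2 * kap)) *
      average G f (X t + D t / kap))) = \int[P n]_t (average G f (X t + D t / kap) * wt t).
    by apply: eq_Rintegral => t _; rewrite /wt; ring.
  by rewrite -(RintegralZl _ measurableT Iphi); apply: eq_Rintegral => t _; rewrite mulrCA.
have := h2 p pl p0; rewrite -/f; set a := \int[N]_h _; set lf := \int[L]_x f x => ha.
have lf1 : `|lf| <= 1 by apply: normr_Rintegral_le.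
(* Separates the approximation error from the normalization error; each is at most eta <= e / 4, and
   1 / Z is at most 2. *)
have -> : Z^-1 * a - lf = Z^-1 * ((a - lf) - lf * (Z - 1)) by field; rewrite gt_eqF.
have iZ : 0 <= Z^-1 by rewrite invr_ge0 ltW.
rewrite normrM (ger0_norm iZ) mulrC ler_pdivrMr//.
apply: (le_trans (ler_normB _ _)).
have : `|lf * (Z - 1)| <= eta by rewrite normrM -[leRHS]mul1r ler_pM.
have : e * (1 / 2) <= e * Z by rewrite ler_wpM2l// ltW.
by move: (`|lf * _|) (`|a - lf|) ha (e * Z) => p1 p2 hp p3; lra.
Qed.

End gaussian_mixture.

(** * Local asymptotic normality *)

Section likelihood.
Context {d} {T : measurableType d} {R : realType} (Q : probability T R).
Variables (s : T -> R) (B : R).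
Hypotheses (ms : measurable_fun setT s) (sB : forall o, `|s o| <= B)
  (s0 : \int[Q]_o s o = 0).
Variable P : forall n, probability (n.-tuple T) R.
Hypothesis PE : forall n A, P n A = iid_law Q n A.
Let sigma2 := \int[Q]_o (s o ^+ 2).

Let scale (h : R) n : R := h / Num.sqrt n%:R.

Lemma bounded_sample_prod n (g : T -> R) C : measurable_fun setT g ->
  (forall o, `|g o| <= C) -> (P n).-integrable setT (EFin \o @sample_prod _ _ _ g n).
Proof.
move=> mg gC; apply: (bounded_integrable (P n) (@measurable_sample_prod _ _ _ g n mg)).
by move=> t; exact: sample_prod_le gC.
Qed.

Let moment (G : R -> R) (g1 g2 K : R) : measurable_fun setT G ->
  (forall y, `|y| <= 1 -> `|G y - 1 - g1 * y - g2 * y ^+ 2| <= K * `|y| ^+ 3) ->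
  forall h, \int[P n]_t sample_prod (fun o => G (scale h n * s o)) t
    @[n --> \oo] --> expR (g2 * h ^+ 2 * sigma2).
Proof.
move=> mG GT h; have := @local_product_moment _ _ _ Q s B ms sB s0 G g1 g2 K mG GT h.
apply: cvg_trans; apply: near_eq_cvg; apply: nearW => n.
have E A : measurable A -> iid_law Q n A = P n A by move=> _; rewrite PE.
exact: (@eq_measure_Rintegral _ _ R (iid_law Q n) (P n) _ E).
Qed.

Let expR_small (y : R) : `|y| <= 1 -> `|expR y - 1 - y - y ^+ 2 / 2| <= expR 1 * `|y| ^+ 3.
Proof.
move=> y1; apply: (le_trans (norm_expR_taylor2 y)).
by rewrite mulrC ler_wpM2r// ler_expR.
Qed.

Let mexp c : measurable_fun setT (fun y : R => expR (c * y)).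
Proof. by apply: measurableT_comp => //; exact: measurable_funM. Qed.

Lemma cvg_expD (h : R) : \int[P n]_t expR (h * (sample_sum s t / Num.sqrt n%:R))
  @[n --> \oo] --> expR (h ^+ 2 * sigma2 / 2).
Proof.
have GT (y : R) : `|y| <= 1 -> `|expR y - 1 - 1 * y - 2^-1 * y ^+ 2| <= expR 1 * `|y| ^+ 3.
  by move=> y1; rewrite mul1r (mulrC 2^-1); exact: expR_small.
have := @moment _ _ _ _ (@measurable_expR R) GT h.
rewrite -mulrA (mulrC 2^-1); apply: cvg_trans; apply: near_eq_cvg; apply: nearW => n.
by apply: eq_Rintegral => t _; rewrite -expR_sample_sum /scale; congr expR; ring.
Qed.

Lemma integrable_expD (h : R) n :
  (P n).-integrable setT (EFin \o (fun t => expR (h * (sample_sum s t / Num.sqrt n%:R)))).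
Proof.
have : (P n).-integrable setT (EFin \o @sample_prod _ _ _ (fun o => expR (scale h n * s o)) n).
  apply: (@bounded_sample_prod _ _ (expR (`|scale h n| * B))).
    by apply: measurableT_comp => //; exact: measurable_funM.
  move=> o; rewrite ger0_norm ?expR_ge0// ler_expR (le_trans (ler_norm _))// normrM.
  exact: ler_wpM2l.
apply: eq_integrable => // t _ /=.
by rewrite -expR_sample_sum /scale; congr (expR _)%:E; ring.
Qed.

(** The distance is computed in L^2 under P. With u = h^2 sigma2, the square of the likelihood
    ratio, the mixed product and the square of the exponential have moments tending to e^u, e^(3u/2)
    and e^(2u), and e^u - 2 e^(-u/2) e^(3u/2) + e^(-u) e^(2u) = 0. *)
Lemma cvg_likelihood (h : R) :
  \int[P n]_t `|sample_prod (fun o => 1 + h / Num.sqrt n%:R * s o) t -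
     expR (h * (sample_sum s t / Num.sqrt n%:R) - h ^+ 2 * sigma2 / 2)|
  @[n --> \oo] --> (0 : R).
Proof.
pose u := h ^+ 2 * sigma2.
(* Second-order coefficients 1, 3/2 and 2 of (1 + y)^2, (1 + y) exp y and exp (2 y), as required by
   [local_product_moment]. *)
have T1 (y : R) : `|y| <= 1 -> `|(1 + y) ^+ 2 - 1 - 2 * y - 1 * y ^+ 2| <= 0 * `|y| ^+ 3.
  by move=> _; rewrite mul0r normr_le0; apply/eqP; ring.
have T2 (y : R) : `|y| <= 1 -> `|(1 + y) * expR y - 1 - 2 * y - (3 / 2) * y ^+ 2| <=
    (2 * expR 1 + 1 / 2) * `|y| ^+ 3.
  move=> y1; have -> : (1 + y) * expR y - 1 - 2 * y - (3 / 2) * y ^+ 2 =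
    (1 + y) * (expR y - 1 - y - y ^+ 2 / 2) + 1 / 2 * y ^+ 3 by field.
  rewrite [leRHS]mulrDl; apply: (le_trans (ler_normD _ _)); apply: lerD.
    rewrite normrM -mulrA; apply: ler_pM => //; last exact: expR_small.
    by apply: (le_trans (ler_normD _ _)); rewrite normr1; lra.
  by rewrite normrM normrX ger0_norm// divr_ge0.
have T3 (y : R) : `|y| <= 1 -> `|expR (2 * y) - 1 - 2 * y - 2 * y ^+ 2| <= (8 * expR 2) * `|y| ^+ 3.
  move=> y1; have -> : 2 * y ^+ 2 = (2 * y) ^+ 2 / 2 by field.
  apply: (le_trans (norm_expR_taylor2 (2 * y))); rewrite normrM exprMn ger0_norm//.
  have -> : 2 ^+ 3 * `|y| ^+ 3 * expR (2 * `|y|) = 8 * expR (2 * `|y|) * `|y| ^+ 3 by ring.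
  by rewrite ler_wpM2r// ler_wpM2l// ler_expR -[leRHS]mulr1 ler_wpM2l.
have m1 : measurable_fun setT (fun y : R => (1 + y) ^+ 2).
  by apply: measurable_funX; exact: measurable_funD.
have m2 : measurable_fun setT (fun y : R => (1 + y) * expR y).
  by apply: measurable_funM => //; exact: measurable_funD.
have c1 := @moment _ _ _ _ m1 T1 h; have c2 := @moment _ _ _ _ m2 T2 h.
have c3 := @moment _ _ _ _ (mexp 2) T3 h.
pose a n (t : n.-tuple T) := sample_prod (fun o => 1 + scale h n * s o) t.
pose e n (t : n.-tuple T) := sample_prod (fun o => expR (scale h n * s o)) t.
pose k := expR (- (u / 2)).
pose g n o := 1 + scale h n * s o.
pose x n o := expR (scale h n * s o).
have mg n : measurable_fun setT (g n) by apply: measurable_funD => //; exact: measurable_funM.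
have mx n : measurable_fun setT (x n) by apply: measurableT_comp => //; exact: measurable_funM.
have gC n o : `|g n o| <= 1 + `|scale h n| * B.
  by apply: (le_trans (ler_normD _ _)); rewrite normr1 normrM lerD2l ler_wpM2l.
have xC n o : `|x n o| <= expR (`|scale h n| * B).
  rewrite ger0_norm ?expR_ge0// ler_expR (le_trans (ler_norm _))// normrM.
  exact: ler_wpM2l.
have prodI n (f f' : T -> R) C C' : measurable_fun setT f -> measurable_fun setT f' ->
   (forall o, `|f o| <= C) -> (forall o, `|f' o| <= C') ->
   (P n).-integrable setT (EFin \o (fun t => @sample_prod _ _ _ f n t * sample_prod f' t)).
  move=> mf mf' fC fC'; apply: (integrable_mulb (C := C ^+ n)).
  - exact: measurable_sample_prod.
  - by move=> t; exact: sample_prod_le fC.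
  - exact: bounded_sample_prod fC'.
have I1 n := prodI n _ _ _ _ (mg n) (mg n) (gC n) (gC n).
have I2 n := prodI n _ _ _ _ (mg n) (mx n) (gC n) (xC n).
have I3 n := prodI n _ _ _ _ (mx n) (mx n) (xC n) (xC n).
pose q n : R := \int[P n]_t (sample_prod (g n) t - k * sample_prod (x n) t) ^+ 2.
have qE n : q n = \int[P n]_t sample_prod (fun o => (1 + scale h n * s o) ^+ 2) t -
   (2 * k) * (\int[P n]_t sample_prod (fun o => (1 + scale h n * s o) * expR (scale h n * s o)) t) +
   k ^+ 2 * \int[P n]_t sample_prod (fun o => expR (2 * (scale h n * s o))) t.
  have e1 : \int[P n]_t sample_prod (fun o => (1 + scale h n * s o) ^+ 2) t =
      \int[P n]_t (sample_prod (g n) t * sample_prod (g n) t).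
    by apply: eq_Rintegral => t _; rewrite -sample_prodM.
  have e2 : \int[P n]_t sample_prod (fun o => (1 + scale h n * s o) * expR (scale h n * s o)) t =
      \int[P n]_t (sample_prod (g n) t * sample_prod (x n) t).
    by apply: eq_Rintegral => t _; rewrite -sample_prodM.
  have e3 : \int[P n]_t sample_prod (fun o => expR (2 * (scale h n * s o))) t =
      \int[P n]_t (sample_prod (x n) t * sample_prod (x n) t).
    apply: eq_Rintegral => t _; rewrite -sample_prodM /sample_prod.
    by apply: eq_bigr => i _; rewrite mulrDl !mul1r expRD.
  rewrite e1 e2 e3 -(RintegralZl _ measurableT (I2 n)) -(RintegralZl _ measurableT (I3 n)).
  rewrite -(RintegralB measurableT (I1 n) (integrableZR _ (I2 n))).
  rewrite -(RintegralD measurableT (integrableBR (I1 n) (integrableZR _ (I2 n))) (integrableZR _ (I3 n))).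
  by apply: eq_Rintegral => t _; ring.
have q0 : q n @[n --> \oo] --> (0 : R).
  have -> : (0 : R) = expR (1 * h ^+ 2 * sigma2) - (2 * k) * expR (3 / 2 * h ^+ 2 * sigma2) +
      k ^+ 2 * expR (2 * h ^+ 2 * sigma2).
    have -> : 1 * h ^+ 2 * sigma2 = u by rewrite /u; ring.
    have -> : 3 / 2 * h ^+ 2 * sigma2 = u + u / 2 by rewrite /u; field.
    have -> : 2 * h ^+ 2 * sigma2 = u + u / 2 + u / 2 by rewrite /u; field.
    rewrite /k expRN !expRD; set w := expR (u / 2); set y := expR u.
    have w0 : w != 0 by rewrite gt_eqF ?expR_gt0.
    by field.
  under eq_fun do rewrite qE.
  by apply: cvgD; [apply: cvgB|] => //; apply: cvgMr.
have Iq n : (P n).-integrable setT (EFin \o (fun t => (sample_prod (g n) t - k * sample_prod (x n) t) ^+ 2)).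
  have := integrableDR (integrableBR (I1 n) (integrableZR (2 * k) (I2 n))) (integrableZR (k ^+ 2) (I3 n)).
  by apply: eq_integrable => // t _ /=; congr EFin; ring.
apply/cvgrPdist_le => r r0.
have r2 : 0 < r ^+ 2 by rewrite exprn_gt0.
have qr : \forall n \near \oo, q n <= r ^+ 2 by exact: cvgr_le q0 _ r2.
apply: filterS qr => n qn; rewrite sub0r normrN ger0_norm; last first.
  by apply: Rintegral_ge0 => t _.
have mt : measurable_fun setT (fun t : n.-tuple T => sample_prod (g n) t - k * sample_prod (x n) t).
  apply: measurable_funB; first exact: measurable_sample_prod.
  by apply: measurable_funM => //; exact: measurable_sample_prod.
have LI := Lfun2I mt (Iq n).
have tE (t : n.-tuple T) : sample_prod (fun o => 1 + h / Num.sqrt n%:R * s o) t -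
     expR (h * (sample_sum s t / Num.sqrt n%:R) - h ^+ 2 * sigma2 / 2) =
     sample_prod (g n) t - k * sample_prod (x n) t.
  congr (_ - _); rewrite /x -expR_sample_sum /k -expRD; congr expR.
  by rewrite /scale /u; ring.
under eq_Rintegral do rewrite tE.
(* From L^2 to L^1 by |y| <= y^2 / (2 r) + r / 2. *)
apply: (@le_trans _ _ (\int[P n]_t ((sample_prod (g n) t - k * sample_prod (x n) t) ^+ 2 / (2 * r) + r / 2))).
  apply: le_Rintegral => //.
  - exact: integrable_norm (Lfun2_integrable LI).
  - apply: integrableDR; last exact: Lfun2_integrable (Lfun_cst (P n) (r / 2) 2).
    have := integrableZR (2 * r)^-1 (Iq n).
    by apply: eq_integrable => // t _ /=; rewrite mulrC.
  - move=> t _; move: (_ - _) => y; rewrite -(real_normK (num_real y)) -subr_ge0.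
    have -> : `|y| ^+ 2 / (2 * r) + r / 2 - `|y| = (`|y| - r) ^+ 2 / (2 * r).
      by field; rewrite gt_eqF.
    by rewrite divr_ge0 ?sqr_ge0// mulr_ge0// ltW.
have J : (P n).-integrable setT (EFin \o (fun t => (sample_prod (g n) t - k * sample_prod (x n) t) ^+ 2 / (2 * r))).
  have := integrableZR (2 * r)^-1 (Iq n).
  by apply: eq_integrable => // t _ /=; rewrite mulrC.
rewrite (RintegralD measurableT J (Lfun2_integrable (Lfun_cst (P n) (r / 2) 2))) Rintegral_cst1.
have -> : \int[P n]_t ((sample_prod (g n) t - k * sample_prod (x n) t) ^+ 2 / (2 * r)) = q n / (2 * r).
  rewrite /q [RHS]mulrC -(RintegralZl _ measurableT (Iq n)).
  by apply: eq_Rintegral => t _; rewrite mulrC.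
have : q n / (2 * r) <= r ^+ 2 / (2 * r) by rewrite ler_wpM2r// invr_ge0 mulr_ge0// ltW.
have -> : r ^+ 2 / (2 * r) = r / 2 by field; rewrite gt_eqF.
lra.
Qed.

End likelihood.

Lemma cvg_local_shift {R : realType} (psi : R -> R) (psi0 c h : R) :
  (forall e : R, 0 < e -> \forall r \near (0 : R), `|psi r - psi0 - r * c| <= e * `|r|) ->
  Num.sqrt n%:R * (psi (h / Num.sqrt n%:R) - psi0) @[n --> \oo] --> h * c.
Proof.
move=> H; have r0 : h / Num.sqrt n%:R @[n --> \oo] --> (0 : R).
  by rewrite -(mulr0 h); apply: cvgMr; exact: cvg_inv_sqrtn.
apply/cvgrPdist_le => e e0.
have e1 : 0 < e / (`|h| + 1) by rewrite divr_gt0// ltr_pwDr.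
have near_h : \forall n \near \oo, `|psi (h / Num.sqrt n%:R) - psi0 - h / Num.sqrt n%:R * c| <=
  e / (`|h| + 1) * `|h / Num.sqrt n%:R| := r0 _ (H _ e1).
have npos : \forall n \near \oo, 0 < Num.sqrt n%:R :> R.
  by apply: filterS (nbhs_infty_gt 0) => n n0; rewrite sqrtr_gt0 ltr0n.
apply: filterS2 npos near_h => n n0.
set w := Num.sqrt n%:R in n0 * => hn.
have -> : h * c - w * (psi (h / w) - psi0) = - (w * (psi (h / w) - psi0 - h / w * c)).
  by field; rewrite gt_eqF.
rewrite normrN normrM (gtr0_norm n0); apply: (le_trans (ler_wpM2l (ltW n0) hn)).
rewrite normrM normfV (gtr0_norm n0).
have -> : w * (e / (`|h| + 1) * (`|h| / w)) = e * (`|h| / (`|h| + 1)).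
  by field; rewrite !gt_eqF//= ltr_pwDr.
by rewrite ger_pMr// ler_pdivrMr ?mul1r ?lerDl// ltr_pwDr.
Qed.

Lemma lipschitz01_continuous {R : realType} (f : R -> R) : lipschitz01 f -> continuous f.
Proof.
move=> [_ _ [K K0 fK]] x; apply/cvgrPdist_le => e e0.
have K1 : 0 < K + 1 by rewrite ltr_pwDr.
apply/nbhs_ballP; exists (e / (K + 1)) => /=; first by rewrite divr_gt0.
move=> y; rewrite /ball/= => xy; apply: (le_trans (fK _ _)).
apply: (@le_trans _ _ (K * (e / (K + 1)))); first by rewrite ler_wpM2l// ltW.
by rewrite mulrCA ger_pMr// ler_pdivrMr// mul1r lerDl.
Qed.

(** * Regular estimators along one score *)

Section regular_along_score.
Context {d} {T : measurableType d} {R : realType} (Q : probability T R).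
Local Notation Rm := (measurableTypeR R).
Variables (s : T -> R) (B : R) (law : R -> probability T R) (psi : R -> R) (psi0 : R)
  (Tn : forall n, n.-tuple T -> R) (L : probability Rm R).
Hypotheses (ms : measurable_fun setT s) (sB : forall o, `|s o| <= B)
  (s0 : \int[Q]_o s o = 0).
Hypothesis lawE : forall r, `|r| * B <= 1 -> forall A, measurable A ->
  law r A = (\int[Q]_(o in A) (1 + r * s o)%:E)%E.
Hypothesis psi_expand : forall e : R, 0 < e -> \forall r \near (0 : R),
  `|psi r - psi0 - r * -1| <= e * `|r|.
Hypothesis mT : forall n, measurable_fun setT (@Tn n).
Hypothesis reg : forall (h : R) (f : R -> R), continuous f ->
  (exists C : R, forall x, `|f x| <= C) ->
  \int[iid_law (law (h / Num.sqrt n%:R)) n]_t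
     f (Num.sqrt n%:R * (Tn t - psi (h / Num.sqrt n%:R)))
  @[n --> \oo] --> \int[L]_x f x.
Let sigma2 := \int[Q]_o (s o ^+ 2).

Let B0 : 0 <= B. Proof. exact: le_trans (normr_ge0 _) (sB point). Qed.

Let X n (t : n.-tuple T) : R := Num.sqrt n%:R * (Tn t - psi0).

Let mX n : measurable_fun setT (@X n).
Proof. by apply: measurable_funM => //; apply: measurable_funB => //; exact: mT. Qed.

Lemma small_local_density (h : R) : \forall n \near \oo, `|h / Num.sqrt n%:R| * B <= 1.
Proof.
have : `|h / Num.sqrt n%:R| * B @[n --> \oo] --> `|h * 0| * B.
  by apply: cvgMl; apply: cvg_norm; apply: cvgMr; exact: cvg_inv_sqrtn.
by rewrite mulr0 normr0 mul0r => /cvgr_le/(_ _ ltr01).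
Qed.

Variable P : forall n, probability (n.-tuple T) R.
Hypothesis PE : forall n A, P n A = iid_law Q n A.

(** Regularity under the local laws is rewritten under the fixed law. Since psi has derivative -1,
    the centring moves by -h / sqrt n, which turns the statistic into X + h; and the product density
    is replaced by its Gaussian approximation. *)
Let regular_tilted (f : R -> R) (h : R) : lipschitz01 f ->
  \int[P n]_t (f (X t + h) * expR (h * (sample_sum s t / Num.sqrt n%:R) - h ^+ 2 * sigma2 / 2))
    @[n --> \oo] --> \int[L]_x f x.
Proof.
move=> fL; have cf := lipschitz01_continuous fL; have [mf f01 [K K0 fK]] := fL.
have fC x : `|f x| <= 1 by have /andP[f0 f1] := f01 x; rewrite ger0_norm.
have creg := @reg h f cf (ex_intro _ 1 fC).
have cdel := @cvg_local_shift R psi psi0 (-1) h psi_expand.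
have clik := @cvg_likelihood _ _ _ Q s B ms sB s0 P PE h.
pose del n := Num.sqrt n%:R * (psi (h / Num.sqrt n%:R) - psi0).
pose E n (t : n.-tuple T) := expR (h * (sample_sum s t / Num.sqrt n%:R) - h ^+ 2 * sigma2 / 2).
pose g n o : R := 1 + h / Num.sqrt n%:R * s o.
pose err n : R := K * `|h * -1 - del n| + \int[P n]_t `|sample_prod (g n) t - E n t|.
have cerr : err n @[n --> \oo] --> (0 : R).
  have -> : (0 : R) = K * `|h * -1 - h * -1| + 0 by rewrite subrr normr0 mulr0 addr0.
  apply: cvgD => //; apply: cvgMr; apply: cvg_norm; apply: cvgB => //; exact: cvg_cst.
have key : \forall n \near \oo,
   `|\int[P n]_t (f (X t + h) * E n t) - \int[iid_law (law (h / Num.sqrt n%:R)) n]_t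
     f (Num.sqrt n%:R * (Tn t - psi (h / Num.sqrt n%:R)))| <= err n.
  apply: filterS (small_local_density h) => n hB.
  have mg : measurable_fun setT (g n) by apply: measurable_funD => //; exact: measurable_funM.
  have gC o : `|g n o| <= 1 + `|h / Num.sqrt n%:R| * B.
    by apply: (le_trans (ler_normD _ _)); rewrite normr1 normrM lerD2l ler_wpM2l.
  have g0 o : 0 <= g n o.
    have : `|h / Num.sqrt n%:R * s o| <= 1 by rewrite normrM (le_trans _ hB)// ler_wpM2l.
    by rewrite ler_norml /g => /andP[? _]; lra.
  have mfX (c : R) : measurable_fun setT (fun t : n.-tuple T => f (X t + c)).
    exact: (measurableT_comp mf (measurable_funD (@mX n) (measurable_cst c))).
  have fE (t : n.-tuple T) : f (Num.sqrt n%:R * (Tn t - psi (h / Num.sqrt n%:R))) = f (X t + - del n).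
    by congr f; rewrite /X /del; ring.
  have -> : \int[iid_law (law (h / Num.sqrt n%:R)) n]_t
     f (Num.sqrt n%:R * (Tn t - psi (h / Num.sqrt n%:R))) =
     \int[P n]_t (f (X t + - del n) * sample_prod (g n) t).
    under eq_Rintegral do rewrite fE.
    rewrite (Rintegral_iid_density (lawE hB) mg g0 gC (mfX _) (fun t => fC _)).
    have E' A : measurable A -> iid_law Q n A = P n A by move=> _; rewrite PE.
    exact: (@eq_measure_Rintegral _ _ R (iid_law Q n) (P n) _ E').
  have IE : (P n).-integrable setT (EFin \o E n).
    have := integrableZR (expR (- (h ^+ 2 * sigma2 / 2))) (@integrable_expD _ _ _ s B ms sB P h n).
    by apply: eq_integrable => // t _ /=; rewrite /E addrC expRD.
  have Ig := @bounded_sample_prod _ _ _ P n _ _ mg gC.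
  have I1 := integrable_mulb (mfX h) (fun t => fC _) IE.
  have I2 := integrable_mulb (mfX (- del n)) (fun t => fC _) Ig.
  rewrite -(RintegralB measurableT I1 I2).
  have sp0 (t : n.-tuple T) : 0 <= sample_prod (g n) t by apply: prodr_ge0.
  have sp1 : \int[P n]_t sample_prod (g n) t = 1.
    have E' A : measurable A -> P n A = iid_law Q n A by move=> _; rewrite PE.
    rewrite (@eq_measure_Rintegral _ _ R (P n) (iid_law Q n) _ E').
    rewrite (Rintegral_sample_prod Q n mg gC).
    have I := bounded_integrable Q ms sB.
    have Ic := Lfun2_integrable (Lfun_cst Q (1 : R) 2).
    rewrite (RintegralD measurableT Ic (integrableZR (h / Num.sqrt n%:R) I)).
    by rewrite (RintegralZl _ measurableT I) s0 mulr0 addr0 Rintegral_cst1 expr1n.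
  have In := integrable_norm (integrableBR Ig IE).
  have Ik := integrableZR (K * `|h * -1 - del n|) Ig.
  have -> : err n = \int[P n]_t (K * `|h * -1 - del n| * sample_prod (g n) t + `|sample_prod (g n) t - E n t|).
    by rewrite (RintegralD measurableT Ik In) (RintegralZl _ measurableT Ig) sp1 mulr1.
  apply: le_abs_Rintegral; last exact: integrableDR Ik In.
    by apply: measurable_funB; [exact: integrable_measurable I1|exact: integrable_measurable I2].
  (* Splits the two replacements: the shift costs the Lipschitz constant times its error, against a
     density of total mass 1, and the likelihood costs its L^1 distance, since |f| <= 1. *)
  move=> t; have -> : f (X t + h) * E n t - f (X t + - del n) * sample_prod (g n) t =
     (f (X t + h) - f (X t + - del n)) * sample_prod (g n) t - f (X t + h) * (sample_prod (g n) t - E n t) by ring.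
  apply: (le_trans (ler_normB _ _)); rewrite !normrM (ger0_norm (sp0 t)); apply: lerD.
    rewrite ler_wpM2r//; apply: (le_trans (fK _ _)); rewrite ler_wpM2l//.
    by rewrite distrC le_eqVlt; apply/orP; left; apply/eqP; congr `|_|; ring.
  by rewrite -[leRHS]mul1r ler_wpM2r.
apply/cvgrPdist_le => e e0; have e2 : 0 < e / 2 by rewrite divr_gt0.
have k2 : \forall n \near \oo, err n <= e / 2 by exact: cvgr_le cerr _ e2.
have k3 : \forall n \near \oo, `|\int[L]_x f x - \int[iid_law (law (h / Num.sqrt n%:R)) n]_t
     f (Num.sqrt n%:R * (Tn t - psi (h / Num.sqrt n%:R)))| <= e / 2.
  by have /cvgrPdist_le := creg; exact.
apply: filterS3 key k2 k3 => n h1 h2 h3.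
rewrite -/(E n); rewrite (le_trans (ler_distD (\int[iid_law (law (h / Num.sqrt n%:R)) n]_t
     f (Num.sqrt n%:R * (Tn t - psi (h / Num.sqrt n%:R)))) _ _))//.
rewrite (distrC _ (\int[P n]_t _)).
by move: h1 h2 h3; move: (`|_ - _|) (`|_ - _|) => p q; lra.
Qed.

Theorem score_mixture_approximation eps (l : seq (R * R)) e : 0 < sigma2 -> 0 < eps -> 0 < e ->
  exists M : probability Rm R, forall p, p \in l -> 0 < p.2 ->
    `|\int[M]_x average (centered_gaussian (sigma2 + eps)^-1) (ramp p.1 p.2) x -
      \int[L]_x ramp p.1 p.2 x| <= e.
Proof.
move=> s2 eps0 e0.
have mD n : measurable_fun setT (fun t : n.-tuple T => sample_sum s t / Num.sqrt n%:R).
  by apply: measurable_funM => //; exact: measurable_sample_sum.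
apply: (@mixture_approximation _ _ _ P X _ L sigma2 mX mD s2 _ _ regular_tilted eps eps0 l e e0).
- by move=> h n; exact: (@integrable_expD _ _ _ s B ms sB P h n).
- by move=> h; exact: (@cvg_expD _ _ _ Q s B ms sB s0 P PE h).
Qed.

End regular_along_score.

Lemma average_dist_le {R : realType} (N : probability (measurableTypeR R) R)
    (f g : R -> R) (K C x : R) :
  measurable_fun setT f -> measurable_fun setT g -> (forall y, `|f y| <= K) ->
  (forall y, `|g y| <= K) -> (forall y, `|f y - g y| <= C) ->
  `|average N f x - average N g x| <= C.
Proof.
move=> mf mg fK gK fg.
have I1 := integrable_shift N x mf fK; have I2 := integrable_shift N x mg gK.
rewrite /average -(RintegralB measurableT I1 I2).
apply: normr_Rintegral_le; last by move=> y; exact: fg.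
by apply: measurable_funB; [exact: integrable_measurable I1|exact: integrable_measurable I2].
Qed.

(** N(0, w + u) is N(0, w) convolved with N(0, u), and the second factor moves a ramp by at most its
    Lipschitz constant times sqrt u. *)
Lemma average_gaussian_close {R : realType} (w u a d x : R) : 0 <= w -> 0 <= u -> 0 < d ->
  `|average (centered_gaussian (w + u)) (ramp a d) x -
    average (centered_gaussian w) (ramp a d) x| <= d^-1 * Num.sqrt u.
Proof.
move=> w0 u0 d0; have mr := @measurable_ramp _ a d d0; have r1 := ramp_le1 a d.
have [ma _ a01 _] := average_ramp (centered_gaussian u) a d0.
have a1 y : `|average (centered_gaussian u) (ramp a d) y| <= 1.
  by have /andP[h0 h1] := a01 y; rewrite ger0_norm.
have di : 0 <= d^-1 by rewrite invr_ge0 ltW.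
have close y : `|average (centered_gaussian u) (ramp a d) y - ramp a d y| <= d^-1 * Num.sqrt u.
  by apply: (average_gaussian_lipschitz u0 _ mr r1 di) => p q; exact: ramp_lipschitz.
apply: (eq_ind _ (fun r => `|r - _| <= _) _ _ (average_gaussian_semigroup x w0 u0 mr r1)).
exact: (average_dist_le _ x ma mr a1 r1 close).
Qed.

(** * Scores that nearly attain the bound *)

Section least_favourable_score.
Context {d} {T : measurableType d} {R : realType} (P : probability T R)
  (S : set (T -> R)).
Hypothesis SL2 : forall s, S s -> s \in Lfun P 2%:E.
Hypothesis S0 : S (cst 0).
Hypothesis Slin : forall (a : R) s1 s2, S s1 -> S s2 -> S (fun o => a * s1 o + s2 o).

(* The multiple of s that is closest to D is at squared distance v - c^2 / t, where
   c = <D, s> and t = |s|^2. *)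
Lemma least_favourable_score (D : T -> R) (rho : R) : L2_closure P S D ->
  0 < \int[P]_o (D o ^+ 2) -> 0 < rho ->
  exists s, [/\ S s, \int[P]_o (D o * s o) = -1, 0 < \int[P]_o (s o ^+ 2) &
    \int[P]_o (D o ^+ 2) - rho <= (\int[P]_o (s o ^+ 2))^-1 <= \int[P]_o (D o ^+ 2)].
Proof.
move=> /(L2_closureP SL2)[LD h]; set v := \int[P]_o (D o ^+ 2) => v0 rho0.
(* A squared distance below v forces c to be nonzero, so that s can be rescaled; a squared distance
   below rho gives the lower estimate. *)
have [|s [Ss hs]] := h (Num.min v rho); first by rewrite lt_min v0.
have Ls := SL2 Ss; set c := \int[P]_o (D o * s o); set t := \int[P]_o (s o ^+ 2).
have IDs := Lfun2M LD Ls; have ID := Lfun2_sqr LD; have Is := Lfun2_sqr Ls.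
have E : \int[P]_o ((D o - s o) ^+ 2) = v - 2 * c + t.
  rewrite /v /c /t -(RintegralZl _ measurableT IDs).
  rewrite -(RintegralB measurableT ID (integrableZR 2 IDs)).
  rewrite -(RintegralD measurableT (integrableBR ID (integrableZR 2 IDs)) Is).
  by apply: eq_Rintegral => o _; ring.
have cs : c ^+ 2 <= v * t by exact: cauchy_schwarz.
have t0 : 0 <= t by apply: Rintegral_ge0 => o _; exact: sqr_ge0.
move: hs; rewrite E lt_min => /andP[h1 h2].
have c0 : c != 0 by apply/eqP => c0; move: h1; rewrite c0; lra.
have tp : 0 < t.
  rewrite lt_def t0 andbT; apply/eqP => tz; move: cs; rewrite tz mulr0.
  by rewrite le_eqVlt sqrf_eq0 (negPf c0)/= ltNge sqr_ge0.
have I : \int[P]_o ((- c^-1 * s o + cst 0 o) ^+ 2) = t / c ^+ 2.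
  rewrite mulrC /t -(RintegralZl _ measurableT Is); apply: eq_Rintegral => o _ /=.
  by rewrite addr0 exprMn sqrrN exprVn.
exists (fun o => - c^-1 * s o + cst 0 o); split.
- exact: Slin.
- transitivity (- c^-1 * c); last by rewrite mulNr mulVf.
  rewrite /c -(RintegralZl _ measurableT IDs); apply: eq_Rintegral => o _ /=.
  by rewrite addr0 mulrCA.
- by rewrite I divr_gt0// exprn_even_gt0.
- rewrite I invf_div; apply/andP; split; last by rewrite ler_pdivrMr.
  rewrite ler_pdivlMr//.
  (* Adding (t - c)^2 >= 0 to (v - 2 c + t) t <= rho t gives (v - rho) t <= c^2. *)
  have := sqr_ge0 (t - c); have : (v - 2 * c + t) * t <= rho * t by rewrite ler_pM2r// ltW.
  by nra.
Qed.

End least_favourable_score.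

Section convolution_theorem.
Context {dX dW} {TX : measurableType dX} {TW : measurableType dW}
  {R : realType} {J : nat} (P : probability (TX * TW)%type R).
Local Notation O := (TX * TW)%type.
Variables (model : set (probability O R))
  (b : probability O R -> 'I_J.+1 -> TX -> R) (zeta : 'I_J.+1 -> O -> R)
  (lam : 'I_J.+1 -> TX -> R) (S : set (O -> R)).
Local Notation L2 f := (f \in Lfun P 2%:E).
Local Notation D := (weighted_score b P zeta lam).
Local Notation Rm := (measurableTypeR R).

Hypothesis mbQ : forall Q, model Q -> forall j, measurable_fun setT (b Q j).
Hypothesis modelP : model P.
Hypothesis Lq : L2 (fun o : O => qfun b P o.1).
Hypothesis Lz : forall j, L2 (zeta j).
Hypothesis z0 : forall j, {ae P, forall o : O, condexp P (zeta j) o.1 = 0}.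
Hypothesis minw : minimizing_weight b P zeta lam.
Hypothesis scoreS : score_space b P zeta S.
Hypothesis smooth : smooth_along model b P zeta S.

Lemma regular_along_score (Tn : forall n, n.-tuple O -> R) L s (h : R) (f : R -> R) :
  regular_with_limit b P S Tn L -> S s ->
  continuous f -> (exists C : R, forall x, `|f x| <= C) ->
  \int[iid_law (linear_tilt P s (h / Num.sqrt n%:R)) n]_t
     f (Num.sqrt n%:R * (Tn n t - Psi b (linear_tilt P s (h / Num.sqrt n%:R))))
  @[n --> \oo] --> \int[L]_x f x.
Proof.
move=> [_ reg] Ss cf fC.
have inj : injective (fun _ : 'I_1 => s) by move=> i j _; rewrite !ord1.
have E n : local_law P (fun=> s) ((Num.sqrt n%:R)^-1 *: const_mx h : 'rV[R]_1) =
    linear_tilt P s (h / Num.sqrt n%:R).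
  by rewrite local_law1 !mxE mulrC.
have H := @reg 1 (fun=> s) (const_mx h) inj (fun=> Ss) f cf fC.
cbv zeta in H.
under eq_fun do rewrite -E.
exact: H.
Qed.

(** For given ramps and precision, s and eps are chosen so that the posterior variance w lies
    between v - rho and v; the exact variance v is then substituted at a cost of K sqrt rho. The
    degenerate case v = 0 takes M = L. *)
Theorem regular_limit_gaussian_factor L : L2_closure P S D -> regular_limit b P S L ->
  has_gaussian_factor (\int[P]_o (D o ^+ 2)) L.
Proof.
move=> SD [Tn regT]; have [SH Sbd S0 Slin] := scoreS.
have SL2 s : S s -> L2 s by exact: (score_Lfun2 scoreS).
set v := \int[P]_o (D o ^+ 2).
have v0 : 0 <= v by apply: Rintegral_ge0 => o _; exact: sqr_ge0.
apply: gaussian_factor_of_approximation => // l e e0.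
have [vz|vnz] := eqVneq v 0.
  exists L => p _ p0; rewrite vz.
  rewrite (_ : \int[L]_x average (centered_gaussian 0) (ramp p.1 p.2) x = \int[L]_x ramp p.1 p.2 x) ?subrr ?normr0 ?(ltW e0)//.
  by apply: eq_Rintegral => x _; apply: average_gaussian0; exact: measurable_ramp.
have vp : 0 < v by rewrite lt_def vnz.
(* Dominates the Lipschitz constants of all the ramps in the list at once. *)
pose K : R := \sum_(p <- l) `|p.2^-1|.
have K0 : 0 <= K by apply: sumr_ge0.
have pK p : p \in l -> p.2^-1 <= K.
  move=> pl; rewrite /K (big_rem p)//=; apply: (le_trans (ler_norm _)).
  by rewrite lerDl sumr_ge0.
pose rho : R := (e / (2 * (K + 1))) ^+ 2.
have K1 : 0 < K + 1 by rewrite ltr_pwDr.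
have rho0 : 0 < rho by rewrite exprn_gt0// divr_gt0// mulr_gt0.
have rho2 : 0 < rho / 2 by rewrite divr_gt0.
have [s [Ss Ds s2 /andP[lo hi]]] := least_favourable_score SL2 S0 Slin SD vp rho2.
have [B sB] := Sbd _ Ss; have ms := Lfun2_measurable (SL2 _ Ss).
have s0 := score_mean0 scoreS Ss.
set sig := \int[P]_o (s o ^+ 2) in s2 lo hi.
(* Chosen so that 1 / sig - 1 / (sig + eps) = eps / (sig (sig + eps)) is at most eps / sig^2 = rho /
   2; the other half of rho is spent on the choice of s. *)
pose eps : R := rho / 2 * sig ^+ 2.
have eps0 : 0 < eps by rewrite mulr_gt0// exprn_gt0.
have e2 : 0 < e / 2 by rewrite divr_gt0.
have Pn n := cid (probability_of (m := iid_law P n) (iid_law_setT P n)).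
have psiE := Psi_expansion mbQ modelP Lq Lz z0 minw scoreS smooth Ss.
rewrite Ds in psiE.
have [mT _] := regT.
have [M HM] := @score_mixture_approximation _ _ R P s B (linear_tilt P s)
  (fun r => Psi b (linear_tilt P s r)) (Psi b P) Tn L ms sB s0 (linear_tiltE ms s0 sB) psiE mT
  (fun h f => @regular_along_score Tn L s h f regT Ss)
  (fun n => projT1 (Pn n)) (fun n => projT2 (Pn n)) eps l (e / 2) s2 eps0 e2.
exists M => p pl p0; have := HM p pl p0; rewrite -/sig.
set w := (sig + eps)^-1 => hM.
have se : 0 < sig + eps by rewrite addr_gt0.
have w0 : 0 <= w by rewrite invr_ge0 ltW.
have wsig : w <= sig^-1 by rewrite lef_pV2 ?posrE// lerDl ltW.
have wv : w <= v by exact: le_trans wsig hi.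
have vw : v - w <= rho.
  have : sig^-1 - w <= rho / 2.
    have -> : sig^-1 - w = eps / (sig * (sig + eps)) by rewrite /w; field; rewrite !gt_eqF.
    rewrite ler_pdivrMr ?mulr_gt0// /eps expr2 mulrDr mulrDr.
    rewrite lerDl; exact: ltW (mulr_gt0 rho2 (mulr_gt0 s2 (mulr_gt0 rho2 (mulr_gt0 s2 s2)))).
  by move: lo; rewrite -/v; move: sig^-1 => y; lra.
have mr := @measurable_ramp _ p.1 p.2 p0; have r1 := ramp_le1 p.1 p.2.
have [ma _ a01 _] := average_ramp (centered_gaussian v) p.1 p0.
have [mw _ w01 _] := average_ramp (centered_gaussian w) p.1 p0.
have Iv : M.-integrable setT (EFin \o (average (centered_gaussian v) (ramp p.1 p.2) : Rm -> R)).
  by apply: (bounded_integrable M ma (C := 1)) => y; have /andP[? ?] := a01 y; rewrite ger0_norm.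
have Iw : M.-integrable setT (EFin \o (average (centered_gaussian w) (ramp p.1 p.2) : Rm -> R)).
  by apply: (bounded_integrable M mw (C := 1)) => y; have /andP[? ?] := w01 y; rewrite ger0_norm.
have diff : `|\int[M]_x average (centered_gaussian v) (ramp p.1 p.2) x -
    \int[M]_x average (centered_gaussian w) (ramp p.1 p.2) x| <= e / 2.
  rewrite -(RintegralB measurableT Iv Iw); apply: normr_Rintegral_le.
    by apply: measurable_funB; [exact: integrable_measurable Iv|exact: integrable_measurable Iw].
  have vw0 : 0 <= v - w by rewrite subr_ge0.
  have vE : w + (v - w) = v by ring.
  have close := average_gaussian_close p.1 _ w0 vw0 p0; rewrite vE in close.
  move=> x; apply: (le_trans (close x)).
  have sq : Num.sqrt (v - w) <= e / (2 * (K + 1)).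
    rewrite -[leRHS]ger0_norm; last by rewrite divr_ge0 ?ltW// mulr_gt0.
    by rewrite -sqrtr_sqr ler_wsqrtr.
  apply: (@le_trans _ _ (K * (e / (2 * (K + 1))))).
    by apply: ler_pM => //; [rewrite invr_ge0 ltW|exact: pK].
  have -> : K * (e / (2 * (K + 1))) = e / 2 * (K / (K + 1)) by field; rewrite gt_eqF.
  by rewrite ger_pMr// ler_pdivrMr// mul1r lerDl.
apply: (le_trans (ler_distD (\int[M]_x average (centered_gaussian w) (ramp p.1 p.2) x) _ _)).
by move: diff hM; move: (`|_|) (`|_|) => q1 q2; lra.
Qed.

End convolution_theorem.

(** * Sharpness of the bound *)

Section sample_mean_regular.
Context {d} {T : measurableType d} {R : realType} (Q : probability T R).
Local Notation Rm := (measurableTypeR R).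
Variables (s D : T -> R) (B : R) (law : R -> probability T R) (psi : R -> R) (psi0 : R).
Hypotheses (ms : measurable_fun setT s) (sB : forall o, `|s o| <= B).
Hypothesis lawE : forall r, `|r| * B <= 1 -> forall A, measurable A ->
  law r A = (\int[Q]_(o in A) (1 + r * s o)%:E)%E.
Hypotheses (LD : D \in Lfun Q 2%:E) (D0 : \int[Q]_o D o = 0).
Hypothesis psi_expand : forall e : R, 0 < e -> \forall r \near (0 : R),
  `|psi r - psi0 - r * \int[Q]_o (D o * s o)| <= e * `|r|.

Let B0 : 0 <= B. Proof. exact: le_trans (normr_ge0 _) (sB point). Qed.
Let c := \int[Q]_o (D o * s o).
Let v := \int[Q]_o (D o ^+ 2).
Let v0 : 0 <= v. Proof. by apply: Rintegral_ge0 => o _; exact: sqr_ge0. Qed.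

Let root n : R := (Num.sqrt n%:R)^-1.
Let g n o : R := 1 + root n * s o.

Let root_ge0 n : 0 <= root n. Proof. by rewrite invr_ge0 sqrtr_ge0. Qed.

Let small : \forall n \near \oo, `|root n| * B <= 1.
Proof. by have := small_local_density B 1; apply: filterS => n; rewrite div1r. Qed.

Let root_sqr n : (0 < n)%N -> root n ^+ 2 = n%:R^-1.
Proof. by move=> n0; rewrite /root exprVn sqr_sqrtr. Qed.

Let mg n : measurable_fun setT (g n).
Proof. by apply: measurable_funD => //; exact: measurable_funM. Qed.

Let g02 n o : `|root n| * B <= 1 -> 0 <= g n o <= 2.
Proof.
move=> hB; have : `|root n * s o| <= 1 by rewrite normrM (le_trans _ hB)// ler_wpM2l.
by rewrite ler_norml /g => /andP[? ?]; apply/andP; split; lra.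
Qed.

Let law_integral n f : `|root n| * B <= 1 -> Q.-integrable setT (EFin \o f) ->
  (law (root n)).-integrable setT (EFin \o f) /\
  \int[law (root n)]_o f o = \int[Q]_o (f o * g n o).
Proof.
move=> hB If; have mf := integrable_measurable If.
have g0 o : 0 <= g n o by have /andP[] := g02 o hB.
have I : Q.-integrable setT (EFin \o (fun o => f o * g n o)).
  have gC o : `|g n o| <= 2 by have /andP[h0 h1] := g02 o hB; rewrite ger0_norm.
  have := integrable_mulb (mg n) gC If.
  by apply: eq_integrable => // o _ /=; rewrite mulrC.
split; first exact: (integrable_density (lawE hB) (mg n) g0 mf I).
exact: (Rintegral_density (lawE hB) (mg n) g0 mf I).
Qed.

Let mD : measurable_fun setT D. Proof. exact: Lfun2_measurable LD. Qed.
Let Y n o : R := root n * D o.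

(** Under the tilted law the summand D / sqrt n has mean c / n, because D has mean zero under Q. D
    is unbounded with only two moments: n times the small moment is at most twice the mean of min
    (D^2, |D|^3 / sqrt n), which vanishes by dominated convergence. *)
Let triangular : triangular_limit (fun n => law (root n)) Y c v.
Proof.
have ID := Lfun2_integrable LD; have ID2 := Lfun2_sqr LD.
have Ls : s \in Lfun Q 2%:E by exact: Lfun2_bounded sB.
have IDs := Lfun2M LD Ls.
have ID2s : Q.-integrable setT (EFin \o (fun o => D o ^+ 2 * s o)).
  have := integrable_mulb ms sB ID2.
  by apply: eq_integrable => // o _ /=; rewrite mulrC.
have LY n : Y n \in Lfun Q 2%:E by exact: Lfun2Z.
have npos : \forall n \near \oo, (0 < n)%N by exact: nbhs_infty_gt.
split.
- apply: filterS small => n hB; apply: Lfun2I; first exact: Lfun2_measurable (LY n).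
  exact: (law_integral hB (Lfun2_sqr (LY n))).1.
- apply: cvg_near_cst; apply: filterS2 small npos => n hB n0.
  rewrite (law_integral hB (Lfun2_integrable (LY n))).2.
  have -> : \int[Q]_o (Y n o * g n o) = \int[Q]_o (root n * D o + root n ^+ 2 * (D o * s o)).
    by apply: eq_Rintegral => o _; rewrite /Y /g; ring.
  rewrite (RintegralD measurableT (integrableZR _ ID) (integrableZR _ IDs)).
  rewrite (RintegralZl _ measurableT ID) (RintegralZl _ measurableT IDs) D0 mulr0 add0r.
  by rewrite root_sqr// mulrA mulfV ?mul1r// pnatr_eq0 -lt0n.
- have E : \forall n \near \oo, v + root n * \int[Q]_o (D o ^+ 2 * s o) =
      n%:R * \int[law (root n)]_o Y n o ^+ 2.
    apply: filterS2 small npos => n hB n0.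
    rewrite (law_integral hB (Lfun2_sqr (LY n))).2.
    have -> : \int[Q]_o (Y n o ^+ 2 * g n o) =
        \int[Q]_o (root n ^+ 2 * (D o ^+ 2 + root n * (D o ^+ 2 * s o))).
      by apply: eq_Rintegral => o _; rewrite /Y /g; ring.
    have IR := integrableZR (root n) ID2s.
    rewrite (RintegralZl _ measurableT (integrableDR ID2 IR)).
    rewrite (RintegralD measurableT ID2 IR) (RintegralZl _ measurableT ID2s).
    by rewrite root_sqr// mulrA mulfV ?mul1r// pnatr_eq0 -lt0n.
  apply: (cvg_trans (near_eq_cvg E)).
  have : v + root n * \int[Q]_o (D o ^+ 2 * s o) @[n --> \oo] -->
      v + 0 * \int[Q]_o (D o ^+ 2 * s o).
    by apply: cvgD; [exact: cvg_cst|apply: cvgMl; exact: cvg_inv_sqrtn].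
  by rewrite mul0r addr0.
- pose m n o : R := Num.min (D o ^+ 2) (root n * `|D o| ^+ 3).
  have mm n : measurable_fun setT (m n).
    apply: measurable_minr; first exact: measurable_funX.
    by apply: measurable_funM => //; apply: measurable_funX; exact: measurableT_comp.
  have m0 n o : 0 <= m n o by rewrite le_min sqr_ge0 mulr_ge0// exprn_ge0.
  have m1 n o : `|m n o| <= D o ^+ 2 by rewrite ger0_norm// ge_min lexx.
  have Im n : Q.-integrable setT (EFin \o m n) by exact: (le_integrableR (mm n) (m1 n) ID2).
  have cm : \int[Q]_o m n o @[n --> \oo] --> (0 : R).
    rewrite -[X in _ --> X](Rintegral_cst1 Q).
    apply: (dominated_Rcvg (g := fun o => D o ^+ 2)) => //.
    apply: aeW => o; apply: (squeeze_cvgr (f := cst 0) (h := fun n => root n * `|D o| ^+ 3)).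
    + by apply: nearW => n; rewrite m0 ge_min lexx orbT.
    + exact: cvg_cst.
    + rewrite -[X in _ --> X](mul0r (`|D o| ^+ 3)).
      by apply: cvgMl; exact: cvg_inv_sqrtn.
  apply: (squeeze_cvgr (f := cst 0) (h := fun n => 2 * \int[Q]_o m n o)).
  + apply: filterS2 small npos => n hB n0; apply/andP; split.
      rewrite mulr_ge0//; apply: Rintegral_ge0 => o _.
      by rewrite le_min sqr_ge0 exprn_ge0.
    rewrite (law_integral hB (integrable_small_moment (LY n))).2.
    have smE o : small_moment (Y n) o = root n ^+ 2 * m n o.
      rewrite /small_moment /m /Y minr_pMr ?sqr_ge0// exprMn; congr Num.min.
      by rewrite normrM (ger0_norm (root_ge0 n)) exprMn; ring.
    have -> : \int[Q]_o (small_moment (Y n) o * g n o) = \int[Q]_o (root n ^+ 2 * (g n o * m n o)).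
      by apply: eq_Rintegral => o _; rewrite smE; ring.
    have Igm : Q.-integrable setT (EFin \o (fun o => g n o * m n o)).
      apply: (integrable_mulb (C := 2)) => // o.
      by have /andP[h0 h1] := g02 o hB; rewrite ger0_norm.
    rewrite (RintegralZl _ measurableT Igm) root_sqr// mulrA mulfV ?mul1r ?pnatr_eq0 -?lt0n//.
    rewrite -(RintegralZl _ measurableT (Im n)).
    apply: le_Rintegral => //; first exact: integrableZR.
    by move=> o _; rewrite ler_wpM2r//; case/andP: (g02 o hB).
  + exact: cvg_cst.
  + by rewrite -(mulr0 2); apply: cvgMr.
Qed.

(** The drift c which the tilt gives to the normalized sum is cancelled by the shift of the target,
    whose derivative is the same c; this cancellation is regularity. *)
Theorem sample_mean_regular (f : R -> R) : continuous f -> (exists C : R, forall x, `|f x| <= C) ->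
  \int[iid_law (law (Num.sqrt n%:R)^-1) n]_t
    f (Num.sqrt n%:R * (psi0 + sample_sum D t / n%:R - psi (Num.sqrt n%:R)^-1))
  @[n --> \oo] --> \int[centered_gaussian v]_x f x.
Proof.
pose del n : R := Num.sqrt n%:R * (psi (root n) - psi0).
have cdel : del n @[n --> \oo] --> c.
  have := @cvg_local_shift R psi psi0 c 1 psi_expand; rewrite mul1r.
  by under eq_fun do rewrite div1r.
pose stat n (t : n.-tuple T) : R := Num.sqrt n%:R * (psi0 + sample_sum D t / n%:R - psi (root n)).
have mstat n : measurable_fun setT (@stat n).
  apply: measurable_funM => //; apply: measurable_funB => //; apply: measurable_funD => //.
  by apply: measurable_funM => //; exact: measurable_sample_sum.
have statE n (t : n.-tuple T) : (0 < n)%N -> stat n t = - del n + sample_sum (Y n) t.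
  move=> n0; rewrite /stat /del /Y /sample_sum -mulr_sumr -/(sample_sum D t).
  have -> : n%:R = Num.sqrt n%:R ^+ 2 :> R by rewrite sqr_sqrtr.
  have w0 : Num.sqrt n%:R != 0 :> R by rewrite gt_eqF// sqrtr_gt0 ltr0n.
  by rewrite sqrtr_sqr ger0_norm ?sqrtr_ge0// /root; field.
have Pn n := cid (probability_of (m := iid_law (law (root n)) n) (iid_law_setT (law (root n)) n)).
have Nu n := cid (image_probability (projT1 (Pn n)) (mstat n : measurable_fun setT (@stat n : _ -> Rm))).
pose nu n := projT1 (Nu n).
have nuE n (h : R -> R) : measurable_fun setT h ->
    \int[nu n]_x h x = \int[iid_law (law (root n)) n]_t h (stat n t).
  move=> mh; rewrite (Rintegral_image (fun A _ => projT2 (Nu n) A) (mstat n) mh).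
  apply: (@eq_measure_Rintegral _ _ R (projT1 (Pn n)) (iid_law (law (root n)) n)) => A _.
  exact: projT2 (Pn n) A.
have npos : \forall n \near \oo, (0 < n)%N by exact: nbhs_infty_gt.
have ramp_cvg a w : 0 < w -> \int[nu n]_x ramp a w x @[n --> \oo] -->
    \int[centered_gaussian v]_x ramp a w x.
  move=> w0; have [f1 [f2 [_ Tp]]] := taylor2_ramp a w0.
  have mr := @measurable_ramp _ a w w0.
  have [_ _ _ lip] := average_ramp (centered_gaussian v) a w0.
  have A0 : \int[centered_gaussian v]_x ramp a w x = average (centered_gaussian v) (ramp a w) 0.
    by rewrite /average; apply: eq_Rintegral => x _; rewrite add0r.
  have cA : w^-1 * `|c - del n| @[n --> \oo] --> (0 : R).
    have -> : (0 : R) = w^-1 * `|c - c| by rewrite subrr normr0 mulr0.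
    by apply: cvgMr; apply: cvg_norm; apply: cvgB => //; exact: cvg_cst.
  apply/cvgrPdist_le => e e0; have e2 : 0 < e / 2 by rewrite divr_gt0.
  have h1 := lindeberg v0 triangular Tp e2.
  have h2 : \forall n \near \oo, w^-1 * `|c - del n| <= e / 2 by exact: cvgr_le cA _ e2.
  (* The starting point -del n varies with n, which the uniformity of [lindeberg] allows; its
     distance to -c is then absorbed by the Lipschitz bound. *)
  apply: filterS3 npos h1 h2 => n n0 /(_ (- del n)) h1 h2.
  rewrite (nuE _ _ mr) A0.
  have -> : \int[iid_law (law (root n)) n]_t ramp a w (stat n t) =
     \int[iid_law (law (root n)) n]_t ramp a w (- del n + sample_sum (Y n) t).
    by apply: eq_Rintegral => t _; rewrite statE.
  have h3 := lip (- del n + c) 0; rewrite subr0 [- _ + c]addrC in h3.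
  rewrite distrC; apply: (le_trans (ler_distD (average (centered_gaussian v) (ramp a w) (- del n + c)) _ _)).
  rewrite [- del n + c]addrC in h1 *; have := lerD h1 (le_trans h3 h2).
  by move=> h4; apply: (le_trans h4); lra.
move=> cf fC.
have mf : measurable_fun setT f by exact: continuous_measurable_fun.
have := @weak_cvg_of_ramps R nu (centered_gaussian v) ramp_cvg f cf fC.
apply: cvg_trans; apply: near_eq_cvg; apply: nearW => n /=.
by rewrite (nuE n f mf).
Qed.

End sample_mean_regular.

(* Compare the integrals of exp x + exp (- x), which is at least 2. *)
Lemma gaussian_factor_variance_le {R : realType} (v v' : R) : 0 <= v -> 0 <= v' ->
  has_gaussian_factor v' (centered_gaussian v) -> v' <= v.
Proof.
pose Rm := measurableTypeR R.
move=> v0 v'0 [M ME].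
have mexp (a : R) : measurable_fun setT (fun z : Rm => (expR (a * (z : R)))%:E).
  by apply/measurable_EFinP; apply: measurableT_comp => //; exact: measurable_funM.
have madd : measurable_fun setT (fun z : Rm * Rm => (z.1 : R) + (z.2 : R) : Rm).
  exact: measurable_funD.
have e0 (a x : R) : (0 <= (expR (a * x))%:E)%E by rewrite lee_fin expR_ge0.
have E (a : R) : ((expR (a ^+ 2 * v / 2))%:E =
    (expR (a ^+ 2 * v' / 2))%:E * \int[M]_y (expR (a * (y : R)))%:E)%E.
  rewrite -(integral_gaussian_expR a v0) -(integral_gaussian_expR a v'0).
  etransitivity.
    exact: (@ge0_integral_image _ _ _ _ R (centered_gaussian v' \x M)%E (centered_gaussian v)
      (fun z : Rm * Rm => (z.1 : R) + (z.2 : R) : Rm) _ ME madd (mexp a) (fun x => e0 a x)).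
  have mF : measurable_fun setT (fun z : Rm * Rm => (expR (a * ((z.1 : R) + (z.2 : R))))%:E).
    exact: (measurableT_comp (mexp a) madd).
  rewrite (@fubini_tonelli1 _ _ Rm Rm R (centered_gaussian v') M _ mF (fun z => e0 a _)).
  rewrite /fubini_F /=.
  transitivity (\int[centered_gaussian v']_x ((expR (a * (x : R)))%:E * \int[M]_y (expR (a * (y : R)))%:E))%E.
    apply: eq_integral => x _; rewrite -(ge0_integralZl M measurableT (mexp a) (fun y _ => e0 a y) (e0 a x)).
    by apply: eq_integral => y _; rewrite mulrDr expRD EFinM.
  have k0 : (0 <= \int[M]_y (expR (a * (y : R)))%:E)%E.
    by apply: integral_ge0 => y _; exact: e0.
  exact: (ge0_integralZr (centered_gaussian v') measurableT (mexp a) (fun x _ => e0 a x) k0).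
have E1 := E 1; have E2 := E (-1).
have sq1 : (-1) ^+ 2 = 1 ^+ 2 :> R by rewrite sqrrN.
rewrite sq1 in E2.
have two : (2%:E <= \int[M]_y (expR (1 * (y : R)))%:E + \int[M]_y (expR (-1 * (y : R)))%:E)%E.
  rewrite -(ge0_integralD M measurableT (fun y _ => e0 1 y) (mexp 1) (fun y _ => e0 (-1) y) (mexp (-1))).
  have -> : 2%:E = (\int[M]_y (2 : R)%:E)%E.
    by rewrite -EFin_Rintegral ?Rintegral_cst1//; exact: Lfun2_integrable (Lfun_cst M 2 2).
  apply: ge0_le_integral.
  - exact: measurableT.
  - by [].
  - exact: measurable_cst.
  - exact: (emeasurable_funD (mexp 1) (mexp (-1))).
  - move=> y _; rewrite -EFinD lee_fin mul1r mulN1r expRN.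
    have : 0 < expR (y : R) by exact: expR_gt0.
    move: (expR (y : R)) => z z0; rewrite -subr_ge0.
    have -> : z + z^-1 - 2 = (z - 1) ^+ 2 / z by field; rewrite gt_eqF.
    by rewrite divr_ge0 ?sqr_ge0// ltW.
have fac0 : (0 <= (expR (1 ^+ 2 * v' / 2))%:E)%E by rewrite lee_fin expR_ge0.
have := lee_wpmul2l fac0 two.
rewrite muleDr; [|by []|by apply: ge0_adde_def; rewrite inE; apply: integral_ge0 => y _; exact: e0].
rewrite -E1 -E2 -EFinM -EFinD lee_fin => h.
have : expR (1 ^+ 2 * v' / 2) <= expR (1 ^+ 2 * v / 2).
  by move: h; move: (expR _) (expR _) => p q; lra.
by rewrite ler_expR expr1n !mul1r ler_pM2r// invr_gt0.
Qed.

(** * Canonical gradient and sharp convolution bound *)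

Section canonical_gradient.
Context {dX dW} {TX : measurableType dX} {TW : measurableType dW}
  {R : realType} {J : nat} (P : probability (TX * TW)%type R).
Local Notation O := (TX * TW)%type.
Variables (model : set (probability O R))
  (b : probability O R -> 'I_J.+1 -> TX -> R) (zeta : 'I_J.+1 -> O -> R)
  (lam : 'I_J.+1 -> TX -> R) (S : set (O -> R)).
Local Notation L2 f := (f \in Lfun P 2%:E).
Local Notation D := (weighted_score b P zeta lam).

Hypothesis mbQ : forall Q, model Q -> forall j, measurable_fun setT (b Q j).
Hypothesis modelP : model P.
Hypothesis Lq : L2 (fun o : O => qfun b P o.1).
Hypothesis Lz : forall j, L2 (zeta j).
Hypothesis z0 : forall j, {ae P, forall o : O, condexp P (zeta j) o.1 = 0}.
Hypothesis minw : minimizing_weight b P zeta lam.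
Hypothesis scoreS : score_space b P zeta S.
Hypothesis smooth : smooth_along model b P zeta S.

Let SL2 s : S s -> L2 s. Proof. exact: (score_Lfun2 scoreS). Qed.
Let S0 : S (cst 0). Proof. by case: scoreS. Qed.
Let Slin (a : R) s1 s2 : S s1 -> S s2 -> S (fun o => a * s1 o + s2 o).
Proof. by case: scoreS => _ _ _; apply. Qed.
Let LD : L2 D. Proof. exact: (Lfun2_weighted_score (mbQ modelP) Lq Lz minw). Qed.

Let Psi_derive := pathwise_gradient_weighted_score mbQ modelP Lq Lz z0 minw scoreS smooth.

(** D* and its projection have the same inner products with scores, so both represent the
    derivative. Two gradients in the closure differ by an element that is orthogonal to S and in its
    closure, hence orthogonal to itself. *)
Lemma canonical_gradient_projection G : orthogonal_projection P (L2_closure P S) D G ->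
  canonical_gradient b P S G.
Proof.
move=> [_ LG SG orth].
have DG s : S s -> \int[P]_o (D o * s o) = \int[P]_o (G o * s o).
  move=> Ss; have := orth _ (sub_L2_closure SL2 Ss).
  have -> : \int[P]_o ((D o - G o) * s o) = \int[P]_o (D o * s o - G o * s o).
    by apply: eq_Rintegral => o _; rewrite mulrBl.
  rewrite (RintegralB measurableT (Lfun2M LD (SL2 Ss)) (Lfun2M LG (SL2 Ss))).
  by move/eqP; rewrite subr_eq0 => /eqP.
split=> //.
  by move=> s Ss; rewrite -DG//; exact: Psi_derive.
move=> G' SG' grad'; have [LG' _] := SG'.
have same s : S s -> \int[P]_o (G' o * s o) = \int[P]_o (G o * s o).
  move=> Ss; have d1 := grad' s Ss; have d2 := Psi_derive Ss.
  by rewrite -DG// -(@derive_val _ _ _ _ _ _ _ d1) (@derive_val _ _ _ _ _ _ _ d2).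
have SB := L2_closureB SL2 Slin SG' SG; have LB := Lfun2B LG' LG.
have orthB s : S s -> \int[P]_o ((G' o - G o) * s o) = 0.
  move=> Ss; have -> : \int[P]_o ((G' o - G o) * s o) = \int[P]_o (G' o * s o - G o * s o).
    by apply: eq_Rintegral => o _; rewrite mulrBl.
  by rewrite (RintegralB measurableT (Lfun2M LG' (SL2 Ss)) (Lfun2M LG (SL2 Ss))) same// subrr.
have := L2_closure_orthogonal SL2 LB orthB SB.
have -> : \int[P]_o ((G' o - G o) * (G' o - G o)) = \int[P]_o ((G' o - G o) ^+ 2).
  by apply: eq_Rintegral => o _; rewrite expr2.
move=> h; have := Rintegral_ae0 (Lfun2_sqr LB) (fun o => sqr_ge0 _) h.
by apply: filterS => o /eqP; rewrite sqrf_eq0 subr_eq0 => /eqP.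
Qed.

Lemma sample_mean_regular_limit :
  regular_limit b P S (centered_gaussian (\int[P]_o (D o ^+ 2))).
Proof.
have mD := Lfun2_measurable LD.
exists (fun n t => Psi b P + sample_sum D t / n%:R); split.
  move=> n; apply: measurable_funD => //; apply: measurable_funM => //.
  exact: measurable_sample_sum.
move=> k s h _ Ss /= f cf fC.
(* A multi-dimensional submodel followed in the direction h is the one-dimensional submodel along
   this combination, which lies in S by linearity. *)
pose sbar o := \sum_l h 0 l * s l o.
have Sbar : S sbar.
  rewrite /sbar; elim: (index_enum _) => [|l r IH].
    by under eq_fun do rewrite big_nil; exact: S0.
  by under eq_fun do rewrite big_cons; exact: Slin.
have lawE (r : R) : local_law P s (r *: h) = linear_tilt P sbar r.
  rewrite /local_law /linear_tilt; congr tilt; apply/funext => o.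
  by rewrite /sbar mulr_sumr; congr (_ + _); apply: eq_bigr => l _; rewrite !mxE mulrA.
have [_ Sbd _ _] := scoreS; have [B sB] := Sbd _ Sbar.
have ms := Lfun2_measurable (SL2 Sbar).
have s0 := score_mean0 scoreS Sbar.
have D0 : \int[P]_o D o = 0.
  by have [] := tangent_H_weighted_score (mbQ modelP) Lq Lz z0 minw.
have psiE := Psi_expansion mbQ modelP Lq Lz z0 minw scoreS smooth Sbar.
under eq_fun do rewrite lawE.
exact: (@sample_mean_regular _ _ R P sbar D B (linear_tilt P sbar)
  (fun r => Psi b (linear_tilt P sbar r)) (Psi b P) ms sB (linear_tiltE ms s0 sB) LD D0 psiE f cf fC).
Qed.

Theorem convolution_bound_weighted_score : L2_closure P S D ->
  convolution_bound b P S (\int[P]_o (D o ^+ 2)).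
Proof.
move=> SD; have v0 : 0 <= \int[P]_o (D o ^+ 2) by apply: Rintegral_ge0 => o _; exact: sqr_ge0.
split => //.
  by move=> L regL; exact: (regular_limit_gaussian_factor mbQ modelP Lq Lz z0 minw scoreS smooth).
move=> v' v'0 h; apply: (gaussian_factor_variance_le v0 v'0); apply: h.
exact: sample_mean_regular_limit.
Qed.

End canonical_gradient.

Theorem theorem6p1 (R : realType) (dX dW : measure_display)
    (TX : measurableType dX) (TW : measurableType dW) (J : nat)
    (model : set (probability (TX * TW)%type R))
    (b : probability (TX * TW)%type R -> 'I_J.+1 -> TX -> R)
    (P : probability (TX * TW)%type R)
    (zeta : 'I_J.+1 -> TX * TW -> R)
    (lam : 'I_J.+1 -> TX -> R) :
  (forall Q, model Q -> forall j, measurable_fun [set: TX] (b Q j)) ->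
  model P ->
  (fun o : TX * TW => qfun b P o.1) \in Lfun P 2%:E ->
  (forall j, zeta j \in Lfun P 2%:E) ->
  (forall j, {ae P, forall o : TX * TW, condexp P (zeta j) o.1 = 0}) ->
  minimizing_weight b P zeta lam ->
  let H := tangent_H b P zeta in
  let Dstar := weighted_score b P zeta lam in
  [/\
    orthogonal_projection P H
        (fun o => qfun b P o.1 + zeta (min_argmax_branch (b P) o.1) o) Dstar /\
    (forall lam' : 'I_J.+1 -> TX -> R,
      unit_sum_weight b P lam' ->
      weighted_score b P zeta lam' \in Lfun P 2%:E ->
      orthogonal_projection P H (weighted_score b P zeta lam') Dstar),
    ((L2norm P Dstar) ^+ 2 =
      'V_P[fun o : TX * TW => max_branch (b P) o.1] +
      \int[P]_o (v_br (Gamma_act b P zeta o.1))%:E)%E &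
    forall S : set (TX * TW -> R),
      score_space b P zeta S ->
      smooth_along model b P zeta S ->
      (exists D, orthogonal_projection P (L2_closure P S) Dstar D /\
                 canonical_gradient b P S D) /\
      (L2_closure P S Dstar ->
        canonical_gradient b P S Dstar /\
        convolution_bound b P S (fine (L2norm P Dstar) ^+ 2))].

Proof.
move=> mbQ modelP Lq Lz z0 minw H Dstar; have mb := mbQ _ modelP.
split.
- split; first exact: projection_first_score.
  by move=> lam' ul' L'; exact: projection_weighted_score.
- exact: weighted_score_value.
- move=> S scoreS smooth; have LD := Lfun2_weighted_score mb Lq Lz minw.
  have SL2 s : S s -> s \in Lfun P 2%:E by exact: (score_Lfun2 scoreS).
  have [_ _ S0 Slin] := scoreS.
  split.
    have [D projD] := L2_projection_exists SL2 S0 Slin LD.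
    exists D; split => //.
    exact: (canonical_gradient_projection mbQ modelP Lq Lz z0 minw scoreS smooth).
  move=> SD; split.
    apply: (canonical_gradient_projection mbQ modelP Lq Lz z0 minw scoreS smooth).
    (* An element of the closure is its own projection. *)
    split => // h _; rewrite -[RHS](Rintegral_cst1 P).
    by apply: eq_Rintegral => o _; rewrite subrr mul0r.
  rewrite (L2normE LD)/= sqr_sqrtr; last by apply: Rintegral_ge0 => o _; exact: sqr_ge0.
  exact: (convolution_bound_weighted_score mbQ modelP Lq Lz z0 minw scoreS smooth).
Qed.
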